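(* Let $M$ be a complex manifold, $z\in M$ and $X\in T_zM$. Suppose that $M$ is hyperbolic at $z$ and that $\kappa_M$, regarded as a function on the tangent bundle $TM$, is continuous at $(z,X)$. Then $$\kappa_M(z;X)=\mathcal D\tilde k_M(z;X)=\underline{\mathcal D}\tilde k_M(z;X).$$
   Context: $\mathbb D\subset\mathbb C$ is the open unit disc and $\mathcal O(\mathbb D,M)$ denotes the holomorphic maps $\mathbb D\to M$. For a complex manifold $M$ of dimension $n$, $z,w\in M$ and $X\in T_zM$ (complex tangent space): - Lempert function: $\tilde k^\ast_M(z,w)=\inf\{|\alpha|:\exists f\in\mathcal O(\mathbb D,M),\ f(0)=z,\ f(\alpha)=w\}$ and $\tilde k_M=\tanh^{-1}\tilde k^\ast_M$. - Kobayashi–Royden pseudometric: $\kappa_M(z;X)=\inf\{|\alpha|:\exists f\in\mathcal O(\mathbb D,M),\ f(0)=z,\ \alpha f_\ast(d/d\zeta)=X\}$. - For $m\in\mathbb N$: $k^{(m)}_M(z,w)=\inf\{\sum_{j=1}^m\tilde k_M(z_{j-1},z_j): z_0,\dots,z_m\in M,\ z_0=z,\ z_m=w\}$ (so $k^{(1)}_M=\tilde k_M$), and the Kobayashi pseudodistance is $k_M=k^{(\infty)}_M:=\inf_m k^{(m)}_M$. - $M$ is hyperbolic at $z$ if $k_M(z,w)>0$ for every $w\in M$, $w\neq z$. - ''Derivatives'': for $m\in\mathbb N\cup\{\infty\}$ and a holomorphic chart $(U,\varphi)$ near $z$, $$\mathcal D k^{(m)}_M(z;X)=\limsup_{t\to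 0,\ t\in\mathbb C\setminus\{0\},\ w\to z,\ Y\to\varphi_\ast X}\frac{k^{(m)}_M\big(w,\varphi^{-1}(\varphi(w)+tY)\big)}{|t|},$$ and $\underline{\mathcal D}k^{(m)}_M(z;X)$ is defined identically with $\liminf$ in place of $\limsup$ (both are independent of the chart). $\mathcal D\tilde k_M$ and $\underline{\mathcal D}\tilde k_M$ denote these for $m=1$. *)

(* Defs.v *)
From Stdlib Require Import Reals.
From Stdlib Require Vectors.Fin.
From Coquelicot Require Import Coquelicot.
Open Scope R_scope.

Definition Cn (n : nat) : Type := Fin.t n -> C.

Fixpoint fsum (n : nat) : (Fin.t n -> R) -> R :=
  match n return (Fin.t n -> R) -> R with
  | O => fun _ => 0
  | S m => fun f => f Fin.F1 + fsum m (fun i => f (Fin.FS i))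
  end.

Fixpoint csum (n : nat) : (Fin.t n -> C) -> C :=
  match n return (Fin.t n -> C) -> C with
  | O => fun _ => RtoC 0
  | S m => fun f => Cplus (f Fin.F1) (csum m (fun i => f (Fin.FS i)))
  end.

Definition vadd {n} (u v : Cn n) : Cn n := fun i => Cplus (u i) (v i).
Definition vsub {n} (u v : Cn n) : Cn n := fun i => Cminus (u i) (v i).
Definition vscale {n} (a : C) (u : Cn n) : Cn n := fun i => Cmult a (u i).
(* l^1 norm on C^n (all norms on C^n are equivalent) *)
Definition cnorm {n} (u : Cn n) : R := fsum n (fun i => Cmod (u i)).

Definition copen {n} (W : Cn n -> Prop) : Prop :=
  forall w, W w -> exists d, 0 < d /\ forall u, cnorm (vsub u w) < d -> W u.

Definition holo_on {n m} (W : Cn n -> Prop) (F : Cn n -> Cn m) : Prop :=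
  forall w, W w -> exists L : Fin.t m -> Fin.t n -> C,
    forall eps, 0 < eps -> exists d, 0 < d /\ forall h : Cn n, cnorm h < d ->
      forall i, Cmod (Cminus (Cminus (F (vadd w h) i) (F w i))
                             (csum n (fun j => Cmult (L i j) (h j))))
                <= eps * cnorm h.

Record complex_manifold (n : nat) : Type := {
  pt :> Type;
  mopen : (pt -> Prop) -> Prop;
  mopen_all : mopen (fun _ => True);
  mopen_inter : forall A B, mopen A -> mopen B -> mopen (fun x => A x /\ B x);
  mopen_union : forall (I : Type) (F : I -> pt -> Prop),
      (forall i, mopen (F i)) -> mopen (fun x => exists i, F i x);
  m_hausdorff : forall x y, x <> y -> exists A B, mopen A /\ mopen B /\ A x /\ B y /\
      forall u, ~ (A u /\ B u);
  m_second_countable : exists B : nat -> pt -> Prop, (forall k, mopen (B k)) /\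
      forall A x, mopen A -> A x -> exists k, B k x /\ forall u, B k u -> A u;
  chart_idx : Type;
  cdom : chart_idx -> pt -> Prop;
  chart : chart_idx -> pt -> Cn n;
  cdom_open : forall i, mopen (cdom i);
  cdom_cover : forall x, exists i, cdom i x;
  chart_inj : forall i x y, cdom i x -> cdom i y -> chart i x = chart i y -> x = y;
  chart_cont : forall i x, cdom i x -> forall eps, 0 < eps ->
      exists A, mopen A /\ A x /\ forall y, A y -> cdom i y ->
        cnorm (vsub (chart i y) (chart i x)) < eps;
  (* charts are open maps, hence homeomorphisms onto open subsets of C^n *)
  chart_open_map : forall i A, mopen A ->
      copen (fun u => exists x, cdom i x /\ A x /\ chart i x = u);
  chart_transition : forall i j, exists F : Cn n -> Cn n,
      holo_on (fun u => exists x, cdom i x /\ cdom j x /\ chart i x = u) F /\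
      forall x, cdom i x -> cdom j x -> F (chart i x) = chart j x
}.

Arguments mopen {n} _ _.
Arguments cdom {n} _ _ _.
Arguments chart {n} _ _ _ _.
Arguments chart_idx {n} _.

Section Kob.
Context {n : nat} (M : complex_manifold n).

Definition in_disc (s : C) : Prop := Cmod s < 1.

(* f : D -> M holomorphic (values of f outside the unit disc are irrelevant) *)
Definition holo_disc (f : C -> M) : Prop :=
  forall s, in_disc s ->
    (forall A, mopen M A -> A (f s) -> exists d, 0 < d /\
       forall s', in_disc s' -> Cmod (Cminus s' s) < d -> A (f s')) /\
    (forall i, cdom M i (f s) -> forall k,
       ex_derive (K := C_AbsRing) (V := C_NormedModule)
                 (fun u => chart M i (f u) k) s).

Definition atanh (r : R) : R := / 2 * ln ((1 + r) / (1 - r)).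

(* Lempert function: star version and tanh^{-1} of it (inf of the empty set = +oo) *)
Definition lempert_star (z w : M) : Rbar :=
  Rbar_glb (fun r => exists (a : C) (f : C -> M), in_disc a /\ holo_disc f /\
              f (RtoC 0) = z /\ f a = w /\ r = Finite (Cmod a)).

Definition lempert (z w : M) : Rbar :=
  match lempert_star z w with
  | Finite r => if Rlt_dec r 1 then Finite (atanh r) else p_infty
  | _ => p_infty
  end.

Fixpoint chain_sum (c : nat -> M) (m : nat) : Rbar :=
  match m with
  | O => Finite 0
  | S p => Rbar_plus (chain_sum c p) (lempert (c p) (c (S p)))
  end.

Definition kob_m (m : nat) (z w : M) : Rbar :=
  Rbar_glb (fun r => exists c : nat -> M, c O = z /\ c m = w /\ r = chain_sum c m).

Definition kob (z w : M) : Rbar :=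
  Rbar_glb (fun r => exists m, (1 <= m)%nat /\ r = kob_m m z w).

Definition hyperbolic_at (z : M) : Prop :=
  forall w, w <> z -> Rbar_lt (Finite 0) (kob z w).

(* Kobayashi-Royden pseudometric at w, for the tangent vector whose coordinates
   in the chart i are v, i.e. (phi_i)_* X = v *)
Definition kappa (i : chart_idx M) (w : M) (v : Cn n) : Rbar :=
  Rbar_glb (fun r => exists (a : C) (f : C -> M) (d : Cn n),
     holo_disc f /\ f (RtoC 0) = w /\
     (forall k, is_derive (K := C_AbsRing) (V := C_NormedModule)
                  (fun u => chart M i (f u) k) (RtoC 0) (d k)) /\
     vscale a d = v /\ r = Finite (Cmod a)).

(* continuity of kappa on TM at (z, X), in the local trivialisation of TM
   given by the chart i *)
Definition kappa_continuous_at (i : chart_idx M) (z : M) (v : Cn n) : Prop :=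
  exists k0, kappa i z v = Finite k0 /\
  forall eps, 0 < eps -> exists d, 0 < d /\ forall w Y, cdom M i w ->
    cnorm (vsub (chart M i w) (chart M i z)) < d -> cnorm (vsub Y v) < d ->
    exists k, kappa i w Y = Finite k /\ Rabs (k - k0) < eps.

Definition Dset (i : chart_idx M) (z : M) (v : Cn n) (eps : R) (r : Rbar) : Prop :=
  exists (t : C) (w w' : M) (Y : Cn n),
    t <> RtoC 0 /\ Cmod t < eps /\
    cdom M i w /\ cnorm (vsub (chart M i w) (chart M i z)) < eps /\
    cnorm (vsub Y v) < eps /\
    cdom M i w' /\ chart M i w' = vadd (chart M i w) (vscale t Y) /\
    r = Rbar_mult (lempert w w') (Finite (/ Cmod t)).

Definition D_lempert (i : chart_idx M) (z : M) (v : Cn n) : Rbar :=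
  Rbar_glb (fun s => exists eps, 0 < eps /\ s = Rbar_lub (Dset i z v eps)).

Definition D_lempert_low (i : chart_idx M) (z : M) (v : Cn n) : Rbar :=
  Rbar_lub (fun s => exists eps, 0 < eps /\ s = Rbar_glb (Dset i z v eps)).

End Kob.

(* Main.v *)
Require Import Defs.
From Stdlib Require Import Reals Lra Psatz Lia ClassicalEpsilon FunctionalExtensionality List.
From Stdlib Require Vectors.Fin.
From Coquelicot Require Import Coquelicot.
Open Scope R_scope.

(** Lower bound: hyperbolicity at [z] forces the discs centred near [z] to be equicontinuous at
    the origin, so a disc realising the Lempert function between nearby points stays in one
    chart on a fixed smaller disc. Cauchy's estimate then bounds its second-order Taylor
    remainder, its derivative at 0 is a competitor for [kappa] at a nearby tangent vector, and
    continuity of [kappa] concludes.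

    Upper bound: a near-optimal disc [f] for [kappa] has to be moved so that it passes through
    two prescribed points close to [f 0] and [f a], at the cost of shrinking it slightly. In the
    chart at [f 0] the required affine correction is added to [f], multiplied by a cut-off
    function. The result has a small conjugate derivative, which is then corrected chart by chart
    along the disc. Every correction is cut off as well and creates a new error in the later
    charts. This does not accumulate because the equation [d-bar v = g] is solved up to an
    arbitrarily small error with [|v| <= theta sup |g|], [theta] arbitrarily small, in the norm
    weighted by a high power of [1/(1 + |z|^2)], and with [v] vanishing at 0 and [a]. So one sweep
    through all charts halves the error; iterating gives a uniform limit, which is holomorphic
    by Goursat's lemma and Cauchy's formula for functions of small conjugate derivative. *)

(** A manifold has no addition and a disc need not fit into one chart, so prescribing two values of
    a disc is a non-linear gluing problem. It stays tractable because transition maps are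
    holomorphic: from chart to chart the conjugate derivative changes by a complex-linear map alone,
    so its vanishing, and its size up to the fixed factor [/ eta0], do not depend on the chart. One
    correction may enlarge the error by a factor [B], so over m cells the solver must gain more than
    [B ^ m]. Hence the order of choices: cells, [eta0] and [C1], then [theta], then the exponent [L]
    of the weight. Returning from the weighted to the ordinary norm costs [2 ^ L]; this is harmless
    because every displacement is proportional to the first error, which is made small last of all.
    In the lower bound hyperbolicity enters through the compactness of a coordinate sphere around
    [z], on which the Kobayashi pseudodistance to [z] is bounded below. *)

(** * Inequalities for the complex modulus *)

Lemma Cmod_minus_sym (x y : C) : Cmod (x - y)%C = Cmod (y - x)%C.
Proof. rewrite <- Cmod_opp; f_equal; ring. Qed.

Lemma Cmod_triangle3 (x y z : C) : Cmod (x - z)%C <= Cmod (x - y)%C + Cmod (y - z)%C.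
Proof.
  replace (x - z)%C with ((x - y) + (y - z))%C by ring; apply Cmod_triangle.
Qed.

Lemma Cmod_le_add (x y : C) : Cmod x <= Cmod (x - y)%C + Cmod y.
Proof.
  replace x with ((x - y) + y)%C at 1 by ring; apply Cmod_triangle.
Qed.

Lemma Cmod_minus_le (x y : C) : Cmod (x - y)%C <= Cmod x + Cmod y.
Proof.
  replace (x - y)%C with (x + - y)%C by ring.
  rewrite <- (Cmod_opp y); apply Cmod_triangle.
Qed.

Lemma Cmod_le_Rabs (x y : R) : Cmod (x, y) <= Rabs x + Rabs y.
Proof.
  replace ((x, y) : C) with (RtoC x + Ci * RtoC y)%C
    by (apply injective_projections; simpl; ring).
  eapply Rle_trans; [apply Cmod_triangle|].
  rewrite Cmod_mult, Cmod_Ci, !Cmod_R; lra.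
Qed.

Lemma Cmod_fst_le (z : C) : Rabs (fst z) <= Cmod z.
Proof. eapply Rle_trans; [|apply Rmax_Cmod]; apply Rmax_l. Qed.

Lemma Cmod_snd_le (z : C) : Rabs (snd z) <= Cmod z.
Proof. eapply Rle_trans; [|apply Rmax_Cmod]; apply Rmax_r. Qed.

Lemma Cmod_le_eps_eq (x y : C) :
  (forall eps, 0 < eps -> Cmod (x - y)%C <= eps) -> x = y.
Proof.
  intros H.
  assert (H0 : Cmod (x - y)%C = 0).
  { apply Rle_antisym; [|apply Cmod_ge_0].
    apply le_epsilon; intros e He; specialize (H e He); lra. }
  apply Cmod_eq_0 in H0.
  replace x with ((x - y) + y)%C by ring; rewrite H0; ring.
Qed.

(** * Landau symbols and Wirtinger derivatives *)

Definition littleo (r : C -> C) : Prop :=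
  forall eps, 0 < eps -> exists d, 0 < d /\
    forall h, Cmod h < d -> Cmod (r h) <= eps * Cmod h.

Definition bigo (r : C -> C) : Prop :=
  exists K d, 0 < d /\ forall h, Cmod h < d -> Cmod (r h) <= K * Cmod h.

Lemma littleo_ext (r s : C -> C) : (forall h, r h = s h) -> littleo r -> littleo s.
Proof.
  intros E H eps He; destruct (H eps He) as [d [Hd Hh]].
  exists d; split; [easy|]; intros h Hh'; rewrite <- E; auto.
Qed.

Lemma littleo_0 : littleo (fun _ => RtoC 0).
Proof.
  intros eps He; exists 1; split; [lra|]; intros h _; rewrite Cmod_0.
  apply Rmult_le_pos; [lra|apply Cmod_ge_0].
Qed.

Lemma littleo_plus (r s : C -> C) :
  littleo r -> littleo s -> littleo (fun h => r h + s h)%C.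
Proof.
  intros Hr Hs eps He.
  destruct (Hr (eps / 2)) as [d1 [H1 H1']]; [lra|].
  destruct (Hs (eps / 2)) as [d2 [H2 H2']]; [lra|].
  exists (Rmin d1 d2); split; [now apply Rmin_case|]; intros h Hh.
  eapply Rle_trans; [apply Cmod_triangle|].
  specialize (H1' h (Rlt_le_trans _ _ _ Hh (Rmin_l _ _))).
  specialize (H2' h (Rlt_le_trans _ _ _ Hh (Rmin_r _ _))); lra.
Qed.

Lemma littleo_scal (c : C) (r : C -> C) : littleo r -> littleo (fun h => c * r h)%C.
Proof.
  intros Hr eps He.
  assert (Hc := Cmod_ge_0 c).
  destruct (Hr (eps / (Cmod c + 1))) as [d [Hd H]].
  { apply Rdiv_lt_0_compat; lra. }
  exists d; split; [easy|]; intros h Hh; rewrite Cmod_mult.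
  specialize (H h Hh); assert (Hh0 := Cmod_ge_0 h).
  apply Rle_trans with ((Cmod c + 1) * (eps / (Cmod c + 1) * Cmod h)).
  - apply Rmult_le_compat; try lra; apply Cmod_ge_0.
  - right; field; lra.
Qed.

Lemma littleo_bigo (r : C -> C) : littleo r -> bigo r.
Proof. intros H; destruct (H 1) as [d [Hd Hh]]; [lra|]; exists 1, d; auto. Qed.

Lemma bigo_plus (r s : C -> C) : bigo r -> bigo s -> bigo (fun h => r h + s h)%C.
Proof.
  intros [K1 [d1 [H1 H1']]] [K2 [d2 [H2 H2']]].
  exists (K1 + K2), (Rmin d1 d2); split; [now apply Rmin_case|]; intros h Hh.
  eapply Rle_trans; [apply Cmod_triangle|].
  specialize (H1' h (Rlt_le_trans _ _ _ Hh (Rmin_l _ _))).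
  specialize (H2' h (Rlt_le_trans _ _ _ Hh (Rmin_r _ _))); lra.
Qed.

Lemma bigo_lin (A B : C) : bigo (fun h => A * h + B * Cconj h)%C.
Proof.
  exists (Cmod A + Cmod B), 1; split; [lra|]; intros h _.
  eapply Rle_trans; [apply Cmod_triangle|].
  rewrite !Cmod_mult, Cmod_conj; lra.
Qed.

Lemma littleo_mult (r s : C -> C) : bigo r -> bigo s -> littleo (fun h => r h * s h)%C.
Proof.
  intros [K1 [d1 [H1 H1']]] [K2 [d2 [H2 H2']]] eps He.
  set (K := Rabs K1 * Rabs K2 + 1).
  assert (HK : 1 <= K) by (assert (H := Rabs_pos K1); assert (H' := Rabs_pos K2); unfold K; nra).
  exists (Rmin (Rmin d1 d2) (eps / K)); split.
  { repeat apply Rmin_case; auto; apply Rdiv_lt_0_compat; lra. }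
  intros h Hh.
  assert (Ha : Cmod h < d1) by (eapply Rlt_le_trans; [apply Hh|]; eapply Rle_trans; apply Rmin_l).
  assert (Hb : Cmod h < d2)
    by (eapply Rlt_le_trans; [apply Hh|]; eapply Rle_trans; [apply Rmin_l|apply Rmin_r]).
  assert (Hc : Cmod h < eps / K) by (eapply Rlt_le_trans; [apply Hh|]; apply Rmin_r).
  specialize (H1' h Ha); specialize (H2' h Hb).
  assert (H0 := Cmod_ge_0 h); rewrite Cmod_mult.
  apply Rle_trans with ((Rabs K1 * Cmod h) * (Rabs K2 * Cmod h)).
  - apply Rmult_le_compat; try apply Cmod_ge_0;
      eapply Rle_trans; try eassumption; apply Rmult_le_compat_r; auto; apply Rle_abs.
  - apply Rle_trans with ((K * Cmod h) * Cmod h).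
    + assert (0 <= Cmod h * Cmod h) by nra; unfold K; nra.
    + apply Rmult_le_compat_r; auto.
      apply Rmult_lt_compat_l with (r := K) in Hc; [|lra].
      replace (K * (eps / K)) with eps in Hc by (field; lra); lra.
Qed.

(* [A] and [B] are the values at [z] of the Wirtinger derivatives of [u]
   with respect to [z] and to its conjugate. *)
Definition rdiff (u : C -> C) (z A B : C) : Prop :=
  littleo (fun h => u (z + h) - u z - (A * h + B * Cconj h))%C.

Lemma rdiff_ext_loc (u v : C -> C) (z A B : C) (d : R) :
  0 < d -> (forall h, Cmod h < d -> u (z + h)%C = v (z + h)%C) ->
  rdiff u z A B -> rdiff v z A B.
Proof.
  intros Hd E H eps He; destruct (H eps He) as [d' [Hd' Hh]].
  exists (Rmin d d'); split; [now apply Rmin_case|]; intros h Hh'.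
  assert (E0 : u z = v z).
  { specialize (E (RtoC 0)); rewrite Cmod_0, Cplus_0_r in E; auto. }
  rewrite <- E0, <- E by (eapply Rlt_le_trans; [apply Hh'|apply Rmin_l]).
  apply Hh; eapply Rlt_le_trans; [apply Hh'|apply Rmin_r].
Qed.

Lemma rdiff_ext (u v : C -> C) (z A B : C) :
  (forall x, u x = v x) -> rdiff u z A B -> rdiff v z A B.
Proof. intros E; apply rdiff_ext_loc with 1; [lra|auto]. Qed.

Lemma rdiff_eq (u : C -> C) (z A B A' B' : C) :
  A = A' -> B = B' -> rdiff u z A B -> rdiff u z A' B'.
Proof. now intros -> ->. Qed.

Lemma rdiff_const (c z : C) : rdiff (fun _ => c) z 0 0.
Proof. eapply littleo_ext; [|apply littleo_0]; intros; simpl; ring. Qed.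

Lemma rdiff_id (z : C) : rdiff (fun x => x) z 1 0.
Proof. eapply littleo_ext; [|apply littleo_0]; intros; simpl; ring. Qed.

Lemma rdiff_conj (z : C) : rdiff Cconj z 0 1.
Proof.
  eapply littleo_ext; [|apply littleo_0]; intros; simpl; rewrite Cplus_conj; ring.
Qed.

Lemma rdiff_plus (u v : C -> C) (z A B A' B' : C) :
  rdiff u z A B -> rdiff v z A' B' -> rdiff (fun x => u x + v x)%C z (A + A') (B + B').
Proof.
  intros H1 H2; eapply littleo_ext; [|apply (littleo_plus _ _ H1 H2)].
  intros h; simpl; ring.
Qed.

Lemma rdiff_bigo (u : C -> C) (z A B : C) :
  rdiff u z A B -> bigo (fun h => u (z + h) - u z)%C.
Proof.
  intros H; destruct (bigo_plus _ _ (littleo_bigo _ H) (bigo_lin A B)) as [K [d [Hd Hh]]].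
  exists K, d; split; [easy|]; intros h Hh'; specialize (Hh h Hh').
  eapply Rle_trans; [|apply Hh]; right; f_equal; ring.
Qed.

Lemma rdiff_mult (u v : C -> C) (z A B A' B' : C) :
  rdiff u z A B -> rdiff v z A' B' ->
  rdiff (fun x => u x * v x)%C z (A * v z + u z * A') (B * v z + u z * B').
Proof.
  intros H1 H2.
  eapply littleo_ext;
    [|apply (littleo_plus _ _
       (littleo_plus _ _ (littleo_scal (v z) _ H1) (littleo_scal (u z) _ H2))
       (littleo_mult _ _ (rdiff_bigo _ _ _ _ H1) (rdiff_bigo _ _ _ _ H2)))].
  intros h; simpl; ring.
Qed.

Lemma rdiff_scal (c : C) (u : C -> C) (z A B : C) :
  rdiff u z A B -> rdiff (fun x => c * u x)%C z (c * A) (c * B).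
Proof.
  intros H; eapply rdiff_eq; [| |apply (rdiff_mult _ _ _ _ _ _ _ (rdiff_const c z) H)]; ring.
Qed.

Lemma rdiff_minus (u v : C -> C) (z A B A' B' : C) :
  rdiff u z A B -> rdiff v z A' B' -> rdiff (fun x => u x - v x)%C z (A - A') (B - B').
Proof.
  intros H1 H2.
  apply rdiff_ext with (fun x => u x + (- (1)) * v x)%C; [intros; ring|].
  eapply rdiff_eq; [| |apply (rdiff_plus _ _ _ _ _ _ _ H1 (rdiff_scal (- (1))%C _ _ _ _ H2))];
    ring.
Qed.

Lemma rdiff_cont (u : C -> C) (z A B : C) : rdiff u z A B ->
  forall eps, 0 < eps -> exists d, 0 < d /\
    forall y, Cmod (y - z)%C < d -> Cmod (u y - u z)%C < eps.
Proof.
  intros H eps He; destruct (rdiff_bigo _ _ _ _ H) as [K [d [Hd Hh]]].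
  assert (HK := Rabs_pos K).
  exists (Rmin d (eps / (Rabs K + 1))); split.
  { apply Rmin_case; auto; apply Rdiv_lt_0_compat; lra. }
  intros y Hy.
  assert (H1 : Cmod (y - z)%C < d) by (eapply Rlt_le_trans; [apply Hy|apply Rmin_l]).
  assert (H2 : Cmod (y - z)%C < eps / (Rabs K + 1))
    by (eapply Rlt_le_trans; [apply Hy|apply Rmin_r]).
  specialize (Hh _ H1); replace (z + (y - z))%C with y in Hh by ring.
  apply Rmult_lt_compat_l with (r := Rabs K + 1) in H2; [|lra].
  replace ((Rabs K + 1) * (eps / (Rabs K + 1))) with eps in H2 by (field; lra).
  assert (H3 := Rle_abs K); assert (H4 := Cmod_ge_0 (y - z)%C); nra.
Qed.

Lemma rdiff_inv (u : C -> C) (z A B : C) : u z <> 0 -> rdiff u z A B ->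
  rdiff (fun x => / u x)%C z (- A / (u z * u z)) (- B / (u z * u z)).
Proof.
  intros Hz H.
  assert (Hz0 : 0 < Cmod (u z)) by now apply Cmod_gt_0.
  destruct (rdiff_cont _ _ _ _ H (Cmod (u z) / 2)) as [d0 [Hd0 Hc]]; [lra|].
  assert (Hnz : forall h, Cmod h < d0 -> Cmod (u z) / 2 <= Cmod (u (z + h)%C)).
  { intros h Hh; specialize (Hc (z + h)%C); replace (z + h - z)%C with h in Hc by ring.
    specialize (Hc Hh); rewrite Cmod_minus_sym in Hc.
    assert (H1 := Cmod_le_add (u z) (u (z + h)%C)); lra. }
  assert (Hnz' : forall h, Cmod h < d0 -> u (z + h)%C <> 0).
  { intros h Hh; apply Cmod_gt_0; specialize (Hnz h Hh); lra. }
  set (D := fun h => (u (z + h) - u z)%C).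
  assert (HD : bigo D) by apply (rdiff_bigo _ _ _ _ H).
  (* 1/u(z+h) - 1/u(z) + D/u(z)^2 = D^2 / (u(z)^2 u(z+h)) *)
  assert (HDD : bigo (fun h => D h / (u z * u z * u (z + h)))%C).
  { destruct HD as [K [d [Hd Hh]]].
    exists (Rabs K * (2 / (Cmod (u z) * Cmod (u z) * Cmod (u z)))), (Rmin d d0).
    split; [now apply Rmin_case|]; intros h Hh'.
    assert (H1 : Cmod h < d) by (eapply Rlt_le_trans; [apply Hh'|apply Rmin_l]).
    assert (H2 : Cmod h < d0) by (eapply Rlt_le_trans; [apply Hh'|apply Rmin_r]).
    specialize (Hh h H1); specialize (Hnz h H2); specialize (Hnz' h H2).
    rewrite Cmod_div by (repeat apply Cmult_neq_0; auto).
    rewrite !Cmod_mult.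
    assert (H3 : / (Cmod (u z) * Cmod (u z) * Cmod (u (z + h)%C)) <=
                 2 / (Cmod (u z) * Cmod (u z) * Cmod (u z))).
    { replace (2 / (Cmod (u z) * Cmod (u z) * Cmod (u z))) with
        (/ (Cmod (u z) * Cmod (u z) * (Cmod (u z) / 2))) by (field; lra).
      apply Rinv_le_contravar; [|apply Rmult_le_compat_l; [nra|auto]].
      repeat apply Rmult_lt_0_compat; lra. }
    apply Rle_trans with ((Rabs K * Cmod h) * (2 / (Cmod (u z) * Cmod (u z) * Cmod (u z))));
      [|right; ring].
    apply Rmult_le_compat; auto; try apply Cmod_ge_0.
    - left; apply Rinv_0_lt_compat; repeat apply Rmult_lt_0_compat; lra.
    - eapply Rle_trans; [apply Hh|]; apply Rmult_le_compat_r; [apply Cmod_ge_0|apply Rle_abs]. }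
  intros eps He.
  destruct (littleo_plus _ _ (littleo_scal (- / (u z * u z))%C _ H) (littleo_mult _ _ HDD HD)
              eps He) as [d [Hd Hh]].
  exists (Rmin d d0); split; [now apply Rmin_case|]; intros h Hh'.
  assert (H1 : Cmod h < d) by (eapply Rlt_le_trans; [apply Hh'|apply Rmin_l]).
  assert (H2 : Cmod h < d0) by (eapply Rlt_le_trans; [apply Hh'|apply Rmin_r]).
  specialize (Hh h H1); specialize (Hnz' h H2).
  eapply Rle_trans; [|apply Hh]; right; f_equal; unfold D; field; auto.
Qed.

(** The increment of [s] is O(h), so the o-term of [phi] at [s z] is o(h); the linear term of [phi]
    carries over the o-term of [s]. *)
Lemma rdiff_real_comp (phi : R -> R) (s : C -> R) (z A B : C) (l : R) :
  is_derive phi (s z) l -> rdiff (fun x => RtoC (s x)) z A B ->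
  rdiff (fun x => RtoC (phi (s x))) z (RtoC l * A) (RtoC l * B).
Proof.
  intros Hphi Hs.
  apply is_derive_Reals in Hphi.
  assert (Hb := rdiff_bigo _ _ _ _ Hs).
  eapply littleo_ext with
    (fun h => (RtoC (phi (s (z + h)%C) - phi (s z) - l * (s (z + h)%C - s z))) +
       RtoC l * (RtoC (s (z + h)) - RtoC (s z) - (A * h + B * Cconj h)))%C.
  { intros h; simpl; rewrite !RtoC_minus, RtoC_mult, RtoC_minus; ring. }
  apply littleo_plus; [|apply littleo_scal, Hs].
  intros eps He; destruct Hb as [K [d [Hd Hh]]].
  assert (HK := Rabs_pos K).
  destruct (Hphi (eps / (Rabs K + 1))) as [e Hphi'].
  { apply Rdiv_lt_0_compat; lra. }
  assert (He' := cond_pos e).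
  exists (Rmin d (e / (Rabs K + 1))); split.
  { apply Rmin_case; auto; apply Rdiv_lt_0_compat; lra. }
  intros h Hh'.
  assert (H1 : Cmod h < d) by (eapply Rlt_le_trans; [apply Hh'|apply Rmin_l]).
  assert (H2 : Cmod h < e / (Rabs K + 1)) by (eapply Rlt_le_trans; [apply Hh'|apply Rmin_r]).
  specialize (Hh h H1); rewrite <- RtoC_minus, Cmod_R in Hh.
  rewrite Cmod_R.
  set (x := s (z + h)%C - s z) in *.
  assert (Hh0 := Cmod_ge_0 h); assert (HKK := Rle_abs K).
  assert (Hx : Rabs x <= (Rabs K + 1) * Cmod h) by nra.
  apply Rmult_lt_compat_l with (r := Rabs K + 1) in H2; [|lra].
  replace ((Rabs K + 1) * (e / (Rabs K + 1))) with (pos e) in H2 by (field; lra).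
  (* The real derivative is given by difference quotients, so a vanishing increment of [s] has to be
     treated apart. *)
  destruct (Req_dec x 0) as [Hx0|Hx0].
  - replace (s (z + h)%C) with (s z) by (unfold x in Hx0; lra).
    replace (phi (s z) - phi (s z) - l * x) with 0 by (rewrite Hx0; ring).
    rewrite Rabs_R0; nra.
  - specialize (Hphi' x Hx0 ltac:(lra)).
    replace (s (z + h)%C) with (s z + x) by (unfold x; ring).
    replace (phi (s z + x) - phi (s z) - l * x) with
      (((phi (s z + x) - phi (s z)) / x - l) * x) by (field; auto).
    rewrite Rabs_mult.
    apply Rle_trans with (eps / (Rabs K + 1) * ((Rabs K + 1) * Cmod h)).
    + apply Rmult_le_compat; try apply Rabs_pos; lra.
    + right; field; lra.
Qed.

(** * Contour integrals along rectangles *)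

Definition cint (f : R -> C) (a b : R) : C :=
  (RInt (fun t => fst (f t)) a b, RInt (fun t => snd (f t)) a b).

(** The point [s] ranges over the whole line, so continuity at the endpoints is two-sided; this is
    the form in which continuity of a function on the plane restricts to an edge. *)
Definition path_cont (f : R -> C) (a b : R) : Prop :=
  forall t, a <= t <= b -> forall eps, 0 < eps -> exists d, 0 < d /\
    forall s, Rabs (s - t) < d -> Cmod (f s - f t)%C < eps.

Lemma path_cont_fst (f : R -> C) (a b : R) : a <= b ->
  path_cont f a b -> ex_RInt (fun t => fst (f t)) a b.
Proof.
  intros Hab H; apply (ex_RInt_continuous (V := R_CompleteNormedModule)).
  intros t; rewrite Rmin_left, Rmax_right by auto; intros Ht.
  apply filterlim_locally; intros eps.
  destruct (H t Ht eps (cond_pos eps)) as [d [Hd Hs]].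
  exists (mkposreal d Hd); intros s Hst.
  eapply Rle_lt_trans; [|apply (Hs s Hst)].
  apply (Cmod_fst_le (f s - f t)%C).
Qed.

Lemma path_cont_snd (f : R -> C) (a b : R) : a <= b ->
  path_cont f a b -> ex_RInt (fun t => snd (f t)) a b.
Proof.
  intros Hab H; apply (ex_RInt_continuous (V := R_CompleteNormedModule)).
  intros t; rewrite Rmin_left, Rmax_right by auto; intros Ht.
  apply filterlim_locally; intros eps.
  destruct (H t Ht eps (cond_pos eps)) as [d [Hd Hs]].
  exists (mkposreal d Hd); intros s Hst.
  eapply Rle_lt_trans; [|apply (Hs s Hst)].
  apply (Cmod_snd_le (f s - f t)%C).
Qed.

Lemma cint_ext (f g : R -> C) (a b : R) : a <= b ->
  (forall t, a <= t <= b -> f t = g t) -> cint f a b = cint g a b.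
Proof.
  intros Hab E; unfold cint; f_equal; apply RInt_ext; intros t;
    rewrite Rmin_left, Rmax_right by auto; intros Ht; rewrite E; auto; lra.
Qed.

Lemma cint_plus (f g : R -> C) (a b : R) : a <= b ->
  path_cont f a b -> path_cont g a b ->
  cint (fun t => f t + g t)%C a b = (cint f a b + cint g a b)%C.
Proof.
  intros Hab Hf Hg; unfold cint, Cplus; simpl; f_equal;
    apply (RInt_plus (V := R_CompleteNormedModule));
    auto using path_cont_fst, path_cont_snd.
Qed.

Lemma cint_scal (c : C) (f : R -> C) (a b : R) : a <= b -> path_cont f a b ->
  cint (fun t => c * f t)%C a b = (c * cint f a b)%C.
Proof.
  intros Hab Hf; unfold cint, Cmult; simpl.
  assert (H1 := path_cont_fst _ _ _ Hab Hf); assert (H2 := path_cont_snd _ _ _ Hab Hf).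
  assert (S : forall (k : R) (h : R -> R), ex_RInt h a b -> ex_RInt (fun t => k * h t) a b)
    by (intros k h Hh; apply (ex_RInt_scal (V := R_NormedModule)); auto).
  assert (S' : forall (k : R) (h : R -> R), ex_RInt h a b ->
    RInt (fun t => k * h t) a b = k * RInt h a b)
    by (intros k h Hh; apply (RInt_scal (V := R_CompleteNormedModule)); auto).
  f_equal.
  - rewrite <- !S' by auto; apply (RInt_minus (V := R_CompleteNormedModule)); auto.
  - rewrite <- !S' by auto; apply (RInt_plus (V := R_CompleteNormedModule)); auto.
Qed.

Lemma path_cont_sub (f : R -> C) (a b a' b' : R) :
  a <= a' -> b' <= b -> path_cont f a b -> path_cont f a' b'.
Proof. intros Ha Hb H t Ht; apply H; lra. Qed.

Lemma cint_Chasles (f : R -> C) (a b c : R) : a <= b <= c -> path_cont f a c ->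
  (cint f a b + cint f b c)%C = cint f a c.
Proof.
  intros Habc H.
  assert (H1 := path_cont_sub f a c a b ltac:(lra) ltac:(lra) H).
  assert (H2 := path_cont_sub f a c b c ltac:(lra) ltac:(lra) H).
  apply injective_projections; cbn [fst snd].
  - apply (RInt_Chasles (V := R_CompleteNormedModule) (fun t => fst (f t)));
      apply path_cont_fst; auto; lra.
  - apply (RInt_Chasles (V := R_CompleteNormedModule) (fun t => snd (f t)));
      apply path_cont_snd; auto; lra.
Qed.

(** Estimating real and imaginary part separately would lose a factor. Instead the pair of integrals
    is read as one integral with values in R x R, whose product norm is the modulus. *)
Lemma cint_bound (f : R -> C) (a b K : R) : a <= b -> path_cont f a b ->
  (forall t, a <= t <= b -> Cmod (f t) <= K) -> Cmod (cint f a b) <= (b - a) * K.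
Proof.
  intros Hab Hf HK.
  assert (N : forall z : C_R_NormedModule, norm z = Cmod z).
  { intros [x y]; unfold Cmod; simpl; unfold norm; simpl; unfold prod_norm; simpl.
    unfold norm; simpl; unfold abs; simpl.
    rewrite !Rmult_1_r, <- !Rabs_mult; f_equal; rewrite !Rabs_pos_eq by nra; ring. }
  assert (HI : is_RInt (V := C_R_NormedModule) f a b (cint f a b)).
  { apply is_RInt_fct_extend_pair; apply (RInt_correct (V := R_CompleteNormedModule));
      auto using path_cont_fst, path_cont_snd. }
  rewrite <- N; apply (norm_RInt_le_const f a b); auto.
  intros t Ht; rewrite N; auto.
Qed.

Lemma RInt_affine (p q a b : R) :
  RInt (fun t => p + q * t) a b = p * (b - a) + q * (b * b - a * a) / 2.
Proof.
  apply is_RInt_unique.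
  replace (p * (b - a) + q * (b * b - a * a) / 2) with
    ((p * b + q * b * b / 2) - (p * a + q * a * a / 2)) by field.
  apply (is_RInt_derive (fun t => p * t + q * t * t / 2) (fun t => p + q * t)).
  - intros x _; auto_derive; auto; field.
  - intros x _; apply (ex_derive_continuous (V := R_NormedModule)); auto_derive; auto.
Qed.

Lemma cint_affine (p q : C) (a b : R) :
  cint (fun t => p + q * RtoC t)%C a b =
  (p * RtoC (b - a) + q * RtoC ((b * b - a * a) / 2))%C.
Proof.
  unfold cint; rewrite (RInt_ext _ (fun t => fst p + fst q * t))
    by (intros; simpl; ring).
  rewrite (RInt_ext (fun t => snd _) (fun t => snd p + snd q * t)) by (intros; simpl; ring).
  rewrite !RInt_affine; apply injective_projections; simpl; field.
Qed.

(** The contour runs counterclockwise: [dz] is [dx] on the bottom edge and [i dy] on the right edge,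
    and the top and left edges are traversed backwards. *)
Definition rect_int (u : C -> C) (x0 x1 y0 y1 : R) : C :=
  (cint (fun x => u (x, y0)) x0 x1 + Ci * cint (fun y => u (x1, y)) y0 y1
   - cint (fun x => u (x, y1)) x0 x1 - Ci * cint (fun y => u (x0, y)) y0 y1)%C.

Definition in_rect (x0 x1 y0 y1 : R) (z : C) : Prop :=
  x0 <= fst z <= x1 /\ y0 <= snd z <= y1.

Definition cont_at (u : C -> C) (z : C) : Prop :=
  forall eps, 0 < eps -> exists d, 0 < d /\
    forall y, Cmod (y - z)%C < d -> Cmod (u y - u z)%C < eps.

Definition cont_rect (u : C -> C) (x0 x1 y0 y1 : R) : Prop :=
  forall z, in_rect x0 x1 y0 y1 z -> cont_at u z.

Lemma path_cont_horizontal (u : C -> C) (x0 x1 y : R) :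
  (forall x, x0 <= x <= x1 -> cont_at u (x, y)) -> path_cont (fun x => u (x, y)) x0 x1.
Proof.
  intros H t Ht eps He; destruct (H t Ht eps He) as [d [Hd Hs]].
  exists d; split; auto; intros s Hst; apply Hs.
  replace ((s, y) - (t, y))%C with (RtoC (s - t))
    by (apply injective_projections; simpl; ring).
  now rewrite Cmod_R.
Qed.

Lemma path_cont_vertical (u : C -> C) (x y0 y1 : R) :
  (forall y, y0 <= y <= y1 -> cont_at u (x, y)) -> path_cont (fun y => u (x, y)) y0 y1.
Proof.
  intros H t Ht eps He; destruct (H t Ht eps He) as [d [Hd Hs]].
  exists d; split; auto; intros s Hst; apply Hs.
  replace ((x, s) - (x, t))%C with (Ci * RtoC (s - t))%C
    by (apply injective_projections; simpl; ring).
  now rewrite Cmod_mult, Cmod_Ci, Cmod_R, Rmult_1_l.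
Qed.

Section RectInt.
Variables (x0 x1 y0 y1 : R).
Hypothesis (Hx : x0 <= x1).
Hypothesis (Hy : y0 <= y1).

Definition on_boundary (z : C) : Prop :=
  in_rect x0 x1 y0 y1 z /\ (fst z = x0 \/ fst z = x1 \/ snd z = y0 \/ snd z = y1).

Lemma rect_int_ext (u v : C -> C) : (forall z, on_boundary z -> u z = v z) ->
  rect_int u x0 x1 y0 y1 = rect_int v x0 x1 y0 y1.
Proof.
  intros E; unfold rect_int; f_equal; [f_equal; [f_equal|]|];
  repeat (match goal with |- (Ci * _)%C = _ => f_equal end);
  apply cint_ext; auto; intros t Ht; apply E; unfold on_boundary, in_rect; simpl;
  intuition lra.
Qed.

Definition cont_bd (u : C -> C) : Prop := forall z, on_boundary z -> cont_at u z.

Lemma cont_bd_bottom (u : C -> C) : cont_bd u -> path_cont (fun x => u (x, y0)) x0 x1.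
Proof.
  intros H; apply path_cont_horizontal; intros; apply H; unfold on_boundary, in_rect; simpl;
    intuition lra.
Qed.
Lemma cont_bd_top (u : C -> C) : cont_bd u -> path_cont (fun x => u (x, y1)) x0 x1.
Proof.
  intros H; apply path_cont_horizontal; intros; apply H; unfold on_boundary, in_rect; simpl;
    intuition lra.
Qed.
Lemma cont_bd_left (u : C -> C) : cont_bd u -> path_cont (fun y => u (x0, y)) y0 y1.
Proof.
  intros H; apply path_cont_vertical; intros; apply H; unfold on_boundary, in_rect; simpl;
    intuition lra.
Qed.
Lemma cont_bd_right (u : C -> C) : cont_bd u -> path_cont (fun y => u (x1, y)) y0 y1.
Proof.
  intros H; apply path_cont_vertical; intros; apply H; unfold on_boundary, in_rect; simpl;
    intuition lra.
Qed.
Hint Resolve cont_bd_bottom cont_bd_top cont_bd_left cont_bd_right : core.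

Lemma rect_int_plus (u v : C -> C) : cont_bd u -> cont_bd v ->
  rect_int (fun z => u z + v z)%C x0 x1 y0 y1 =
  (rect_int u x0 x1 y0 y1 + rect_int v x0 x1 y0 y1)%C.
Proof. intros Hu Hv; unfold rect_int; rewrite !cint_plus; auto; ring. Qed.

Lemma rect_int_scal (c : C) (u : C -> C) : cont_bd u ->
  rect_int (fun z => c * u z)%C x0 x1 y0 y1 = (c * rect_int u x0 x1 y0 y1)%C.
Proof. intros Hu; unfold rect_int; rewrite !cint_scal; auto; ring. Qed.

Lemma rect_int_bound (u : C -> C) (K : R) : cont_bd u ->
  (forall z, on_boundary z -> Cmod (u z) <= K) ->
  Cmod (rect_int u x0 x1 y0 y1) <= 2 * ((x1 - x0) + (y1 - y0)) * K.
Proof.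
  intros Hu HK; unfold rect_int.
  assert (B1 : Cmod (cint (fun x => u (x, y0)) x0 x1) <= (x1 - x0) * K).
  { apply cint_bound; auto; intros; apply HK; unfold on_boundary, in_rect; simpl; intuition lra. }
  assert (B2 : Cmod (cint (fun x => u (x, y1)) x0 x1) <= (x1 - x0) * K).
  { apply cint_bound; auto; intros; apply HK; unfold on_boundary, in_rect; simpl; intuition lra. }
  assert (B3 : Cmod (cint (fun y => u (x0, y)) y0 y1) <= (y1 - y0) * K).
  { apply cint_bound; auto; intros; apply HK; unfold on_boundary, in_rect; simpl; intuition lra. }
  assert (B4 : Cmod (cint (fun y => u (x1, y)) y0 y1) <= (y1 - y0) * K).
  { apply cint_bound; auto; intros; apply HK; unfold on_boundary, in_rect; simpl; intuition lra. }
  eapply Rle_trans; [apply Cmod_minus_le|].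
  eapply Rle_trans; [apply Rplus_le_compat_r, Cmod_minus_le|].
  eapply Rle_trans; [do 2 apply Rplus_le_compat_r; apply Cmod_triangle|].
  rewrite !Cmod_mult, Cmod_Ci; lra.
Qed.

End RectInt.

Lemma rect_int_split_vertical (u : C -> C) (x0 xm x1 y0 y1 : R) :
  x0 <= xm <= x1 -> y0 <= y1 ->
  (forall x, x0 <= x <= x1 -> cont_at u (x, y0) /\ cont_at u (x, y1)) ->
  rect_int u x0 x1 y0 y1 = (rect_int u x0 xm y0 y1 + rect_int u xm x1 y0 y1)%C.
Proof.
  intros Hx Hy H; unfold rect_int.
  rewrite <- (cint_Chasles (fun x => u (x, y0)) x0 xm x1);
    [|auto|apply path_cont_horizontal; intros; now apply H].
  rewrite <- (cint_Chasles (fun x => u (x, y1)) x0 xm x1);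
    [|auto|apply path_cont_horizontal; intros; now apply H].
  ring.
Qed.

Lemma rect_int_split_horizontal (u : C -> C) (x0 x1 y0 ym y1 : R) :
  y0 <= ym <= y1 -> x0 <= x1 ->
  (forall y, y0 <= y <= y1 -> cont_at u (x0, y) /\ cont_at u (x1, y)) ->
  rect_int u x0 x1 y0 y1 = (rect_int u x0 x1 y0 ym + rect_int u x0 x1 ym y1)%C.
Proof.
  intros Hy Hx H; unfold rect_int.
  rewrite <- (cint_Chasles (fun y => u (x0, y)) y0 ym y1);
    [|auto|apply path_cont_vertical; intros; now apply H].
  rewrite <- (cint_Chasles (fun y => u (x1, y)) y0 ym y1);
    [|auto|apply path_cont_vertical; intros; now apply H].
  ring.
Qed.

(** Green's formula for an affine function, where it is an exact computation: only the coefficient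
    of the conjugate variable contributes, namely [2 i B] times the area. This term produces the
    bound in [goursat]. *)
Lemma rect_int_affine (p A B : C) (x0 x1 y0 y1 : R) :
  rect_int (fun z => p + (A * z + B * Cconj z))%C x0 x1 y0 y1 =
  (2 * Ci * B * RtoC ((x1 - x0) * (y1 - y0)))%C.
Proof.
  unfold rect_int.
  assert (H1 : forall y, (fun x => p + (A * (x, y) + B * Cconj (x, y)))%C =
     (fun x => (p + Ci * RtoC y * (A - B)) + (A + B) * RtoC x)%C).
  { intros y; apply functional_extensionality; intros x.
    apply injective_projections; simpl; ring. }
  assert (H2 : forall x, (fun y => p + (A * (x, y) + B * Cconj (x, y)))%C =
     (fun y => (p + RtoC x * (A + B)) + (Ci * (A - B)) * RtoC y)%C).
  { intros x; apply functional_extensionality; intros y.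
    apply injective_projections; simpl; ring. }
  rewrite !H1, !H2, !cint_affine.
  apply injective_projections; simpl; field.
Qed.

(** * Goursat's lemma with a small conjugate derivative *)

(** The predicate [bad a b k] speaks of the rectangle with lower left corner [(a, b)] and sides
    [w / 2 ^ k], [h / 2 ^ k]; a bad rectangle has a bad quarter. Dependent choice gives a nested
    sequence, and the two coordinates of the common point are found independently. *)
Lemma bisection (bad : R -> R -> nat -> Prop) (w h x y : R) : 0 <= w -> 0 <= h ->
  bad x y O ->
  (forall a b k, bad a b k -> exists a' b', bad a' b' (S k) /\
     (a' = a \/ a' = a + w / 2 ^ S k) /\ (b' = b \/ b' = b + h / 2 ^ S k)) ->
  exists px py, forall k, exists a b, bad a b k /\
    x <= a /\ a + w / 2 ^ k <= x + w /\ y <= b /\ b + h / 2 ^ k <= y + h /\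
    a <= px <= a + w / 2 ^ k /\ b <= py <= b + h / 2 ^ k.
Proof.
  intros Hw Hh H0 Hs.
  assert (P2 : forall k, 0 < 2 ^ k) by (intros; apply pow_lt; lra).
  assert (Hstep : forall k (s : {s : R * R | bad (fst s) (snd s) k}),
    {s' : R * R | bad (fst s') (snd s') (S k) /\
      (fst s' = fst (proj1_sig s) \/ fst s' = fst (proj1_sig s) + w / 2 ^ S k) /\
      (snd s' = snd (proj1_sig s) \/ snd s' = snd (proj1_sig s) + h / 2 ^ S k)}).
  { intros k [s Hb]; apply constructive_indefinite_description.
    destruct (Hs _ _ _ Hb) as [a' [b' H']]; exists (a', b'); simpl; tauto. }
  set (seq := fix seq k : {s : R * R | bad (fst s) (snd s) k} :=
    match k with
    | O => exist _ (x, y) H0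
    | S k' => let s' := Hstep k' (seq k') in exist _ (proj1_sig s') (proj1 (proj2_sig s'))
    end).
  set (X := fun k => fst (proj1_sig (seq k))).
  set (Y := fun k => snd (proj1_sig (seq k))).
  assert (HX : forall k, X (S k) = X k \/ X (S k) = X k + w / 2 ^ S k).
  { intros k; unfold X; simpl.
    exact (proj1 (proj2 (proj2_sig (Hstep k (seq k))))). }
  assert (HY : forall k, Y (S k) = Y k \/ Y (S k) = Y k + h / 2 ^ S k).
  { intros k; unfold Y; simpl.
    exact (proj2 (proj2 (proj2_sig (Hstep k (seq k))))). }
  (* In one coordinate the left ends increase and the right ends decrease, so every left end lies
     below every right end and the supremum of the left ends is in all intervals. *)
  assert (L : forall (Z : nat -> R) (c : R), 0 <= c ->
    (forall k, Z (S k) = Z k \/ Z (S k) = Z k + c / 2 ^ S k) ->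
    exists p, forall k, Z O <= Z k /\ Z k + c / 2 ^ k <= Z O + c /\
                        Z k <= p <= Z k + c / 2 ^ k).
  { intros Z c Hc HZ.
    assert (Hhalf : forall k, c / 2 ^ k = 2 * (c / 2 ^ S k)).
    { intros k; simpl; specialize (P2 k); field; lra. }
    assert (Hpos : forall k, 0 <= c / 2 ^ k).
    { intros k; apply Rmult_le_pos; auto; left; apply Rinv_0_lt_compat; auto. }
    assert (Hmono : forall k, Z k <= Z (S k) /\ Z (S k) + c / 2 ^ S k <= Z k + c / 2 ^ k).
    { intros k; specialize (Hpos (S k)); rewrite (Hhalf k); destruct (HZ k) as [E|E]; rewrite E; lra. }
    assert (Hall : forall k j, Z k <= Z (k + j)%nat /\
        Z (k + j)%nat + c / 2 ^ (k + j) <= Z k + c / 2 ^ k).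
    { intros k j; induction j as [|j IH]; [rewrite Nat.add_0_r; lra|].
      rewrite Nat.add_succ_r; destruct (Hmono (k + j)%nat); lra. }
    assert (Hcross : forall k j, Z j <= Z k + c / 2 ^ k).
    { intros k j; destruct (Nat.le_ge_cases k j) as [Hkj|Hkj].
      - destruct (Hall k (j - k)%nat) as [_ H]; replace (k + (j - k))%nat with j in H by lia.
        specialize (Hpos j); lra.
      - destruct (Hall j (k - j)%nat) as [H _]; replace (j + (k - j))%nat with k in H by lia.
        specialize (Hpos k); lra. }
    destruct (completeness (fun r => exists k, r = Z k)) as [p [Hp1 Hp2]].
    - exists (Z O + c / 2 ^ 0); intros r [k ->]; apply Hcross.
    - exists (Z O); exists O; auto.
    - exists p; intros k; repeat split.
      + apply (Hall O k).
      + destruct (Hall O k) as [_ H]; simpl in H; lra.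
      + apply Hp1; eauto.
      + apply Hp2; intros r [j ->]; apply Hcross. }
  destruct (L X w Hw HX) as [px Hpx]; destruct (L Y h Hh HY) as [py Hpy].
  exists px, py; intros k; exists (X k), (Y k).
  split; [exact (proj2_sig (seq k))|].
  change (X O) with x in Hpx; change (Y O) with y in Hpy.
  specialize (Hpx k); specialize (Hpy k); tauto.
Qed.

Lemma cont_at_rdiff (u : C -> C) (z A B : C) : rdiff u z A B -> cont_at u z.
Proof. exact (rdiff_cont u z A B). Qed.

Lemma cont_at_minus_affine (u : C -> C) (p A B z : C) : cont_at u z ->
  cont_at (fun x => u x - (p + (A * x + B * Cconj x)))%C z.
Proof.
  intros H eps He.
  assert (Hr : rdiff (fun x => p + (A * x + B * Cconj x))%C z A B).
  { eapply littleo_ext; [|apply littleo_0]; intros; simpl; rewrite Cplus_conj; ring. }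
  destruct (H (eps / 2)) as [d1 [Hd1 H1]]; [lra|].
  destruct (rdiff_cont _ _ _ _ Hr (eps / 2)) as [d2 [Hd2 H2]]; [lra|].
  exists (Rmin d1 d2); split; [now apply Rmin_case|]; intros y Hy.
  specialize (H1 y (Rlt_le_trans _ _ _ Hy (Rmin_l _ _))).
  specialize (H2 y (Rlt_le_trans _ _ _ Hy (Rmin_r _ _))).
  match goal with |- Cmod ?e < _ =>
    replace e with ((u y - u z) - ((p + (A * y + B * Cconj y)) - (p + (A * z + B * Cconj z))))%C
      by ring end.
  eapply Rle_lt_trans; [apply Cmod_minus_le|]; lra.
Qed.

Lemma rect_int_minus_affine (u : C -> C) (p A B : C) (x0 x1 y0 y1 : R) :
  x0 <= x1 -> y0 <= y1 -> cont_rect u x0 x1 y0 y1 ->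
  rect_int u x0 x1 y0 y1 =
  (rect_int (fun x => u x - (p + (A * x + B * Cconj x)))%C x0 x1 y0 y1 +
   2 * Ci * B * RtoC ((x1 - x0) * (y1 - y0)))%C.
Proof.
  intros Hx Hy Hu; rewrite <- (rect_int_affine p A B), <- rect_int_plus; auto.
  - apply rect_int_ext; auto; intros; ring.
  - intros z [Hz _]; apply cont_at_minus_affine, Hu, Hz.
  - intros z _; apply cont_at_rdiff with A B.
    eapply littleo_ext; [|apply littleo_0]; intros; simpl; rewrite Cplus_conj; ring.
Qed.

Lemma in_rect_dist (x0 x1 y0 y1 : R) (p z : C) :
  in_rect x0 x1 y0 y1 p -> in_rect x0 x1 y0 y1 z ->
  Cmod (z - p)%C <= (x1 - x0) + (y1 - y0).
Proof.
  intros [H1 H2] [H3 H4]; destruct z as [zx zy], p as [px py]; simpl in *.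
  eapply Rle_trans; [apply (Cmod_le_Rabs (zx + - px) (zy + - py))|].
  apply Rplus_le_compat; apply Rabs_le; lra.
Qed.

(** If the bound failed by [gam], some quarter would fail by [gam / 4], and so on. At the limit
    point the affine part of [u] integrates exactly to at most [2 * eps] times the area, while the
    remainder is small against the side on a perimeter proportional to the side, hence small against
    [4 ^ (-k)]: it cannot account for the excess [gam / 4 ^ k]. *)
Lemma goursat (u : C -> C) (x0 x1 y0 y1 eps : R) : x0 <= x1 -> y0 <= y1 ->
  (forall z, in_rect x0 x1 y0 y1 z -> exists A B, rdiff u z A B /\ Cmod B <= eps) ->
  Cmod (rect_int u x0 x1 y0 y1) <= 2 * eps * ((x1 - x0) * (y1 - y0)).
Proof.
  intros Hx Hy Hu; apply le_epsilon; intros gam Hgam.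
  set (w := x1 - x0); set (h := y1 - y0).
  destruct (Rle_lt_dec (Cmod (rect_int u x0 x1 y0 y1)) (2 * eps * (w * h) + gam)) as [G|G]; [auto|].
  exfalso.
  assert (P2 : forall k, 0 < 2 ^ k) by (intros; apply pow_lt; lra).
  assert (Hc : cont_rect u x0 x1 y0 y1).
  { intros z Hz; destruct (Hu z Hz) as [A [B [H _]]]; now apply cont_at_rdiff with A B. }
  set (inside := fun a b k => x0 <= a /\ a + w / 2 ^ k <= x1 /\ y0 <= b /\ b + h / 2 ^ k <= y1).
  (* The excess [gam / 4 ^ k] scales like the area, so it passes to one of the four quarters. *)
  set (bad := fun a b k => inside a b k /\
    2 * eps * ((w / 2 ^ k) * (h / 2 ^ k)) + gam / 4 ^ k <
    Cmod (rect_int u a (a + w / 2 ^ k) b (b + h / 2 ^ k))).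
  assert (Hw0 : 0 <= w) by (unfold w; lra); assert (Hh0 : 0 <= h) by (unfold h; lra).
  assert (Hpos : forall c k, 0 <= c -> 0 <= c / 2 ^ k).
  { intros c k Hc0; apply Rmult_le_pos; auto; left; apply Rinv_0_lt_compat; auto. }
  destruct (bisection bad w h x0 y0) as [px [py Hp]]; auto.
  - split; [unfold inside, w, h; simpl; lra|].
    simpl; rewrite !Rdiv_1_r; unfold w, h in *.
    replace (x0 + (x1 - x0)) with x1 by ring; replace (y0 + (y1 - y0)) with y1 by ring; auto.
  - intros a b k [[I1 [I2 [I3 I4]]] Hb].
    set (w' := w / 2 ^ S k); set (h' := h / 2 ^ S k).
    assert (Ew : w / 2 ^ k = w' + w') by (unfold w'; simpl; specialize (P2 k); field; lra).
    assert (Eh : h / 2 ^ k = h' + h') by (unfold h'; simpl; specialize (P2 k); field; lra).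
    assert (Hw' : 0 <= w') by (apply Hpos; auto); assert (Hh' : 0 <= h') by (apply Hpos; auto).
    assert (E4 : gam / 4 ^ k = 4 * (gam / 4 ^ S k))
      by (simpl; assert (0 < 4 ^ k) by (apply pow_lt; lra); field; lra).
    rewrite Ew, Eh, E4 in Hb; rewrite Ew, Eh in *.
    set (g' := gam / 4 ^ S k) in *.
    assert (Hc' : cont_rect u a (a + (w' + w')) b (b + (h' + h'))).
    { intros z [Hz1 Hz2]; apply Hc; split; lra. }
    rewrite (rect_int_split_vertical u a (a + w')) in Hb;
      [|lra|lra|intros; split; apply Hc'; split; simpl; lra].
    rewrite (rect_int_split_horizontal u a (a + w') b (b + h')) in Hb;
      [|lra|lra|intros; split; apply Hc'; split; simpl; lra].
    rewrite (rect_int_split_horizontal u (a + w') (a + (w' + w')) b (b + h')) in Hb;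
      [|lra|lra|intros; split; apply Hc'; split; simpl; lra].
    replace (a + (w' + w')) with (a + w' + w') in Hb by ring.
    replace (b + (h' + h')) with (b + h' + h') in Hb by ring.
    set (q1 := rect_int u a (a + w') b (b + h')) in *.
    set (q2 := rect_int u a (a + w') (b + h') (b + h' + h')) in *.
    set (q3 := rect_int u (a + w') (a + w' + w') b (b + h')) in *.
    set (q4 := rect_int u (a + w') (a + w' + w') (b + h') (b + h' + h')) in *.
    assert (T : Cmod (q1 + q2 + (q3 + q4))%C <= Cmod q1 + Cmod q2 + (Cmod q3 + Cmod q4)).
    { eapply Rle_trans; [apply Cmod_triangle|].
      apply Rplus_le_compat; apply Cmod_triangle. }
    assert (Alt : 2 * eps * (w' * h') + g' < Cmod q1 \/ 2 * eps * (w' * h') + g' < Cmod q2 \/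
                  2 * eps * (w' * h') + g' < Cmod q3 \/ 2 * eps * (w' * h') + g' < Cmod q4).
    { destruct (Rlt_le_dec (2 * eps * (w' * h') + g') (Cmod q1)); auto.
      destruct (Rlt_le_dec (2 * eps * (w' * h') + g') (Cmod q2)); auto.
      destruct (Rlt_le_dec (2 * eps * (w' * h') + g') (Cmod q3)); auto.
      destruct (Rlt_le_dec (2 * eps * (w' * h') + g') (Cmod q4)); auto.
      exfalso; lra. }
    destruct Alt as [Hq|[Hq|[Hq|Hq]]].
    + exists a, b; split; [|auto]; split; [unfold inside; fold w' h'; lra|exact Hq].
    + exists a, (b + h'); split; [|auto]; split; [unfold inside; fold w' h'; lra|exact Hq].
    + exists (a + w'), b; split; [|auto]; split; [unfold inside; fold w' h'; lra|exact Hq].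
    + exists (a + w'), (b + h'); split; [|auto]; split; [unfold inside; fold w' h'; lra|exact Hq].
  - set (p := (px, py) : C).
    assert (Hin : in_rect x0 x1 y0 y1 p).
    { destruct (Hp O) as [a [b [_ H]]]; simpl in H; unfold in_rect, p; simpl.
      unfold w, h in H; lra. }
    destruct (Hu p Hin) as [A [B [HAB HB]]].
    set (s := w + h).
    assert (Hs : 0 <= s) by (unfold s; lra).
    (* Chosen so that the remainder, at most [2 * s * s * eta / 4 ^ k], stays below [gam / 4 ^ k];
       the added 1 covers a degenerate rectangle. *)
    set (eta := gam / (4 * (s * s) + 1)).
    assert (Heta : 0 < eta) by (apply Rdiv_lt_0_compat; nra).
    destruct (HAB eta Heta) as [d [Hd Hh]].
    assert (Hk : exists k, s / 2 ^ k < d).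
    { destruct (pow_lt_1_zero (/ 2) ltac:(rewrite Rabs_pos_eq; lra) (d / (s + 1))) as [N HN].
      { apply Rdiv_lt_0_compat; lra. }
      exists N; specialize (HN N (Nat.le_refl _)).
      rewrite Rabs_pos_eq in HN by (apply pow_le; lra).
      rewrite pow_inv in HN.
      assert (H1 := Rinv_0_lt_compat _ (P2 N)).
      apply Rmult_lt_compat_l with (r := s + 1) in HN; [|lra].
      replace ((s + 1) * (d / (s + 1))) with d in HN by (field; lra).
      unfold Rdiv; nra. }
    destruct Hk as [k Hk]; destruct (Hp k) as [a [b [[[I1 [I2 [I3 I4]]] Hb] H]]].
    assert (Hwk := Hpos w k Hw0); assert (Hhk := Hpos h k Hh0).
    assert (Hc' : cont_rect u a (a + w / 2 ^ k) b (b + h / 2 ^ k)).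
    { intros z [Hz1 Hz2]; apply Hc; split; lra. }
    rewrite (rect_int_minus_affine u (u p - (A * p + B * Cconj p)) A B) in Hb; auto; try lra.
    replace (a + w / 2 ^ k - a) with (w / 2 ^ k) in Hb by ring.
    replace (b + h / 2 ^ k - b) with (h / 2 ^ k) in Hb by ring.
    assert (Hinp : in_rect a (a + w / 2 ^ k) b (b + h / 2 ^ k) p)
      by (unfold in_rect, p; simpl; lra).
    assert (Esk : w / 2 ^ k + h / 2 ^ k = s / 2 ^ k) by (unfold s; field; specialize (P2 k); lra).
    assert (B1 : Cmod (rect_int (fun x => u x - (u p - (A * p + B * Cconj p) +
       (A * x + B * Cconj x)))%C a (a + w / 2 ^ k) b (b + h / 2 ^ k)) <=
       2 * (s / 2 ^ k) * (eta * (s / 2 ^ k))).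
    { eapply Rle_trans; [apply rect_int_bound with (K := eta * (s / 2 ^ k)); try lra|].
      - intros z [Hz _]; apply cont_at_minus_affine, Hc', Hz.
      - intros z [Hz _].
        assert (Hd' := in_rect_dist _ _ _ _ p z Hinp Hz).
        replace (a + w / 2 ^ k - a + (b + h / 2 ^ k - b)) with (s / 2 ^ k) in Hd'
          by (rewrite <- Esk; ring).
        specialize (Hh (z - p)%C ltac:(lra)).
        replace (p + (z - p))%C with z in Hh by ring.
        replace (u z - (u p - (A * p + B * Cconj p) + (A * z + B * Cconj z)))%C with
          (u z - u p - (A * (z - p) + B * Cconj (z - p)))%C by (rewrite Cminus_conj; ring).
        eapply Rle_trans; [apply Hh|]; apply Rmult_le_compat_l; lra.
      - replace (a + w / 2 ^ k - a + (b + h / 2 ^ k - b)) with (s / 2 ^ k)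
          by (rewrite <- Esk; ring); lra. }
    assert (B2 : Cmod (2 * Ci * B * RtoC (w / 2 ^ k * (h / 2 ^ k)))%C <=
       2 * eps * (w / 2 ^ k * (h / 2 ^ k))).
    { rewrite !Cmod_mult, Cmod_Ci, !Cmod_R, (Rabs_pos_eq 2) by lra.
      rewrite (Rabs_pos_eq (w / 2 ^ k * _)) by nra.
      assert (0 <= w / 2 ^ k * (h / 2 ^ k)) by nra; nra. }
    assert (B3 : 2 * (s / 2 ^ k) * (eta * (s / 2 ^ k)) < gam / 4 ^ k).
    { replace (4 ^ k) with (2 ^ k * 2 ^ k) by (rewrite <- Rpow_mult_distr; f_equal; lra).
      specialize (P2 k).
      replace (2 * (s / 2 ^ k) * (eta * (s / 2 ^ k))) with
        ((2 * s * s * eta) / (2 ^ k * 2 ^ k)) by (field; lra).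
      apply Rmult_lt_compat_r; [apply Rinv_0_lt_compat; nra|].
      unfold eta; apply Rmult_lt_reg_r with (4 * (s * s) + 1); [nra|].
      replace (2 * s * s * (gam / (4 * (s * s) + 1)) * (4 * (s * s) + 1)) with
        (2 * s * s * gam) by (field; nra); nra. }
    eapply Rlt_irrefl, Rlt_trans; [apply Hb|].
    eapply Rle_lt_trans; [apply Cmod_triangle|]; lra.
Qed.

(** * Cauchy's formula on a square *)

Lemma sqr_add_pos (s : R) : 0 < s -> forall t, 0 < t * t + s * s.
Proof. intros Hs t; assert (H1 := Rle_0_sqr t); unfold Rsqr in H1; nra. Qed.

Lemma RInt_shifted_odd (c s : R) : 0 < s ->
  RInt (fun x => (x - c) / ((x - c) * (x - c) + s * s)) (c - s) (c + s) = 0.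
Proof.
  intros Hs; apply is_RInt_unique.
  assert (Hp := sqr_add_pos s Hs); assert (Hq := fun x => Hp (x - c)); clear Hp; rename Hq into Hp.
  cbv beta in Hp.
  assert (H : is_RInt (fun x => (x - c) / ((x - c) * (x - c) + s * s)) (c - s) (c + s)
    (/ 2 * ln ((c + s - c) * (c + s - c) + s * s) -
     / 2 * ln ((c - s - c) * (c - s - c) + s * s))).
  { apply (is_RInt_derive (fun x => / 2 * ln ((x - c) * (x - c) + s * s))).
    - intros x _; auto_derive; [apply Hp|]; specialize (Hp x); field; lra.
    - intros x _; apply (ex_derive_continuous (V := R_NormedModule)); auto_derive.
      specialize (Hp x); lra. }
  replace ((c + s - c) * (c + s - c)) with ((c - s - c) * (c - s - c)) in H by ring.
  now rewrite Rminus_diag in H.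
Qed.

Lemma RInt_shifted_even (c s : R) : 0 < s ->
  RInt (fun x => s / ((x - c) * (x - c) + s * s)) (c - s) (c + s) = 2 * atan 1.
Proof.
  intros Hs; apply is_RInt_unique.
  assert (Hp := sqr_add_pos s Hs); assert (Hq := fun x => Hp (x - c)); clear Hp; rename Hq into Hp.
  cbv beta in Hp.
  assert (H : is_RInt (fun x => s / ((x - c) * (x - c) + s * s)) (c - s) (c + s)
    (atan ((c + s - c) / s) - atan ((c - s - c) / s))).
  { apply (is_RInt_derive (fun x => atan ((x - c) / s))).
    - intros x _; auto_derive; [lra|]; specialize (Hp x).
      assert (H0 : 1 + (x - c) / s * ((x - c) / s) = ((x - c) * (x - c) + s * s) / (s * s))
        by (field; lra).
      field; repeat split; try lra; nra.
    - intros x _; apply (ex_derive_continuous (V := R_NormedModule)); auto_derive.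
      specialize (Hp x); lra. }
  replace ((c + s - c) / s) with 1 in H by (field; lra).
  replace ((c - s - c) / s) with (- (1)) in H by (field; lra).
  rewrite atan_opp in H; replace (atan 1 - - atan 1) with (2 * atan 1) in H by ring; auto.
Qed.

(** This is [2 pi i]; each of the four edges of a centred square contributes [2 * atan 1] to the
    imaginary part. *)
Definition winding : C := (Ci * RtoC (8 * atan 1))%C.

Lemma winding_mod : 4 <= Cmod winding.
Proof.
  unfold winding; rewrite Cmod_mult, Cmod_Ci, Cmod_R, atan_1.
  assert (H := PI2_1); rewrite Rabs_pos_eq; lra.
Qed.

Lemma winding_neq_0 : winding <> 0.
Proof. apply Cmod_gt_0; assert (H := winding_mod); lra. Qed.

Lemma rect_int_inv (a : C) (s : R) : 0 < s ->
  rect_int (fun z => / (z - a))%C (fst a - s) (fst a + s) (snd a - s) (snd a + s) = winding.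
Proof.
  intros Hs; destruct a as [ax ay]; simpl.
  assert (Hp := sqr_add_pos s Hs).
  assert (Ho : RInt (fun x => - ((x - ay) / ((x - ay) * (x - ay) + s * s))) (ay - s) (ay + s) = 0).
  { rewrite (RInt_opp (V := R_CompleteNormedModule) (fun x => (x - ay) / ((x - ay) * (x - ay) + s * s))).
    - rewrite RInt_shifted_odd by auto; apply Ropp_0.
    - apply (ex_RInt_continuous (V := R_CompleteNormedModule)); intros x _.
      apply (ex_derive_continuous (V := R_NormedModule)); auto_derive; specialize (Hp (x - ay)); lra. }
  assert (He : forall c, RInt (fun x => - (s / ((x - c) * (x - c) + s * s))) (c - s) (c + s)
             = - (2 * atan 1)).
  { intros c.
    rewrite (RInt_opp (V := R_CompleteNormedModule) (fun x => s / ((x - c) * (x - c) + s * s))).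
    - rewrite RInt_shifted_even by auto; reflexivity.
    - apply (ex_RInt_continuous (V := R_CompleteNormedModule)); intros x _.
      apply (ex_derive_continuous (V := R_NormedModule)); auto_derive; specialize (Hp (x - c)); lra. }
  assert (B1 : cint (fun x => / ((x, (ay - s)%R) - (ax, ay)))%C (ax - s) (ax + s) = (0, 2 * atan 1)).
  { unfold cint; f_equal.
    - rewrite <- (RInt_shifted_odd ax s Hs); apply RInt_ext; intros x _; simpl.
      specialize (Hp (x - ax)); field; nra.
    - rewrite <- (RInt_shifted_even ax s Hs); apply RInt_ext; intros x _; simpl.
      specialize (Hp (x - ax)); field; nra. }
  assert (B2 : cint (fun x => / ((x, (ay + s)%R) - (ax, ay)))%C (ax - s) (ax + s) = (0, - (2 * atan 1))).
  { unfold cint; f_equal.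
    - rewrite <- (RInt_shifted_odd ax s Hs); apply RInt_ext; intros x _; simpl.
      specialize (Hp (x - ax)); field; nra.
    - rewrite <- (He ax); apply RInt_ext; intros x _; simpl.
      specialize (Hp (x - ax)); field; nra. }
  assert (B3 : cint (fun y => / (((ax + s)%R, y) - (ax, ay)))%C (ay - s) (ay + s) = (2 * atan 1, 0)).
  { unfold cint; f_equal.
    - rewrite <- (RInt_shifted_even ay s Hs); apply RInt_ext; intros x _; simpl.
      specialize (Hp (x - ay)); field; nra.
    - rewrite <- Ho; apply RInt_ext; intros x _; simpl.
      specialize (Hp (x - ay)); field; nra. }
  assert (B4 : cint (fun y => / (((ax - s)%R, y) - (ax, ay)))%C (ay - s) (ay + s) = (- (2 * atan 1), 0)).
  { unfold cint; f_equal.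
    - rewrite <- (He ay); apply RInt_ext; intros x _; simpl.
      specialize (Hp (x - ay)); field; nra.
    - rewrite <- Ho; apply RInt_ext; intros x _; simpl.
      specialize (Hp (x - ay)); field; nra. }
  unfold rect_int; rewrite B1, B2, B3, B4; unfold winding.
  apply injective_projections; simpl; ring.
Qed.

Lemma rdiff_shift_inv (a z : C) : z <> a ->
  rdiff (fun x => / (x - a))%C z (- (1) / ((z - a) * (z - a))) 0.
Proof.
  intros Hz.
  assert (Hz' : (z - a <> 0)%C).
  { intros E; apply Hz; replace z with (z - a + a)%C by ring; rewrite E; ring. }
  eapply rdiff_eq; [| |apply (rdiff_inv (fun x => x - a)%C z (1 - 0) (0 - 0))].
  - field; auto.
  - field; auto.
  - auto.
  - apply rdiff_minus; [apply rdiff_id|apply rdiff_const].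
Qed.

(** The rectangle is cut into a square of half side [s] around [a] and four pieces away from it. On
    the pieces [1/(z - a)] is holomorphic of size at most [1/s], so [goursat] applies with
    [eps / s]. On the square [u] is replaced by [u a], with an error [om / s] on a contour of length
    [8 s]. *)
Lemma cauchy_approx (u : C -> C) (a : C) (x0 x1 y0 y1 s eps om : R) :
  0 < s -> 0 <= eps ->
  x0 <= fst a - s -> fst a + s <= x1 -> y0 <= snd a - s -> snd a + s <= y1 ->
  (forall z, in_rect x0 x1 y0 y1 z -> exists A B, rdiff u z A B /\ Cmod B <= eps) ->
  (forall z, in_rect (fst a - s) (fst a + s) (snd a - s) (snd a + s) z ->
     Cmod (u z - u a)%C <= om) ->
  Cmod (rect_int (fun z => u z * / (z - a))%C x0 x1 y0 y1 - winding * u a)%C <=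
  2 * (eps / s) * ((x1 - x0) * (y1 - y0)) + 8 * om.
Proof.
  intros Hs Heps Ha1 Ha2 Ha3 Ha4 Hu Hom.
  set (ax := fst a) in *; set (ay := snd a) in *.
  set (phi := (fun z => u z * / (z - a))%C).
  assert (Hfar : forall z, s <= Rabs (fst z - ax) \/ s <= Rabs (snd z - ay) -> s <= Cmod (z - a)%C).
  { intros z [H|H]; eapply Rle_trans; try apply H.
    - apply (Cmod_fst_le (z - a)%C).
    - apply (Cmod_snd_le (z - a)%C). }
  assert (Hneq : forall z, s <= Cmod (z - a)%C -> z <> a).
  { intros z H E; rewrite E in H; replace (a - a)%C with (RtoC 0) in H by ring.
    rewrite Cmod_0 in H; lra. }
  assert (Hphi : forall z, in_rect x0 x1 y0 y1 z -> s <= Cmod (z - a)%C ->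
     exists A B, rdiff phi z A B /\ Cmod B <= eps / s).
  { intros z Hz Hza; destruct (Hu z Hz) as [A [B [HAB HB]]].
    do 2 eexists; split; [apply (rdiff_mult _ _ _ _ _ _ _ HAB (rdiff_shift_inv a z (Hneq z Hza)))|].
    rewrite Cmult_0_r, Cplus_0_r, Cmod_mult.
    assert (Hza' : (z - a <> 0)%C) by (apply Cmod_gt_0; lra).
    rewrite Cmod_inv by auto.
    apply Rmult_le_compat; auto; try apply Cmod_ge_0.
    - left; apply Rinv_0_lt_compat; lra.
    - apply Rinv_le_contravar; auto. }
  assert (Hphic : forall z, in_rect x0 x1 y0 y1 z -> s <= Cmod (z - a)%C -> cont_at phi z).
  { intros z Hz Hza; destruct (Hphi z Hz Hza) as [A [B [H _]]]; now apply cont_at_rdiff with A B. }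
  assert (RA : forall t, s <= t -> s <= Rabs t) by (intros t Ht; rewrite Rabs_pos_eq; lra).
  assert (RB : forall t, t <= - s -> s <= Rabs t) by (intros t Ht; rewrite Rabs_left1; lra).
  assert (E : rect_int phi x0 x1 y0 y1 =
    (rect_int phi x0 (ax - s) y0 y1 + (rect_int phi (ax - s) (ax + s) y0 (ay - s) +
       (rect_int phi (ax - s) (ax + s) (ay - s) (ay + s) +
        rect_int phi (ax - s) (ax + s) (ay + s) y1) + rect_int phi (ax + s) x1 y0 y1))%C).
  { rewrite (rect_int_split_vertical phi x0 (ax - s) x1) by
      first [lra|intros x Hx; split; (apply Hphic; [split; simpl; lra|]);
       apply Hfar; right; simpl; [apply RB|apply RA]; lra].
    rewrite (rect_int_split_vertical phi (ax - s) (ax + s) x1) by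
      first [lra|intros x Hx; split; (apply Hphic; [split; simpl; lra|]);
       apply Hfar; right; simpl; [apply RB|apply RA]; lra].
    rewrite (rect_int_split_horizontal phi (ax - s) (ax + s) y0 (ay - s) y1) by
      first [lra|intros x Hx; split; (apply Hphic; [split; simpl; lra|]);
       apply Hfar; left; simpl; [apply RB|apply RA]; lra].
    rewrite (rect_int_split_horizontal phi (ax - s) (ax + s) (ay - s) (ay + s) y1) by
      first [lra|intros x Hx; split; (apply Hphic; [split; simpl; lra|]);
       apply Hfar; left; simpl; [apply RB|apply RA]; lra].
    ring. }
  assert (G1 : Cmod (rect_int phi x0 (ax - s) y0 y1) <= 2 * (eps / s) * ((ax - s - x0) * (y1 - y0))).
  { apply goursat; try lra; intros z [Hz1 Hz2]; apply Hphi; [split; lra|].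
    apply Hfar; left; apply RB; lra. }
  assert (G2 : Cmod (rect_int phi (ax + s) x1 y0 y1) <= 2 * (eps / s) * ((x1 - (ax + s)) * (y1 - y0))).
  { apply goursat; try lra; intros z [Hz1 Hz2]; apply Hphi; [split; lra|].
    apply Hfar; left; apply RA; lra. }
  assert (G3 : Cmod (rect_int phi (ax - s) (ax + s) y0 (ay - s)) <=
     2 * (eps / s) * ((ax + s - (ax - s)) * (ay - s - y0))).
  { apply goursat; try lra; intros z [Hz1 Hz2]; apply Hphi; [split; lra|].
    apply Hfar; right; apply RB; lra. }
  assert (G4 : Cmod (rect_int phi (ax - s) (ax + s) (ay + s) y1) <=
     2 * (eps / s) * ((ax + s - (ax - s)) * (y1 - (ay + s)))).
  { apply goursat; try lra; intros z [Hz1 Hz2]; apply Hphi; [split; lra|].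
    apply Hfar; right; apply RA; lra. }
  set (Q := rect_int phi (ax - s) (ax + s) (ay - s) (ay + s)) in *.
  assert (Hbd : forall z, on_boundary (ax - s) (ax + s) (ay - s) (ay + s) z ->
     in_rect x0 x1 y0 y1 z /\ s <= Cmod (z - a)%C).
  { intros z [[Hz1 Hz2] Hz3]; split; [split; lra|]; apply Hfar.
    destruct Hz3 as [Hz3|[Hz3|[Hz3|Hz3]]]; rewrite Hz3;
      [left; apply RB|left; apply RA|right; apply RB|right; apply RA]; lra. }
  assert (Hinvc : forall z, on_boundary (ax - s) (ax + s) (ay - s) (ay + s) z ->
     cont_at (fun z => / (z - a))%C z).
  { intros z Hz; eapply cont_at_rdiff, rdiff_shift_inv, Hneq, Hbd, Hz. }
  assert (Hmulc : forall c z, on_boundary (ax - s) (ax + s) (ay - s) (ay + s) z ->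
     cont_at (fun z => (u z - c) * / (z - a))%C z).
  { intros c z Hz; destruct (Hbd z Hz) as [Hz1 Hz2]; destruct (Hu z Hz1) as [A [B [HAB _]]].
    eapply cont_at_rdiff, rdiff_mult; [apply rdiff_minus; [apply HAB|apply rdiff_const]|].
    apply rdiff_shift_inv; auto. }
  assert (EQ : (Q - winding * u a)%C =
    rect_int (fun z => (u z - u a) * / (z - a))%C (ax - s) (ax + s) (ay - s) (ay + s)).
  { rewrite <- (rect_int_inv a s Hs); fold ax ay.
    rewrite (Cmult_comm (rect_int _ _ _ _ _)), <- rect_int_scal by (try lra; auto).
    unfold Q.
    replace (rect_int phi (ax - s) (ax + s) (ay - s) (ay + s)) with
      (rect_int (fun z => (u z - u a) * / (z - a) + u a * / (z - a))%C
        (ax - s) (ax + s) (ay - s) (ay + s))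
      by (apply rect_int_ext; try lra; intros; unfold phi; ring).
    rewrite rect_int_plus; try lra; [ring|intro z; apply Hmulc|].
    intros z Hz; destruct (Hbd z Hz) as [Hz1 Hz2].
    eapply cont_at_rdiff, rdiff_scal, rdiff_shift_inv, Hneq, Hz2. }
  assert (G5 : Cmod (Q - winding * u a)%C <= 8 * om).
  { rewrite EQ; eapply Rle_trans; [apply rect_int_bound with (K := om / s); try lra|].
    - intro z; apply Hmulc.
    - intros z Hz; destruct (Hbd z Hz) as [Hz1 Hz2]; destruct Hz as [Hz _].
      assert (Hza' : (z - a <> 0)%C) by (apply Cmod_gt_0; lra).
      rewrite Cmod_mult, Cmod_inv by auto.
      apply Rmult_le_compat; auto; try apply Cmod_ge_0.
      + left; apply Rinv_0_lt_compat; lra.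
      + apply Rinv_le_contravar; auto.
    - right; field; lra. }
  change (Cmod (rect_int phi x0 x1 y0 y1 - winding * u a)%C <=
    2 * (eps / s) * ((x1 - x0) * (y1 - y0)) + 8 * om).
  rewrite E.
  match goal with |- Cmod ?e <= _ => replace e with
    (rect_int phi x0 (ax - s) y0 y1 + (rect_int phi (ax + s) x1 y0 y1 +
      (rect_int phi (ax - s) (ax + s) y0 (ay - s) + (rect_int phi (ax - s) (ax + s) (ay + s) y1 +
        (Q - winding * u a)))))%C by ring end.
  eapply Rle_trans; [apply Cmod_triangle|].
  assert (T : forall q r t w : C, Cmod (q + (r + (t + w)))%C <=
     Cmod q + Cmod r + Cmod t + Cmod w).
  { intros; eapply Rle_trans; [apply Cmod_triangle|].
    eapply Rle_trans; [apply Rplus_le_compat_l, Cmod_triangle|].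
    eapply Rle_trans; [do 2 apply Rplus_le_compat_l; apply Cmod_triangle|]; lra. }
  eapply Rle_trans; [apply Rplus_le_compat_l, T|].
  assert (He : 0 <= eps / s) by (apply Rmult_le_pos; [auto|left; apply Rinv_0_lt_compat; lra]).
  assert (0 <= (eps / s) * (4 * (s * s))) by (apply Rmult_le_pos; nra).
  lra.
Qed.

(** * Uniform limits of functions with small conjugate derivative *)

(** The property that the limit of the iterated corrections visibly has. The approximants are not
    holomorphic, so Cauchy's formula is proved for this class directly. *)
Definition almost_hol (u : C -> C) (p : C) (rho : R) : Prop :=
  forall eps, 0 < eps -> exists u', forall z, Cmod (z - p)%C < rho ->
    Cmod (u' z - u z)%C <= eps /\ exists A B, rdiff u' z A B /\ Cmod B <= eps.

Lemma almost_hol_cont (u : C -> C) (p : C) (rho : R) (z : C) :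
  almost_hol u p rho -> Cmod (z - p)%C < rho -> cont_at u z.
Proof.
  intros H Hz eps He; destruct (H (eps / 4)) as [u' Hu]; [lra|].
  destruct (Hu z Hz) as [H1 [A [B [HAB _]]]].
  destruct (rdiff_cont _ _ _ _ HAB (eps / 4)) as [d [Hd Hc]]; [lra|].
  exists (Rmin d (rho - Cmod (z - p)%C)); split; [apply Rmin_case; lra|]; intros y Hy.
  assert (Hy1 : Cmod (y - z)%C < d) by (eapply Rlt_le_trans; [apply Hy|apply Rmin_l]).
  assert (Hy2 : Cmod (y - z)%C < rho - Cmod (z - p)%C)
    by (eapply Rlt_le_trans; [apply Hy|apply Rmin_r]).
  assert (Hy3 : Cmod (y - p)%C < rho)
    by (eapply Rle_lt_trans; [apply (Cmod_triangle3 y z p)|]; lra).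
  destruct (Hu y Hy3) as [H2 _]; specialize (Hc y Hy1).
  assert (T1 := Cmod_triangle3 (u y) (u' y) (u z)).
  assert (T2 := Cmod_triangle3 (u' y) (u' z) (u z)).
  rewrite (Cmod_minus_sym (u y) (u' y)) in T1; lra.
Qed.

Lemma cont_at_plus (u v : C -> C) (z : C) : cont_at u z -> cont_at v z ->
  cont_at (fun x => u x + v x)%C z.
Proof.
  intros Hu Hv e He.
  destruct (Hu (e / 2)) as [d1 [Hd1 H1]]; [lra|].
  destruct (Hv (e / 2)) as [d2 [Hd2 H2]]; [lra|].
  exists (Rmin d1 d2); split; [now apply Rmin_case|]; intros y Hy.
  specialize (H1 y (Rlt_le_trans _ _ _ Hy (Rmin_l _ _))).
  specialize (H2 y (Rlt_le_trans _ _ _ Hy (Rmin_r _ _))).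
  replace (u y + v y - (u z + v z))%C with ((u y - u z) + (v y - v z))%C by ring.
  eapply Rle_lt_trans; [apply Cmod_triangle|]; lra.
Qed.

Lemma cont_at_mult (u v : C -> C) (z : C) : cont_at u z -> cont_at v z ->
  cont_at (fun x => u x * v x)%C z.
Proof.
  intros Hu Hv eps He.
  assert (H1 := Cmod_ge_0 (u z)); assert (H2 := Cmod_ge_0 (v z)).
  set (K := Cmod (u z) + Cmod (v z) + 2).
  set (e := Rmin 1 (eps / K)).
  assert (HeK : 0 < eps / K) by (apply Rdiv_lt_0_compat; unfold K; lra).
  assert (He0 : 0 < e) by (unfold e; apply Rmin_case; lra).
  destruct (Hu e He0) as [d1 [Hd1 H1']]; destruct (Hv e He0) as [d2 [Hd2 H2']].
  exists (Rmin d1 d2); split; [now apply Rmin_case|]; intros y Hy.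
  specialize (H1' y (Rlt_le_trans _ _ _ Hy (Rmin_l _ _))).
  specialize (H2' y (Rlt_le_trans _ _ _ Hy (Rmin_r _ _))).
  replace (u y * v y - u z * v z)%C with
    ((u y - u z) * (v y - v z) + (u y - u z) * v z + u z * (v y - v z))%C by ring.
  eapply Rle_lt_trans; [apply Cmod_triangle|].
  eapply Rle_lt_trans; [apply Rplus_le_compat_r, Cmod_triangle|].
  rewrite !Cmod_mult.
  assert (P1 := Cmod_ge_0 (u y - u z)%C); assert (P2 := Cmod_ge_0 (v y - v z)%C).
  assert (L1 : e <= 1) by apply Rmin_l; assert (L2 : e <= eps / K) by apply Rmin_r.
  apply Rlt_le_trans with (K * e).
  - unfold K.
    assert (Cmod (u y - u z)%C * Cmod (v y - v z)%C <= e * 1)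
      by (apply Rmult_le_compat; lra).
    nra.
  - apply Rle_trans with (K * (eps / K)); [apply Rmult_le_compat_l; unfold K in *; lra|].
    right; field; unfold K; lra.
Qed.

Lemma square_boundary_far (p a z : C) (s t : R) :
  on_boundary (fst p - s) (fst p + s) (snd p - s) (snd p + s) z ->
  Cmod (a - p)%C <= t -> s - t <= Cmod (z - a)%C.
Proof.
  intros [_ Hz] Ha.
  assert (T1 := Cmod_fst_le (z - a)%C); assert (T2 := Cmod_snd_le (z - a)%C).
  assert (A1 := Cmod_fst_le (a - p)%C); assert (A2 := Cmod_snd_le (a - p)%C).
  simpl in T1, T2, A1, A2.
  assert (B1 : Rabs (fst a + - fst p) <= t) by lra.
  assert (B2 : Rabs (snd a + - snd p) <= t) by lra.
  apply Rabs_le_between in B1; apply Rabs_le_between in B2.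
  destruct Hz as [Hz|[Hz|[Hz|Hz]]]; rewrite Hz in *.
  - assert (R := Rle_abs (- (fst p - s + - fst a))); rewrite Rabs_Ropp in R; lra.
  - assert (R := Rle_abs (fst p + s + - fst a)); lra.
  - assert (R := Rle_abs (- (snd p - s + - snd a))); rewrite Rabs_Ropp in R; lra.
  - assert (R := Rle_abs (snd p + s + - snd a)); lra.
Qed.

(** An approximant satisfies the formula up to an error containing [e / t], with [t] the half side
    of the small square. So [t] is taken from the continuity of [u] itself, and only then [e], with
    its approximant; the latter oscillates little on the square because it is uniformly close to
    [u]. *)
Lemma almost_hol_cauchy (u : C -> C) (p a : C) (rho s : R) :
  0 < s -> 2 * s < rho -> Cmod (a - p)%C <= s / 2 -> almost_hol u p rho ->
  rect_int (fun z => u z * / (z - a))%C (fst p - s) (fst p + s) (snd p - s) (snd p + s) =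
  (winding * u a)%C.
Proof.
  intros Hs Hrho Ha Hu.
  set (x0 := fst p - s); set (x1 := fst p + s); set (y0 := snd p - s); set (y1 := snd p + s).
  assert (Hin : forall z, in_rect x0 x1 y0 y1 z -> Cmod (z - p)%C < rho).
  { intros [zx zy] [H1 H2]; unfold x0, x1, y0, y1 in *; simpl in *.
    eapply Rle_lt_trans; [apply (Cmod_le_Rabs (zx + - fst p) (zy + - snd p))|].
    assert (Rabs (zx + - fst p) <= s) by (apply Rabs_le; lra).
    assert (Rabs (zy + - snd p) <= s) by (apply Rabs_le; lra); lra. }
  assert (Ha1 := Cmod_fst_le (a - p)%C); assert (Ha2 := Cmod_snd_le (a - p)%C).
  change (fst (a - p)%C) with (fst a + - fst p) in Ha1.
  change (snd (a - p)%C) with (snd a + - snd p) in Ha2.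
  assert (Ha3 : Rabs (fst a + - fst p) <= s / 2) by lra.
  assert (Ha4 : Rabs (snd a + - snd p) <= s / 2) by lra.
  apply Rabs_le_between in Ha3; apply Rabs_le_between in Ha4.
  assert (Hina : in_rect x0 x1 y0 y1 a) by (unfold in_rect, x0, x1, y0, y1; lra).
  assert (Hbd : forall z, on_boundary x0 x1 y0 y1 z -> s / 2 <= Cmod (z - a)%C).
  { intros z Hz; assert (H := square_boundary_far p a z s (s / 2) Hz Ha); lra. }
  assert (Hnz : forall z, on_boundary x0 x1 y0 y1 z -> z <> a).
  { intros z Hz E; specialize (Hbd z Hz); rewrite E in Hbd.
    replace (a - a)%C with (RtoC 0) in Hbd by ring; rewrite Cmod_0 in Hbd; lra. }
  apply Cmod_le_eps_eq; intros eps He.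
  assert (Hca := almost_hol_cont u p rho a Hu (Hin a Hina)).
  destruct (Hca (eps / 100)) as [d [Hd Hosc]]; [lra|].
  set (t := Rmin (s / 2) (d / 4)).
  assert (Ht : 0 < t) by (unfold t; apply Rmin_case; lra).
  assert (Ht1 : t <= s / 2) by apply Rmin_l.
  assert (Ht2 : t <= d / 4) by apply Rmin_r.
  (* The first bound serves the closeness of [u'] to [u] in the value at [a], on the contour and in
     the oscillation; the second makes the term with [e / t] small against [eps]. *)
  set (e := Rmin (eps / 200) (eps * t / (100 * (s * s)))).
  assert (Hss : 0 < s * s) by nra.
  assert (Hept : 0 < eps * t / (100 * (s * s))) by (apply Rdiv_lt_0_compat; nra).
  assert (He0 : 0 < e) by (unfold e; apply Rmin_case; lra).
  assert (He1 : e <= eps / 200) by apply Rmin_l.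
  assert (He2 : e <= eps * t / (100 * (s * s))) by apply Rmin_r.
  destruct (Hu e He0) as [u' Hu'].
  assert (M1 : Cmod (rect_int (fun z => u' z * / (z - a))%C x0 x1 y0 y1 - winding * u' a)%C <=
    2 * (e / t) * ((x1 - x0) * (y1 - y0)) + 8 * (eps / 50)).
  { apply cauchy_approx; unfold x0, x1, y0, y1 in *; try lra.
    - intros z Hz; apply Hu', Hin, Hz.
    - intros z [Hz1 Hz2].
      assert (Hz : in_rect (fst p - s) (fst p + s) (snd p - s) (snd p + s) z) by (split; lra).
      destruct (Hu' z (Hin z Hz)) as [K1 _]; destruct (Hu' a (Hin a Hina)) as [K2 _].
      assert (K3 : Cmod (u z - u a)%C < eps / 100).
      { apply Hosc; destruct z as [zx zy], a as [ax ay]; simpl in *.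
        eapply Rle_lt_trans; [apply (Cmod_le_Rabs (zx + - ax) (zy + - ay))|].
        assert (Rabs (zx + - ax) <= t) by (apply Rabs_le; lra).
        assert (Rabs (zy + - ay) <= t) by (apply Rabs_le; lra); lra. }
      assert (T1 := Cmod_triangle3 (u' z) (u z) (u' a)).
      assert (T2 := Cmod_triangle3 (u z) (u a) (u' a)).
      rewrite (Cmod_minus_sym (u a) (u' a)) in T2; lra. }
  assert (M2 : 2 * (e / t) * ((x1 - x0) * (y1 - y0)) <= eps * (8 / 100)).
  { unfold x0, x1, y0, y1.
    replace ((fst p + s - (fst p - s)) * (snd p + s - (snd p - s))) with (4 * (s * s)) by ring.
    apply Rle_trans with (2 * ((eps * t / (100 * (s * s))) / t) * (4 * (s * s))).
    - apply Rmult_le_compat_r; [lra|]; apply Rmult_le_compat_l; [lra|].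
      apply Rmult_le_compat_r; [left; apply Rinv_0_lt_compat|]; lra.
    - right; field; split; lra. }
  assert (Hcu : forall v : C -> C, (forall z, in_rect x0 x1 y0 y1 z -> cont_at v z) ->
     forall z, on_boundary x0 x1 y0 y1 z -> cont_at (fun z => v z * / (z - a))%C z).
  { intros v Hv z Hz; apply cont_at_mult; [apply Hv, Hz|].
    eapply cont_at_rdiff, rdiff_shift_inv, Hnz, Hz. }
  assert (Hcu' : forall z, in_rect x0 x1 y0 y1 z -> cont_at u' z).
  { intros z Hz; destruct (Hu' z (Hin z Hz)) as [_ [A [B [H _]]]]; now apply cont_at_rdiff with A B. }
  assert (Hcuu : forall z, in_rect x0 x1 y0 y1 z -> cont_at u z).
  { intros z Hz; apply (almost_hol_cont u p rho); auto. }
  assert (Hcd : forall z, in_rect x0 x1 y0 y1 z -> cont_at (fun x => u x - u' x)%C z).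
  { intros z Hz.
    assert (H := cont_at_plus _ _ z (Hcuu z Hz)
      (cont_at_mult (fun _ => - (1))%C u' z (cont_at_rdiff _ _ _ _ (rdiff_const _ z)) (Hcu' z Hz))).
    replace (fun x => u x - u' x)%C with (fun x => u x + - (1) * u' x)%C; auto.
    apply functional_extensionality; intros; ring. }
  assert (M3 : Cmod (rect_int (fun z => (u z - u' z) * / (z - a))%C x0 x1 y0 y1) <=
     2 * ((x1 - x0) + (y1 - y0)) * (e * (2 / s))).
  { apply rect_int_bound; try (unfold x0, x1, y0, y1; lra).
    - intro z; apply (Hcu (fun x => u x - u' x)%C); auto.
    - intros z Hz; specialize (Hnz z Hz); specialize (Hbd z Hz).
      assert (Hza' : (z - a <> 0)%C) by (apply Cmod_gt_0; lra).
      rewrite Cmod_mult, Cmod_inv by auto.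
      apply Rmult_le_compat; try apply Cmod_ge_0.
      + left; apply Rinv_0_lt_compat; lra.
      + rewrite Cmod_minus_sym; apply Hu', Hin, Hz.
      + replace (2 / s) with (/ (s / 2)) by (field; lra); apply Rinv_le_contravar; lra. }
  assert (M4 : 2 * ((x1 - x0) + (y1 - y0)) * (e * (2 / s)) = 16 * e)
    by (unfold x0, x1, y0, y1; field; lra).
  assert (EI : rect_int (fun z => u z * / (z - a))%C x0 x1 y0 y1 =
    (rect_int (fun z => u' z * / (z - a))%C x0 x1 y0 y1 +
     rect_int (fun z => (u z - u' z) * / (z - a))%C x0 x1 y0 y1)%C).
  { rewrite <- rect_int_plus; try (unfold x0, x1, y0, y1; lra).
    - apply rect_int_ext; try (unfold x0, x1, y0, y1; lra); intros; ring.
    - intro z; apply Hcu; auto.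
    - intro z; apply (Hcu (fun x => u x - u' x)%C); auto. }
  rewrite EI.
  match goal with |- Cmod (?I + ?J - ?w * ?v)%C <= _ =>
    replace (I + J - w * v)%C with ((I - w * u' a) + (J + w * (u' a - v)))%C by ring end.
  eapply Rle_trans; [apply Cmod_triangle|].
  eapply Rle_trans; [apply Rplus_le_compat_l, Cmod_triangle|].
  rewrite Cmod_mult.
  assert (HW : Cmod winding <= 16).
  { unfold winding; rewrite Cmod_mult, Cmod_Ci, Cmod_R, atan_1.
    assert (H := PI_4); assert (H' := PI_RGT_0); rewrite Rabs_pos_eq; lra. }
  destruct (Hu' a (Hin a Hina)) as [K2 _].
  assert (Cmod winding * Cmod (u' a - u a)%C <= 16 * e)
    by (apply Rmult_le_compat; try apply Cmod_ge_0; auto).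
  lra.
Qed.

(** [D] is Cauchy's integral for the derivative over the square of half side [s = rho / 3], which
    lies in the disc. The constants 6 and 36 come from this [s], from the contour length [8 s], from
    [4 <= Cmod winding], and from the distance at least [s / 2] between the contour and [p + h]. *)
Lemma almost_hol_estimate (u : C -> C) (p : C) (rho K : R) :
  0 < rho -> almost_hol u p rho -> (forall z, Cmod (z - p)%C < rho -> Cmod (u z) <= K) ->
  exists D, Cmod D <= 6 * K / rho /\
    forall h, Cmod h <= rho / 6 ->
      Cmod (u (p + h) - u p - h * D)%C <= 36 * K * (Cmod h * Cmod h) / (rho * rho).
Proof.
  intros Hrho Hu HK.
  set (s := rho / 3).
  assert (Hs : 0 < s) by (unfold s; lra).
  set (x0 := fst p - s); set (x1 := fst p + s); set (y0 := snd p - s); set (y1 := snd p + s).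
  assert (Hx : x0 <= x1) by (unfold x0, x1; lra).
  assert (Hy : y0 <= y1) by (unfold y0, y1; lra).
  assert (HK0 : 0 <= K).
  { apply Rle_trans with (Cmod (u p)); [apply Cmod_ge_0|apply HK].
    replace (p - p)%C with (RtoC 0) by ring; rewrite Cmod_0; auto. }
  assert (Hin : forall z, in_rect x0 x1 y0 y1 z -> Cmod (z - p)%C < rho).
  { intros [zx zy] [H1 H2]; unfold x0, x1, y0, y1 in *; simpl in *.
    eapply Rle_lt_trans; [apply (Cmod_le_Rabs (zx + - fst p) (zy + - snd p))|].
    assert (Rabs (zx + - fst p) <= s) by (apply Rabs_le; lra).
    assert (Rabs (zy + - snd p) <= s) by (apply Rabs_le; lra); unfold s in *; lra. }
  assert (Hbd : forall z, on_boundary x0 x1 y0 y1 z -> s <= Cmod (z - p)%C).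
  { intros z Hz; assert (H := square_boundary_far p p z s 0 Hz).
    replace (p - p)%C with (RtoC 0) in H by ring; rewrite Cmod_0 in H; lra. }
  assert (Hbh : forall h z, Cmod h <= s / 2 -> on_boundary x0 x1 y0 y1 z ->
     s / 2 <= Cmod (z - (p + h))%C).
  { intros h z Hh Hz; specialize (Hbd z Hz).
    assert (T := Cmod_triangle3 z (p + h)%C p); replace (p + h - p)%C with h in T by ring; lra. }
  assert (Hci : forall h z, Cmod h <= s / 2 -> on_boundary x0 x1 y0 y1 z ->
     cont_at (fun z => / (z - (p + h)))%C z).
  { intros h z Hh Hz; specialize (Hbh h z Hh Hz); eapply cont_at_rdiff, rdiff_shift_inv.
    intros E; rewrite E in Hbh; replace (p + h - (p + h))%C with (RtoC 0) in Hbh by ring.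
    rewrite Cmod_0 in Hbh; lra. }
  assert (Hc0 : forall z, on_boundary x0 x1 y0 y1 z -> cont_at (fun z => / (z - p))%C z).
  { intros z Hz.
    specialize (Hci (RtoC 0) z ltac:(rewrite Cmod_0; lra) Hz).
    replace (p + 0)%C with p in Hci by ring; auto. }
  assert (Hcu : forall z, on_boundary x0 x1 y0 y1 z -> cont_at u z).
  { intros z [Hz _]; apply (almost_hol_cont u p rho); auto. }
  assert (HW := winding_mod); assert (HW0 := winding_neq_0).
  set (D := (/ winding * rect_int (fun z => u z * (/ (z - p) * / (z - p))) x0 x1 y0 y1)%C).
  assert (Hiw : / Cmod winding <= / 4) by (apply Rinv_le_contravar; lra).
  assert (Hiw0 : 0 <= / Cmod winding) by (left; apply Rinv_0_lt_compat; lra).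
  assert (HcD : cont_bd x0 x1 y0 y1 (fun z => u z * (/ (z - p) * / (z - p)))%C).
  { intros z Hz; repeat apply cont_at_mult; auto. }
  exists D; split.
  - unfold D; rewrite Cmod_mult, Cmod_inv by auto.
    apply Rle_trans with (/ 4 * (2 * ((x1 - x0) + (y1 - y0)) * (K * (/ s * / s)))).
    + apply Rmult_le_compat; auto; try apply Cmod_ge_0.
      apply rect_int_bound; auto; intros z Hz; specialize (Hbd z Hz).
      assert (Hz' : (z - p <> 0)%C) by (apply Cmod_gt_0; lra).
      rewrite !Cmod_mult, !Cmod_inv by auto.
      assert (0 <= / Cmod (z - p)%C) by (left; apply Rinv_0_lt_compat; lra).
      assert (/ Cmod (z - p)%C <= / s) by (apply Rinv_le_contravar; lra).
      apply Rmult_le_compat; try apply Cmod_ge_0; try nra.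
      apply HK, Hin, Hz.
    + unfold x0, x1, y0, y1, s; right; field; lra.
  - intros h Hh.
    assert (Hhs : Cmod h <= s / 2) by (unfold s; lra).
    assert (C1 : rect_int (fun z => u z * / (z - (p + h)))%C x0 x1 y0 y1 = (winding * u (p + h))%C).
    { apply almost_hol_cauchy with rho; auto; [unfold s; lra|].
      replace (p + h - p)%C with h by ring; auto. }
    assert (C2 : rect_int (fun z => u z * / (z - p))%C x0 x1 y0 y1 = (winding * u p)%C).
    { apply almost_hol_cauchy with rho; auto; [unfold s; lra|].
      replace (p - p)%C with (RtoC 0) by ring; rewrite Cmod_0; lra. }
    (* The second-order remainder of the Cauchy kernel: [1/(z-p-h) - 1/(z-p) - h/(z-p)^2] equals
       [h^2 / ((z-p)^2 (z-p-h))]. *)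
    set (ker := (fun z => u z * (h * h * (/ (z - p) * / (z - p) * / (z - (p + h)))))%C).
    assert (Hnz : forall z, on_boundary x0 x1 y0 y1 z -> (z - p <> 0)%C /\ (z - (p + h) <> 0)%C).
    { intros z Hz; split; apply Cmod_gt_0; [specialize (Hbd z Hz)|specialize (Hbh h z Hhs Hz)]; lra. }
    assert (Hck : cont_bd x0 x1 y0 y1 ker).
    { intros z Hz; unfold ker; repeat apply cont_at_mult; auto;
        try (eapply cont_at_rdiff, rdiff_const). }
    assert (E : (u (p + h) - u p - h * D)%C = (/ winding * rect_int ker x0 x1 y0 y1)%C).
    { replace (u (p + h)%C) with (/ winding * (winding * u (p + h)))%C by (field; auto).
      replace (u p) with (/ winding * (winding * u p))%C by (field; auto).
      rewrite <- C1, <- C2; unfold D.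
      assert (E1 : rect_int (fun z => u z * / (z - (p + h)))%C x0 x1 y0 y1 =
        (rect_int ker x0 x1 y0 y1 + (rect_int (fun z => u z * / (z - p)) x0 x1 y0 y1 +
          h * rect_int (fun z => u z * (/ (z - p) * / (z - p))) x0 x1 y0 y1))%C).
      { assert (Q1 : cont_bd x0 x1 y0 y1 (fun z => u z * / (z - p))%C)
          by (intros z Hz; apply cont_at_mult; auto).
        assert (Q2 : cont_bd x0 x1 y0 y1 (fun z => h * (u z * (/ (z - p) * / (z - p))))%C)
          by (intros z Hz; apply cont_at_mult; [eapply cont_at_rdiff, rdiff_const|];
              apply (HcD z Hz)).
        rewrite <- rect_int_scal by auto; rewrite <- !rect_int_plus; auto.
        - apply rect_int_ext; auto; intros z Hz; destruct (Hnz z Hz); unfold ker; field; auto.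
        - intros z Hz; apply cont_at_plus; auto. }
      rewrite E1; ring. }
    rewrite E, Cmod_mult, Cmod_inv by auto.
    apply Rle_trans with (/ 4 * (2 * ((x1 - x0) + (y1 - y0)) *
       (K * (Cmod h * Cmod h * (/ s * / s * (2 / s)))))).
    + apply Rmult_le_compat; auto; try apply Cmod_ge_0.
      apply rect_int_bound; auto; intros z Hz; destruct (Hnz z Hz) as [N1 N2].
      unfold ker; rewrite !Cmod_mult, !Cmod_inv by auto.
      assert (B1 := Hbd z Hz); assert (B2 := Hbh h z Hhs Hz).
      assert (I1 : / Cmod (z - p)%C <= / s) by (apply Rinv_le_contravar; lra).
      assert (I2 : / Cmod (z - (p + h))%C <= 2 / s).
      { replace (2 / s) with (/ (s / 2)) by (field; lra); apply Rinv_le_contravar; lra. }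
      assert (J1 : 0 <= / Cmod (z - p)%C) by (left; apply Rinv_0_lt_compat; lra).
      assert (J2 : 0 <= / Cmod (z - (p + h))%C) by (left; apply Rinv_0_lt_compat; lra).
      assert (Hh0 := Cmod_ge_0 h).
      apply Rmult_le_compat; try apply Cmod_ge_0.
      * repeat apply Rmult_le_pos; auto.
      * apply HK, Hin, Hz.
      * apply Rmult_le_compat_l; [nra|].
        apply Rmult_le_compat; auto; [nra|]; apply Rmult_le_compat; auto.
    + unfold x0, x1, y0, y1, s; right; field; lra.
Qed.

Lemma almost_hol_sub (u : C -> C) (p q : C) (rho s : R) :
  Cmod (q - p)%C + s <= rho -> almost_hol u p rho -> almost_hol u q s.
Proof.
  intros H Hu eps He; destruct (Hu eps He) as [u' Hu']; exists u'; intros z Hz; apply Hu'.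
  eapply Rle_lt_trans; [apply (Cmod_triangle3 z q p)|]; lra.
Qed.

(** Continuity gives a local bound, and then the quadratic Taylor estimate is already complex
    differentiability. *)
Lemma almost_hol_rdiff (u : C -> C) (p z : C) (rho : R) :
  almost_hol u p rho -> Cmod (z - p)%C < rho -> exists D, rdiff u z D 0.
Proof.
  intros Hu Hz.
  destruct (almost_hol_cont u p rho z Hu Hz 1) as [d [Hd Hc]]; [lra|].
  set (s := Rmin d (rho - Cmod (z - p)%C)).
  assert (Hs : 0 < s) by (unfold s; apply Rmin_case; lra).
  assert (Hs1 : s <= d) by apply Rmin_l.
  assert (Hs2 : s <= rho - Cmod (z - p)%C) by apply Rmin_r.
  destruct (almost_hol_estimate u z s (Cmod (u z) + 1)) as [D [_ HD]]; auto.
  { apply almost_hol_sub with p rho; auto; lra. }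
  { intros y Hy; assert (Hc' := Hc y ltac:(lra)); assert (H := Cmod_le_add (u y) (u z)); lra. }
  exists D; intros eps He.
  set (K := 36 * (Cmod (u z) + 1)).
  assert (HK : 36 <= K) by (assert (H := Cmod_ge_0 (u z)); unfold K; lra).
  assert (Hss : 0 < s * s) by nra.
  exists (Rmin (s / 6) (eps * (s * s) / K)); split.
  { apply Rmin_case; [lra|]; apply Rdiv_lt_0_compat; nra. }
  intros h Hh.
  assert (H1 : Cmod h <= s / 6) by (left; eapply Rlt_le_trans; [apply Hh|apply Rmin_l]).
  assert (H2 : Cmod h < eps * (s * s) / K) by (eapply Rlt_le_trans; [apply Hh|apply Rmin_r]).
  specialize (HD h H1); fold K in HD.
  replace (u (z + h) - u z - (D * h + 0 * Cconj h))%C with (u (z + h) - u z - h * D)%C by ring.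
  eapply Rle_trans; [apply HD|].
  apply Rmult_lt_compat_l with (r := K) in H2; [|lra].
  replace (K * (eps * (s * s) / K)) with (eps * (s * s)) in H2 by (field; lra).
  apply Rmult_le_reg_r with (s * s); auto.
  replace (K * (Cmod h * Cmod h) / (s * s) * (s * s)) with (K * Cmod h * Cmod h) by (field; lra).
  assert (H0 := Cmod_ge_0 h); nra.
Qed.

Lemma hol_almost_hol (u : C -> C) (p : C) (rho : R) :
  (forall z, Cmod (z - p)%C < rho -> exists D, rdiff u z D 0) -> almost_hol u p rho.
Proof.
  intros H eps He; exists u; intros z Hz; split.
  - replace (u z - u z)%C with (RtoC 0) by ring; rewrite Cmod_0; lra.
  - destruct (H z Hz) as [D HD]; exists D, 0; split; auto; rewrite Cmod_0; lra.
Qed.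

Lemma rdiff_hol_unique (u : C -> C) (z A B : C) : rdiff u z A 0 -> rdiff u z B 0 -> A = B.
Proof.
  intros HA HB; apply Cmod_le_eps_eq; intros eps He.
  destruct (HA (eps / 2)) as [d1 [Hd1 H1]]; [lra|].
  destruct (HB (eps / 2)) as [d2 [Hd2 H2]]; [lra|].
  set (d := Rmin d1 d2).
  assert (Hd : 0 < d) by (unfold d; apply Rmin_case; auto).
  assert (Hm : Cmod (RtoC (d / 2)) = d / 2) by (rewrite Cmod_R, Rabs_pos_eq; lra).
  specialize (H1 (RtoC (d / 2))); specialize (H2 (RtoC (d / 2))); rewrite Hm in H1, H2.
  specialize (H1 ltac:(assert (T := Rmin_l d1 d2); fold d in T; lra)).
  specialize (H2 ltac:(assert (T := Rmin_r d1 d2); fold d in T; lra)).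
  assert (Hp : Cmod ((A - B) * RtoC (d / 2))%C <= eps * (d / 2)).
  { match type of H1 with Cmod ?a <= _ => match type of H2 with Cmod ?b <= _ =>
      replace ((A - B) * RtoC (d / 2))%C with (b - a)%C by ring end end.
    eapply Rle_trans; [apply Cmod_minus_le|]; lra. }
  rewrite Cmod_mult, Hm in Hp; apply Rmult_le_reg_r with (d / 2); lra.
Qed.

(** A holomorphic function approximates itself, and its derivative is the [D] of the integral
    formula by uniqueness of the linear term. *)
Lemma cauchy_estimate (u : C -> C) (p D : C) (rho K : R) : 0 < rho ->
  (forall z, Cmod (z - p)%C < rho -> exists D, rdiff u z D 0) ->
  (forall z, Cmod (z - p)%C < rho -> Cmod (u z) <= K) -> rdiff u p D 0 ->
  Cmod D <= 6 * K / rho /\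
  forall h, Cmod h <= rho / 6 ->
    Cmod (u (p + h) - u p - h * D)%C <= 36 * K * (Cmod h * Cmod h) / (rho * rho).
Proof.
  intros Hrho Hu HK HD.
  destruct (almost_hol_estimate u p rho K Hrho (hol_almost_hol u p rho Hu) HK) as [D' [H1 H2]].
  assert (E : D = D').
  { apply rdiff_hol_unique with u p; auto.
    intros eps He.
    assert (HK0 : 0 <= K).
    { apply Rle_trans with (Cmod (u p)); [apply Cmod_ge_0|apply HK].
      replace (p - p)%C with (RtoC 0) by ring; rewrite Cmod_0; auto. }
    assert (Hss : 0 < rho * rho) by nra.
    exists (Rmin (rho / 6) (eps * (rho * rho) / (36 * K + 1))); split.
    { apply Rmin_case; [lra|]; apply Rdiv_lt_0_compat; nra. }
    intros h Hh.
    assert (L1 : Cmod h <= rho / 6) by (left; eapply Rlt_le_trans; [apply Hh|apply Rmin_l]).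
    assert (L2 : Cmod h < eps * (rho * rho) / (36 * K + 1))
      by (eapply Rlt_le_trans; [apply Hh|apply Rmin_r]).
    specialize (H2 h L1).
    replace (u (p + h) - u p - (D' * h + 0 * Cconj h))%C with (u (p + h) - u p - h * D')%C by ring.
    eapply Rle_trans; [apply H2|].
    apply Rmult_lt_compat_l with (r := 36 * K + 1) in L2; [|lra].
    replace ((36 * K + 1) * (eps * (rho * rho) / (36 * K + 1))) with (eps * (rho * rho)) in L2
      by (field; lra).
    apply Rmult_le_reg_r with (rho * rho); auto.
    replace (36 * K * (Cmod h * Cmod h) / (rho * rho) * (rho * rho)) with
      (36 * K * Cmod h * Cmod h) by (field; lra).
    assert (H0 := Cmod_ge_0 h); nra. }
  rewrite E; auto.
Qed.

(** * Vectors of [Cn n] and Fréchet derivatives *)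

Lemma fsum_le (n : nat) (f g : Fin.t n -> R) : (forall i, f i <= g i) -> fsum n f <= fsum n g.
Proof. induction n as [|n IH]; simpl; intros H; [lra|]; apply Rplus_le_compat; auto. Qed.

Lemma fsum_nonneg (n : nat) (f : Fin.t n -> R) : (forall i, 0 <= f i) -> 0 <= fsum n f.
Proof. induction n as [|n IH]; simpl; intros H; [lra|]; apply Rplus_le_le_0_compat; auto. Qed.

Lemma fsum_const (n : nat) (c : R) : fsum n (fun _ => c) = INR n * c.
Proof. induction n as [|n IH]; simpl fsum; [simpl; ring|]; rewrite IH, S_INR; ring. Qed.

Lemma fsum_plus (n : nat) (f g : Fin.t n -> R) : fsum n (fun i => f i + g i) = fsum n f + fsum n g.
Proof. induction n as [|n IH]; simpl; [ring|]; rewrite IH; ring. Qed.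

Lemma fsum_scal (n : nat) (c : R) (f : Fin.t n -> R) : fsum n (fun i => c * f i) = c * fsum n f.
Proof. induction n as [|n IH]; simpl; [ring|]; rewrite IH; ring. Qed.

Lemma fsum_ext (n : nat) (f g : Fin.t n -> R) : (forall i, f i = g i) -> fsum n f = fsum n g.
Proof. intros H; f_equal; apply functional_extensionality; auto. Qed.

Lemma fsum_ge_term (n : nat) (f : Fin.t n -> R) (i : Fin.t n) :
  (forall k, 0 <= f k) -> f i <= fsum n f.
Proof.
  induction i as [n|n i IH]; simpl; intros H.
  - assert (0 <= fsum n (fun i => f (Fin.FS i))) by (apply fsum_nonneg; auto); lra.
  - specialize (IH (fun i => f (Fin.FS i)) (fun k => H (Fin.FS k))); specialize (H Fin.F1); simpl in IH; lra.
Qed.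

Lemma csum_plus (n : nat) (f g : Fin.t n -> C) :
  csum n (fun i => f i + g i)%C = (csum n f + csum n g)%C.
Proof. induction n as [|n IH]; simpl; [ring|]; rewrite IH; ring. Qed.

Lemma csum_scal (n : nat) (c : C) (f : Fin.t n -> C) :
  csum n (fun i => c * f i)%C = (c * csum n f)%C.
Proof. induction n as [|n IH]; simpl; [ring|]; rewrite IH; ring. Qed.

Lemma csum_ext (n : nat) (f g : Fin.t n -> C) : (forall i, f i = g i) -> csum n f = csum n g.
Proof. intros H; f_equal; apply functional_extensionality; auto. Qed.

Lemma csum_0 (n : nat) : csum n (fun _ => RtoC 0) = 0.
Proof. induction n as [|n IH]; simpl; [auto|]; rewrite IH; ring. Qed.

Lemma Cmod_csum_le (n : nat) (f : Fin.t n -> C) : Cmod (csum n f) <= fsum n (fun i => Cmod (f i)).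
Proof.
  induction n as [|n IH]; simpl; [rewrite Cmod_0; lra|].
  eapply Rle_trans; [apply Cmod_triangle|]; apply Rplus_le_compat_l, IH.
Qed.

Lemma cnorm_ge_0 {n} (u : Cn n) : 0 <= cnorm u.
Proof. apply fsum_nonneg; intros; apply Cmod_ge_0. Qed.

Lemma cnorm_comp {n} (u : Cn n) (i : Fin.t n) : Cmod (u i) <= cnorm u.
Proof. apply (fsum_ge_term n (fun i => Cmod (u i))); intros; apply Cmod_ge_0. Qed.

Lemma cnorm_le_const {n} (u : Cn n) (K : R) : (forall i, Cmod (u i) <= K) -> cnorm u <= INR n * K.
Proof. intros H; rewrite <- fsum_const; apply fsum_le; auto. Qed.

Lemma cnorm_triangle {n} (u v : Cn n) : cnorm (vadd u v) <= cnorm u + cnorm v.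
Proof.
  unfold cnorm; rewrite <- fsum_plus; apply fsum_le; intros; apply Cmod_triangle.
Qed.

Lemma cnorm_scale {n} (a : C) (u : Cn n) : cnorm (vscale a u) = Cmod a * cnorm u.
Proof.
  unfold cnorm; rewrite <- fsum_scal; apply fsum_ext; intros; apply Cmod_mult.
Qed.

Lemma cnorm_sub_sym {n} (u v : Cn n) : cnorm (vsub u v) = cnorm (vsub v u).
Proof. apply fsum_ext; intros; apply Cmod_minus_sym. Qed.

Lemma cnorm_sub_triangle {n} (u v w : Cn n) :
  cnorm (vsub u w) <= cnorm (vsub u v) + cnorm (vsub v w).
Proof.
  unfold cnorm; rewrite <- fsum_plus; apply fsum_le; intros; apply Cmod_triangle3.
Qed.

Lemma cnorm_sub_diag {n} (u : Cn n) : cnorm (vsub u u) = 0.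
Proof.
  unfold cnorm; rewrite (fsum_ext n _ (fun _ => 0)); [rewrite fsum_const; ring|].
  intros i; unfold vsub; replace (u i - u i)%C with (RtoC 0) by ring; apply Cmod_0.
Qed.

Lemma cnorm_sub_eq_0 {n} (u v : Cn n) : cnorm (vsub u v) = 0 -> u = v.
Proof.
  intros H; apply functional_extensionality; intros i.
  assert (H1 := cnorm_comp (vsub u v) i); rewrite H in H1.
  apply Cmod_le_eps_eq; intros e He; unfold vsub in H1; lra.
Qed.

Lemma vadd_sub {n} (u v : Cn n) : vadd u (vsub v u) = v.
Proof. apply functional_extensionality; intros i; unfold vadd, vsub; ring. Qed.

Lemma vsub_add {n} (u v : Cn n) : vsub (vadd u v) u = v.
Proof. apply functional_extensionality; intros i; unfold vadd, vsub; ring. Qed.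

Lemma vadd_sub_assoc {n} (u v w : Cn n) : vsub (vadd u v) w = vadd (vsub u w) v.
Proof. apply functional_extensionality; intros i; unfold vadd, vsub; ring. Qed.

Lemma cnorm_opp {n} (u v : Cn n) : (forall i, u i = (- v i)%C) -> cnorm u = cnorm v.
Proof. intros H; apply fsum_ext; intros i; rewrite H; apply Cmod_opp. Qed.

Definition lapp {n m} (L : Fin.t m -> Fin.t n -> C) (h : Cn n) : Cn m :=
  fun i => csum n (fun j => L i j * h j)%C.

Definition fderiv {n m} (F : Cn n -> Cn m) (w : Cn n) (L : Fin.t m -> Fin.t n -> C) : Prop :=
  forall eps, 0 < eps -> exists d, 0 < d /\ forall h : Cn n, cnorm h < d ->
    forall i, Cmod (F (vadd w h) i - F w i - lapp L h i)%C <= eps * cnorm h.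

Lemma littleo_csum (n : nat) (a : Fin.t n -> C) (r : Fin.t n -> C -> C) :
  (forall j, littleo (r j)) -> littleo (fun h => csum n (fun j => a j * r j h)%C).
Proof.
  induction n as [|n IH]; simpl; intros H; [apply littleo_0|].
  apply littleo_plus; [apply littleo_scal, H|].
  apply (IH (fun j => a (Fin.FS j)) (fun j => r (Fin.FS j))); auto.
Qed.

Lemma bigo_fin (n : nat) (r : Fin.t n -> C -> C) : (forall j, bigo (r j)) ->
  exists K d, 0 <= K /\ 0 < d /\ forall h, Cmod h < d -> cnorm (fun j => r j h) <= K * Cmod h.
Proof.
  unfold cnorm; induction n as [|n IH]; simpl; intros H.
  - exists 0, 1; repeat split; try lra; intros; lra.
  - destruct (H Fin.F1) as [K1 [d1 [Hd1 H1]]].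
    destruct (IH (fun j => r (Fin.FS j)) (fun j => H (Fin.FS j))) as [K2 [d2 [HK2 [Hd2 H2]]]].
    exists (Rabs K1 + K2), (Rmin d1 d2).
    assert (HK := Rabs_pos K1); split; [lra|]; split; [now apply Rmin_case|]; intros h Hh.
    specialize (H1 h (Rlt_le_trans _ _ _ Hh (Rmin_l _ _))).
    specialize (H2 h (Rlt_le_trans _ _ _ Hh (Rmin_r _ _))).
    assert (Hh0 := Cmod_ge_0 h); assert (Ha := Rle_abs K1); nra.
Qed.

(** Since [L] is complex linear it acts on both Wirtinger derivatives separately. With [B = 0] this
    is the chain rule for holomorphic maps; in general it says that the conjugate derivative
    transforms like a vector. *)
Lemma fderiv_comp_rdiff {n m} (F : Cn n -> Cn m) (L : Fin.t m -> Fin.t n -> C)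
  (u : C -> Cn n) (z : C) (A B : Cn n) (i : Fin.t m) :
  fderiv F (u z) L -> (forall j, rdiff (fun x => u x j) z (A j) (B j)) ->
  rdiff (fun x => F (u x) i) z (lapp L A i) (lapp L B i).
Proof.
  intros HF Hu.
  apply littleo_ext with (fun h =>
    (F (vadd (u z) (vsub (u (z + h)) (u z))) i - F (u z) i - lapp L (vsub (u (z + h)) (u z)) i) +
    csum n (fun j => L i j * (u (z + h) j - u z j - (A j * h + B j * Cconj h))))%C.
  { intros h; rewrite vadd_sub; unfold lapp, vsub.
    replace (csum n (fun j => L i j * (u (z + h) j - u z j - (A j * h + B j * Cconj h))))%C with
      (csum n (fun j => L i j * (u (z + h) j - u z j))%C +
       (- h * csum n (fun j => L i j * A j) + - Cconj h * csum n (fun j => L i j * B j)))%C.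
    - ring.
    - rewrite <- !csum_scal, <- !csum_plus; apply csum_ext; intros j; ring. }
  apply littleo_plus; [|apply littleo_csum; auto].
  destruct (bigo_fin n (fun j h => (u (z + h) j - u z j)%C)) as [K [d [HK [Hd Hb]]]].
  { intros j; apply (rdiff_bigo (fun x => u x j) _ _ _ (Hu j)). }
  intros eps He.
  destruct (HF (eps / (K + 1))) as [d' [Hd' HF']]; [apply Rdiv_lt_0_compat; lra|].
  exists (Rmin d (d' / (K + 1))); split.
  { apply Rmin_case; auto; apply Rdiv_lt_0_compat; lra. }
  intros h Hh.
  assert (H1 : Cmod h < d) by (eapply Rlt_le_trans; [apply Hh|apply Rmin_l]).
  assert (H2 : Cmod h < d' / (K + 1)) by (eapply Rlt_le_trans; [apply Hh|apply Rmin_r]).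
  specialize (Hb h H1).
  change (cnorm (vsub (u (z + h)%C) (u z)) <= K * Cmod h) in Hb.
  assert (Hh0 := Cmod_ge_0 h).
  apply Rmult_lt_compat_l with (r := K + 1) in H2; [|lra].
  replace ((K + 1) * (d' / (K + 1))) with d' in H2 by (field; lra).
  eapply Rle_trans; [apply HF'; nra|].
  apply Rle_trans with (eps / (K + 1) * ((K + 1) * Cmod h)).
  - apply Rmult_le_compat_l; [left; apply Rdiv_lt_0_compat; lra|nra].
  - right; field; lra.
Qed.

Lemma lapp_0 {n m} (L : Fin.t m -> Fin.t n -> C) (i : Fin.t m) : lapp L (fun _ => RtoC 0) i = 0.
Proof.
  unfold lapp; rewrite (csum_ext n _ (fun _ => RtoC 0)); [apply csum_0|intros; ring].
Qed.

Lemma fderiv_line {n m} (F : Cn n -> Cn m) (L : Fin.t m -> Fin.t n -> C) (w h : Cn n) (t : C)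
  (i : Fin.t m) : fderiv F (vadd w (vscale t h)) L ->
  rdiff (fun s => F (vadd w (vscale s h)) i) t (lapp L h i) 0.
Proof.
  intros HF; rewrite <- (lapp_0 L i).
  apply (fderiv_comp_rdiff F L (fun s => vadd w (vscale s h)) t h (fun _ => RtoC 0)); auto.
  intros j; unfold vadd, vscale.
  eapply rdiff_eq; [| |apply rdiff_plus; [apply rdiff_const|apply rdiff_mult;
    [apply rdiff_id|apply rdiff_const]]]; cbv beta; ring.
Qed.

Lemma fderiv_cont {n m} (F : Cn n -> Cn m) (L : Fin.t m -> Fin.t n -> C) (w : Cn n) :
  fderiv F w L -> forall eps, 0 < eps -> exists d, 0 < d /\
    forall u, cnorm (vsub u w) < d -> forall i, Cmod (F u i - F w i)%C < eps.
Proof.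
  intros HF eps He; destruct (HF 1) as [d [Hd Hh]]; [lra|].
  assert (HL : exists K, 0 <= K /\ forall i j, Cmod (L i j) <= K).
  { exists (fsum m (fun i => fsum n (fun j => Cmod (L i j)))); split.
    - apply fsum_nonneg; intros; apply fsum_nonneg; intros; apply Cmod_ge_0.
    - intros i j.
      eapply Rle_trans; [|apply (fsum_ge_term m (fun i => fsum n (fun j => Cmod (L i j))) i)].
      + apply (fsum_ge_term n (fun j => Cmod (L i j))); intros; apply Cmod_ge_0.
      + intros; apply fsum_nonneg; intros; apply Cmod_ge_0. }
  destruct HL as [K [HK HL]].
  exists (Rmin d (eps / (K + 2))); split.
  { apply Rmin_case; auto; apply Rdiv_lt_0_compat; lra. }
  intros u Hu i.
  assert (H1 : cnorm (vsub u w) < d) by (eapply Rlt_le_trans; [apply Hu|apply Rmin_l]).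
  assert (H2 : cnorm (vsub u w) < eps / (K + 2)) by (eapply Rlt_le_trans; [apply Hu|apply Rmin_r]).
  specialize (Hh _ H1 i); rewrite vadd_sub in Hh.
  assert (H3 : Cmod (lapp L (vsub u w) i) <= K * cnorm (vsub u w)).
  { eapply Rle_trans; [apply Cmod_csum_le|]; unfold cnorm; rewrite <- fsum_scal.
    apply fsum_le; intros j; rewrite Cmod_mult.
    apply Rmult_le_compat_r; [apply Cmod_ge_0|auto]. }
  assert (H4 := Cmod_le_add (F u i - F w i)%C (lapp L (vsub u w) i)).
  apply Rmult_lt_compat_l with (r := K + 2) in H2; [|lra].
  replace ((K + 2) * (eps / (K + 2))) with eps in H2 by (field; lra).
  assert (H5 := cnorm_ge_0 (vsub u w)); nra.
Qed.

(* Cauchy's estimate along complex lines makes a pointwise differentiable map locally C^1,1. *)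
Lemma fderiv_local {n m} (F : Cn n -> Cn m) (w0 : Cn n) (d0 : R) : 0 < d0 ->
  (forall w, cnorm (vsub w w0) < d0 -> exists L, fderiv F w L) ->
  exists rho K, 0 < rho /\ 0 < K /\ rho <= d0 /\
   (forall w w', cnorm (vsub w w0) < rho -> cnorm (vsub w' w0) < rho ->
      cnorm (vsub (F w) (F w')) <= K * cnorm (vsub w w')) /\
   (forall w L h, cnorm (vsub w w0) < rho -> fderiv F w L -> cnorm (lapp L h) <= K * cnorm h) /\
   (forall w w' L L' h, cnorm (vsub w w0) < rho -> cnorm (vsub w' w0) < rho ->
      fderiv F w L -> fderiv F w' L' ->
      cnorm (vsub (lapp L h) (lapp L' h)) <= K * cnorm (vsub w w') * cnorm h).
Proof.
  intros Hd0 HF.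
  destruct (HF w0) as [L0 HL0]; [rewrite cnorm_sub_diag; lra|].
  destruct (fderiv_cont F L0 w0 HL0 1) as [d1 [Hd1 Hc]]; [lra|].
  set (d := Rmin d0 d1).
  assert (Hd : 0 < d) by (unfold d; apply Rmin_case; auto).
  assert (Hdd0 : d <= d0) by apply Rmin_l; assert (Hdd1 : d <= d1) by apply Rmin_r.
  assert (Hb : forall w i, cnorm (vsub w w0) < d -> Cmod (F w i - F w0 i)%C <= 1).
  { intros w i Hw; left; apply Hc; lra. }
  assert (Hline : forall w h s, cnorm (vsub (vadd w (vscale s h)) w0) <=
      cnorm (vsub w w0) + Cmod s * cnorm h).
  { intros w h s; rewrite vadd_sub_assoc, <- cnorm_scale; apply cnorm_triangle. }
  assert (Hv0 : forall (w h : Cn n), vadd w (vscale 0 h) = w).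
  { intros; apply functional_extensionality; intros; unfold vadd, vscale; ring. }
  assert (Ezero : forall (h : Cn n) (q : Fin.t m -> Fin.t n -> C) i, cnorm h = 0 -> lapp q h i = 0).
  { intros h q i Hh; rewrite <- (lapp_0 q i); f_equal.
    apply functional_extensionality; intros j; apply Cmod_eq_0, Rle_antisym; [|apply Cmod_ge_0].
    rewrite <- Hh; apply cnorm_comp. }
  assert (Hhol : forall w h s i, cnorm (vsub (vadd w (vscale s h)) w0) < d ->
     exists D, rdiff (fun s => F (vadd w (vscale s h)) i) s D 0).
  { intros w h s i Hs; destruct (HF _ (Rlt_le_trans _ _ _ Hs Hdd0)) as [L HL].
    exists (lapp L h i); apply fderiv_line; auto. }
  assert (HDb : forall w L h i, cnorm (vsub w w0) < d / 2 -> fderiv F w L ->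
     Cmod (lapp L h i) <= 12 / d * cnorm h).
  { intros w L h i Hw HL.
    destruct (Req_dec (cnorm h) 0) as [Hh|Hh].
    { rewrite Ezero, Hh, Cmod_0 by auto; lra. }
    assert (Hh0 : 0 < cnorm h) by (assert (H := cnorm_ge_0 h); lra).
    set (rho := d / 2 / cnorm h).
    assert (Hrho : 0 < rho) by (apply Rdiv_lt_0_compat; lra).
    assert (Hin : forall s, Cmod (s - 0)%C < rho -> cnorm (vsub (vadd w (vscale s h)) w0) < d).
    { intros s Hs; replace (s - 0)%C with s in Hs by ring.
      eapply Rle_lt_trans; [apply Hline|].
      apply Rmult_lt_compat_r with (r := cnorm h) in Hs; auto.
      unfold rho in Hs; replace (d / 2 / cnorm h * cnorm h) with (d / 2) in Hs by (field; lra); lra. }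
    destruct (cauchy_estimate (fun s => F (vadd w (vscale s h)) i - F w0 i)%C 0 (lapp L h i - 0) rho 1)
      as [H1 _]; auto.
    - intros s Hs; destruct (Hhol w h s i (Hin s Hs)) as [D HD].
      exists (D - 0)%C; eapply rdiff_eq; [| |apply rdiff_minus; [apply HD|apply rdiff_const]]; ring.
    - eapply rdiff_eq; [| |apply rdiff_minus; [apply (fderiv_line F L)|apply rdiff_const]]; try ring.
      rewrite Hv0; auto.
    - replace (lapp L h i - 0)%C with (lapp L h i) in H1 by ring.
      eapply Rle_trans; [apply H1|]; unfold rho; right; field; lra. }
  (* The point [w] is the value at parameter 1 of the line from [w'] in direction [w - w']. The
     distance [d / 32] makes [rho] larger than 8, so parameter 1 is admissible in the Taylor
     bound. *)
  assert (HLip : forall w w' i, cnorm (vsub w w0) < d / 32 -> cnorm (vsub w' w0) < d / 32 ->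
     Cmod (F w i - F w' i)%C <= 24 / d * cnorm (vsub w w')).
  { intros w w' i Hw Hw'.
    set (h := vsub w w').
    destruct (Req_dec (cnorm h) 0) as [Hh|Hh].
    { rewrite (cnorm_sub_eq_0 w w' Hh); replace (F w' i - F w' i)%C with (RtoC 0) by ring.
      rewrite Cmod_0, Hh; lra. }
    assert (Hh0 : 0 < cnorm h) by (assert (H := cnorm_ge_0 h); lra).
    assert (Hh1 : cnorm h < d / 16).
    { eapply Rle_lt_trans; [apply (cnorm_sub_triangle w w0 w')|]; rewrite (cnorm_sub_sym w0); lra. }
    set (rho := d / 2 / cnorm h).
    assert (Hrho : 0 < rho) by (apply Rdiv_lt_0_compat; lra).
    assert (Erho : rho * cnorm h = d / 2) by (unfold rho; field; lra).
    assert (Hin : forall s, Cmod (s - 0)%C < rho -> cnorm (vsub (vadd w' (vscale s h)) w0) < d).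
    { intros s Hs; replace (s - 0)%C with s in Hs by ring.
      eapply Rle_lt_trans; [apply Hline|].
      apply Rmult_lt_compat_r with (r := cnorm h) in Hs; auto; lra. }
    destruct (HF w') as [L HL]; [lra|].
    destruct (cauchy_estimate (fun s => F (vadd w' (vscale s h)) i - F w0 i)%C 0 (lapp L h i) rho 1)
      as [H1 H2]; auto.
    - intros s Hs; destruct (Hhol w' h s i (Hin s Hs)) as [D HD].
      exists (D - 0)%C; eapply rdiff_eq; [| |apply rdiff_minus; [apply HD|apply rdiff_const]]; ring.
    - eapply rdiff_eq; [| |apply rdiff_minus; [apply (fderiv_line F L w' h)|apply rdiff_const]];
        try ring.
      rewrite Hv0; auto.
    - specialize (H2 1); rewrite Cmod_1 in H2.
      specialize (H2 ltac:(nra)).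
      replace (vadd w' (vscale (0 + 1) h)) with w in H2.
      2:{ apply functional_extensionality; intros j; unfold vadd, vscale, h, vsub; ring. }
      rewrite Hv0 in H2.
      assert (E : (F w i - F w' i)%C =
        ((F w i - F w0 i - (F w' i - F w0 i) - 1 * lapp L h i) + lapp L h i)%C) by ring.
      rewrite E; eapply Rle_trans; [apply Cmod_triangle|].
      assert (H3 := HDb w' L h i ltac:(lra) HL).
      assert (H4 : 36 * 1 * (1 * 1) / (rho * rho) <= 12 / d * cnorm h).
      { apply Rmult_le_reg_r with (rho * rho); [nra|].
        replace (36 * 1 * (1 * 1) / (rho * rho) * (rho * rho)) with 36 by (field; lra).
        replace (12 / d * cnorm h * (rho * rho)) with (12 / d * (rho * cnorm h) * rho) by ring.
        rewrite Erho; replace (12 / d * (d / 2) * rho) with (6 * rho) by (field; lra); nra. }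
      lra. }
  set (K1 := 24 / d); set (K2 := 6 * (24 / d) * (64 / d)).
  assert (HK1 : 0 < K1) by (apply Rdiv_lt_0_compat; lra).
  assert (HK64 : 0 < 64 / d) by (apply Rdiv_lt_0_compat; lra).
  assert (HK2 : 0 < K2) by (unfold K2; fold K1; nra).
  (* Cauchy's estimate is applied to the difference of [F] along two parallel lines; this difference
     is already bounded by the Lipschitz estimate, which yields the factor [cnorm (vsub w w')]. *)
  assert (HDL : forall w w' L L' h i, cnorm (vsub w w0) < d / 64 -> cnorm (vsub w' w0) < d / 64 ->
     fderiv F w L -> fderiv F w' L' ->
     Cmod (lapp L h i - lapp L' h i)%C <= K2 * cnorm (vsub w w') * cnorm h).
  { intros w w' L L' h i Hw Hw' HL HL'.
    destruct (Req_dec (cnorm h) 0) as [Hh|Hh].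
    { rewrite !Ezero, Hh by auto; replace (0 - 0)%C with (RtoC 0) by ring; rewrite Cmod_0; lra. }
    assert (Hh0 : 0 < cnorm h) by (assert (H := cnorm_ge_0 h); lra).
    set (rho := d / 64 / cnorm h).
    assert (Hrho : 0 < rho) by (apply Rdiv_lt_0_compat; lra).
    assert (Hin : forall x s, cnorm (vsub x w0) < d / 64 -> Cmod (s - 0)%C < rho ->
       cnorm (vsub (vadd x (vscale s h)) w0) < d / 32).
    { intros x s Hx Hs; replace (s - 0)%C with s in Hs by ring.
      eapply Rle_lt_trans; [apply Hline|].
      apply Rmult_lt_compat_r with (r := cnorm h) in Hs; auto.
      unfold rho in Hs; replace (d / 64 / cnorm h * cnorm h) with (d / 64) in Hs by (field; lra); lra. }
    destruct (cauchy_estimate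
      (fun s => F (vadd w (vscale s h)) i - F (vadd w' (vscale s h)) i)%C 0
      (lapp L h i - lapp L' h i) rho (24 / d * cnorm (vsub w w'))) as [H1 _]; auto.
    - intros s Hs.
      destruct (Hhol w h s i) as [D HD]; [specialize (Hin w s Hw Hs); lra|].
      destruct (Hhol w' h s i) as [D' HD']; [specialize (Hin w' s Hw' Hs); lra|].
      exists (D - D')%C; eapply rdiff_eq; [| |apply rdiff_minus; [apply HD|apply HD']]; ring.
    - intros s Hs.
      replace (cnorm (vsub w w')) with (cnorm (vsub (vadd w (vscale s h)) (vadd w' (vscale s h)))).
      + apply HLip; auto.
      + f_equal; apply functional_extensionality; intros j; unfold vadd, vscale, vsub; ring.
    - eapply rdiff_eq; [| |apply rdiff_minus; [apply (fderiv_line F L w h)|apply (fderiv_line F L' w' h)]];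
        try ring; rewrite Hv0; auto.
    - eapply Rle_trans; [apply H1|]; unfold rho, K2; right; field; lra. }
  set (N := INR m + 1).
  assert (HN : 1 <= N) by (unfold N; assert (H := pos_INR m); lra).
  assert (HmN : INR m <= N) by (unfold N; lra).
  assert (Hm := pos_INR m).
  assert (Hm1 : INR m * K1 <= N * (K1 + K2)) by (apply Rmult_le_compat; lra).
  assert (Hm2 : INR m * K2 <= N * (K1 + K2)) by (apply Rmult_le_compat; lra).
  exists (d / 64), (N * (K1 + K2)).
  split; [lra|]; split; [nra|]; split; [lra|]; split; [|split].
  - intros w w' Hw Hw'.
    eapply Rle_trans; [apply (cnorm_le_const _ (K1 * cnorm (vsub w w')))|].
    + intros i; apply HLip; lra.
    + rewrite <- Rmult_assoc; apply Rmult_le_compat_r; auto using cnorm_ge_0.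
  - intros w L h Hw HL.
    eapply Rle_trans; [apply (cnorm_le_const _ (K1 * cnorm h))|].
    + intros i; eapply Rle_trans; [apply (HDb w L h i); auto; lra|].
      apply Rmult_le_compat_r; [apply cnorm_ge_0|]; unfold K1.
      apply Rmult_le_compat_r; [left; apply Rinv_0_lt_compat|]; lra.
    + rewrite <- Rmult_assoc; apply Rmult_le_compat_r; auto using cnorm_ge_0.
  - intros w w' L L' h Hw Hw' HL HL'.
    eapply Rle_trans; [apply (cnorm_le_const _ (K2 * cnorm (vsub w w') * cnorm h))|].
    + intros i; apply HDL; auto.
    + assert (H := cnorm_ge_0 h); assert (H' := cnorm_ge_0 (vsub w w')).
      assert (0 <= cnorm (vsub w w') * cnorm h) by nra.
      replace (INR m * (K2 * cnorm (vsub w w') * cnorm h)) with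
        ((INR m * K2) * (cnorm (vsub w w') * cnorm h)) by ring.
      replace (N * (K1 + K2) * cnorm (vsub w w') * cnorm h) with
        ((N * (K1 + K2)) * (cnorm (vsub w w') * cnorm h)) by ring.
      apply Rmult_le_compat_r; auto.
Qed.

(** * Charts and holomorphic maps from planar domains *)

Lemma is_derive_rdiff (u : C -> C) (z l : C) :
  is_derive (K := C_AbsRing) (V := C_NormedModule) u z l <-> rdiff u z l 0.
Proof.
  split.
  - intros [_ H] eps He.
    specialize (H z (fun P HP => HP) (mkposreal eps He)).
    destruct H as [d Hd]; exists (pos d); split; [apply cond_pos|]; intros h Hh.
    specialize (Hd (z + h)%C).
    assert (Hb : ball (M := AbsRing_UniformSpace C_AbsRing) z d (z + h)%C).
    { change (Cmod (z + h - z)%C < d); now replace (z + h - z)%C with h by ring. }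
    specialize (Hd Hb).
    change (Cmod (u (z + h) - u z - (z + h - z) * l)%C <= eps * Cmod (z + h - z)%C) in Hd.
    replace (z + h - z)%C with h in Hd by ring.
    replace (u (z + h) - u z - (l * h + 0 * Cconj h))%C with (u (z + h) - u z - h * l)%C by ring.
    auto.
  - intros H; split; [apply is_linear_scal_l|].
    intros x Hx eps.
    assert (E : x = z).
    { symmetry; apply (is_filter_lim_locally_unique (K := C_AbsRing)
        (V := AbsRing_NormedModule C_AbsRing) z x); auto. }
    subst x; destruct (H eps (cond_pos eps)) as [d [Hd Hh]].
    exists (mkposreal d Hd); intros y Hy.
    change (Cmod (y - z)%C < d) in Hy; specialize (Hh _ Hy).
    assert (E1 : forall a b : C, (a + (b - a))%C = b) by (intros; ring).
    rewrite E1 in Hh.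
    change (Cmod (u y - u z - (y - z) * l)%C <= eps * Cmod (y - z)%C).
    assert (E2 : forall a b : C, (a - (b * l) = a - (l * b + 0 * Cconj b))%C) by (intros; ring).
    rewrite E2; auto.
Qed.

Section Charts.
Context {n : nat} (M : complex_manifold n).

Lemma chart_ball (j : chart_idx M) (x : M) (A : M -> Prop) :
  cdom M j x -> mopen M A -> A x ->
  exists rho, 0 < rho /\ forall u, cnorm (vsub u (chart M j x)) < rho ->
    exists y, cdom M j y /\ A y /\ chart M j y = u.
Proof.
  intros Hx HA HAx; apply (chart_open_map n M j A HA (chart M j x)); exists x; auto.
Qed.

Lemma chart_ball_in (j : chart_idx M) (x : M) (A : M -> Prop) :
  cdom M j x -> mopen M A -> A x ->
  exists rho, 0 < rho /\ forall y, cdom M j y ->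
    cnorm (vsub (chart M j y) (chart M j x)) < rho -> A y.
Proof.
  intros Hx HA HAx; destruct (chart_ball j x A Hx HA HAx) as [rho [Hrho H]].
  exists rho; split; auto; intros y Hy Hxy; destruct (H _ Hxy) as [y' [H1 [H2 H3]]].
  rewrite (chart_inj n M j y y'); auto.
Qed.

(** The manifold only asserts that a transition map exists. One is chosen once and for all, so that
    estimates can speak of the same map; its values off the overlap are arbitrary. *)
Definition trans (j k : chart_idx M) : Cn n -> Cn n :=
  proj1_sig (constructive_indefinite_description _ (chart_transition n M j k)).

Lemma trans_chart (j k : chart_idx M) (x : M) :
  cdom M j x -> cdom M k x -> trans j k (chart M j x) = chart M k x.
Proof.
  unfold trans; destruct (constructive_indefinite_description _ _) as [F [HF1 HF2]]; simpl; auto.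
Qed.

Lemma trans_fderiv (j k : chart_idx M) (x : M) :
  cdom M j x -> cdom M k x -> exists L, fderiv (trans j k) (chart M j x) L.
Proof.
  unfold trans; destruct (constructive_indefinite_description _ _) as [F [HF1 HF2]]; simpl.
  intros Hj Hk; apply HF1; eauto.
Qed.

Definition cont_M (f : C -> M) (s : C) : Prop :=
  forall A, mopen M A -> A (f s) -> exists d, 0 < d /\
    forall s', Cmod (s' - s)%C < d -> A (f s').

Definition hol_at (f : C -> M) (s : C) : Prop :=
  cont_M f s /\
  forall i, cdom M i (f s) -> forall k, exists D, rdiff (fun u => chart M i (f u) k) s D 0.

Lemma vec_cont (u : C -> Cn n) (s : C) : (forall k, cont_at (fun x => u x k) s) ->
  forall eps, 0 < eps -> exists d, 0 < d /\
    forall y, Cmod (y - s)%C < d -> cnorm (vsub (u y) (u s)) < eps.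
Proof.
  intros H.
  assert (G : forall m (v : C -> Cn m), (forall k, cont_at (fun x => v x k) s) ->
    forall eps, 0 < eps -> exists d, 0 < d /\
      forall y, Cmod (y - s)%C < d -> cnorm (vsub (v y) (v s)) < eps).
  { intros m; induction m as [|m IH]; intros v Hv eps He.
    - exists 1; split; [lra|]; intros; unfold cnorm; simpl; lra.
    - destruct (Hv Fin.F1 (eps / 2)) as [d1 [Hd1 H1]]; [lra|].
      destruct (IH (fun x k => v x (Fin.FS k)) (fun k => Hv (Fin.FS k)) (eps / 2))
        as [d2 [Hd2 H2]]; [lra|].
      exists (Rmin d1 d2); split; [now apply Rmin_case|]; intros y Hy.
      specialize (H1 y (Rlt_le_trans _ _ _ Hy (Rmin_l _ _))).
      specialize (H2 y (Rlt_le_trans _ _ _ Hy (Rmin_r _ _))).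
      unfold cnorm, vsub in *; simpl in *; lra. }
  apply G; auto.
Qed.

Lemma chart_cont_along (f : C -> M) (s : C) (j : chart_idx M) :
  cont_M f s -> cdom M j (f s) -> forall eps, 0 < eps -> exists d, 0 < d /\
    forall y, Cmod (y - s)%C < d ->
      cdom M j (f y) /\ cnorm (vsub (chart M j (f y)) (chart M j (f s))) < eps.
Proof.
  intros Hc Hj eps He.
  destruct (chart_cont n M j (f s) Hj eps He) as [A [HA1 [HA2 HA3]]].
  destruct (Hc (fun x => A x /\ cdom M j x)) as [d [Hd H]]; auto.
  { apply mopen_inter; auto; apply cdom_open. }
  exists d; split; auto; intros y Hy; destruct (H y Hy); auto.
Qed.

Lemma rdiff_chart_change (f : C -> M) (s : C) (j k : chart_idx M) (A B : Cn n)
  (L : Fin.t n -> Fin.t n -> C) :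
  cont_M f s -> cdom M j (f s) -> cdom M k (f s) ->
  fderiv (trans j k) (chart M j (f s)) L ->
  (forall l, rdiff (fun u => chart M j (f u) l) s (A l) (B l)) ->
  forall l, rdiff (fun u => chart M k (f u) l) s (lapp L A l) (lapp L B l).
Proof.
  intros Hc Hj Hk HL HA l.
  destruct (chart_cont_along f s j Hc Hj 1) as [d1 [Hd1 H1]]; [lra|].
  destruct (chart_cont_along f s k Hc Hk 1) as [d2 [Hd2 H2]]; [lra|].
  apply rdiff_ext_loc with (fun u => trans j k (chart M j (f u)) l) (Rmin d1 d2).
  - now apply Rmin_case.
  - intros h Hh.
    rewrite trans_chart; auto.
    + apply H1; replace (s + h - s)%C with h by ring.
      eapply Rlt_le_trans; [apply Hh|apply Rmin_l].
    + apply H2; replace (s + h - s)%C with h by ring.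
      eapply Rlt_le_trans; [apply Hh|apply Rmin_r].
  - apply (fderiv_comp_rdiff (trans j k) L (fun u => chart M j (f u))); auto.
Qed.

Lemma cont_M_of_chart (f : C -> M) (s : C) (j : chart_idx M) (d : R) : 0 < d ->
  (forall y, Cmod (y - s)%C < d -> cdom M j (f y)) ->
  (forall k, cont_at (fun u => chart M j (f u) k) s) -> cont_M f s.
Proof.
  intros Hd Hj Hc A HA HAs.
  assert (Hjs : cdom M j (f s)).
  { apply Hj; replace (s - s)%C with (RtoC 0) by ring; now rewrite Cmod_0. }
  destruct (chart_ball_in j (f s) A Hjs HA HAs) as [rho [Hrho H]].
  destruct (vec_cont (fun u => chart M j (f u)) s Hc rho Hrho) as [d' [Hd' H']].
  exists (Rmin d d'); split; [now apply Rmin_case|]; intros y Hy.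
  apply H; [apply Hj|apply H']; eapply Rlt_le_trans; try apply Hy; [apply Rmin_l|apply Rmin_r].
Qed.

(** One chart suffices: a zero conjugate derivative is mapped to zero by the derivative of a chart
    change. *)
Lemma hol_at_of_chart (f : C -> M) (s : C) (j : chart_idx M) (d : R) : 0 < d ->
  (forall y, Cmod (y - s)%C < d -> cdom M j (f y)) ->
  (forall k, exists D, rdiff (fun u => chart M j (f u) k) s D 0) -> hol_at f s.
Proof.
  intros Hd Hj HD.
  assert (Hjs : cdom M j (f s)).
  { apply Hj; replace (s - s)%C with (RtoC 0) by ring; now rewrite Cmod_0. }
  assert (Hc : cont_M f s).
  { apply cont_M_of_chart with j d; auto; intros k; destruct (HD k) as [D H].
    now apply cont_at_rdiff with D (RtoC 0). }
  split; auto; intros i Hi k.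
  destruct (trans_fderiv j i (f s) Hjs Hi) as [L HL].
  set (A := fun l => proj1_sig (constructive_indefinite_description _ (HD l))).
  exists (lapp L A k); rewrite <- (lapp_0 L k).
  apply (rdiff_chart_change f s j i A (fun _ => RtoC 0)); auto.
  intros l; exact (proj2_sig (constructive_indefinite_description _ (HD l))).
Qed.

Lemma holo_disc_hol_at (f : C -> M) : holo_disc M f <-> forall s, in_disc s -> hol_at f s.
Proof.
  unfold in_disc; split.
  - intros H s Hs; destruct (H s Hs) as [H1 H2]; split.
    + intros A HA HAs; destruct (H1 A HA HAs) as [d [Hd Hd']].
      exists (Rmin d (1 - Cmod s)); split; [apply Rmin_case; lra|]; intros y Hy.
      apply Hd'; [|eapply Rlt_le_trans; [apply Hy|apply Rmin_l]].
      unfold in_disc; assert (T := Cmod_le_add y s).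
      assert (Cmod (y - s)%C < 1 - Cmod s) by (eapply Rlt_le_trans; [apply Hy|apply Rmin_r]); lra.
    + intros i Hi k; destruct (H2 i Hi k) as [D HD]; exists D; now apply is_derive_rdiff.
  - intros H s Hs; destruct (H s Hs) as [H1 H2]; split.
    + intros A HA HAs; destruct (H1 A HA HAs) as [d [Hd Hd']]; exists d; split; auto.
    + intros i Hi k; destruct (H2 i Hi k) as [D HD]; exists D; now apply is_derive_rdiff.
Qed.

Lemma hol_at_rescale (f : C -> M) (c s : C) : c <> 0 -> hol_at f (c * s)%C ->
  hol_at (fun x => f (c * x)%C) s.
Proof.
  intros Hc [H1 H2].
  assert (Hc0 : 0 < Cmod c) by now apply Cmod_gt_0.
  split.
  - intros A HA HAs; destruct (H1 A HA HAs) as [d [Hd Hd']].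
    exists (d / Cmod c); split; [now apply Rdiv_lt_0_compat|]; intros y Hy; apply Hd'.
    replace (c * y - c * s)%C with (c * (y - s))%C by ring; rewrite Cmod_mult.
    apply Rmult_lt_compat_l with (r := Cmod c) in Hy; auto.
    replace (Cmod c * (d / Cmod c)) with d in Hy by (field; lra); auto.
  - intros i Hi k; destruct (H2 i Hi k) as [D HD]; exists (c * D)%C.
    intros eps He; destruct (HD (eps / Cmod c)) as [d [Hd Hh]]; [now apply Rdiv_lt_0_compat|].
    exists (d / Cmod c); split; [now apply Rdiv_lt_0_compat|]; intros h Hh'.
    apply Rmult_lt_compat_l with (r := Cmod c) in Hh'; auto.
    replace (Cmod c * (d / Cmod c)) with d in Hh' by (field; lra).
    rewrite <- Cmod_mult in Hh'; specialize (Hh _ Hh').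
    replace (c * (s + h))%C with (c * s + c * h)%C by ring.
    replace (c * D * h + 0 * Cconj h)%C with (D * (c * h) + 0 * Cconj (c * h))%C by ring.
    eapply Rle_trans; [apply Hh|]; rewrite Cmod_mult; right; field; lra.
Qed.

(** * Uniform estimates for chart changes near a point *)

(** Everything about a chart change near [x] that the gluing uses: the ball of radius [eta] lies in
    the overlap, and there the change is Lipschitz and its derivative bounded and Lipschitz. One
    number is both the radius and the inverse of all constants, so the property persists when [eta]
    shrinks, as compactness arguments require. *)
Definition tube (j k : chart_idx M) (x : M) (eta : R) : Prop :=
  (forall u, cnorm (vsub u (chart M j x)) < eta ->
     exists y, cdom M j y /\ cdom M k y /\ chart M j y = u) /\
  (forall w w', cnorm (vsub w (chart M j x)) < eta -> cnorm (vsub w' (chart M j x)) < eta ->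
     cnorm (vsub (trans j k w) (trans j k w')) <= / eta * cnorm (vsub w w')) /\
  (forall w L h, cnorm (vsub w (chart M j x)) < eta -> fderiv (trans j k) w L ->
     cnorm (lapp L h) <= / eta * cnorm h) /\
  (forall w w' L L' h, cnorm (vsub w (chart M j x)) < eta -> cnorm (vsub w' (chart M j x)) < eta ->
     fderiv (trans j k) w L -> fderiv (trans j k) w' L' ->
     cnorm (vsub (lapp L h) (lapp L' h)) <= / eta * cnorm (vsub w w') * cnorm h).

(** With [y = x] this is monotonicity in [eta]; with [y] near [x] it is the local uniformity that
    feeds [compact_uniform]. *)
Lemma tube_shift (j k : chart_idx M) (x y : M) (eta eta' : R) : 0 < eta' ->
  tube j k x eta -> cnorm (vsub (chart M j y) (chart M j x)) + eta' <= eta -> tube j k y eta'.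
Proof.
  intros He [H1 [H2 [H3 H4]]] Hy.
  assert (T : forall w, cnorm (vsub w (chart M j y)) < eta' -> cnorm (vsub w (chart M j x)) < eta).
  { intros w Hw; eapply Rle_lt_trans; [apply (cnorm_sub_triangle w (chart M j y))|]; lra. }
  assert (Hee : eta' <= eta) by (assert (H := cnorm_ge_0 (vsub (chart M j y) (chart M j x))); lra).
  assert (Hi : / eta <= / eta') by (apply Rinv_le_contravar; lra).
  split; [|split; [|split]].
  - intros u Hu; apply H1; auto.
  - intros w w' Hw Hw'; eapply Rle_trans; [apply H2; auto|].
    apply Rmult_le_compat_r; auto; apply cnorm_ge_0.
  - intros w L h Hw HL; eapply Rle_trans; [apply (H3 w); auto|].
    apply Rmult_le_compat_r; auto; apply cnorm_ge_0.
  - intros w w' L L' h Hw Hw' HL HL'; eapply Rle_trans; [apply (H4 w w'); auto|].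
    apply Rmult_le_compat_r; [apply cnorm_ge_0|].
    apply Rmult_le_compat_r; auto; apply cnorm_ge_0.
Qed.

Lemma tube_exists (j k : chart_idx M) (x : M) : cdom M j x -> cdom M k x ->
  exists eta, 0 < eta /\ tube j k x eta.
Proof.
  intros Hj Hk.
  destruct (chart_ball j x (cdom M k) Hj (cdom_open n M k) Hk) as [d0 [Hd0 H0]].
  destruct (fderiv_local (trans j k) (chart M j x) d0 Hd0) as [rho [K [Hr [HK [Hrd [H1 [H2 H3]]]]]]].
  { intros w Hw; destruct (H0 w Hw) as [y [Y1 [Y2 <-]]]; now apply trans_fderiv. }
  set (eta := Rmin rho (/ K)).
  assert (HiK : 0 < / K) by (now apply Rinv_0_lt_compat).
  assert (He : 0 < eta) by (unfold eta; apply Rmin_case; auto).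
  assert (E1 : eta <= rho) by apply Rmin_l.
  assert (E2 : K <= / eta).
  { rewrite <- (Rinv_inv K); apply Rinv_le_contravar; auto; apply Rmin_r. }
  exists eta; split; auto; split; [|split; [|split]].
  - intros u Hu; apply H0; lra.
  - intros w w' Hw Hw'; eapply Rle_trans; [apply H1; lra|].
    apply Rmult_le_compat_r; auto; apply cnorm_ge_0.
  - intros w L h Hw HL; eapply Rle_trans; [apply (H2 w); auto; lra|].
    apply Rmult_le_compat_r; auto; apply cnorm_ge_0.
  - intros w w' L L' h Hw Hw' HL HL'; eapply Rle_trans; [apply (H3 w w'); auto; lra|].
    apply Rmult_le_compat_r; [apply cnorm_ge_0|].
    apply Rmult_le_compat_r; auto; apply cnorm_ge_0.
Qed.

Lemma tube_dom (j k : chart_idx M) (x y : M) (eta : R) : tube j k x eta -> cdom M j y ->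
  cnorm (vsub (chart M j y) (chart M j x)) < eta -> cdom M k y.
Proof.
  intros [H _] Hy Hxy; destruct (H _ Hxy) as [y' [H1 [H2 H3]]].
  rewrite (chart_inj n M j y y'); auto.
Qed.

Lemma tube_lip (j k : chart_idx M) (x y y' : M) (eta : R) : tube j k x eta ->
  cdom M j y -> cdom M j y' ->
  cnorm (vsub (chart M j y) (chart M j x)) < eta ->
  cnorm (vsub (chart M j y') (chart M j x)) < eta ->
  cnorm (vsub (chart M k y) (chart M k y')) <= / eta * cnorm (vsub (chart M j y) (chart M j y')).
Proof.
  intros Ht Hy Hy' Hxy Hxy'.
  rewrite <- (trans_chart j k y), <- (trans_chart j k y'); auto.
  - now apply Ht.
  - now apply (tube_dom j k x y' eta).
  - now apply (tube_dom j k x y eta).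
Qed.

End Charts.

(* A Lebesgue number argument. *)
Lemma compact_uniform (S : C -> Prop) (P : C -> R -> Prop) (b : R) :
  (forall z, S z -> Cmod z <= b) ->
  (forall z, ~ S z -> exists d, 0 < d /\ forall y, Cmod (y - z)%C < d -> ~ S y) ->
  (forall z e e', P z e -> 0 < e' -> e' <= e -> P z e') ->
  (forall z, S z -> exists d, 0 < d /\ forall y, S y -> Cmod (y - z)%C < d -> P y d) ->
  exists e, 0 < e /\ forall z, S z -> P z e.
Proof.
  intros Hb Hcl Hmono Hloc.
  (* The covering lemma below measures the two coordinates separately, so a modulus up to [2 * d]
     has to be allowed. Points outside [S] also need a radius; there the condition is vacuous
     because [S] is closed. *)
  assert (Hg : forall x y : R, exists d : posreal, forall z, S z ->
      Cmod (z - (x, y))%C < 2 * d -> P z d).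
  { intros x y; destruct (excluded_middle_informative (S (x, y))) as [HS|HS].
    - destruct (Hloc _ HS) as [d [Hd H]].
      assert (Hd2 : 0 < d / 2) by lra.
      exists (mkposreal _ Hd2); simpl; intros z Hz Hzd; apply Hmono with d; try lra.
      apply H; auto; lra.
    - destruct (Hcl _ HS) as [d [Hd H]].
      assert (Hd2 : 0 < d / 2) by lra.
      exists (mkposreal _ Hd2); simpl; intros z Hz Hzd; exfalso; apply (H z); auto; lra. }
  set (delta := fun x y => proj1_sig (constructive_indefinite_description _ (Hg x y))).
  assert (Hdelta : forall x y z, S z -> Cmod (z - (x, y))%C < 2 * delta x y -> P z (delta x y)).
  { intros x y; exact (proj2_sig (constructive_indefinite_description _ (Hg x y))). }
  destruct (compactness_value_2d (- b) b (- b) b delta) as [d Hd].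
  exists d; split; [apply cond_pos|]; intros z Hz.
  assert (Hz1 := Cmod_fst_le z); assert (Hz2 := Cmod_snd_le z); specialize (Hb z Hz).
  assert (Hz1' : Rabs (fst z) <= b) by lra; assert (Hz2' : Rabs (snd z) <= b) by lra.
  apply Rabs_le_between in Hz1'; apply Rabs_le_between in Hz2'.
  apply NNPP; intros HN; apply (Hd (fst z) (snd z)); auto.
  intros [u [v [_ [_ [H1 [H2 H3]]]]]]; apply HN.
  apply Hmono with (delta u v); auto; [|apply cond_pos].
  apply Hdelta; auto.
  destruct z as [zx zy]; simpl in *.
  eapply Rle_lt_trans; [apply (Cmod_le_Rabs (zx + - u) (zy + - v))|].
  unfold Rminus in H1, H2; lra.
Qed.

(** * The Lempert function and the Kobayashi pseudodistance *)

(** This and the next bound come from [1 + y <= exp y] at plus and minus the logarithm in [atanh].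
    They are crude, but exact to first order at 0, which is all that a derivative sees. *)
Lemma atanh_le (x : R) : 0 <= x < 1 -> Defs.atanh x <= x / (1 - x).
Proof.
  intros Hx; unfold Defs.atanh.
  assert (Hp : 0 < (1 + x) / (1 - x)) by (apply Rdiv_lt_0_compat; lra).
  assert (H := exp_ineq1_le (ln ((1 + x) / (1 - x)))); rewrite exp_ln in H by auto.
  assert (E : (1 + x) / (1 - x) = 1 + 2 * (x / (1 - x))) by (field; lra); lra.
Qed.

Lemma atanh_ge (x : R) : 0 <= x < 1 -> x / (1 + x) <= Defs.atanh x.
Proof.
  intros Hx; unfold Defs.atanh.
  assert (Hp : 0 < (1 + x) / (1 - x)) by (apply Rdiv_lt_0_compat; lra).
  assert (H := exp_ineq1_le (- ln ((1 + x) / (1 - x)))).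
  rewrite exp_Ropp, exp_ln in H by auto.
  assert (E : / ((1 + x) / (1 - x)) = 1 - 2 * (x / (1 + x))) by (field; lra); lra.
Qed.

Lemma atanh_mono (x y : R) : 0 <= x <= y -> y < 1 -> Defs.atanh x <= Defs.atanh y.
Proof.
  intros Hx Hy; unfold Defs.atanh; apply Rmult_le_compat_l; [lra|].
  apply ln_le; [apply Rdiv_lt_0_compat; lra|].
  apply Rmult_le_compat; try lra.
  - left; apply Rinv_0_lt_compat; lra.
  - apply Rinv_le_contravar; lra.
Qed.

Lemma Rbar_glb_correct (E : Rbar -> Prop) : Rbar_is_glb E (Rbar_glb E).
Proof. unfold Rbar_glb; now destruct (Rbar_ex_glb E). Qed.

Lemma Rbar_lub_correct (E : Rbar -> Prop) : Rbar_is_lub E (Rbar_lub E).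
Proof. unfold Rbar_lub; now destruct (Rbar_ex_lub E). Qed.

Lemma glb_lt_ex (E : Rbar -> Prop) (e : Rbar) : Rbar_lt (Rbar_glb E) e ->
  exists r, E r /\ Rbar_lt r e.
Proof.
  intros H; apply NNPP; intros HN.
  destruct (Rbar_glb_correct E) as [_ H2].
  apply (Rbar_lt_not_le _ _ H), H2; intros r Hr.
  apply Rbar_not_lt_le; intros Hlt; apply HN; eauto.
Qed.

Lemma glb_le (E : Rbar -> Prop) (r : Rbar) : E r -> Rbar_le (Rbar_glb E) r.
Proof. intros H; now apply (Rbar_glb_correct E). Qed.

Section Lempert.
Context {n : nat} (M : complex_manifold n).

Lemma lempert_star_nonneg (z w : M) : Rbar_le (Finite 0) (lempert_star M z w).
Proof.
  apply (Rbar_glb_correct _); intros r [a [f [_ [_ [_ [_ ->]]]]]]; simpl; apply Cmod_ge_0.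
Qed.

Lemma lempert_nonneg (z w : M) : Rbar_le (Finite 0) (lempert M z w).
Proof.
  unfold lempert; assert (H := lempert_star_nonneg z w).
  destruct (lempert_star M z w) as [r| |]; simpl in *; auto.
  destruct (Rlt_dec r 1) as [Hr|Hr]; simpl; auto.
  assert (G := atanh_ge r (conj H Hr)).
  assert (0 <= r / (1 + r)) by (apply Rmult_le_pos; auto; left; apply Rinv_0_lt_compat; lra); lra.
Qed.

Lemma lempert_le (z w : M) (a : C) (f : C -> M) : in_disc a -> holo_disc M f ->
  f (RtoC 0) = z -> f a = w ->
  exists l, lempert M z w = Finite l /\ 0 <= l /\ l <= Defs.atanh (Cmod a).
Proof.
  intros Ha Hf H0 Hw.
  assert (H1 := lempert_star_nonneg z w); assert (H2 := lempert_nonneg z w).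
  assert (H3 : Rbar_le (lempert_star M z w) (Finite (Cmod a))).
  { apply glb_le; exists a, f; auto. }
  unfold in_disc in Ha; unfold lempert in *.
  destruct (lempert_star M z w) as [r| |]; simpl in *; try tauto.
  destruct (Rlt_dec r 1) as [Hr|Hr]; [|lra].
  eexists; split; [reflexivity|]; split; auto.
  apply atanh_mono; auto.
Qed.

(** The radius [e / (1 - e)] is the solution of [x / (1 + x) = e], the left side being the lower
    bound for [atanh]. *)
Lemma lempert_lt_disc (z w : M) (e : R) : e < 1 -> Rbar_lt (lempert M z w) (Finite e) ->
  exists a f, in_disc a /\ holo_disc M f /\ f (RtoC 0) = z /\ f a = w /\ Cmod a < e / (1 - e).
Proof.
  intros He H; unfold lempert in H; assert (H1 := lempert_star_nonneg z w).
  destruct (lempert_star M z w) as [r| |] eqn:E; simpl in *; try tauto.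
  destruct (Rlt_dec r 1) as [Hr|Hr]; simpl in H; [|tauto].
  assert (G := atanh_ge r (conj H1 Hr)).
  assert (Hlt : r < e / (1 - e)).
  { assert (G2 : r / (1 + r) < e) by lra.
    apply Rmult_lt_compat_r with (r := 1 + r) in G2; [|lra].
    replace (r / (1 + r) * (1 + r)) with r in G2 by (field; lra).
    apply Rmult_lt_reg_r with (1 - e); [lra|].
    replace (e / (1 - e) * (1 - e)) with e by (field; lra); lra. }
  destruct (glb_lt_ex _ (Finite (e / (1 - e))) ltac:(unfold lempert_star in E; rewrite E; exact Hlt))
    as [r' [[a [f [A1 [A2 [A3 [A4 ->]]]]]] Hr']].
  exists a, f; simpl in Hr'; tauto.
Qed.

(** Inverse of a chart, total with the default [x0] outside the image. *)
Definition cinv (i : chart_idx M) (x0 : M) (u : Cn n) : M :=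
  match excluded_middle_informative (exists y, cdom M i y /\ chart M i y = u) with
  | left H => proj1_sig (constructive_indefinite_description _ H)
  | right _ => x0
  end.

Lemma cinv_spec (i : chart_idx M) (x0 : M) (u : Cn n) :
  (exists y, cdom M i y /\ chart M i y = u) ->
  cdom M i (cinv i x0 u) /\ chart M i (cinv i x0 u) = u.
Proof.
  intros H; unfold cinv; destruct (excluded_middle_informative _) as [H'|H']; [|tauto].
  exact (proj2_sig (constructive_indefinite_description _ H')).
Qed.

Lemma cinv_chart (i : chart_idx M) (x0 x : M) : cdom M i x -> cinv i x0 (chart M i x) = x.
Proof.
  intros H; destruct (cinv_spec i x0 (chart M i x)) as [H1 H2]; [eauto|].
  now apply (chart_inj n M i).
Qed.

Lemma rdiff_line (p q : C) (s : C) : rdiff (fun x => p + x * q)%C s q 0.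
Proof. eapply littleo_ext; [|apply littleo_0]; intros; simpl; ring. Qed.

Lemma holo_disc_affine (i : chart_idx M) (x0 : M) (u h : Cn n) :
  (forall s, in_disc s -> exists y, cdom M i y /\ chart M i y = vadd u (vscale s h)) ->
  holo_disc M (fun s => cinv i x0 (vadd u (vscale s h))).
Proof.
  intros H; apply holo_disc_hol_at; intros s Hs; unfold in_disc in *.
  assert (Hnear : forall y, Cmod (y - s)%C < 1 - Cmod s -> Cmod y < 1).
  { intros y Hy; assert (T := Cmod_le_add y s); lra. }
  apply hol_at_of_chart with i (1 - Cmod s); [lra| |].
  - intros y Hy; apply cinv_spec, H, Hnear, Hy.
  - intros k; exists (h k).
    apply rdiff_ext_loc with (fun x => u k + x * h k)%C (1 - Cmod s); [lra| |apply rdiff_line].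
    intros x Hx; destruct (cinv_spec i x0 (vadd u (vscale (s + x)%C h))) as [_ E].
    + apply H, Hnear; now replace (s + x - s)%C with x by ring.
    + now rewrite E.
Qed.

(** Both points lie on a complex line in the chart. The affine disc centred at one of them with
    radius [R0 / 2] stays in the chart ball, so the parameter of the other point is their distance
    divided by [R0 / 2]. *)
Lemma lempert_local (i : chart_idx M) (x0 : M) : cdom M i x0 ->
  exists rho, 0 < rho /\ forall x y, cdom M i x -> cdom M i y ->
    cnorm (vsub (chart M i x) (chart M i x0)) < rho ->
    cnorm (vsub (chart M i y) (chart M i x0)) < rho ->
    exists l, lempert M x y = Finite l /\ 0 <= l /\
      l <= / rho * cnorm (vsub (chart M i x) (chart M i y)).
Proof.
  intros Hx0.
  destruct (chart_ball M i x0 (fun _ => True) Hx0 (mopen_all n M) I) as [R0 [HR HB]].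
  exists (R0 / 8); split; [lra|]; intros x y Hx Hy Hxr Hyr.
  set (u := chart M i x) in *; set (u' := chart M i y) in *.
  set (N := cnorm (vsub u' u)).
  assert (HN : 0 <= N) by apply cnorm_ge_0.
  assert (HN1 : N < R0 / 4).
  { eapply Rle_lt_trans; [apply (cnorm_sub_triangle u' (chart M i x0) u)|].
    rewrite (cnorm_sub_sym (chart M i x0)); lra. }
  set (a := N / (R0 / 2)).
  assert (Ha : 0 <= a) by (apply Rmult_le_pos; [auto|left; apply Rinv_0_lt_compat; lra]).
  assert (Ha2 : a * (R0 / 2) = N) by (unfold a; field; lra).
  assert (Ha1 : a < / 2) by nra.
  (* If the points coincide then [a = 0], but the vector being scaled is 0 as well, so the default
     value of the inverse does no harm. *)
  set (h := vscale (/ RtoC a)%C (vsub u' u)).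
  assert (Hh : cnorm h <= R0 / 2).
  { unfold h; rewrite cnorm_scale; fold N.
    destruct (Req_dec a 0) as [E|E].
    - assert (N = 0) by (rewrite E in Ha2; lra); rewrite H, Rmult_0_r; lra.
    - assert (0 < a) by lra.
      rewrite Cmod_inv, Cmod_R, Rabs_pos_eq by (try lra; intros E'; apply RtoC_inj in E'; lra).
      rewrite <- Ha2; right; field; lra. }
  destruct (lempert_le x y (RtoC a) (fun s => cinv i x0 (vadd u (vscale s h)))) as [l [L1 [L2 L3]]].
  - unfold in_disc; rewrite Cmod_R, Rabs_pos_eq; lra.
  - apply holo_disc_affine; intros s Hs; unfold in_disc in Hs.
    destruct (HB (vadd u (vscale s h))) as [z [Z1 [_ Z2]]]; [|eauto].
    rewrite vadd_sub_assoc; eapply Rle_lt_trans; [apply cnorm_triangle|].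
    rewrite cnorm_scale.
    assert (Hs0 := Cmod_ge_0 s); assert (Hh0 := cnorm_ge_0 h).
    assert (Cmod s * cnorm h <= 1 * (R0 / 2)) by (apply Rmult_le_compat; lra); lra.
  - replace (vadd u (vscale 0 h)) with u; [now apply cinv_chart|].
    apply functional_extensionality; intros k; unfold vadd, vscale; ring.
  - replace (vadd u (vscale (RtoC a) h)) with u'; [now apply cinv_chart|].
    destruct (Req_dec a 0) as [E|E].
    + assert (E0 : N = 0) by (rewrite E in Ha2; lra).
      rewrite <- (cnorm_sub_eq_0 u' u E0), E.
      apply functional_extensionality; intros k; unfold vadd, vscale; ring.
    + apply functional_extensionality; intros k; unfold vadd, vscale, h, vscale, vsub.
      field; intros E'; apply RtoC_inj in E'; lra.
  - exists l; repeat split; auto; eapply Rle_trans; [apply L3|].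
    rewrite Cmod_R, Rabs_pos_eq by lra.
    eapply Rle_trans; [apply atanh_le; lra|].
    rewrite cnorm_sub_sym; fold N.
    apply Rle_trans with (2 * a).
    + apply Rmult_le_reg_r with (1 - a); [lra|].
      replace (a / (1 - a) * (1 - a)) with a by (field; lra); nra.
    + rewrite <- Ha2; replace (/ (R0 / 8) * (a * (R0 / 2))) with (4 * a) by (field; lra); lra.
Qed.

Lemma chain_sum_ext (c c' : nat -> M) (m : nat) : (forall k, (k <= m)%nat -> c k = c' k) ->
  chain_sum M c m = chain_sum M c' m.
Proof.
  induction m as [|m IH]; simpl; intros H; auto.
  rewrite IH by (intros; apply H; lia); rewrite !H by lia; auto.
Qed.

(** A near-optimal chain from [z] to [x] is lengthened by the single link from [x] to [y]. This is
    the only form of the triangle inequality in use. *)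
Lemma kob_lt_step (z x y : M) (e l : R) : Rbar_lt (kob M z x) (Finite e) ->
  lempert M x y = Finite l -> Rbar_lt (kob M z y) (Finite (e + l)).
Proof.
  intros H Hl.
  destruct (glb_lt_ex _ _ H) as [r [[m [Hm ->]] Hr]].
  destruct (glb_lt_ex _ _ Hr) as [r' [[c [C1 [C2 ->]]] Hr']].
  set (c' := fun k => if Nat.leb k m then c k else y).
  assert (E1 : forall k, (k <= m)%nat -> c k = c' k).
  { intros k Hk; unfold c'; apply Nat.leb_le in Hk; now rewrite Hk. }
  assert (E2 : c' (S m) = y).
  { unfold c'; destruct (Nat.leb (S m) m) eqn:E; auto; apply Nat.leb_le in E; lia. }
  assert (S1 : Rbar_le (kob M z y) (chain_sum M c' (S m))).
  { eapply Rbar_le_trans; [apply glb_le; exists (S m); split; [lia|reflexivity]|].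
    apply glb_le; exists c'; rewrite <- E1 by lia; auto. }
  eapply Rbar_le_lt_trans; [apply S1|].
  simpl; rewrite E2, <- (chain_sum_ext c c' m E1), <- E1, C2, Hl by lia.
  destruct (chain_sum M c m) as [s| |]; simpl in *; auto; lra.
Qed.

Lemma kob_lt_lempert (z x : M) (l e : R) : lempert M z x = Finite l -> l < e ->
  Rbar_lt (kob M z x) (Finite e).
Proof.
  intros Hl He.
  eapply Rbar_le_lt_trans with (Finite l); [|exact He].
  eapply Rbar_le_trans; [apply glb_le; exists 1%nat; split; [lia|reflexivity]|].
  apply glb_le; exists (fun k => match k with O => z | _ => x end); simpl; rewrite Hl; simpl.
  repeat split; auto; now rewrite Rplus_0_l.
Qed.

End Lempert.

(** * Sequential compactness *)

(** Instead of a strictly increasing sequence of indices only [k <= phi k] is recorded; this is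
    enough for passing to the limit and is preserved when index maps are composed. *)
Lemma bolzano_R (u : nat -> R) (b : R) : (forall k, Rabs (u k) <= b) ->
  exists (phi : nat -> nat) (l : R), (forall k, (k <= phi k)%nat) /\
    forall eps, 0 < eps -> exists N, forall k, (N <= k)%nat -> Rabs (u (phi k) - l) < eps.
Proof.
  intros Hb.
  destruct (Bolzano_Weierstrass u _ (compact_P3 (- b) b)) as [l Hl].
  { intros k; apply Rabs_le_between, Hb. }
  assert (H : forall k, exists p, (k <= p)%nat /\ Rabs (u p - l) < / (INR k + 1)).
  { intros k; assert (Hp : 0 < / (INR k + 1))
      by (apply Rinv_0_lt_compat; assert (H := pos_INR k); lra).
    destruct (Hl (disc l (mkposreal _ Hp)) k) as [p [P1 P2]].
    - exists (mkposreal _ Hp); intros x Hx; exact Hx.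
    - exists p; split; auto. }
  set (phi := fun k => proj1_sig (constructive_indefinite_description _ (H k))).
  assert (Hphi : forall k, (k <= phi k)%nat /\ Rabs (u (phi k) - l) < / (INR k + 1)).
  { intros k; exact (proj2_sig (constructive_indefinite_description _ (H k))). }
  exists phi, l; split; [intros; apply Hphi|]; intros eps He.
  destruct (archimed_cor1 eps He) as [N [HN HN0]].
  exists N; intros k Hk; eapply Rlt_trans; [apply Hphi|].
  eapply Rle_lt_trans; [|apply HN]; apply Rinv_le_contravar; [apply lt_0_INR; lia|].
  apply le_INR in Hk; lra.
Qed.

Lemma bolzano_Cn (n : nat) : forall (u : nat -> Cn n) (b : R), (forall k, cnorm (u k) <= b) ->
  exists (phi : nat -> nat) (l : Cn n), (forall k, (k <= phi k)%nat) /\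
    forall eps, 0 < eps -> exists N, forall k, (N <= k)%nat -> cnorm (vsub (u (phi k)) l) < eps.
Proof.
  induction n as [|n IH]; intros u b Hb.
  - exists (fun k => k), (fun _ => RtoC 0); split; auto; intros eps He; exists O; intros.
    unfold cnorm; simpl; auto.
  - destruct (IH (fun k i => u k (Fin.FS i)) b) as [p1 [l1 [P1 L1]]].
    { intros k; eapply Rle_trans; [|apply (Hb k)]; unfold cnorm; simpl.
      assert (H := Cmod_ge_0 (u k Fin.F1)); lra. }
    assert (Hc : forall k, Cmod (u k Fin.F1) <= b)
      by (intros k; eapply Rle_trans; [apply cnorm_comp|apply Hb]).
    destruct (bolzano_R (fun k => fst (u (p1 k) Fin.F1)) b) as [p2 [l2 [P2 L2]]].
    { intros k; eapply Rle_trans; [apply Cmod_fst_le|auto]. }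
    destruct (bolzano_R (fun k => snd (u (p1 (p2 k)) Fin.F1)) b) as [p3 [l3 [P3 L3]]].
    { intros k; eapply Rle_trans; [apply Cmod_snd_le|auto]. }
    exists (fun k => p1 (p2 (p3 k))), (fun i => Fin.caseS' i (fun _ => C) (l2, l3) l1).
    split.
    { intros k; eapply Nat.le_trans; [apply P3|]; eapply Nat.le_trans; [apply P2|apply P1]. }
    intros eps He.
    destruct (L1 (eps / 3)) as [N1 H1]; [lra|].
    destruct (L2 (eps / 3)) as [N2 H2]; [lra|].
    destruct (L3 (eps / 3)) as [N3 H3]; [lra|].
    exists (Nat.max N1 (Nat.max N2 N3)); intros k Hk.
    specialize (H1 (p2 (p3 k))); specialize (H2 (p3 k)); specialize (H3 k).
    specialize (P2 (p3 k)); specialize (P3 k).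
    specialize (H1 ltac:(lia)); specialize (H2 ltac:(lia)); specialize (H3 ltac:(lia)).
    unfold cnorm in *; simpl in *; unfold vsub in *; simpl.
    assert (T := Cmod_le_Rabs (fst (u (p1 (p2 (p3 k))) Fin.F1) + - l2)
                              (snd (u (p1 (p2 (p3 k))) Fin.F1) + - l3)).
    unfold Rminus in H2, H3; unfold Cminus, Cplus, Copp in *; simpl in *; lra.
Qed.

(** * The lower bound: discs near a hyperbolic point *)

Section Lower.
Context {n : nat} (M : complex_manifold n).

(** Otherwise points of the sphere with pseudodistance to [z] tending to 0 accumulate at a point [y]
    of the sphere. The last link to [y] is short by [lempert_local], so the pseudodistance from [z]
    to [y] is 0, against hyperbolicity at [z]. *)
Lemma kob_sphere_bound (i : chart_idx M) (z : M) (R0 : R) : 0 < R0 ->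
  cdom M i z -> hyperbolic_at M z ->
  (forall u, cnorm (vsub u (chart M i z)) <= R0 -> exists y, cdom M i y /\ chart M i y = u) ->
  exists c, 0 < c /\ forall x, cdom M i x -> cnorm (vsub (chart M i x) (chart M i z)) = R0 ->
    ~ Rbar_lt (kob M z x) (Finite c).
Proof.
  intros HR Hz Hyp HB; apply NNPP; intros HN.
  assert (Hseq : forall k : nat, exists x, cdom M i x /\
     cnorm (vsub (chart M i x) (chart M i z)) = R0 /\ Rbar_lt (kob M z x) (Finite (/ (INR k + 1)))).
  { intros k; apply NNPP; intros HN'; apply HN.
    exists (/ (INR k + 1)); split.
    - apply Rinv_0_lt_compat; assert (H := pos_INR k); lra.
    - intros x Hx1 Hx2 Hx3; apply HN'; eauto. }
  set (x := fun k => proj1_sig (constructive_indefinite_description _ (Hseq k))).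
  assert (Hx : forall k, cdom M i (x k) /\ cnorm (vsub (chart M i (x k)) (chart M i z)) = R0 /\
     Rbar_lt (kob M z (x k)) (Finite (/ (INR k + 1)))).
  { intros k; exact (proj2_sig (constructive_indefinite_description _ (Hseq k))). }
  destruct (bolzano_Cn n (fun k => vsub (chart M i (x k)) (chart M i z)) R0) as [phi [l [Hphi Hl]]].
  { intros k; right; apply Hx. }
  set (v := vadd (chart M i z) l).
  assert (Hdist : forall k, cnorm (vsub (chart M i (x k)) v) =
     cnorm (vsub (vsub (chart M i (x k)) (chart M i z)) l)).
  { intros k; f_equal; apply functional_extensionality; intros j; unfold v, vsub, vadd; ring. }
  assert (Hvz : cnorm (vsub v (chart M i z)) = R0).
  { apply Rle_antisym; apply le_epsilon; intros e He; destruct (Hl e He) as [N HN'];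
      specialize (HN' N (Nat.le_refl N)); rewrite <- Hdist in HN';
      destruct (Hx (phi N)) as [_ [E _]].
    - assert (T := cnorm_sub_triangle v (chart M i (x (phi N))) (chart M i z)).
      rewrite (cnorm_sub_sym v (chart M i (x (phi N)))) in T; lra.
    - assert (T := cnorm_sub_triangle (chart M i (x (phi N))) v (chart M i z)); lra. }
  destruct (HB v) as [y [Hy Ev]]; [lra|].
  assert (Hyz : y <> z).
  { intros E; rewrite <- Ev, E, cnorm_sub_diag in Hvz; lra. }
  specialize (Hyp y Hyz).
  destruct (lempert_local M i y Hy) as [rho [Hrho Hloc]].
  assert (Hirho : 0 < / rho) by (now apply Rinv_0_lt_compat).
  assert (Hsmall : forall e, 0 < e -> Rbar_lt (kob M z y) (Finite e)).
  { intros e He.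
    assert (He1 : 0 < Rmin rho (e / 2 * rho)) by (apply Rmin_case; nra).
    destruct (Hl _ He1) as [N HN'].
    destruct (archimed_cor1 (e / 2)) as [N' [HN1 HN2]]; [lra|].
    set (k := Nat.max N N').
    specialize (HN' k ltac:(lia)); rewrite <- Hdist, <- Ev in HN'.
    destruct (Hx (phi k)) as [X1 [_ X3]].
    destruct (Hloc (x (phi k)) y X1 Hy) as [l' [L1 [L2 L3]]].
    - eapply Rlt_le_trans; [apply HN'|apply Rmin_l].
    - rewrite cnorm_sub_diag; auto.
    - eapply Rbar_lt_le_trans; [apply (kob_lt_step M z _ y _ l' X3 L1)|]; simpl.
      assert (A1 : cnorm (vsub (chart M i (x (phi k))) (chart M i y)) < e / 2 * rho)
        by (eapply Rlt_le_trans; [apply HN'|apply Rmin_r]).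
      apply Rmult_lt_compat_l with (r := / rho) in A1; auto.
      replace (/ rho * (e / 2 * rho)) with (e / 2) in A1 by (field; lra).
      assert (A2 : / (INR (phi k) + 1) <= / INR N').
      { apply Rinv_le_contravar; [apply lt_0_INR; lia|].
        assert (N' <= phi k)%nat by (specialize (Hphi k); lia).
        apply le_INR in H; lra. }
      lra. }
  destruct (kob M z y) as [q| |]; simpl in *; try tauto.
  - specialize (Hsmall q Hyp); lra.
  - specialize (Hsmall 1 Rlt_0_1); auto.
Qed.

(** For small [s] the point [f s] is at pseudodistance less than [c] from [z]: one link to [f 0],
    one inside the disc. So [f] never meets the coordinate sphere of radius [R0], and by
    connectedness of the segment from 0 to [s] it stays inside. *)
Lemma equicontinuity (i : chart_idx M) (z : M) : cdom M i z -> hyperbolic_at M z ->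
  exists rho r R0, 0 < rho /\ 0 < r <= 1 /\ 0 < R0 /\
    forall f, holo_disc M f -> cdom M i (f (RtoC 0)) ->
      cnorm (vsub (chart M i (f (RtoC 0))) (chart M i z)) < rho ->
      forall s, Cmod s < r -> cdom M i (f s) /\
        cnorm (vsub (chart M i (f s)) (chart M i z)) < R0.
Proof.
  intros Hz Hyp.
  destruct (chart_ball M i z (fun _ => True) Hz (mopen_all n M) I) as [R1 [HR1 HB1]].
  set (R0 := R1 / 2).
  assert (HR : 0 < R0) by (unfold R0; lra).
  assert (HB : forall u, cnorm (vsub u (chart M i z)) <= R0 ->
     exists y, cdom M i y /\ chart M i y = u).
  { intros u Hu; destruct (HB1 u) as [y [Y1 [_ Y2]]]; [unfold R0 in Hu; lra|eauto]. }
  destruct (kob_sphere_bound i z R0 HR Hz Hyp HB) as [c [Hc Hsph]].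
  destruct (lempert_local M i z Hz) as [rho0 [Hrho0 Hloc]].
  (* The bounds [rho0 * (c / 4)] here and [c / 4] in [r] keep the two links below [c / 2] each. *)
  set (rho := Rmin (Rmin rho0 R0) (rho0 * (c / 4))).
  assert (Hrho : 0 < rho) by (unfold rho; repeat apply Rmin_case; auto; nra).
  assert (Hrho1 : rho <= rho0) by (eapply Rle_trans; [apply Rmin_l|apply Rmin_l]).
  assert (Hrho2 : rho <= R0) by (eapply Rle_trans; [apply Rmin_l|apply Rmin_r]).
  assert (Hrho3 : rho <= rho0 * (c / 4)) by apply Rmin_r.
  set (r := Rmin (/ 2) (c / 4)).
  assert (Hr : 0 < r) by (unfold r; apply Rmin_case; lra).
  assert (Hr1 : r <= / 2) by apply Rmin_l.
  assert (Hr2 : r <= c / 4) by apply Rmin_r.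
  exists rho, r, R0; split; [auto|split; [lra|split; [auto|]]].
  intros f Hf Hf0 Hf0z s Hs.
  assert (Hf' := proj1 (holo_disc_hol_at M f) Hf).
  (* the disc would have to cross the sphere, which is too far from z *)
  assert (Hfar : forall t, 0 <= t <= 1 -> cdom M i (f (RtoC t * s)%C) ->
     cnorm (vsub (chart M i (f (RtoC t * s)%C)) (chart M i z)) <> R0).
  { intros t Ht Hd E; apply (Hsph _ Hd E).
    assert (Hts : Cmod (RtoC t * s)%C <= r).
    { rewrite Cmod_mult, Cmod_R, Rabs_pos_eq by lra.
      assert (H := Cmod_ge_0 s); nra. }
    destruct (Hloc z (f (RtoC 0)) Hz Hf0) as [l1 [A1 [A2 A3]]]; [rewrite cnorm_sub_diag; lra|lra|].
    destruct (lempert_le M (f (RtoC 0)) (f (RtoC t * s)%C) (RtoC t * s)%C f) as [l2 [B1 [B2 B3]]];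
      auto; [unfold in_disc; lra|].
    replace c with (c / 2 + c / 2) by field.
    assert (Hl1 : l1 < c / 2).
    { rewrite cnorm_sub_sym in A3.
      apply Rmult_lt_compat_l with (r := / rho0) in Hf0z; [|now apply Rinv_0_lt_compat].
      assert (/ rho0 * rho <= c / 4); [|lra].
      apply Rmult_le_reg_l with rho0; auto.
      replace (rho0 * (/ rho0 * rho)) with rho by (field; lra); auto. }
    assert (Hl2 : l2 <= c / 2).
    { assert (H0 := Cmod_ge_0 (RtoC t * s)%C).
      assert (H1 := atanh_le (Cmod (RtoC t * s)%C) ltac:(lra)).
      assert (H2 : Cmod (RtoC t * s)%C / (1 - Cmod (RtoC t * s)%C) <= 2 * Cmod (RtoC t * s)%C).
      { apply Rmult_le_reg_r with (1 - Cmod (RtoC t * s)%C); [lra|].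
        replace (Cmod (RtoC t * s)%C / (1 - Cmod (RtoC t * s)%C) * (1 - Cmod (RtoC t * s)%C)) with
          (Cmod (RtoC t * s)%C) by (field; lra); nra. }
      lra. }
    eapply Rbar_lt_le_trans;
      [apply (kob_lt_step M z (f (RtoC 0)) _ (c / 2) l2); auto;
       apply (kob_lt_lempert M z _ l1); auto|].
    simpl; lra. }
  set (good := fun t => cdom M i (f (RtoC t * s)%C) /\
    cnorm (vsub (chart M i (f (RtoC t * s)%C)) (chart M i z)) < R0).
  assert (Hdisc : forall t, 0 <= t <= 1 -> in_disc (RtoC t * s)%C).
  { intros t Ht; unfold in_disc; rewrite Cmod_mult, Cmod_R, Rabs_pos_eq by lra.
    assert (H := Cmod_ge_0 s); nra. }
  assert (Hdts : forall t t', Cmod (RtoC t' * s - RtoC t * s)%C <= Rabs (t' - t)).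
  { intros t t'; replace (RtoC t' * s - RtoC t * s)%C with (RtoC (t' - t) * s)%C
      by (rewrite RtoC_minus; ring).
    rewrite Cmod_mult, Cmod_R; assert (H := Rabs_pos (t' - t)); assert (H' := Cmod_ge_0 s); nra. }
  assert (Hopen : forall t, 0 <= t <= 1 -> good t -> exists d, 0 < d /\
     forall t', Rabs (t' - t) < d -> good t').
  { intros t Ht [G1 G2]; destruct (Hf' _ (Hdisc t Ht)) as [Hcf _].
    destruct (chart_cont_along M f _ i Hcf G1
      (R0 - cnorm (vsub (chart M i (f (RtoC t * s)%C)) (chart M i z)))) as [d [Hd H]]; [lra|].
    exists d; split; auto; intros t' Ht'.
    destruct (H (RtoC t' * s)%C) as [K1 K2]; [eapply Rle_lt_trans; [apply Hdts|auto]|].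
    split; auto; eapply Rle_lt_trans; [apply (cnorm_sub_triangle _ (chart M i (f (RtoC t * s)%C)))|];
      lra. }
  (* The difficulty is that [f] might leave the chart domain exactly at [t]. But the closed
     coordinate ball is compact: the earlier points have an accumulation point [y] in the chart, and
     the Hausdorff property together with continuity forces the value at [t] to be [y]. *)
  assert (Hclosed : forall t, 0 < t <= 1 -> (forall t', 0 <= t' < t -> good t') -> good t).
  { intros t Ht Hlt.
    set (tk := fun k : nat => t * (1 - / (INR k + 1))).
    assert (Hk : forall k, 0 < / (INR k + 1) <= 1).
    { intros k; assert (H := pos_INR k); split; [apply Rinv_0_lt_compat; lra|].
      rewrite <- Rinv_1; apply Rinv_le_contravar; lra. }
    assert (Htk : forall k, 0 <= tk k < t) by (intros k; specialize (Hk k); unfold tk; nra).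
    assert (Hgk : forall k, good (tk k)) by auto.
    destruct (bolzano_Cn n (fun k => vsub (chart M i (f (RtoC (tk k) * s)%C)) (chart M i z)) R0)
      as [phi [l [Hphi Hl]]].
    { intros k; left; apply Hgk. }
    set (v := vadd (chart M i z) l).
    assert (Hdist : forall k, cnorm (vsub (chart M i (f (RtoC (tk k) * s)%C)) v) =
       cnorm (vsub (vsub (chart M i (f (RtoC (tk k) * s)%C)) (chart M i z)) l)).
    { intros k; f_equal; apply functional_extensionality; intros j; unfold v, vsub, vadd; ring. }
    assert (Hv : cnorm (vsub v (chart M i z)) <= R0).
    { apply le_epsilon; intros e He; destruct (Hl e He) as [N HN].
      specialize (HN N (Nat.le_refl N)); rewrite <- Hdist in HN.
      assert (T := cnorm_sub_triangle v (chart M i (f (RtoC (tk (phi N)) * s)%C)) (chart M i z)).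
      rewrite (cnorm_sub_sym v (chart M i (f (RtoC (tk (phi N)) * s)%C))) in T; destruct (Hgk (phi N)); lra. }
    destruct (HB v Hv) as [y [Hy Ev]].
    assert (E : f (RtoC t * s)%C = y).
    { apply NNPP; intros Hne.
      destruct (m_hausdorff n M _ _ Hne) as [A [B [HA [HBo [HAx [HBy Hdisj]]]]]].
      destruct (Hf' _ (Hdisc t ltac:(lra))) as [Hcf _].
      destruct (Hcf A HA HAx) as [d [Hd Hd']].
      destruct (chart_ball_in M i y B Hy HBo HBy) as [q [Hq Hq']].
      destruct (Hl q Hq) as [N1 HN1].
      destruct (archimed_cor1 d Hd) as [N2 [HN2 HN2']].
      set (k := Nat.max N1 N2).
      apply (Hdisj (f (RtoC (tk (phi k)) * s)%C)); split.
      - apply Hd'; eapply Rle_lt_trans; [apply Hdts|].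
        replace (tk (phi k) - t) with (- (t * / (INR (phi k) + 1))) by (unfold tk; ring).
        destruct (Hk (phi k)) as [K1 K2].
        rewrite Rabs_Ropp, Rabs_pos_eq by nra.
        assert (/ (INR (phi k) + 1) <= / INR N2).
        { apply Rinv_le_contravar; [apply lt_0_INR; lia|].
          assert (N2 <= phi k)%nat by (specialize (Hphi k); lia).
          apply le_INR in H; lra. }
        nra.
      - apply Hq'; [apply Hgk|]; rewrite Ev, Hdist; apply HN1; lia. }
    assert (Hd : cdom M i (f (RtoC t * s)%C)) by (rewrite E; auto).
    split; auto.
    assert (Hne := Hfar t ltac:(lra) Hd).
    assert (cnorm (vsub (chart M i (f (RtoC t * s)%C)) (chart M i z)) <= R0)
      by (rewrite E, Ev; auto).
    lra. }
  assert (H0 : good 0).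
  { unfold good; replace (RtoC 0 * s)%C with (RtoC 0) by ring; split; auto; lra. }
  assert (H1 : good 1).
  { destruct (completeness (fun t => 0 <= t <= 1 /\ forall t', 0 <= t' <= t -> good t'))
      as [m [Hm1 Hm2]].
    - exists 1; intros t [Ht _]; lra.
    - exists 0; split; [lra|]; intros t' Ht'; now replace t' with 0 by lra.
    - assert (Hm : 0 <= m <= 1).
      { split.
        - apply Hm1; split; [lra|]; intros t' Ht'; now replace t' with 0 by lra.
        - apply Hm2; intros t [Ht _]; lra. }
      assert (Hlt : forall t, 0 <= t < m -> good t).
      { intros t Ht; apply NNPP; intros HN.
        assert (m <= t); [|lra]; apply Hm2; intros q [Hq1 Hq2].
        apply Rnot_lt_le; intros Hq; apply HN, Hq2; lra. }
      assert (Hgm : good m).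
      { destruct (Req_dec m 0) as [->|Hm0]; auto; apply Hclosed; auto; lra. }
      destruct (Req_dec m 1) as [<-|Hne]; auto; exfalso.
      destruct (Hopen m Hm Hgm) as [d [Hd Hd']].
      set (q := Rmin 1 (m + d / 2)).
      assert (Hq : m < q) by (unfold q; apply Rmin_case; lra).
      assert (Hq1 : q <= 1) by apply Rmin_l; assert (Hq2 : q <= m + d / 2) by apply Rmin_r.
      assert (q <= m); [|lra]; apply Hm1; split; [lra|]; intros t' Ht'.
      destruct (Rlt_le_dec t' m); [apply Hlt; lra|].
      apply Hd'; rewrite Rabs_pos_eq; lra. }
  unfold good in H1; replace (RtoC 1 * s)%C with s in H1 by ring; auto.
Qed.

(** A quotient below [k0 - eta] comes from a disc with [f 0 = w] and [f a = w']. To first order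
    [t Y] is [a] times its derivative [D], so [Z = (a / t) D] is close to [Y], and [f] shows that
    [kappa] at [(w, Z)] is at most [|a / t| <= k0 - eta / 2]. Continuity of [kappa] at [(z, v)]
    excludes this. *)
Lemma lempert_derivative_lower (i : chart_idx M) (z : M) (v : Cn n) (k0 eta : R) :
  cdom M i z -> hyperbolic_at M z -> 0 <= k0 -> 0 < eta ->
  (forall eps, 0 < eps -> exists d, 0 < d /\ forall w Y, cdom M i w ->
     cnorm (vsub (chart M i w) (chart M i z)) < d -> cnorm (vsub Y v) < d ->
     exists k, kappa M i w Y = Finite k /\ Rabs (k - k0) < eps) ->
  exists eps, 0 < eps /\ forall r, Dset M i z v eps r -> Rbar_le (Finite (k0 - eta)) r.
Proof.
  intros Hz Hyp Hk0 Heta Hcont.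
  destruct (equicontinuity i z Hz Hyp) as [rho [r [R0 [Hrho [Hr [HR0 Heq]]]]]].
  destruct (Hcont (eta / 2)) as [d [Hd Hk]]; [lra|].
  set (K := cnorm (chart M i z) + R0).
  assert (HK : 0 < K) by (assert (H := cnorm_ge_0 (chart M i z)); unfold K; lra).
  set (C2 := INR n * (36 * K / (r * r))).
  assert (HC2 : 0 <= C2).
  { apply Rmult_le_pos; [apply pos_INR|]; left; apply Rdiv_lt_0_compat; nra. }
  (* [C2] is the second-order Taylor constant in the l^1 norm. [Q] collects every factor by which
     [eps] gets multiplied below, so that [eps = m / Q] meets all smallness conditions gathered in
     [m]. *)
  set (Q := 1 + k0 + k0 * k0 + 4 * C2 * (k0 * k0)).
  assert (HC2k : 0 <= C2 * (k0 * k0)) by (apply Rmult_le_pos; nra).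
  assert (HQ : 1 <= Q) by (unfold Q; nra).
  set (m := Rmin (Rmin rho (r / 16)) (Rmin d (Rmin (/ 4) (eta / 16)))).
  assert (Hm : 0 < m) by (unfold m; repeat apply Rmin_case; lra).
  assert (M1 : m <= rho) by (eapply Rle_trans; [apply Rmin_l|apply Rmin_l]).
  assert (M2 : m <= r / 16) by (eapply Rle_trans; [apply Rmin_l|apply Rmin_r]).
  assert (M3 : m <= d) by (eapply Rle_trans; [apply Rmin_r|apply Rmin_l]).
  assert (M4 : m <= / 4) by (do 2 (eapply Rle_trans; [apply Rmin_r|]); apply Rmin_l).
  assert (M5 : m <= eta / 16) by (do 2 (eapply Rle_trans; [apply Rmin_r|]); apply Rmin_r).
  exists (m / Q); split; [apply Rdiv_lt_0_compat; lra|].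
  intros q [t [w [w' [Y [Ht [Hte [Hw [Hwz [HY [Hw' [Ew' ->]]]]]]]]]]].
  set (eps := m / Q) in *.
  assert (HepsQ : eps * Q = m) by (unfold eps; field; lra).
  assert (Heps : 0 < eps) by (apply Rdiv_lt_0_compat; lra).
  assert (E1 : eps <= m) by nra.
  assert (E2 : eps * k0 <= m) by (unfold Q in HepsQ; nra).
  assert (E3 : eps * (k0 * k0) <= m) by (unfold Q in HepsQ; nra).
  assert (E4 : eps * (1 + 4 * C2 * (k0 * k0)) <= m).
  { rewrite <- HepsQ; apply Rmult_le_compat_l; [lra|]; unfold Q; nra. }
  apply Rbar_not_lt_le; intros Hlt.
  assert (Ht0 : 0 < Cmod t) by now apply Cmod_gt_0.
  assert (Hit : 0 < / Cmod t) by now apply Rinv_0_lt_compat.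
  assert (Hnn := lempert_nonneg M w w').
  destruct (lempert M w w') as [l| |] eqn:El.
  2:{ simpl in Hlt; destruct (Rle_dec 0 (/ Cmod t)) as [h|h]; [|lra].
      destruct (Rle_lt_or_eq_dec 0 (/ Cmod t) h); simpl in Hlt; [tauto|lra]. }
  2:{ simpl in Hnn; tauto. }
  simpl in Hlt, Hnn.
  set (kp := k0 - eta) in *.
  assert (Hl : l < kp * Cmod t).
  { apply Rmult_lt_compat_r with (r := Cmod t) in Hlt; auto.
    replace (l * / Cmod t * Cmod t) with l in Hlt by (field; lra); auto. }
  (* The Lempert function is nonnegative, so no quotient lies below [kp] unless [kp] is positive. *)
  assert (Hkp : 0 < kp) by nra.
  assert (Hkpk0 : kp <= k0) by (unfold kp; lra).
  set (e := kp * Cmod t) in *.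
  assert (He : 0 < e) by (unfold e; nra).
  assert (He1 : e <= eps * k0).
  { unfold e; rewrite Rmult_comm; apply Rmult_le_compat; lra. }
  destruct (lempert_lt_disc M w w' e) as [a [f [Ha [Hf [Hf0 [Hfa Hae]]]]]];
    [lra|rewrite El; exact Hl|].
  assert (Ha2 : Cmod a <= 2 * e).
  { left; eapply Rlt_le_trans; [apply Hae|].
    apply Rmult_le_reg_r with (1 - e); [lra|].
    replace (e / (1 - e) * (1 - e)) with e by (field; lra); nra. }
  assert (Hat : Cmod a / Cmod t <= k0 - eta / 2).
  { apply Rmult_le_reg_r with (Cmod t); auto.
    replace (Cmod a / Cmod t * Cmod t) with (Cmod a) by (field; lra).
    left; eapply Rlt_le_trans; [apply Hae|].
    apply Rmult_le_reg_r with (1 - e); [lra|].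
    replace (e / (1 - e) * (1 - e)) with e by (field; lra).
    unfold e at 1; rewrite (Rmult_comm _ (Cmod t)), (Rmult_comm (k0 - eta / 2)), Rmult_assoc.
    apply Rmult_le_compat_l; [lra|].
    assert (k0 * e <= eta / 16); [|unfold kp; nra].
    apply Rle_trans with (k0 * (eps * k0)); [apply Rmult_le_compat_l; lra|].
    replace (k0 * (eps * k0)) with (eps * (k0 * k0)) by ring; lra. }
  assert (Hf' := proj1 (holo_disc_hol_at M f) Hf).
  assert (Heq' : forall s, Cmod s < r -> cdom M i (f s) /\
        cnorm (vsub (chart M i (f s)) (chart M i z)) < R0).
  { apply Heq; rewrite ?Hf0; auto; lra. }
  assert (Hd0 : forall k, exists D, rdiff (fun u => chart M i (f u) k) 0 D 0).
  { intros k; apply (proj2 (Hf' (RtoC 0) ltac:(unfold in_disc; rewrite Cmod_0; lra))).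
    rewrite Hf0; auto. }
  set (D := fun k => proj1_sig (constructive_indefinite_description _ (Hd0 k))).
  assert (HD : forall k, rdiff (fun u => chart M i (f u) k) 0 (D k) 0).
  { intros k; exact (proj2_sig (constructive_indefinite_description _ (Hd0 k))). }
  assert (Hcau : forall k, Cmod (chart M i w' k - chart M i w k - a * D k)%C <=
     36 * K / (r * r) * (Cmod a * Cmod a)).
  { intros k.
    destruct (cauchy_estimate (fun u => chart M i (f u) k) 0 (D k) r K) as [_ H]; auto; try lra.
    - intros s Hs; replace (s - 0)%C with s in Hs by ring.
      apply (proj2 (Hf' s ltac:(unfold in_disc; lra))); now apply Heq'.
    - intros s Hs; replace (s - 0)%C with s in Hs by ring.
      destruct (Heq' s Hs) as [_ Hb]; unfold K.
      eapply Rle_trans; [apply (Cmod_le_add _ (chart M i z k))|].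
      assert (G1 := cnorm_comp (chart M i z) k).
      assert (G2 := cnorm_comp (vsub (chart M i (f s)) (chart M i z)) k); unfold vsub in G2, Hb; lra.
    - specialize (H a ltac:(lra)); rewrite Cplus_0_l, Hf0, Hfa in H.
      eapply Rle_trans; [apply H|]; right; field; lra. }
  (* The tangent vector for which [f] is an exact competitor; its distance to [Y] is of order
     [|a|^2 / |t|], hence of order [|t|]. *)
  set (Z := vscale (a / t)%C D).
  assert (HZY : cnorm (vsub Z Y) <= 4 * C2 * (k0 * k0) * eps).
  { assert (G : forall k, Cmod (vsub Z Y k) <= / Cmod t * (36 * K / (r * r) * (Cmod a * Cmod a))).
    { intros k; unfold vsub, Z, vscale.
      replace (a / t * D k - Y k)%C with (- (/ t * (t * Y k - a * D k)))%C by (field; auto).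
      rewrite Cmod_opp, Cmod_mult, Cmod_inv by auto; apply Rmult_le_compat_l; [lra|].
      eapply Rle_trans; [|apply (Hcau k)]; rewrite Ew'; right; f_equal; unfold vadd, vscale; ring. }
    eapply Rle_trans; [apply (cnorm_le_const _ _ G)|].
    replace (INR n * (/ Cmod t * (36 * K / (r * r) * (Cmod a * Cmod a)))) with
      (C2 * (Cmod a * Cmod a / Cmod t)) by (unfold C2; field; lra).
    replace (4 * C2 * (k0 * k0) * eps) with (C2 * (4 * (k0 * k0) * eps)) by ring.
    apply Rmult_le_compat_l; auto.
    apply Rmult_le_reg_r with (Cmod t); auto.
    replace (Cmod a * Cmod a / Cmod t * Cmod t) with (Cmod a * Cmod a) by (field; lra).
    assert (Ha0 := Cmod_ge_0 a).
    apply Rle_trans with ((2 * e) * (2 * e)); [apply Rmult_le_compat; auto|].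
    assert (He2 : e <= k0 * Cmod t) by (unfold e; apply Rmult_le_compat_r; lra).
    apply Rle_trans with ((2 * (k0 * Cmod t)) * (2 * (k0 * Cmod t)));
      [apply Rmult_le_compat; lra|].
    replace (2 * (k0 * Cmod t) * (2 * (k0 * Cmod t))) with
      (4 * (k0 * k0) * Cmod t * Cmod t) by ring.
    apply Rmult_le_compat_r; [lra|]; apply Rmult_le_compat_l; nra. }
  destruct (Hk w Z Hw) as [k [Ek Hkk]]; [lra| |].
  { eapply Rle_lt_trans; [apply (cnorm_sub_triangle Z Y v)|].
    assert (eps * (1 + 4 * C2 * (k0 * k0)) = eps + 4 * C2 * (k0 * k0) * eps) by ring; lra. }
  assert (Hle : Rbar_le (kappa M i w Z) (Finite (Cmod (a / t)%C))).
  { apply glb_le; exists (a / t)%C, f, D; split; [auto|split; [auto|split; [|split; reflexivity]]].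
    intros l'; apply is_derive_rdiff; auto. }
  rewrite Ek, Cmod_div in Hle by auto; simpl in Hle.
  apply Rabs_lt_between in Hkk; lra.
Qed.

End Lower.

(** * Lattice sums *)

Fixpoint rsum (N : nat) (f : nat -> R) : R :=
  match N with O => 0 | S m => rsum m f + f m end.

Fixpoint zsum (N : nat) (f : nat -> C) : C :=
  match N with O => RtoC 0 | S m => (zsum m f + f m)%C end.

Lemma rsum_le (N : nat) (f g : nat -> R) : (forall k, f k <= g k) -> rsum N f <= rsum N g.
Proof. intros H; induction N; simpl; [lra|]; apply Rplus_le_compat; auto. Qed.

Lemma rsum_ext (N : nat) (f g : nat -> R) : (forall k, f k = g k) -> rsum N f = rsum N g.
Proof. intros H; induction N; simpl; [auto|]; rewrite IHN, H; auto. Qed.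

Lemma rsum_scal (N : nat) (c : R) (f : nat -> R) : rsum N (fun k => c * f k) = c * rsum N f.
Proof. induction N; simpl; [ring|]; rewrite IHN; ring. Qed.

Lemma rsum_plus (N : nat) (f g : nat -> R) : rsum N (fun k => f k + g k) = rsum N f + rsum N g.
Proof. induction N; simpl; [ring|]; rewrite IHN; ring. Qed.

Lemma rsum_const (N : nat) (c : R) : rsum N (fun _ => c) = INR N * c.
Proof. induction N; [simpl; ring|]; rewrite S_INR; simpl rsum; rewrite IHN; ring. Qed.

Lemma rsum_nonneg (N : nat) (f : nat -> R) : (forall k, 0 <= f k) -> 0 <= rsum N f.
Proof. intros H; induction N; simpl; [lra|]; apply Rplus_le_le_0_compat; auto. Qed.

Lemma rsum_prod (N : nat) (f g : nat -> R) :
  rsum N (fun k => rsum N (fun l => f k * g l)) = rsum N f * rsum N g.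
Proof.
  rewrite (rsum_ext N _ (fun k => rsum N g * f k)).
  - rewrite rsum_scal; ring.
  - intros k; rewrite rsum_scal; ring.
Qed.

Lemma Rabs_rsum_le (N : nat) (f : nat -> R) : Rabs (rsum N f) <= rsum N (fun k => Rabs (f k)).
Proof.
  induction N; simpl; [rewrite Rabs_R0; lra|].
  eapply Rle_trans; [apply Rabs_triang|]; apply Rplus_le_compat_r; auto.
Qed.

Lemma rsum_minus (N : nat) (f g : nat -> R) : rsum N (fun k => f k - g k) = rsum N f - rsum N g.
Proof. induction N; simpl; [ring|]; rewrite IHN; ring. Qed.

Lemma Cmod_zsum_le (N : nat) (f : nat -> C) : Cmod (zsum N f) <= rsum N (fun k => Cmod (f k)).
Proof.
  induction N; simpl; [rewrite Cmod_0; lra|].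
  eapply Rle_trans; [apply Cmod_triangle|]; apply Rplus_le_compat_r; auto.
Qed.

Lemma zsum_scal (N : nat) (c : C) (f : nat -> C) : zsum N (fun k => c * f k)%C = (c * zsum N f)%C.
Proof. induction N; simpl; [ring|]; rewrite IHN; ring. Qed.

Lemma zsum_plus (N : nat) (f g : nat -> C) :
  zsum N (fun k => f k + g k)%C = (zsum N f + zsum N g)%C.
Proof. induction N; simpl; [ring|]; rewrite IHN; ring. Qed.

Lemma zsum_ext (N : nat) (f g : nat -> C) : (forall k, f k = g k) -> zsum N f = zsum N g.
Proof. intros H; induction N; simpl; [auto|]; rewrite IHN, H; auto. Qed.

Lemma zsum_RtoC (N : nat) (f : nat -> R) : zsum N (fun k => RtoC (f k)) = RtoC (rsum N f).
Proof. induction N; simpl; [auto|]; rewrite IHN, RtoC_plus; auto. Qed.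

Lemma rdiff_zsum (N : nat) (u : nat -> C -> C) (z : C) (A B : nat -> C) :
  (forall k, rdiff (u k) z (A k) (B k)) -> rdiff (fun x => zsum N (fun k => u k x)) z (zsum N A) (zsum N B).
Proof.
  intros H; induction N; simpl; [apply rdiff_const|]; apply rdiff_plus; auto.
Qed.

Lemma cont_at_zsum (N : nat) (u : nat -> C -> C) (z : C) :
  (forall k, cont_at (u k) z) -> cont_at (fun x => zsum N (fun k => u k x)) z.
Proof.
  intros H; induction N; simpl.
  - intros e He; exists 1; split; [lra|]; intros y _.
    replace (RtoC 0 - RtoC 0)%C with (RtoC 0) by ring; now rewrite Cmod_0.
  - apply cont_at_plus; auto.
Qed.

(** Riemann sums are compared with a primitive [G] through its central increments, which avoids
    integrals. The increments overlap twice, hence four boundary terms. *)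
Lemma telescope (G : R -> R) (t d : R) (N : nat) :
  rsum N (fun k => G (t - INR k * d + d) - G (t - INR k * d - d)) =
  G (t + d) + G t - G (t - INR N * d) - G (t - INR N * d + d).
Proof.
  induction N as [|N IH]; simpl rsum.
  - simpl; replace (t - 0 * d) with t by ring; replace (t - 0 * d + d) with (t + d) by ring; ring.
  - rewrite IH, S_INR.
    replace (t - (INR N + 1) * d) with (t - INR N * d - d) by ring.
    replace (t - INR N * d - d + d) with (t - INR N * d) by ring; ring.
Qed.

(** A primitive of the indicator of [[-m, m]]. It is bounded, so the telescoped sums have bounds
    independent of the number of lattice points. *)
Definition clamp (m t : R) : R := Rmax (- m) (Rmin m t).

Lemma clamp_bounds (m t : R) : 0 <= m -> - m <= clamp m t <= m.
Proof.
  intros Hm; unfold clamp; split; [apply Rmax_l|]; apply Rmax_lub; [lra|apply Rmin_l].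
Qed.

Lemma clamp_mono (m s t : R) : s <= t -> clamp m s <= clamp m t.
Proof. intros H; unfold clamp; apply Rle_max_compat_l, Rle_min_compat_l, H. Qed.

Lemma clamp_id (m t : R) : - m <= t <= m -> clamp m t = t.
Proof. intros H; unfold clamp; rewrite Rmin_right, Rmax_right; lra. Qed.

Lemma clamp_hi (m t : R) : 0 <= m -> m <= t -> clamp m t = m.
Proof. intros H H'; unfold clamp; rewrite Rmin_left, Rmax_right; lra. Qed.

Lemma clamp_lo (m t : R) : 0 <= m -> t <= - m -> clamp m t = - m.
Proof. intros H H'; unfold clamp; rewrite Rmin_right, Rmax_left; lra. Qed.

Definition ind (e t : R) : R := if Rlt_dec (Rabs t) e then 1 else 0.

Lemma ind_nonneg (e t : R) : 0 <= ind e t.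
Proof. unfold ind; destruct (Rlt_dec _ _); lra. Qed.

Lemma count_upper (t d eta : R) (N : nat) : 0 < d <= eta ->
  rsum N (fun k => ind eta (t - INR k * d)) <= 8 * eta / d.
Proof.
  intros Hd.
  apply Rmult_le_reg_l with d; [lra|]; rewrite <- rsum_scal.
  replace (d * (8 * eta / d)) with (8 * eta) by (field; lra).
  eapply Rle_trans; [apply (rsum_le N _
    (fun k => clamp (2 * eta) (t - INR k * d + d) - clamp (2 * eta) (t - INR k * d - d)))|].
  - intros k; unfold ind; destruct (Rlt_dec _ _) as [H|H].
    + apply Rabs_lt_between in H; rewrite !clamp_id by lra; lra.
    + assert (H1 := clamp_mono (2 * eta) (t - INR k * d - d) (t - INR k * d + d)); lra.
  - rewrite telescope.
    assert (B := fun x => clamp_bounds (2 * eta) x ltac:(lra)).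
    assert (B1 := B (t + d)); assert (B2 := B t); assert (B3 := B (t - INR N * d));
      assert (B4 := B (t - INR N * d + d)); lra.
Qed.

(** With [m = eta / 2 - d] the central increment of [clamp m] vanishes wherever the indicator does.
    The conditions on [t] and [N] place both ends of the lattice beyond the clamped range, so the
    total is [4 * m], at least [eta]. *)
Lemma count_lower (t d eta : R) (N : nat) : 0 < d -> 4 * d <= eta -> eta <= 1 -> 1 <= t ->
  t + 1 <= INR N * d -> eta / (2 * d) <= rsum N (fun k => ind (eta / 2) (t - INR k * d)).
Proof.
  intros Hd Hde He Ht HN.
  set (m := eta / 2 - d).
  apply Rmult_le_reg_l with (2 * d); [lra|]; rewrite <- rsum_scal.
  replace (2 * d * (eta / (2 * d))) with eta by (field; lra).
  apply Rle_trans with (rsum N (fun k => clamp m (t - INR k * d + d) - clamp m (t - INR k * d - d))).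
  - rewrite telescope, !(clamp_hi m) by (unfold m; lra).
    rewrite !(clamp_lo m) by (unfold m; lra); unfold m; lra.
  - apply rsum_le; intros k; unfold ind; destruct (Rlt_dec _ _) as [H|H].
    + unfold clamp, m; unfold Rmax, Rmin; repeat destruct (Rle_dec _ _); lra.
    + apply Rnot_lt_le in H.
      destruct (Rle_lt_dec 0 (t - INR k * d)) as [H0|H0].
      * rewrite Rabs_pos_eq in H by auto; rewrite !(clamp_hi m) by (unfold m; lra); lra.
      * rewrite Rabs_left in H by auto; rewrite !(clamp_lo m) by (unfold m; lra); lra.
Qed.

(** The kernel [1 / |x + i y|], cut off at scale [eta], is at most the product of [isq] in [x] and
    in [y], because [max(|x|,|y|)] is at least the geometric mean. A planar singular sum thus
    becomes a product of two sums on the line. *)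
Definition isq (kap eta t : R) : R :=
  if Rlt_dec (Rabs t) kap then / sqrt (Rmax (Rabs t) eta) else 0.

(** The odd primitive of [1 / sqrt |t|]. *)
Definition osqrt (t : R) : R := if Rle_dec 0 t then 2 * sqrt t else - (2 * sqrt (- t)).

Lemma osqrt_mono (s t : R) : s <= t -> osqrt s <= osqrt t.
Proof.
  intros H; unfold osqrt; destruct (Rle_dec 0 s); destruct (Rle_dec 0 t); try lra.
  - apply Rmult_le_compat_l; [lra|]; apply sqrt_le_1; lra.
  - assert (H1 := sqrt_pos (- s)); assert (H2 := sqrt_pos t); lra.
  - assert (sqrt (- t) <= sqrt (- s)) by (apply sqrt_le_1; lra); lra.
Qed.

Lemma osqrt_opp (t : R) : osqrt (- t) = - osqrt t.
Proof.
  unfold osqrt; destruct (Rle_dec 0 (- t)); destruct (Rle_dec 0 t); try lra.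
  - replace t with 0 by lra; rewrite Ropp_0, sqrt_0; ring.
  - now rewrite Ropp_involutive.
Qed.

(** Away from 0 this is concavity, [sqrt (t + d) + sqrt (t - d) <= 2 * sqrt t]. For [0 <= t < d] the
    increment across 0 is at least [sqrt d], and the truncation at [eta >= d] keeps the left side
    below that. *)
Lemma isq_increment (kap eta d t : R) : 0 < d <= eta ->
  d * isq kap eta t <= osqrt (t + d) - osqrt (t - d).
Proof.
  intros Hd.
  assert (P : forall t, 0 <= t -> d * / sqrt (Rmax t eta) <= osqrt (t + d) - osqrt (t - d)).
  { clear t; intros t Ht.
    assert (Hm : 0 < Rmax t eta) by (apply Rlt_le_trans with eta; [lra|apply Rmax_r]).
    assert (Hs := sqrt_lt_R0 _ Hm).
    unfold osqrt; destruct (Rle_dec 0 (t + d)) as [_|]; [|lra].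
    destruct (Rle_dec 0 (t - d)) as [H|H].
    - assert (Ht0 : 0 < t) by lra; assert (Hst := sqrt_lt_R0 _ Ht0).
      apply Rle_trans with (d * / sqrt t).
      { apply Rmult_le_compat_l; [lra|]; apply Rinv_le_contravar; auto.
        apply sqrt_le_1; [lra|lra|apply Rmax_l]. }
      assert (A1 := sqrt_sqrt (t + d) ltac:(lra)); assert (A2 := sqrt_sqrt (t - d) ltac:(lra)).
      assert (A3 := sqrt_sqrt t ltac:(lra)).
      assert (A4 := sqrt_pos (t + d)); assert (A5 := sqrt_pos (t - d)).
      set (p := sqrt (t + d)) in *; set (q := sqrt (t - d)) in *; set (s := sqrt t) in *.
      assert (Hpq : p + q <= 2 * s).
      { apply Rsqr_incr_0_var; [|lra]; unfold Rsqr; nra. }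
      assert (Hp : 0 < p) by (apply sqrt_lt_R0; lra).
      apply Rmult_le_reg_r with s; auto.
      replace (d * / s * s) with d by (field; lra).
      assert (E : 2 * d = (p - q) * (p + q)) by nra.
      assert (q <= p) by (apply sqrt_le_1; lra).
      assert ((p - q) * (p + q) <= (p - q) * (2 * s)) by (apply Rmult_le_compat_l; lra); nra.
    - apply Rle_trans with (sqrt d).
      { assert (Hsd := sqrt_lt_R0 d ltac:(lra)).
        apply Rmult_le_reg_r with (sqrt (Rmax t eta)); auto.
        replace (d * / sqrt (Rmax t eta) * sqrt (Rmax t eta)) with d by (field; lra).
        rewrite <- (sqrt_sqrt d) at 1 by lra; apply Rmult_le_compat_l; [lra|].
        apply sqrt_le_1; [lra|lra|]; apply Rle_trans with eta; [lra|apply Rmax_r]. }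
      assert (sqrt d <= sqrt (t + d)) by (apply sqrt_le_1; lra).
      assert (H1 := sqrt_pos (- (t - d))); assert (H2 := sqrt_pos d); lra. }
  unfold isq; destruct (Rlt_dec (Rabs t) kap) as [H|H].
  - destruct (Rle_lt_dec 0 t) as [Ht|Ht].
    + rewrite Rabs_pos_eq by auto; auto.
    + rewrite Rabs_left by auto; specialize (P (- t) ltac:(lra)).
      replace (- t + d) with (- (t - d)) in P by ring.
      replace (- t - d) with (- (t + d)) in P by ring.
      rewrite !osqrt_opp in P; lra.
  - rewrite Rmult_0_r; assert (H1 := osqrt_mono (t - d) (t + d)); lra.
Qed.

Lemma osqrt_bound (m t : R) : Rabs t <= m -> - (2 * sqrt m) <= osqrt t <= 2 * sqrt m.
Proof.
  intros H; apply Rabs_le_between in H; unfold osqrt; destruct (Rle_dec 0 t).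
  - assert (sqrt t <= sqrt m) by (apply sqrt_le_1; lra); assert (H1 := sqrt_pos t); lra.
  - assert (sqrt (- t) <= sqrt m) by (apply sqrt_le_1; lra); assert (H1 := sqrt_pos (- t)); lra.
Qed.

Lemma isq_sum (t d eta kap : R) (N : nat) : 0 < d <= eta -> eta <= kap ->
  rsum N (fun k => isq kap eta (t - INR k * d)) <= 8 * sqrt (2 * kap) / d.
Proof.
  intros Hd Hk.
  apply Rmult_le_reg_l with d; [lra|]; rewrite <- rsum_scal.
  replace (d * (8 * sqrt (2 * kap) / d)) with (8 * sqrt (2 * kap)) by (field; lra).
  set (G := fun t => osqrt (clamp (2 * kap) t)).
  eapply Rle_trans; [apply (rsum_le N _
    (fun k => G (t - INR k * d + d) - G (t - INR k * d - d)))|].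
  - intros k; unfold G.
    destruct (Rlt_dec (Rabs (t - INR k * d)) kap) as [H|H].
    + assert (H' := H); apply Rabs_lt_between in H'; rewrite !clamp_id by lra.
      now apply isq_increment.
    + unfold isq; destruct (Rlt_dec _ _); [tauto|]; rewrite Rmult_0_r.
      assert (H1 := osqrt_mono _ _ (clamp_mono (2 * kap) (t - INR k * d - d) (t - INR k * d + d)
        ltac:(lra))); lra.
  - rewrite telescope.
    assert (B : forall x, - (2 * sqrt (2 * kap)) <= G x <= 2 * sqrt (2 * kap)).
    { intros x; apply osqrt_bound, Rabs_le; apply clamp_bounds; lra. }
    assert (B1 := B (t + d)); assert (B2 := B t); assert (B3 := B (t - INR N * d));
      assert (B4 := B (t - INR N * d + d)); lra.
Qed.

Lemma rsum_shift (phi : R -> R) (t d : R) (N : nat) :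
  phi (t + d) = 0 -> phi (t + d - INR N * d) = 0 ->
  rsum N (fun k => phi (t + d - INR k * d)) = rsum N (fun k => phi (t - INR k * d)).
Proof.
  intros H0 HN.
  assert (G : forall m, rsum m (fun k => phi (t + d - INR k * d)) + phi (t + d - INR m * d) =
     phi (t + d) + rsum m (fun k => phi (t - INR k * d))).
  { induction m as [|m IH]; simpl rsum.
    - simpl; replace (t + d - 0 * d) with (t + d) by ring; ring.
    - rewrite IH, S_INR; replace (t + d - (INR m + 1) * d) with (t - INR m * d) by ring; ring. }
  specialize (G N); lra.
Qed.

(** * An explicit kernel for the conjugate derivative *)

Definition nrm2 (z : C) : R := fst z * fst z + snd z * snd z.

Lemma nrm2_nonneg (z : C) : 0 <= nrm2 z.
Proof. unfold nrm2; nra. Qed.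

Lemma nrm2_Cmod (z : C) : nrm2 z = Cmod z * Cmod z.
Proof.
  unfold Cmod; rewrite sqrt_sqrt; unfold nrm2; [ring|]; nra.
Qed.

Lemma nrm2_conj (z : C) : RtoC (nrm2 z) = (z * Cconj z)%C.
Proof. apply injective_projections; unfold nrm2; simpl; ring. Qed.

Lemma rdiff_nrm2 (z : C) : rdiff (fun x => RtoC (nrm2 x)) z (Cconj z) z.
Proof.
  apply rdiff_ext with (fun x => x * Cconj x)%C; [intros; now rewrite nrm2_conj|].
  eapply rdiff_eq; [| |apply rdiff_mult; [apply rdiff_id|apply rdiff_conj]]; cbv beta; ring.
Qed.

(** The two branches meet at 1 with equal value and slope. Hence [conj z] times [kmod (|z|^2)],
    which is [1/z] outside the unit disc, is a Cauchy kernel with its pole smoothed out. *)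
Definition kmod (s : R) : R := if Rle_dec s 1 then 2 - s else / s.
Definition kmod' (s : R) : R := if Rle_dec s 1 then - 1 else - / (s * s).

Lemma is_derive_kmod (s : R) : is_derive kmod s (kmod' s).
Proof.
  unfold kmod'; destruct (Rle_dec s 1) as [H|H].
  - destruct (Req_dec s 1) as [E|E].
    + subst s; apply is_derive_Reals; intros eps He.
      exists (mkposreal eps He); simpl; intros h Hh Hhe.
      unfold kmod; destruct (Rle_dec 1 1) as [_|]; [|lra].
      destruct (Rle_dec (1 + h) 1) as [Hle|Hle].
      * replace ((2 - (1 + h) - (2 - 1)) / h - - 1) with 0 by (field; auto); rewrite Rabs_R0; auto.
      * assert (Hp : 0 < h) by lra; rewrite Rabs_pos_eq in Hhe by lra.
        replace ((/ (1 + h) - (2 - 1)) / h - - 1) with (h / (1 + h)) by (field; lra).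
        rewrite Rabs_pos_eq.
        -- apply Rle_lt_trans with h; auto.
           apply Rmult_le_reg_r with (1 + h); [lra|].
           replace (h / (1 + h) * (1 + h)) with h by (field; lra); nra.
        -- left; apply Rdiv_lt_0_compat; lra.
    + apply is_derive_ext_loc with (fun s => 2 - s).
      * exists (mkposreal (1 - s) ltac:(lra)); intros y Hy.
        apply Rabs_lt_between in Hy; simpl in Hy; unfold minus, plus, opp in Hy; simpl in Hy.
        unfold kmod; destruct (Rle_dec y 1); lra.
      * auto_derive; auto; ring.
  - apply is_derive_ext_loc with (fun s => / s).
    + exists (mkposreal (s - 1) ltac:(lra)); intros y Hy.
      apply Rabs_lt_between in Hy; simpl in Hy; unfold minus, plus, opp in Hy; simpl in Hy.
      unfold kmod; destruct (Rle_dec y 1); lra.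
    + auto_derive; [lra|]; field; lra.
Qed.

Definition bump (z : C) : R := 2 * Rmax (1 - nrm2 z) 0.
Definition bker (z : C) : C := (Cconj z * RtoC (kmod (nrm2 z)))%C.

(** Outside the unit disc [1/z] is holomorphic; inside, the conjugate derivative of
    [conj z (2 - |z|^2)] is [2 - 2|z|^2]. So [bump] is the point mass of the Cauchy kernel spread
    over the disc. *)
Lemma rdiff_bker (z : C) : exists A, rdiff bker z A (RtoC (bump z)).
Proof.
  assert (H := rdiff_mult _ _ _ _ _ _ _ (rdiff_conj z)
    (rdiff_real_comp kmod nrm2 z _ _ _ (is_derive_kmod (nrm2 z)) (rdiff_nrm2 z))).
  eexists; eapply rdiff_eq; [reflexivity| |exact H].
  cbv beta.
  replace (1 * RtoC (kmod (nrm2 z)) + Cconj z * (RtoC (kmod' (nrm2 z)) * z))%C with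
    (RtoC (kmod (nrm2 z)) + RtoC (kmod' (nrm2 z)) * (z * Cconj z))%C by ring.
  rewrite <- nrm2_conj, <- RtoC_mult, <- RtoC_plus; f_equal.
  unfold bump, kmod, kmod'; set (s := nrm2 z); destruct (Rle_dec s 1) as [h|h].
  - rewrite Rmax_left by lra; ring.
  - rewrite Rmax_right by lra; field; lra.
Qed.

Lemma bker_bound (z : C) : Cmod (bker z) * Rmax (Cmod z) 1 <= 2.
Proof.
  unfold bker; rewrite Cmod_mult, Cmod_conj, Cmod_R, nrm2_Cmod.
  assert (Hz := Cmod_ge_0 z); set (s := Cmod z) in *; unfold kmod.
  destruct (Rle_dec (s * s) 1) as [H|H].
  - assert (s <= 1) by nra; rewrite Rmax_right by lra; rewrite Rabs_pos_eq by lra; nra.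
  - assert (1 < s) by nra; rewrite Rmax_left by lra.
    rewrite Rabs_pos_eq by (left; apply Rinv_0_lt_compat; nra).
    replace (s * / (s * s) * s) with 1 by (field; lra); lra.
Qed.

Lemma bump_bounds (z : C) : 0 <= bump z <= 2.
Proof.
  unfold bump; assert (H := nrm2_nonneg z); assert (H1 := Rmax_r (1 - nrm2 z) 0).
  assert (Rmax (1 - nrm2 z) 0 <= 1) by (apply Rmax_lub; lra); lra.
Qed.

Lemma bump_0 (z : C) : 1 <= Cmod z -> bump z = 0.
Proof.
  intros H; unfold bump; rewrite nrm2_Cmod, Rmax_right by nra; ring.
Qed.

Lemma bump_lip (z z' : C) :
  Rabs (bump z - bump z') <= 2 * (Cmod (z - z')%C * (Cmod z + Cmod z')).
Proof.
  assert (E : Rabs (nrm2 z - nrm2 z') <= Cmod (z - z')%C * (Cmod z + Cmod z')).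
  { rewrite !nrm2_Cmod.
    replace (Cmod z * Cmod z - Cmod z' * Cmod z') with
      ((Cmod z - Cmod z') * (Cmod z + Cmod z')) by ring.
    assert (H1 := Cmod_ge_0 z); assert (H2 := Cmod_ge_0 z').
    rewrite Rabs_mult, (Rabs_pos_eq (Cmod z + _)) by lra.
    apply Rmult_le_compat_r; [lra|]; apply Rabs_le.
    assert (H3 := Cmod_le_add z z'); assert (H4 := Cmod_le_add z' z).
    rewrite (Cmod_minus_sym z' z) in H4; lra. }
  unfold bump; apply Rabs_le_between in E; apply Rabs_le.
  unfold Rmax; repeat destruct (Rle_dec _ _); lra.
Qed.

Lemma rdiff_comp_affine (u : C -> C) (a : R) (c z A B : C) :
  rdiff u (RtoC a * (z - c))%C A B ->
  rdiff (fun x => u (RtoC a * (x - c)))%C z (RtoC a * A) (RtoC a * B).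
Proof.
  intros H.
  destruct (Req_dec a 0) as [E|E].
  { subst a; eapply rdiff_ext; [|eapply rdiff_eq; [| |apply (rdiff_const (u 0))]]; try ring.
    intros x; cbv beta; f_equal; ring. }
  assert (Ha : 0 < Rabs a) by now apply Rabs_pos_lt.
  intros eps He; destruct (H (eps / Rabs a)) as [d [Hd Hh]]; [now apply Rdiv_lt_0_compat|].
  exists (d / Rabs a); split; [now apply Rdiv_lt_0_compat|]; intros h Hh'.
  apply Rmult_lt_compat_l with (r := Rabs a) in Hh'; auto.
  replace (Rabs a * (d / Rabs a)) with d in Hh' by (field; lra).
  rewrite <- Cmod_R, <- Cmod_mult in Hh'; specialize (Hh _ Hh').
  replace (RtoC a * (z - c) + RtoC a * h)%C with (RtoC a * (z + h - c))%C in Hh by ring.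
  assert (Ec : Cconj (RtoC a * h)%C = (RtoC a * Cconj h)%C).
  { apply injective_projections; simpl; ring. }
  rewrite Ec in Hh.
  replace (RtoC a * A * h + RtoC a * B * Cconj h)%C with
    (A * (RtoC a * h) + B * (RtoC a * Cconj h))%C by ring.
  eapply Rle_trans; [apply Hh|]; rewrite Cmod_mult, Cmod_R; right; field; lra.
Qed.

Lemma rdiff_hol_pow (u : C -> C) (z A : C) (m : nat) : rdiff u z A 0 ->
  exists D, rdiff (fun x => Cpow (u x) m) z D 0.
Proof.
  intros H; induction m as [|m [D HD]]; simpl.
  - exists 0; apply rdiff_const.
  - eexists; eapply rdiff_eq; [reflexivity| |apply (rdiff_mult _ _ _ _ _ _ _ H HD)]; ring.
Qed.

Lemma Cpow_near_1 (x : C) (m : nat) : Cmod x <= 1 ->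
  Cmod (Cpow (1 + x)%C m - 1)%C <= INR m * 2 ^ m * Cmod x.
Proof.
  intros Hx; induction m as [|m IH].
  - simpl; replace (1 - 1)%C with (RtoC 0) by ring; rewrite Cmod_0; lra.
  - replace (Cpow (1 + x)%C (S m) - 1)%C with
      (Cpow (1 + x) m - 1 + x * Cpow (1 + x) m)%C by (simpl; ring).
    eapply Rle_trans; [apply Cmod_triangle|].
    rewrite Cmod_mult, Cmod_pow, S_INR.
    assert (H1 : Cmod (1 + x)%C ^ m <= 2 ^ m).
    { apply pow_incr; split; [apply Cmod_ge_0|].
      eapply Rle_trans; [apply Cmod_triangle|]; rewrite Cmod_1; lra. }
    assert (H2 := Cmod_ge_0 x); assert (H3 := pos_INR m).
    assert (H4 : 0 < 2 ^ m) by (apply pow_lt; lra).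
    assert (H5 : Cmod x * Cmod (1 + x)%C ^ m <= 2 ^ m * Cmod x) by nra.
    assert (H6 : 0 <= INR m * 2 ^ m * Cmod x) by (repeat apply Rmult_le_pos; lra).
    simpl pow; nra.
Qed.

(** * The conjugate-derivative equation in a weighted norm *)

Definition wt (L : nat) (z : C) : R := (/ (1 + nrm2 z)) ^ L.

(** The peak function at [c] for the weight [wt L]: holomorphic in [z] and equal to 1 at [z = c].
    The exponent is [2 * L] because Cauchy-Schwarz bounds the square of [|1 + conj(c) z|] by
    [(1 + |c|^2)(1 + |z|^2)]. *)
Definition kern (L : nat) (c z : C) : C :=
  Cpow ((1 + Cconj c * z) / RtoC (1 + nrm2 c))%C (2 * L).

Lemma wt_pos (L : nat) (z : C) : 0 < wt L z.
Proof. apply pow_lt, Rinv_0_lt_compat; assert (H := nrm2_nonneg z); lra. Qed.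

Lemma wt_le_1 (L : nat) (z : C) : wt L z <= 1.
Proof.
  assert (H := nrm2_nonneg z); rewrite <- (pow1 L); apply pow_incr; split.
  - left; apply Rinv_0_lt_compat; lra.
  - rewrite <- Rinv_1; apply Rinv_le_contravar; lra.
Qed.

Lemma wt_lower (L : nat) (z : C) : Cmod z <= 1 -> (/ 2) ^ L <= wt L z.
Proof.
  intros Hz; assert (H := Cmod_ge_0 z); assert (H' := nrm2_nonneg z); apply pow_incr; split; [lra|].
  apply Rinv_le_contravar; [lra|]; rewrite nrm2_Cmod in *; nra.
Qed.

Lemma RtoC_neq_0 (x : R) : x <> 0 -> RtoC x <> 0.
Proof. intros H E; apply RtoC_inj in E; auto. Qed.

(* |1 + conj(c) z|^2 = (1 + |c|^2)(1 + |z|^2) - |z - c|^2: the kernel is concentrated near z = c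
   once it is weighted by [wt]. *)
Lemma kern_bound (L : nat) (c z : C) : Cmod z <= 1 -> Cmod c <= 1 ->
  Cmod (kern L c z) * wt L z <= (1 - nrm2 (z - c) / 4) ^ L * wt L c.
Proof.
  intros Hz Hc; unfold kern, wt.
  assert (Pz := nrm2_nonneg z); assert (Pc := nrm2_nonneg c); assert (Pd := nrm2_nonneg (z - c)%C).
  rewrite Cmod_pow, Cmod_div by (apply RtoC_neq_0; lra).
  rewrite Cmod_R, (Rabs_pos_eq (1 + nrm2 c)) by lra.
  rewrite pow_mult, <- !Rpow_mult_distr.
  assert (E : nrm2 (1 + Cconj c * z)%C = (1 + nrm2 c) * (1 + nrm2 z) - nrm2 (z - c)%C).
  { destruct c as [c1 c2], z as [z1 z2]; unfold nrm2; simpl; ring. }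
  assert (Nz : nrm2 z <= 1) by (rewrite nrm2_Cmod; assert (H := Cmod_ge_0 z); nra).
  assert (Nc : nrm2 c <= 1) by (rewrite nrm2_Cmod; assert (H := Cmod_ge_0 c); nra).
  assert (P1 := nrm2_nonneg (1 + Cconj c * z)%C).
  apply pow_incr.
  replace ((Cmod (1 + Cconj c * z)%C / (1 + nrm2 c)) ^ 2 * / (1 + nrm2 z)) with
    (nrm2 (1 + Cconj c * z)%C / ((1 + nrm2 c) * (1 + nrm2 z)) * / (1 + nrm2 c))
    by (rewrite nrm2_Cmod; field; lra).
  assert (I : 0 <= / (1 + nrm2 c)) by (left; apply Rinv_0_lt_compat; lra).
  split.
  - apply Rmult_le_pos; auto; apply Rmult_le_pos; auto; left; apply Rinv_0_lt_compat; nra.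
  - apply Rmult_le_compat_r; auto; rewrite E.
    replace (((1 + nrm2 c) * (1 + nrm2 z) - nrm2 (z - c)%C) / ((1 + nrm2 c) * (1 + nrm2 z))) with
      (1 - nrm2 (z - c)%C * / ((1 + nrm2 c) * (1 + nrm2 z))) by (field; lra).
    assert (/ 4 <= / ((1 + nrm2 c) * (1 + nrm2 z))); [|unfold Rdiv; nra].
    apply Rinv_le_contravar; nra.
Qed.

Lemma kern_near (L : nat) (c z : C) : Cmod (z - c)%C <= 1 ->
  Cmod (kern L c z - 1)%C <= INR (2 * L) * 2 ^ (2 * L) * Cmod (z - c)%C.
Proof.
  intros Hz; unfold kern.
  assert (Pc := nrm2_nonneg c).
  set (x := (Cconj c * (z - c) / RtoC (1 + nrm2 c))%C).
  assert (E : ((1 + Cconj c * z) / RtoC (1 + nrm2 c) = 1 + x)%C).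
  { assert (Hn : RtoC (1 + nrm2 c) <> 0) by (apply RtoC_neq_0; lra).
    unfold x; replace (1 + Cconj c * z)%C with (RtoC (1 + nrm2 c) + Cconj c * (z - c))%C.
    - field; auto.
    - rewrite RtoC_plus, nrm2_conj; ring. }
  rewrite E.
  assert (Hx : Cmod x <= Cmod (z - c)%C).
  { unfold x; rewrite Cmod_div, Cmod_mult, Cmod_conj, Cmod_R by (apply RtoC_neq_0; lra).
    rewrite (Rabs_pos_eq (1 + nrm2 c)) by lra.
    assert (H1 := Cmod_ge_0 c); assert (H2 := Cmod_ge_0 (z - c)%C).
    assert (H3 : Cmod c <= 1 + nrm2 c) by (rewrite nrm2_Cmod; nra).
    apply Rmult_le_reg_r with (1 + nrm2 c); [lra|].
    replace (Cmod c * Cmod (z - c)%C / (1 + nrm2 c) * (1 + nrm2 c)) with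
      (Cmod c * Cmod (z - c)%C) by (field; lra); nra. }
  eapply Rle_trans; [apply Cpow_near_1; lra|].
  apply Rmult_le_compat_l; auto.
  apply Rmult_le_pos; [apply pos_INR|]; apply pow_le; lra.
Qed.

Lemma kern_hol (L : nat) (c z : C) : exists D, rdiff (kern L c) z D 0.
Proof.
  unfold kern; apply rdiff_hol_pow with (Cconj c / RtoC (1 + nrm2 c))%C.
  eapply littleo_ext; [|apply littleo_0]; intros h; simpl.
  assert (Hn : RtoC (1 + nrm2 c) <> 0) by (apply RtoC_neq_0; assert (H := nrm2_nonneg c); lra).
  field; auto.
Qed.

(** * Lattice sums of bumps are almost constant *)

Definition sbump (eta x y : R) : R := bump (RtoC (/ eta) * (x, y))%C.

Lemma scaled_mod (eta x y : R) : 0 < eta -> Cmod (RtoC (/ eta) * (x, y))%C = Cmod (x, y) / eta.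
Proof.
  intros H; rewrite Cmod_mult, Cmod_R, Rabs_pos_eq by (left; now apply Rinv_0_lt_compat).
  unfold Rdiv; ring.
Qed.

Lemma sbump_0 (eta x y : R) : 0 < eta -> eta <= Rabs x \/ eta <= Rabs y -> sbump eta x y = 0.
Proof.
  intros He H; apply bump_0; rewrite scaled_mod by auto.
  apply Rmult_le_reg_r with eta; auto.
  replace (Cmod (x, y) / eta * eta) with (Cmod (x, y)) by (field; lra).
  assert (H1 := Cmod_fst_le (x, y)); assert (H2 := Cmod_snd_le (x, y)); simpl in H1, H2.
  destruct H; lra.
Qed.

Lemma sbump_ge (eta x y : R) : 0 < eta -> ind (eta / 2) x * ind (eta / 2) y <= sbump eta x y.
Proof.
  intros He; assert (B := bump_bounds (RtoC (/ eta) * (x, y))%C); fold (sbump eta x y) in B.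
  unfold ind; destruct (Rlt_dec (Rabs x) _) as [Hx|Hx]; [|lra].
  destruct (Rlt_dec (Rabs y) _) as [Hy|Hy]; [|lra].
  apply Rabs_lt_between in Hx; apply Rabs_lt_between in Hy.
  unfold sbump, bump.
  assert (Hn : nrm2 (RtoC (/ eta) * (x, y))%C <= / 2).
  { replace (nrm2 (RtoC (/ eta) * (x, y))%C) with ((x * x + y * y) / (eta * eta))
      by (unfold nrm2; simpl; field; lra).
    apply Rmult_le_reg_r with (eta * eta); [nra|].
    replace ((x * x + y * y) / (eta * eta) * (eta * eta)) with (x * x + y * y) by (field; lra).
    nra. }
  rewrite Rmax_left by lra; lra.
Qed.

Lemma sbump_lip (eta d x y x' y' : R) : 0 < eta -> 0 <= d -> 2 * d <= eta ->
  Rabs (x' - x) <= d -> Rabs (y' - y) <= d ->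
  Rabs (sbump eta x' y' - sbump eta x y) <= 64 * (d / eta) * (ind (3 * eta) x * ind (3 * eta) y).
Proof.
  intros He Hd Hde Hx Hy.
  unfold ind; destruct (Rlt_dec (Rabs x) (3 * eta)) as [H1|H1].
  2:{ assert (T : Rabs x <= Rabs x' + d).
      { replace x with (x' - (x' - x)) by ring.
        eapply Rle_trans; [apply Rabs_triang|]; rewrite Rabs_Ropp; lra. }
      rewrite !sbump_0 by (auto; left; lra); rewrite Rminus_0_r, Rabs_R0; lra. }
  destruct (Rlt_dec (Rabs y) (3 * eta)) as [H2|H2].
  2:{ assert (T : Rabs y <= Rabs y' + d).
      { replace y with (y' - (y' - y)) by ring.
        eapply Rle_trans; [apply Rabs_triang|]; rewrite Rabs_Ropp; lra. }
      rewrite !sbump_0 by (auto; right; lra); rewrite Rminus_0_r, Rabs_R0; lra. }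
  unfold sbump; eapply Rle_trans; [apply bump_lip|].
  replace (RtoC (/ eta) * (x', y') - RtoC (/ eta) * (x, y))%C with
    (RtoC (/ eta) * ((x' - x)%R, (y' - y)%R))%C
    by (apply injective_projections; simpl; ring).
  rewrite !scaled_mod by auto.
  assert (A1 := Cmod_le_Rabs (x' - x) (y' - y)); assert (A2 := Cmod_le_Rabs x y).
  assert (A3 : Cmod (x', y') <= 7 * eta).
  { eapply Rle_trans; [apply (Cmod_le_add (x', y') (x, y))|].
    replace ((x', y') - (x, y))%C with ((x' - x)%R, (y' - y)%R)
      by (apply injective_projections; simpl; ring); lra. }
  assert (P1 := Cmod_ge_0 ((x' - x)%R, (y' - y)%R)); assert (P2 := Cmod_ge_0 (x, y));
    assert (P3 := Cmod_ge_0 (x', y')).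
  assert (Ie : 0 < / eta) by now apply Rinv_0_lt_compat.
  replace (2 * (Cmod ((x' - x)%R, (y' - y)%R) / eta * (Cmod (x', y') / eta + Cmod (x, y) / eta)))
    with (2 * (Cmod ((x' - x)%R, (y' - y)%R) * (Cmod (x', y') + Cmod (x, y))) / (eta * eta))
    by (field; lra).
  apply Rmult_le_reg_r with (eta * eta); [nra|].
  replace (2 * (Cmod ((x' - x)%R, (y' - y)%R) * (Cmod (x', y') + Cmod (x, y))) / (eta * eta) *
    (eta * eta)) with (2 * (Cmod ((x' - x)%R, (y' - y)%R) * (Cmod (x', y') + Cmod (x, y))))
    by (field; lra).
  replace (64 * (d / eta) * (1 * 1) * (eta * eta)) with (2 * ((2 * d) * (16 * eta))) by (field; lra).
  apply Rmult_le_compat_l; [lra|]; apply Rmult_le_compat; lra.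
Qed.

Section Normalisation.
Variables (eta d : R) (N : nat).
Hypotheses (Hd : 0 < d) (Hde : 4 * d <= eta) (He : eta <= / 8) (HN : INR N * d = 4).

(** Up to normalisation a partition of unity. The nodes fill the square [[0, 4] x [0, 4]]; the unit
    disc is placed into [[1, 3] x [1, 3]] by adding 2 to both coordinates, so the edge of the
    lattice is out of reach of bumps of radius [eta]. *)
Definition lattice_sum (t s : R) : R :=
  rsum N (fun k => rsum N (fun l => sbump eta (t - INR k * d) (s - INR l * d))).

Lemma lattice_shift_t (t s : R) : 1 <= t -> t + d <= 3 -> lattice_sum (t + d) s = lattice_sum t s.
Proof.
  intros H1 H2; apply (rsum_shift (fun t' => rsum N (fun l => sbump eta t' (s - INR l * d)))).
  - rewrite (rsum_ext N _ (fun _ => 0)); [rewrite rsum_const; ring|].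
    intros l; apply sbump_0; [lra|]; left; rewrite Rabs_pos_eq; lra.
  - rewrite (rsum_ext N _ (fun _ => 0)); [rewrite rsum_const; ring|].
    intros l; apply sbump_0; [lra|]; left; rewrite Rabs_left1; lra.
Qed.

Lemma lattice_shift_s (t s : R) : 1 <= s -> s + d <= 3 -> lattice_sum t (s + d) = lattice_sum t s.
Proof.
  intros H1 H2; apply rsum_ext; intros k.
  apply (rsum_shift (fun s' => sbump eta (t - INR k * d) s')).
  - apply sbump_0; [lra|]; right; rewrite Rabs_pos_eq; lra.
  - apply sbump_0; [lra|]; right; rewrite Rabs_left1; lra.
Qed.

(** A function invariant under steps of length [d] on [[1, 3]] is determined by its values within
    [d] of the midpoint 2. *)
Lemma shift_reduce (f : R -> R) : (forall t, 1 <= t -> t + d <= 3 -> f (t + d) = f t) ->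
  forall t, 1 <= t <= 3 -> exists t', Rabs (t' - 2) <= d /\ f t = f t'.
Proof.
  intros Hf t Ht.
  assert (Hm : forall m t, 1 <= t -> t + INR m * d <= 3 -> f (t + INR m * d) = f t).
  { induction m as [|m IH]; intros t0 H1 H2.
    - simpl; f_equal; ring.
    - rewrite S_INR in *; replace (t0 + (INR m + 1) * d) with (t0 + INR m * d + d) in * by ring.
      assert (0 <= INR m * d) by (apply Rmult_le_pos; [apply pos_INR|lra]).
      rewrite Hf by lra; apply IH; lra. }
  destruct (Rle_lt_dec 2 t) as [H|H].
  - destruct (nfloor_ex ((t - 2) / d)) as [m [M1 M2]].
    { apply Rmult_le_pos; [lra|left; now apply Rinv_0_lt_compat]. }
    apply Rmult_le_compat_r with (r := d) in M1; [|lra].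
    apply Rmult_lt_compat_r with (r := d) in M2; [|lra].
    replace ((t - 2) / d * d) with (t - 2) in M1, M2 by (field; lra).
    exists (t - INR m * d); split; [apply Rabs_le; lra|].
    rewrite <- (Hm m (t - INR m * d)) by lra; f_equal; ring.
  - destruct (nfloor_ex ((2 - t) / d)) as [m [M1 M2]].
    { apply Rmult_le_pos; [lra|left; now apply Rinv_0_lt_compat]. }
    apply Rmult_le_compat_r with (r := d) in M1; [|lra].
    apply Rmult_lt_compat_r with (r := d) in M2; [|lra].
    replace ((2 - t) / d * d) with (2 - t) in M1, M2 by (field; lra).
    exists (t + INR m * d); split; [apply Rabs_le; lra|].
    symmetry; apply Hm; lra.
Qed.

Lemma lattice_lower : (eta / (2 * d)) * (eta / (2 * d)) <= lattice_sum 2 2.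
Proof.
  assert (H := count_lower 2 d eta N Hd Hde ltac:(lra) ltac:(lra) ltac:(lra)).
  assert (0 <= eta / (2 * d)) by (apply Rmult_le_pos; [lra|left; apply Rinv_0_lt_compat; lra]).
  eapply Rle_trans; [apply Rmult_le_compat; [auto|auto|apply H|apply H]|].
  rewrite <- rsum_prod; apply rsum_le; intros k; apply rsum_le; intros l; apply sbump_ge; lra.
Qed.

(** After reduction modulo the lattice the arguments differ by at most [d]. About [(24 * eta / d)^2]
    bumps can change, each by at most [64 * d / eta], while the sum is at least [(eta / (2 * d))^2];
    the ratio is [64 * 48^2 = 147456] times [d / eta]. *)
Lemma lattice_const (t s : R) : 1 <= t <= 3 -> 1 <= s <= 3 ->
  Rabs (lattice_sum t s - lattice_sum 2 2) <= 147456 * (d / eta) * lattice_sum 2 2.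
Proof.
  intros Ht Hs.
  destruct (shift_reduce (fun t => lattice_sum t s)
    (fun t H1 H2 => lattice_shift_t t s H1 H2) t Ht) as [t' [Ht' ->]].
  destruct (shift_reduce (fun s => lattice_sum t' s)
    (fun s H1 H2 => lattice_shift_s t' s H1 H2) s Hs) as [s' [Hs' ->]].
  unfold lattice_sum at 1 2; rewrite <- rsum_minus.
  eapply Rle_trans; [apply Rabs_rsum_le|].
  apply Rle_trans with (rsum N (fun k => rsum N (fun l =>
    64 * (d / eta) * (ind (3 * eta) (2 - INR k * d) * ind (3 * eta) (2 - INR l * d))))).
  { apply rsum_le; intros k; rewrite <- rsum_minus.
    eapply Rle_trans; [apply Rabs_rsum_le|]; apply rsum_le; intros l.
    apply sbump_lip; try lra.
    - now replace (t' - INR k * d - (2 - INR k * d)) with (t' - 2) by ring.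
    - now replace (s' - INR l * d - (2 - INR l * d)) with (s' - 2) by ring. }
  rewrite (rsum_ext N _ (fun k => 64 * (d / eta) * rsum N (fun l =>
     ind (3 * eta) (2 - INR k * d) * ind (3 * eta) (2 - INR l * d)))) by
    (intros k; apply rsum_scal).
  rewrite rsum_scal, rsum_prod.
  assert (C := count_upper 2 d (3 * eta) N ltac:(lra)).
  assert (P : 0 <= rsum N (fun k => ind (3 * eta) (2 - INR k * d)))
    by (apply rsum_nonneg; intros; apply ind_nonneg).
  assert (Pd : 0 <= d / eta) by (apply Rmult_le_pos; [lra|left; apply Rinv_0_lt_compat; lra]).
  replace (147456 * (d / eta) * lattice_sum 2 2) with
    (64 * (d / eta) * (2304 * lattice_sum 2 2)) by ring.
  apply Rmult_le_compat_l; [lra|].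
  apply Rle_trans with ((8 * (3 * eta) / d) * (8 * (3 * eta) / d)); [apply Rmult_le_compat; auto|].
  assert (Lo := lattice_lower).
  replace (8 * (3 * eta) / d * (8 * (3 * eta) / d)) with
    (2304 * (eta / (2 * d) * (eta / (2 * d)))) by (field; lra); lra.
Qed.

End Normalisation.

(** * Solving the conjugate-derivative equation up to a small error *)

Lemma cont_at_bump (z : C) : cont_at (fun x => RtoC (bump x)) z.
Proof.
  intros e He; assert (Hz := Cmod_ge_0 z).
  exists (Rmin 1 (e / (2 * (2 * Cmod z + 1) + 1))); split.
  { apply Rmin_case; [lra|]; apply Rdiv_lt_0_compat; lra. }
  intros y Hy; rewrite <- RtoC_minus, Cmod_R.
  assert (H1 : Cmod (y - z)%C < 1) by (eapply Rlt_le_trans; [apply Hy|apply Rmin_l]).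
  assert (H2 : Cmod (y - z)%C < e / (2 * (2 * Cmod z + 1) + 1))
    by (eapply Rlt_le_trans; [apply Hy|apply Rmin_r]).
  eapply Rle_lt_trans; [apply bump_lip|].
  assert (H3 := Cmod_le_add y z); assert (H4 := Cmod_ge_0 (y - z)%C).
  apply Rmult_lt_compat_r with (r := 2 * (2 * Cmod z + 1) + 1) in H2; [|lra].
  replace (e / (2 * (2 * Cmod z + 1) + 1) * (2 * (2 * Cmod z + 1) + 1)) with e in H2 by (field; lra).
  assert (H5 := Cmod_ge_0 y); nra.
Qed.

Lemma cont_at_comp_affine (u : C -> C) (a : R) (c z : C) :
  cont_at u (RtoC a * (z - c))%C -> cont_at (fun x => u (RtoC a * (x - c)))%C z.
Proof.
  intros H e He; destruct (H e He) as [d [Hd Hh]].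
  assert (Ha := Rabs_pos a).
  exists (d / (Rabs a + 1)); split; [apply Rdiv_lt_0_compat; lra|]; intros y Hy; apply Hh.
  replace (RtoC a * (y - c) - RtoC a * (z - c))%C with (RtoC a * (y - z))%C by ring.
  rewrite Cmod_mult, Cmod_R.
  apply Rmult_lt_compat_l with (r := Rabs a + 1) in Hy; [|lra].
  replace ((Rabs a + 1) * (d / (Rabs a + 1))) with d in Hy by (field; lra).
  assert (H4 := Cmod_ge_0 (y - z)%C); nra.
Qed.

(* The weight exponent [L] depends on [theta] only, the lattice on the modulus of continuity of [g]. *)
Lemma dbar_solver (theta : R) : 0 < theta -> exists L : nat,
  forall (g : C -> C) (Gb K eps s : R), 0 < s ->
    (forall e, 0 < e -> exists d, 0 < d /\ forall x y, Cmod (x - y)%C < d -> Cmod (g x - g y)%C < e) ->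
    (forall z, Cmod (g z) <= Gb) -> (forall z, 1 <= Cmod z -> g z = 0) ->
    (forall z, Cmod (g z) * wt L z <= K) -> 0 < eps ->
    exists v beta : C -> C, forall z, Cmod z < 1 ->
      (exists A, rdiff v z A (beta z)) /\ cont_at beta z /\
      Cmod (beta z - g z)%C <= eps /\ Cmod (v z) * wt L z <= theta * K /\
      ((forall y, Cmod (z - y)%C < s -> g y = 0) -> beta z = 0).
Proof.
  intros Hth.
  (* [kap] separates near from far nodes. Near nodes contribute at most [1024 * kap * K], half of
     the allowed bound; far nodes carry the factor [q ^ L / kap], and [L] is chosen to make that the
     other half. *)
  set (kap := Rmin (/ 8) (theta / 2048)).
  assert (Hkap : 0 < kap) by (unfold kap; apply Rmin_case; lra).
  assert (Hkap1 : kap <= / 8) by apply Rmin_l.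
  assert (Hkap2 : kap <= theta / 2048) by apply Rmin_r.
  set (q := 1 - kap * kap / 4).
  assert (Hq : 0 <= q < 1) by (unfold q; nra).
  destruct (pow_lt_1_zero q ltac:(rewrite Rabs_pos_eq; lra) (theta * kap / 256)) as [L HL].
  { apply Rdiv_lt_0_compat; nra. }
  specialize (HL L (Nat.le_refl L)); rewrite Rabs_pos_eq in HL by (apply pow_le; lra).
  exists L; intros g Gb K eps s Hspos Hgc HGb Hg0 HgK Heps.
  assert (HGb0 : 0 <= Gb) by (eapply Rle_trans; [apply Cmod_ge_0|apply (HGb (RtoC 0))]).
  assert (HK0 : 0 <= K).
  { eapply Rle_trans; [|apply (HgK (RtoC 0))]; apply Rmult_le_pos; [apply Cmod_ge_0|].
    left; apply wt_pos. }
  destruct (Hgc (eps / 8)) as [d0' [Hd0' Hgu']]; [lra|].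
  set (d0 := Rmin d0' s).
  assert (Hd0 : 0 < d0) by now apply Rmin_pos.
  assert (Hd0s : d0 <= s) by apply Rmin_r.
  assert (Hgu : forall x y, Cmod (x - y)%C < d0 -> Cmod (g x - g y)%C < eps / 8).
  { intros x y Hxy; apply Hgu'; eapply Rlt_le_trans; [apply Hxy|apply Rmin_l]. }
  set (Ck := INR (2 * L) * 2 ^ (2 * L)).
  assert (HCk : 0 <= Ck) by (apply Rmult_le_pos; [apply pos_INR|apply pow_le; lra]).
  (* The bump radius: below [d0] so that [g] hardly varies over a bump, and so small that [kern],
     whose Lipschitz constant [Ck] depends on [L], is close to 1 there. *)
  set (eta := Rmin (Rmin kap d0) (eps / (8 * (Gb * Ck + 1)))).
  assert (HGC : 0 <= Gb * Ck) by now apply Rmult_le_pos.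
  assert (Heta : 0 < eta).
  { apply Rmin_pos; [now apply Rmin_pos|]; apply Rdiv_lt_0_compat; lra. }
  assert (Heta1 : eta <= kap) by (eapply Rle_trans; [apply Rmin_l|apply Rmin_l]).
  assert (Heta2 : eta <= d0) by (eapply Rle_trans; [apply Rmin_l|apply Rmin_r]).
  assert (Heta3 : Gb * Ck * eta <= eps / 8).
  { assert (E : eta <= eps / (8 * (Gb * Ck + 1))) by apply Rmin_r.
    apply Rmult_le_compat_l with (r := Gb * Ck + 1) in E; [|lra].
    replace ((Gb * Ck + 1) * (eps / (8 * (Gb * Ck + 1)))) with (eps / 8) in E by (field; lra).
    nra. }
  set (Cq := 147456) in *.
  (* The spacing is chosen after [eta], so that the sum of bumps is constant up to a relative error
     [Cq * (d / eta)]; the step is then rounded to [4 / N]. *)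
  set (d1 := Rmin (eta / 4) (Rmin (eta / Cq) (eps * eta / (4 * Cq * (Gb + 1))))).
  assert (Hd1 : 0 < d1).
  { apply Rmin_pos; [lra|]; apply Rmin_pos; apply Rdiv_lt_0_compat; unfold Cq; nra. }
  destruct (archimed_cor1 (d1 / 4)) as [N [HN HN0]]; [lra|].
  assert (HNpos : 0 < INR N) by now apply lt_0_INR.
  set (d := 4 / INR N).
  assert (Hd : 0 < d) by (apply Rdiv_lt_0_compat; lra).
  assert (Hdd1 : d <= d1) by (unfold d, Rdiv; lra).
  assert (HNd : INR N * d = 4) by (unfold d; field; lra).
  assert (D1 : 4 * d <= eta) by (assert (T := Rmin_l (eta / 4) (Rmin (eta / Cq)
      (eps * eta / (4 * Cq * (Gb + 1))))); fold d1 in T; lra).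
  assert (D2 : Cq * (d / eta) <= 1).
  { assert (T : d <= eta / Cq).
    { eapply Rle_trans; [apply Hdd1|]; eapply Rle_trans; [apply Rmin_r|apply Rmin_l]. }
    apply Rmult_le_reg_r with eta; auto.
    replace (Cq * (d / eta) * eta) with (Cq * d) by (field; lra).
    unfold Cq in *; lra. }
  assert (D3 : Gb * (Cq * (d / eta)) <= eps / 4).
  { assert (T : d <= eps * eta / (4 * Cq * (Gb + 1))).
    { eapply Rle_trans; [apply Hdd1|]; eapply Rle_trans; [apply Rmin_r|apply Rmin_r]. }
    apply Rle_trans with ((Gb + 1) * (Cq * ((eps * eta / (4 * Cq * (Gb + 1))) / eta))).
    - assert (I : 0 <= / eta) by (left; now apply Rinv_0_lt_compat).
      assert (T2 : d / eta <= eps * eta / (4 * Cq * (Gb + 1)) / eta)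
        by (apply Rmult_le_compat_r; auto).
      assert (0 <= d / eta) by (apply Rmult_le_pos; lra).
      apply Rmult_le_compat; unfold Cq in *; lra.
    - right; field; unfold Cq; lra. }
  assert (He8 : eta <= / 8) by lra.
  set (n0 := lattice_sum eta d N 2 2).
  assert (Hn0 : eta / (2 * d) * (eta / (2 * d)) <= n0) by (apply lattice_lower; auto).
  assert (Hed : 0 < eta / (2 * d)) by (apply Rdiv_lt_0_compat; lra).
  assert (Hn0p : 0 < n0) by nra.
  set (c := fun k l : nat => ((INR k * d - 2)%R, (INR l * d - 2)%R) : C).
  assert (Hzc : forall z k l, (z - c k l)%C =
     ((fst z + 2 - INR k * d)%R, (snd z + 2 - INR l * d)%R)).
  { intros z k l; apply injective_projections; simpl; ring. }
  (* A discretised Cauchy transform of [g], each node multiplied by its holomorphic [kern], so the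
     conjugate derivative is exactly [beta]. In [beta] the bumps near [z] add up to about [n0], and
     [g * kern] at their nodes is close to [g z]. *)
  set (v := fun z => (RtoC (eta / n0) * zsum N (fun k => zsum N (fun l =>
     g (c k l) * (kern L (c k l) z * bker (RtoC (/ eta) * (z - c k l))))))%C).
  set (beta := fun z => (RtoC (/ n0) * zsum N (fun k => zsum N (fun l =>
     g (c k l) * (kern L (c k l) z * RtoC (bump (RtoC (/ eta) * (z - c k l)))))))%C).
  exists v, beta; intros z Hz.
  assert (Hx : Rabs (fst z) < 1) by (eapply Rle_lt_trans; [apply Cmod_fst_le|auto]).
  assert (Hy : Rabs (snd z) < 1) by (eapply Rle_lt_trans; [apply Cmod_snd_le|auto]).
  apply Rabs_lt_between in Hx; apply Rabs_lt_between in Hy.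
  split; [|split; [|split; [|split]]].
  -     assert (Hkl : forall k l, exists A, rdiff (fun z => g (c k l) * (kern L (c k l) z *
       bker (RtoC (/ eta) * (z - c k l))))%C z A
       (g (c k l) * (kern L (c k l) z * (RtoC (/ eta) * RtoC (bump (RtoC (/ eta) * (z - c k l))))))%C).
    { intros k l.
      destruct (kern_hol L (c k l) z) as [D HD].
      destruct (rdiff_bker (RtoC (/ eta) * (z - c k l))%C) as [A HA].
      eexists; eapply rdiff_eq; [reflexivity| |apply rdiff_scal, rdiff_mult;
        [exact HD|apply rdiff_comp_affine, HA]].
      cbv beta; ring. }
    set (A := fun k l => proj1_sig (constructive_indefinite_description _ (Hkl k l))).
    assert (HA : forall k l, rdiff (fun z => g (c k l) * (kern L (c k l) z *
       bker (RtoC (/ eta) * (z - c k l))))%C z (A k l)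
       (g (c k l) * (kern L (c k l) z * (RtoC (/ eta) * RtoC (bump (RtoC (/ eta) * (z - c k l))))))%C).
    { intros k l; exact (proj2_sig (constructive_indefinite_description _ (Hkl k l))). }
    eexists; eapply rdiff_eq; [reflexivity| |apply rdiff_scal, rdiff_zsum; intros k;
      apply rdiff_zsum; intros l; apply HA].
    unfold beta; rewrite <- !zsum_scal; apply zsum_ext; intros k.
    rewrite <- !zsum_scal; apply zsum_ext; intros l.
    rewrite RtoC_div, !RtoC_inv by lra; field; split; apply RtoC_neq_0; lra.
  - unfold beta; apply cont_at_mult; [eapply cont_at_rdiff, rdiff_const|].
    apply cont_at_zsum; intros k; apply cont_at_zsum; intros l.
    apply cont_at_mult; [eapply cont_at_rdiff, rdiff_const|].
    destruct (kern_hol L (c k l) z) as [D HD].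
    apply cont_at_mult; [eapply cont_at_rdiff, HD|].
    apply (cont_at_comp_affine (fun x => RtoC (bump x))), cont_at_bump.
  - set (Sz := lattice_sum eta d N (fst z + 2) (snd z + 2)).
    assert (HS : Rabs (Sz - n0) <= Cq * (d / eta) * n0).
    { apply lattice_const; auto; lra. }
    assert (HS2 : Sz <= 2 * n0).
    { apply Rabs_le_between in HS; nra. }
    assert (Ebeta : (beta z - g z)%C = (RtoC (/ n0) * zsum N (fun k => zsum N (fun l =>
      (g (c k l) * kern L (c k l) z - g z) *
        RtoC (sbump eta (fst z + 2 - INR k * d) (snd z + 2 - INR l * d)))) +
      g z * RtoC ((Sz - n0) / n0))%C).
    { assert (E1 : zsum N (fun k => zsum N (fun l =>
        g z * RtoC (sbump eta (fst z + 2 - INR k * d) (snd z + 2 - INR l * d)))%C) = (g z * RtoC Sz)%C).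
      { unfold Sz, lattice_sum; rewrite <- zsum_RtoC, <- zsum_scal; apply zsum_ext; intros k.
        now rewrite <- zsum_RtoC, <- zsum_scal. }
      assert (E2 : zsum N (fun k => zsum N (fun l =>
        g (c k l) * (kern L (c k l) z * RtoC (bump (RtoC (/ eta) * (z - c k l))))))%C =
        (zsum N (fun k => zsum N (fun l => (g (c k l) * kern L (c k l) z - g z) *
        RtoC (sbump eta (fst z + 2 - INR k * d) (snd z + 2 - INR l * d)))) + g z * RtoC Sz)%C).
      { rewrite <- E1, <- zsum_plus; apply zsum_ext; intros k.
        rewrite <- zsum_plus; apply zsum_ext; intros l; unfold sbump; rewrite Hzc; ring. }
      unfold beta; rewrite E2, RtoC_div, RtoC_minus, RtoC_inv by lra.
      field; apply RtoC_neq_0; lra. }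
    rewrite Ebeta; eapply Rle_trans; [apply Cmod_triangle|].
    rewrite !Cmod_mult, !Cmod_R.
    assert (B1 : Cmod (zsum N (fun k => zsum N (fun l => (g (c k l) * kern L (c k l) z - g z) *
        RtoC (sbump eta (fst z + 2 - INR k * d) (snd z + 2 - INR l * d)))))%C <= eps / 4 * Sz).
    { eapply Rle_trans; [apply Cmod_zsum_le|].
      unfold Sz, lattice_sum; rewrite <- rsum_scal; apply rsum_le; intros k.
      eapply Rle_trans; [apply Cmod_zsum_le|].
      rewrite <- rsum_scal; apply rsum_le; intros l.
      rewrite Cmod_mult, Cmod_R.
      set (sb := sbump eta (fst z + 2 - INR k * d) (snd z + 2 - INR l * d)).
      assert (Hsb : 0 <= sb) by apply bump_bounds.
      rewrite Rabs_pos_eq by auto.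
      destruct (Rlt_le_dec (Cmod (z - c k l)%C) eta) as [H|H].
      - apply Rmult_le_compat_r; auto.
        replace (g (c k l) * kern L (c k l) z - g z)%C with
          (g (c k l) * (kern L (c k l) z - 1) + (g (c k l) - g z))%C by ring.
        eapply Rle_trans; [apply Cmod_triangle|]; rewrite Cmod_mult.
        assert (H1 : Cmod (g (c k l) - g z)%C < eps / 8).
        { apply Hgu; rewrite Cmod_minus_sym; lra. }
        assert (H2 := kern_near L (c k l) z ltac:(lra)); fold Ck in H2.
        assert (H3 : Cmod (g (c k l)) * Cmod (kern L (c k l) z - 1)%C <= Gb * (Ck * eta)).
        { apply Rmult_le_compat; try apply Cmod_ge_0; auto.
          eapply Rle_trans; [apply H2|]; apply Rmult_le_compat_l; lra. }
        lra.
      - assert (E0 : sb = 0).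
        { unfold sb, sbump; apply bump_0; rewrite scaled_mod by auto; rewrite <- Hzc.
          apply Rmult_le_reg_r with eta; auto.
          replace (Cmod (z - c k l)%C / eta * eta) with (Cmod (z - c k l)%C) by (field; lra); lra. }
        rewrite E0, !Rmult_0_r; lra. }
    assert (Hin : 0 < / n0) by now apply Rinv_0_lt_compat.
    rewrite (Rabs_pos_eq (/ n0)) by lra.
    assert (B2 : / n0 * Cmod (zsum N (fun k => zsum N (fun l => (g (c k l) * kern L (c k l) z - g z) *
        RtoC (sbump eta (fst z + 2 - INR k * d) (snd z + 2 - INR l * d)))))%C <= eps / 2).
    { apply Rle_trans with (/ n0 * (eps / 4 * (2 * n0))).
      - apply Rmult_le_compat_l; [lra|]; eapply Rle_trans; [apply B1|].
        apply Rmult_le_compat_l; lra.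
      - right; field; lra. }
    assert (B3 : Cmod (g z) * Rabs ((Sz - n0) / n0) <= eps / 4).
    { apply Rle_trans with (Gb * (Cq * (d / eta))); auto.
      apply Rmult_le_compat; auto; try apply Cmod_ge_0; try apply Rabs_pos.
      unfold Rdiv at 1; rewrite Rabs_mult, (Rabs_pos_eq (/ n0)) by lra.
      apply Rmult_le_reg_r with n0; auto.
      replace (Rabs (Sz - n0) * / n0 * n0) with (Rabs (Sz - n0)) by (field; lra); auto. }
    lra.
  - set (far := q ^ L / kap).
    assert (Hfar : 0 <= far)
      by (apply Rmult_le_pos; [apply pow_le; lra|left; now apply Rinv_0_lt_compat]).
    assert (Hisq : forall t, 0 <= isq kap eta t).
    { intros t; unfold isq; destruct (Rlt_dec _ _); [|lra]; left; apply Rinv_0_lt_compat, sqrt_lt_R0.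
      apply Rlt_le_trans with eta; auto; apply Rmax_r. }
    (* The weight at [z] is traded through [kern_bound] for the weight at the node, where the bound
       [K] on [g] applies; what remains is the decay factor [D] times the smoothed Cauchy kernel. *)
    assert (Hterm : forall k l, Cmod (g (c k l) * (kern L (c k l) z *
        bker (RtoC (/ eta) * (z - c k l))))%C * wt L z <=
      2 * eta * K * (isq kap eta (fst z + 2 - INR k * d) * isq kap eta (snd z + 2 - INR l * d) + far)).
    { intros k l; rewrite !Cmod_mult.
      assert (Hrhs : 0 <= isq kap eta (fst z + 2 - INR k * d) *
        isq kap eta (snd z + 2 - INR l * d) + far).
      { assert (H := Rmult_le_pos _ _ (Hisq (fst z + 2 - INR k * d))
          (Hisq (snd z + 2 - INR l * d))); lra. }
      destruct (Rle_lt_dec 1 (Cmod (c k l))) as [Hc|Hc].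
      { rewrite Hg0, Cmod_0, !Rmult_0_l by auto.
        apply Rmult_le_pos; auto; repeat apply Rmult_le_pos; lra. }
      set (zeta := (z - c k l)%C).
      set (xx := fst z + 2 - INR k * d) in *; set (yy := snd z + 2 - INR l * d) in *.
      assert (Ez : zeta = (xx, yy)) by apply Hzc.
      assert (Hkb := kern_bound L (c k l) z ltac:(lra) ltac:(lra)); fold zeta in Hkb.
      assert (Hbk := bker_bound (RtoC (/ eta) * zeta)%C).
      assert (Emod : Cmod (RtoC (/ eta) * zeta)%C = Cmod zeta / eta)
        by (rewrite Ez; now apply scaled_mod).
      rewrite Emod in Hbk.
      set (bk := Cmod (bker (RtoC (/ eta) * zeta)%C)) in *.
      assert (Hbk0 : 0 <= bk) by apply Cmod_ge_0.
      set (mx := Rmax (Cmod zeta) eta).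
      assert (Hmx : 0 < mx) by (apply Rlt_le_trans with eta; auto; apply Rmax_r).
      assert (Emx : Rmax (Cmod zeta / eta) 1 = mx / eta).
      { unfold mx; destruct (Rle_dec (Cmod zeta) eta) as [H|H].
        - rewrite (Rmax_right (Cmod zeta)) by auto; rewrite Rmax_right; [field; lra|].
          apply Rmult_le_reg_r with eta; auto.
          replace (Cmod zeta / eta * eta) with (Cmod zeta) by (field; lra); lra.
        - rewrite (Rmax_left (Cmod zeta)) by lra; rewrite Rmax_left; auto.
          apply Rmult_le_reg_r with eta; auto.
          replace (Cmod zeta / eta * eta) with (Cmod zeta) by (field; lra); lra. }
      assert (Hbk2 : bk <= 2 * eta * / mx).
      { rewrite Emx in Hbk; apply Rmult_le_reg_r with (mx / eta); [now apply Rdiv_lt_0_compat|].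
        replace (2 * eta * / mx * (mx / eta)) with 2 by (field; lra); auto. }
      set (D := (1 - nrm2 zeta / 4) ^ L) in *.
      assert (Hz2 : Cmod zeta <= 2).
      { unfold zeta; eapply Rle_trans; [apply Cmod_minus_le|]; lra. }
      assert (Hnz : 0 <= 1 - nrm2 zeta / 4 <= 1).
      { rewrite nrm2_Cmod; assert (H := Cmod_ge_0 zeta).
        assert (H1 := Rmult_le_pos _ _ H H).
        assert (H2 := Rmult_le_compat _ _ _ _ H H Hz2 Hz2); lra. }
      assert (HD0 : 0 <= D) by (apply pow_le; lra).
      assert (HD1 : D <= 1) by (rewrite <- (pow1 L); apply pow_incr; lra).
      assert (Hwt := wt_pos L z); assert (Hwc := wt_pos L (c k l)).
      assert (Hgk : Cmod (g (c k l)) * (Cmod (kern L (c k l) z) * wt L z) <= K * D).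
      { apply Rle_trans with (Cmod (g (c k l)) * (D * wt L (c k l))).
        - apply Rmult_le_compat_l; auto; apply Cmod_ge_0.
        - replace (Cmod (g (c k l)) * (D * wt L (c k l))) with
            ((Cmod (g (c k l)) * wt L (c k l)) * D) by ring.
          apply Rmult_le_compat_r; auto. }
      assert (Hgk0 : 0 <= Cmod (g (c k l)) * (Cmod (kern L (c k l) z) * wt L z)).
      { repeat apply Rmult_le_pos; try apply Cmod_ge_0; lra. }
      replace (Cmod (g (c k l)) * (Cmod (kern L (c k l) z) * bk) * wt L z) with
        ((Cmod (g (c k l)) * (Cmod (kern L (c k l) z) * wt L z)) * bk) by ring.
      apply Rle_trans with ((K * D) * (2 * eta * / mx)); [apply Rmult_le_compat; auto|].
      replace (K * D * (2 * eta * / mx)) with (2 * eta * K * (D * / mx)) by ring.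
      apply Rmult_le_compat_l; [repeat apply Rmult_le_pos; lra|].
      assert (Hm1 := Cmod_fst_le zeta); assert (Hm2 := Cmod_snd_le zeta).
      rewrite Ez in Hm1, Hm2; cbn [fst snd] in Hm1, Hm2; rewrite <- Ez in Hm1, Hm2.
      assert (Himx : 0 < / mx) by now apply Rinv_0_lt_compat.
      (* Far from the node the decay is at least [q ^ L]. Near it [D <= 1] and the kernel is
         summable, with small sum because [kap] is small. *)
      destruct (Rle_lt_dec kap (Cmod zeta)) as [Hk|Hk].
      - apply Rle_trans with far.
        + unfold far; apply Rmult_le_compat; auto; try lra.
          * apply pow_incr; split; [lra|]; unfold q; rewrite nrm2_Cmod.
            assert (H2 := Rmult_le_compat _ _ _ _ (Rlt_le _ _ Hkap) (Rlt_le _ _ Hkap) Hk Hk); lra.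
          * apply Rinv_le_contravar; auto; eapply Rle_trans; [apply Hk|apply Rmax_l].
        + assert (H := Rmult_le_pos _ _ (Hisq xx) (Hisq yy)); lra.
      - apply Rle_trans with (isq kap eta xx * isq kap eta yy); [|lra].
        apply Rle_trans with (/ mx);
          [rewrite <- (Rmult_1_l (/ mx)) at 2; apply Rmult_le_compat_r; lra|].
        unfold isq; destruct (Rlt_dec (Rabs xx) kap) as [_|H]; [|lra].
        destruct (Rlt_dec (Rabs yy) kap) as [_|H]; [|lra].
        set (p := Rmax (Rabs xx) eta); set (r := Rmax (Rabs yy) eta).
        assert (Hp : 0 < p) by (apply Rlt_le_trans with eta; auto; apply Rmax_r).
        assert (Hr : 0 < r) by (apply Rlt_le_trans with eta; auto; apply Rmax_r).
        assert (Hpm : p <= mx) by (apply Rle_max_compat_r; lra).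
        assert (Hrm : r <= mx) by (apply Rle_max_compat_r; lra).
        rewrite <- Rinv_mult, <- sqrt_mult by lra.
        assert (Hpr := Rmult_lt_0_compat _ _ Hp Hr).
        assert (Hprm := Rmult_le_compat _ _ _ _ (Rlt_le _ _ Hp) (Rlt_le _ _ Hr) Hpm Hrm).
        apply Rinv_le_contravar; [now apply sqrt_lt_R0|].
        rewrite <- (sqrt_square mx) by lra; apply sqrt_le_1; lra. }
    assert (Hwt := wt_pos L z).
    assert (Hen : 0 < eta / n0) by now apply Rdiv_lt_0_compat.
    assert (B1 : Cmod (v z) * wt L z <= eta / n0 * (2 * eta * K *
       (rsum N (fun k => isq kap eta (fst z + 2 - INR k * d)) *
        rsum N (fun l => isq kap eta (snd z + 2 - INR l * d)) + INR N * (INR N * far)))).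
    { unfold v; rewrite Cmod_mult, Cmod_R, Rabs_pos_eq by lra.
      rewrite Rmult_assoc; apply Rmult_le_compat_l; [lra|].
      assert (ER : 2 * eta * K *
       (rsum N (fun k => isq kap eta (fst z + 2 - INR k * d)) *
        rsum N (fun l => isq kap eta (snd z + 2 - INR l * d)) + INR N * (INR N * far)) =
        rsum N (fun k => rsum N (fun l => 2 * eta * K *
          (isq kap eta (fst z + 2 - INR k * d) * isq kap eta (snd z + 2 - INR l * d) + far)))).
      { set (B := rsum N (fun l => isq kap eta (snd z + 2 - INR l * d))).
        rewrite (rsum_ext N (fun k => rsum N _) (fun k => 2 * eta * K *
          (B * isq kap eta (fst z + 2 - INR k * d) + INR N * far))).
        - rewrite rsum_scal, rsum_plus, rsum_scal, rsum_const; ring.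
        - intros k; rewrite rsum_scal, rsum_plus, rsum_scal, rsum_const; unfold B; ring. }
      rewrite ER.
      eapply Rle_trans; [apply Rmult_le_compat_r; [lra|apply Cmod_zsum_le]|].
      rewrite Rmult_comm, <- rsum_scal; apply rsum_le; intros k.
      rewrite Rmult_comm; eapply Rle_trans; [apply Rmult_le_compat_r; [lra|apply Cmod_zsum_le]|].
      rewrite Rmult_comm, <- rsum_scal; apply rsum_le; intros l; rewrite Rmult_comm; apply Hterm. }
    eapply Rle_trans; [apply B1|].
    assert (I1 := isq_sum (fst z + 2) d eta kap N ltac:(lra) ltac:(lra)).
    assert (I2 := isq_sum (snd z + 2) d eta kap N ltac:(lra) ltac:(lra)).
    assert (P1 : 0 <= rsum N (fun k => isq kap eta (fst z + 2 - INR k * d))) by (apply rsum_nonneg; auto).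
    assert (P2 : 0 <= rsum N (fun k => isq kap eta (snd z + 2 - INR k * d))) by (apply rsum_nonneg; auto).
    assert (I3 := Rmult_le_compat _ _ _ _ P1 P2 I1 I2).
    replace (8 * sqrt (2 * kap) / d * (8 * sqrt (2 * kap) / d)) with
      (64 * (sqrt (2 * kap) * sqrt (2 * kap)) / (d * d)) in I3 by (field; lra).
    rewrite sqrt_sqrt in I3 by lra.
    assert (EN : INR N * (INR N * far) = 16 * far / (d * d)).
    { replace (INR N) with (4 / d) by (rewrite <- HNd; field; lra); field; lra. }
    rewrite EN.
    apply Rle_trans with (eta / n0 * (2 * eta * K * (64 * (2 * kap) / (d * d) + 16 * far / (d * d)))).
    { apply Rmult_le_compat_l; [lra|]; apply Rmult_le_compat_l; [repeat apply Rmult_le_pos; lra|].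
      apply Rplus_le_compat_r; exact I3. }
    apply Rle_trans with (K * ((eta * eta / (n0 * (d * d))) * (2 * (128 * kap + 16 * far))));
      [right; field; lra|].
    rewrite (Rmult_comm theta K); apply Rmult_le_compat_l; auto.
    assert (Hdd : 0 < d * d) by now apply Rmult_lt_0_compat.
    assert (Hn4 : eta * eta / (n0 * (d * d)) <= 4).
    { apply Rmult_le_reg_r with (n0 * (d * d)); [now apply Rmult_lt_0_compat|].
      replace (eta * eta / (n0 * (d * d)) * (n0 * (d * d))) with (eta * eta) by (field; lra).
      replace (eta * eta) with (4 * (eta / (2 * d) * (eta / (2 * d)) * (d * d))) by (field; lra).
      apply Rmult_le_compat_l; [lra|]; apply Rmult_le_compat_r; [lra|exact Hn0]. }
    assert (Hf2 : 16 * far <= theta / 16).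
    { unfold far; apply Rmult_le_reg_r with kap; auto.
      replace (16 * (q ^ L / kap) * kap) with (16 * q ^ L) by (field; lra); lra. }
    apply Rle_trans with (4 * (2 * (theta / 16 + theta / 16))); [|lra].
    apply Rmult_le_compat; try lra.
    apply Rmult_le_pos; [nra|]; left; apply Rinv_0_lt_compat; now apply Rmult_lt_0_compat.
  - intros Hzero; unfold beta.
    (* A bump that reaches [z] has its node within [eta <= d0 <= s], where [g] vanishes. *)
    assert (E0 : forall k l, (g (c k l) * (kern L (c k l) z *
       RtoC (bump (RtoC (/ eta) * (z - c k l)))))%C = 0).
    { intros k l; destruct (Rlt_le_dec (Cmod (z - c k l)%C) eta) as [H|H].
      - rewrite Hzero by lra; ring.
      - rewrite bump_0; [ring|].
        rewrite Hzc, scaled_mod, <- Hzc by auto.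
        apply Rmult_le_reg_r with eta; auto.
        replace (Cmod (z - c k l)%C / eta * eta) with (Cmod (z - c k l)%C) by (field; lra); lra. }
    assert (Z0 : forall m, zsum m (fun _ => RtoC 0) = 0)
      by (induction m as [|m IH]; simpl; [auto|rewrite IH; ring]).
    rewrite (zsum_ext N _ (fun _ => RtoC 0)); [rewrite Z0; ring|].
    intros k; rewrite (zsum_ext N _ (fun _ => RtoC 0)); [apply Z0|intros l; apply E0].
Qed.

(** * Compactly supported right-hand sides and solutions with prescribed zeros *)

Lemma closed_ball_compl (b : R) (z : C) : ~ Cmod z <= b ->
  exists d, 0 < d /\ forall y, Cmod (y - z)%C < d -> ~ Cmod y <= b.
Proof.
  intros H; apply Rnot_le_lt in H; exists (Cmod z - b); split; [lra|]; intros y Hy Hyb.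
  assert (T := Cmod_le_add z y); rewrite Cmod_minus_sym in T; lra.
Qed.

Lemma compact_support_unif (h : C -> C) : (forall z, cont_at h z) ->
  (forall z, 1 <= Cmod z -> h z = 0) ->
  forall e, 0 < e -> exists d, 0 < d /\ forall x y, Cmod (x - y)%C < d -> Cmod (h x - h y)%C < e.
Proof.
  intros Hc H0 e He.
  destruct (compact_uniform (fun z => Cmod z <= 2)
    (fun z d => forall y, Cmod (y - z)%C < d -> Cmod (h y - h z)%C < e) 2) as [d [Hd H]].
  - auto.
  - intros z Hz; now apply closed_ball_compl.
  - intros z d d' H Hd' Hdd y Hy; apply H; lra.
  - intros z _; destruct (Hc z (e / 2)) as [d [Hd H]]; [lra|].
    exists (d / 2); split; [lra|]; intros y _ Hy x Hx.
    assert (Hxz : Cmod (x - z)%C < d)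
      by (eapply Rle_lt_trans; [apply (Cmod_triangle3 x y z)|]; lra).
    assert (H1 := H x Hxz); assert (H2 := H y ltac:(lra)).
    eapply Rle_lt_trans; [apply (Cmod_triangle3 _ (h z))|].
    rewrite (Cmod_minus_sym (h z)); lra.
  - exists (Rmin d 1); split; [apply Rmin_pos; lra|]; intros x y Hxy.
    destruct (Rle_lt_dec (Cmod y) 2) as [Hy|Hy].
    + apply H; auto; eapply Rlt_le_trans; [apply Hxy|apply Rmin_l].
    + assert (Hx : 1 <= Cmod x).
      { assert (T := Cmod_le_add y x); rewrite Cmod_minus_sym in T.
        assert (Cmod (x - y)%C < 1) by (eapply Rlt_le_trans; [apply Hxy|apply Rmin_r]); lra. }
      rewrite !H0 by lra; replace (0 - 0)%C with (RtoC 0) by ring; now rewrite Cmod_0.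
Qed.

(** The bound is written as [/ e], so that it weakens as [e] shrinks and the compactness lemma
    applies. *)
Lemma compact_support_bounded (h : C -> C) : (forall z, cont_at h z) ->
  (forall z, 1 <= Cmod z -> h z = 0) -> exists K, forall z, Cmod (h z) <= K.
Proof.
  intros Hc H0.
  destruct (compact_uniform (fun z => Cmod z <= 2) (fun z e => Cmod (h z) <= / e) 2) as [e [He H]].
  - auto.
  - intros z Hz; now apply closed_ball_compl.
  - intros z e e' H He' Hee; eapply Rle_trans; [apply H|]; now apply Rinv_le_contravar.
  - intros z _; destruct (Hc z 1) as [d [Hd H]]; [lra|].
    assert (Hz := Cmod_ge_0 (h z)).
    set (m := Rmin d (/ (Cmod (h z) + 1))).
    assert (Hm : 0 < m) by (apply Rmin_pos; auto; apply Rinv_0_lt_compat; lra).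
    exists m; split; auto; intros y _ Hy.
    assert (Hyd : Cmod (y - z)%C < d) by (eapply Rlt_le_trans; [apply Hy|apply Rmin_l]).
    specialize (H y Hyd); assert (T := Cmod_le_add (h y) (h z)).
    apply Rle_trans with (Cmod (h z) + 1); [lra|].
    rewrite <- (Rinv_inv (Cmod (h z) + 1)); apply Rinv_le_contravar; auto; apply Rmin_r.
  - exists (/ e); intros z; destruct (Rle_lt_dec (Cmod z) 2) as [Hz|Hz]; auto.
    rewrite H0 by lra; rewrite Cmod_0; left; now apply Rinv_0_lt_compat.
Qed.

Lemma cont_at_ext_loc (u v : C -> C) (z : C) (d : R) : 0 < d ->
  (forall y, Cmod (y - z)%C < d -> u y = v y) -> cont_at u z -> cont_at v z.
Proof.
  intros Hd E H e He; destruct (H e He) as [d' [Hd' H']].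
  exists (Rmin d d'); split; [now apply Rmin_pos|]; intros y Hy.
  rewrite <- !E.
  - apply H'; eapply Rlt_le_trans; [apply Hy|apply Rmin_r].
  - replace (z - z)%C with (RtoC 0) by ring; now rewrite Cmod_0.
  - eapply Rlt_le_trans; [apply Hy|apply Rmin_l].
Qed.

Lemma cont_at_const (c z : C) : cont_at (fun _ => c) z.
Proof. eapply cont_at_rdiff, rdiff_const. Qed.

(* Solutions with zeros at the two points 0 and a, obtained by dividing by z (z - a). *)
Lemma vdbar_solver (n : nat) (theta a0 : R) : 0 < theta -> 0 < a0 <= 1 ->
  exists L : nat, forall (a : C), Cmod a <= a0 / 4 ->
  forall (g : C -> Cn n) (K eps s : R), 0 < s ->
    (forall z k, cont_at (fun x => g x k) z) ->
    (forall z k, 1 <= Cmod z -> g z k = 0) -> (forall z k, Cmod z < a0 / 2 -> g z k = 0) ->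
    (forall z, cnorm (g z) * wt L z <= K) -> 0 < eps ->
    exists v beta : C -> Cn n,
      (forall k, v 0 k = 0) /\ (forall k, v a k = 0) /\
      forall z, Cmod z < 1 ->
        (forall k, exists A, rdiff (fun x => v x k) z A (beta z k)) /\
        (forall k, cont_at (fun x => beta x k) z) /\
        cnorm (vsub (beta z) (g z)) <= eps /\ cnorm (v z) * wt L z <= theta * K /\
        ((forall y k, Cmod (z - y)%C < s -> g y k = 0) -> forall k, beta z k = 0).
Proof.
  intros Hth Ha0.
  set (Nn := INR n + 1).
  assert (HNn : 1 <= Nn) by (unfold Nn; assert (H := pos_INR n); lra).
  (* Dividing by [q] costs [8 / (a0 * a0)], multiplying back costs 2, and adding up components costs
     [Nn]; together they turn this constant into [theta]. *)
  destruct (dbar_solver (theta * (a0 * a0) / (16 * Nn))) as [L HL].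
  { apply Rdiv_lt_0_compat; [|lra]; apply Rmult_lt_0_compat; nra. }
  exists L; intros a Ha g K eps s Hspos Hgc Hg1 Hg0 HgK Heps.
  set (q := fun z => (z * (z - a))%C).
  assert (Hq : forall z, a0 / 2 <= Cmod z -> a0 * a0 / 8 <= Cmod (q z)).
  { intros z Hz; unfold q; rewrite Cmod_mult.
    assert (T := Cmod_le_add z a).
    replace (a0 * a0 / 8) with ((a0 / 2) * (a0 / 4)) by field.
    apply Rmult_le_compat; lra. }
  assert (Hq2 : forall z, Cmod z < 1 -> Cmod (q z) <= 2).
  { intros z Hz; unfold q; rewrite Cmod_mult.
    assert (T := Cmod_minus_le z a); assert (H := Cmod_ge_0 z); assert (H' := Cmod_ge_0 (z - a)%C).
    replace 2 with (1 * 2) by ring; apply Rmult_le_compat; lra. }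
  assert (Hqd : forall z, exists D, rdiff q z D 0).
  { intros z; eexists; eapply rdiff_eq; [reflexivity| |apply rdiff_mult;
      [apply rdiff_id|apply rdiff_minus; [apply rdiff_id|apply rdiff_const]]]; cbv beta; ring. }
  assert (Haa : 0 < a0 * a0) by nra.
  (* Both zeros of [q] lie where [g] vanishes, so the value of the inverse at 0 is immaterial and
     [h] is continuous. *)
  set (h := fun k z => (g z k * / q z)%C).
  assert (Hh0 : forall k z, Cmod z < a0 / 2 -> h k z = 0)
    by (intros k z Hz; unfold h; rewrite Hg0 by auto; ring).
  assert (Hh1 : forall k z, 1 <= Cmod z -> h k z = 0)
    by (intros k z Hz; unfold h; rewrite Hg1 by auto; ring).
  assert (Hhc : forall k z, cont_at (h k) z).
  { intros k z; destruct (Rlt_le_dec (Cmod z) (a0 / 2)) as [Hz|Hz].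
    - apply cont_at_ext_loc with (fun _ => RtoC 0) (a0 / 2 - Cmod z); [lra| |apply cont_at_const].
      intros y Hy; symmetry; apply Hh0; assert (T := Cmod_le_add y z); lra.
    - apply cont_at_mult; [apply Hgc|].
      destruct (Hqd z) as [D HD].
      eapply cont_at_rdiff, (rdiff_inv q z D 0); auto.
      apply Cmod_gt_0; specialize (Hq z Hz); lra. }
  set (K' := K / (a0 * a0 / 8)).
  assert (HhK : forall k z, Cmod (h k z) * wt L z <= K').
  { intros k z; unfold K'; assert (Hw := wt_pos L z).
    apply Rmult_le_reg_r with (a0 * a0 / 8); [lra|].
    replace (K / (a0 * a0 / 8) * (a0 * a0 / 8)) with K by (field; lra).
    assert (HK0 : 0 <= K).
    { eapply Rle_trans; [|apply (HgK z)]; apply Rmult_le_pos; [apply cnorm_ge_0|lra]. }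
    destruct (Rlt_le_dec (Cmod z) (a0 / 2)) as [Hz|Hz].
    { rewrite Hh0, Cmod_0 by auto; lra. }
    specialize (Hq z Hz).
    assert (Hqn : q z <> 0) by (apply Cmod_gt_0; lra).
    unfold h; rewrite Cmod_mult, Cmod_inv by auto.
    apply Rle_trans with (Cmod (g z k) * wt L z * (/ Cmod (q z) * Cmod (q z))).
    - assert (Hi : 0 < / Cmod (q z)) by (apply Rinv_0_lt_compat; lra).
      assert (Hp : 0 <= Cmod (g z k) * wt L z) by (apply Rmult_le_pos; [apply Cmod_ge_0|lra]).
      replace (Cmod (g z k) * / Cmod (q z) * wt L z * (a0 * a0 / 8)) with
        (Cmod (g z k) * wt L z * (/ Cmod (q z) * (a0 * a0 / 8))) by ring.
      apply Rmult_le_compat_l; auto; apply Rmult_le_compat_l; lra.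
    - rewrite Rinv_l, Rmult_1_r by lra.
      eapply Rle_trans; [|apply (HgK z)]; apply Rmult_le_compat_r; [lra|apply cnorm_comp]. }
  assert (Hsol : forall k, exists vb : (C -> C) * (C -> C), forall z, Cmod z < 1 ->
      (exists A, rdiff (fst vb) z A (snd vb z)) /\ cont_at (snd vb) z /\
      Cmod (snd vb z - h k z)%C <= eps / (2 * Nn) /\
      Cmod (fst vb z) * wt L z <= theta * (a0 * a0) / (16 * Nn) * K' /\
      ((forall y, Cmod (z - y)%C < s -> h k y = 0) -> snd vb z = 0)).
  { intros k; destruct (compact_support_bounded (h k) (Hhc k) (Hh1 k)) as [Gb HGb].
    destruct (HL (h k) Gb K' (eps / (2 * Nn)) s Hspos) as [v [b Hvb]]; auto.
    - apply compact_support_unif; auto.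
    - apply Rdiv_lt_0_compat; lra.
    - exists (v, b); exact Hvb. }
  set (sol := fun k => proj1_sig (constructive_indefinite_description _ (Hsol k))).
  assert (Hs : forall k z, Cmod z < 1 ->
      (exists A, rdiff (fst (sol k)) z A (snd (sol k) z)) /\ cont_at (snd (sol k)) z /\
      Cmod (snd (sol k) z - h k z)%C <= eps / (2 * Nn) /\
      Cmod (fst (sol k) z) * wt L z <= theta * (a0 * a0) / (16 * Nn) * K' /\
      ((forall y, Cmod (z - y)%C < s -> h k y = 0) -> snd (sol k) z = 0)).
  { intros k; exact (proj2_sig (constructive_indefinite_description _ (Hsol k))). }
  exists (fun z k => q z * fst (sol k) z)%C, (fun z k => q z * snd (sol k) z)%C.
  split; [intros k; unfold q; ring|]; split; [intros k; unfold q; ring|]; intros z Hz.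
  specialize (Hq2 z Hz).
  split; [|split; [|split; [|split]]].
  - intros k; destruct (Hs k z Hz) as [[A HA] _]; destruct (Hqd z) as [D HD].
    eexists; eapply rdiff_eq; [reflexivity| |apply (rdiff_mult _ _ _ _ _ _ _ HD HA)]; ring.
  - intros k; destruct (Hs k z Hz) as [_ [Hc _]]; destruct (Hqd z) as [D HD].
    apply cont_at_mult; auto; eapply cont_at_rdiff, HD.
  - apply Rle_trans with (INR n * (eps / Nn)).
    + apply cnorm_le_const; intros k; unfold vsub.
      destruct (Hs k z Hz) as [_ [_ [Hb _]]].
      assert (E : (q z * snd (sol k) z - g z k)%C = (q z * (snd (sol k) z - h k z))%C).
      { unfold h; destruct (Rlt_le_dec (Cmod z) (a0 / 2)) as [Hz'|Hz'].
        - rewrite Hg0 by auto; ring.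
        - specialize (Hq z Hz'); assert (Hqn : q z <> 0) by (apply Cmod_gt_0; lra); field; auto. }
      rewrite E, Cmod_mult.
      apply Rle_trans with (2 * (eps / (2 * Nn))); [apply Rmult_le_compat; auto; apply Cmod_ge_0|].
      right; field; lra.
    + apply Rmult_le_reg_r with Nn; [lra|].
      replace (INR n * (eps / Nn) * Nn) with (INR n * eps) by (field; lra).
      unfold Nn; lra.
  - assert (HK0 : 0 <= K).
    { eapply Rle_trans; [|apply (HgK z)]; apply Rmult_le_pos; [apply cnorm_ge_0|].
      left; apply wt_pos. }
    assert (Hw := wt_pos L z).
    apply Rle_trans with (INR n * (2 * (theta * (a0 * a0) / (16 * Nn) * K'))).
    + rewrite Rmult_comm; unfold cnorm; rewrite <- fsum_scal, <- fsum_const.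
      apply fsum_le; intros k; destruct (Hs k z Hz) as [_ [_ [_ [Hv _]]]].
      rewrite Cmod_mult.
      replace (wt L z * (Cmod (q z) * Cmod (fst (sol k) z))) with
        (Cmod (q z) * (Cmod (fst (sol k) z) * wt L z)) by ring.
      apply Rmult_le_compat; auto; [apply Cmod_ge_0|].
      apply Rmult_le_pos; [apply Cmod_ge_0|lra].
    + unfold K'.
      replace (INR n * (2 * (theta * (a0 * a0) / (16 * Nn) * (K / (a0 * a0 / 8))))) with
        (INR n / Nn * (theta * K)) by (field; lra).
      assert (INR n / Nn <= 1).
      { apply Rmult_le_reg_r with Nn; [lra|].
        replace (INR n / Nn * Nn) with (INR n) by (field; lra); unfold Nn; lra. }
      assert (0 <= theta * K) by (apply Rmult_le_pos; lra); nra.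
  - intros Hzero k; destruct (Hs k z Hz) as [_ [_ [_ [_ Hb]]]].
    rewrite Hb; [ring|]; intros y Hy; unfold h; rewrite Hzero by auto; ring.
Qed.

(** * Cut-off functions *)

(** The difference of two real-linear maps is o(h), hence vanishes on the unit vectors 1 and i;
    adding the two equations suitably isolates [2 * b]. *)
Lemma rdiff_unique (u : C -> C) (z A B A' B' : C) :
  rdiff u z A B -> rdiff u z A' B' -> B = B'.
Proof.
  intros H H'.
  set (a := (A - A')%C); set (b := (B - B')%C).
  assert (Hl : littleo (fun h => a * h + b * Cconj h)%C).
  { eapply littleo_ext; [|apply (littleo_plus _ _ H' (littleo_scal (- (1))%C _ H))].
    intros h; unfold a, b; simpl; ring. }
  assert (Hd : forall w : C, Cmod w = 1 -> (a * w + b * Cconj w)%C = 0).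
  { intros w Hw; apply Cmod_le_eps_eq; intros e He; destruct (Hl e He) as [d [Hd Hh]].
    specialize (Hh (RtoC (d / 2) * w)%C).
    rewrite Cmod_mult, Hw, Cmod_R, Rabs_pos_eq, Rmult_1_r in Hh by lra; specialize (Hh ltac:(lra)).
    assert (E : (a * (RtoC (d / 2) * w) + b * Cconj (RtoC (d / 2) * w))%C =
                (RtoC (d / 2) * (a * w + b * Cconj w))%C).
    { rewrite Cmult_conj; replace (Cconj (RtoC (d / 2))) with (RtoC (d / 2));
        [ring|apply injective_projections; simpl; ring]. }
    rewrite E, Cmod_mult, Cmod_R, Rabs_pos_eq in Hh by lra.
    replace (a * w + b * Cconj w - 0)%C with (a * w + b * Cconj w)%C by ring.
    apply Rmult_le_reg_l with (d / 2); lra. }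
  assert (E1 := Hd (RtoC 1) Cmod_1); assert (E2 := Hd Ci Cmod_Ci).
  assert (Hb : b = 0).
  { assert (C1 : Cconj (RtoC 1) = RtoC 1) by (apply injective_projections; simpl; ring).
    assert (C2 : Cconj Ci = (- Ci)%C) by (apply injective_projections; simpl; ring).
    rewrite C1 in E1; rewrite C2 in E2.
    assert (Hi : (Ci * Ci = - (1))%C) by (apply injective_projections; simpl; ring).
    assert (E3 : (2 * b)%C = 0).
    { replace (2 * b)%C with ((a * 1 + b * 1) + Ci * (a * Ci + b * - Ci) +
        (1 + Ci * Ci) * (b - a))%C by ring.
      rewrite E1, E2, Hi; ring. }
    replace b with (/ 2 * (2 * b))%C by (field; apply RtoC_neq_0; lra); rewrite E3; ring. }
  unfold b in Hb; replace B with ((B - B') + B')%C by ring; rewrite Hb; ring.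
Qed.

(** Selected by [epsilon]: the conjugate derivative where [u] is real differentiable, an arbitrary
    number elsewhere. *)
Definition dbar (u : C -> C) (z : C) : C :=
  epsilon (inhabits (RtoC 0)) (fun B => exists A, rdiff u z A B).

Lemma dbar_unique (u : C -> C) (z A B : C) : rdiff u z A B -> dbar u z = B.
Proof.
  intros H; assert (E : exists B, exists A, rdiff u z A B) by eauto.
  destruct (epsilon_spec (inhabits (RtoC 0)) _ E) as [A' H'].
  now apply rdiff_unique with u z A' A.
Qed.

Lemma dbar_rdiff (u : C -> C) (z : C) : (exists A B, rdiff u z A B) ->
  exists A, rdiff u z A (dbar u z).
Proof. intros [A [B H]]; exists A; now rewrite (dbar_unique u z A B). Qed.

Lemma dbar_ext_loc (u v : C -> C) (z : C) (d : R) : 0 < d ->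
  (forall h, Cmod h < d -> u (z + h)%C = v (z + h)%C) ->
  (exists A B, rdiff u z A B) -> dbar u z = dbar v z.
Proof.
  intros Hd E [A [B H]]; rewrite (dbar_unique u z A B H).
  symmetry; apply dbar_unique with A; eapply rdiff_ext_loc; eauto.
Qed.

Definition psq (x : R) : R := Rmax x 0 * Rmax x 0.

Lemma is_derive_psq (x : R) : is_derive psq x (2 * Rmax x 0).
Proof.
  destruct (Rtotal_order x 0) as [H|[H|H]].
  - rewrite Rmax_right by lra; apply is_derive_ext_loc with (fun _ => 0).
    + exists (mkposreal (- x) ltac:(lra)); intros y Hy.
      apply Rabs_lt_between in Hy; simpl in Hy; unfold minus, plus, opp in Hy; simpl in Hy.
      unfold psq; rewrite Rmax_right by lra; lra.
    + auto_derive; auto; ring.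
  - subst x; rewrite Rmax_left by lra; apply is_derive_Reals; intros eps He.
    exists (mkposreal eps He); simpl; intros h Hh Hhe.
    unfold psq; rewrite Rplus_0_l, (Rmax_left 0 0) by lra.
    replace ((Rmax h 0 * Rmax h 0 - 0 * 0) / h - 2 * 0) with (Rmax h 0 * Rmax h 0 / h) by (field; auto).
    unfold Rmax; destruct (Rle_dec h 0).
    + replace (0 * 0 / h) with 0 by (field; auto); now rewrite Rabs_R0.
    + replace (h * h / h) with h by (field; auto); auto.
  - rewrite Rmax_left by lra; apply is_derive_ext_loc with (fun y => y * y).
    + exists (mkposreal x H); intros y Hy.
      apply Rabs_lt_between in Hy; simpl in Hy; unfold minus, plus, opp in Hy; simpl in Hy.
      unfold psq; rewrite Rmax_left by lra; auto.
    + auto_derive; auto; ring.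
Qed.

(** Composing the C^1 function [psq] with itself gives an explicit C^1 step from 1 at [s <= 0] to 0
    at [s >= 1]. *)
Definition cutoff (s : R) : R := psq (1 - psq s).
Definition cutoff' (s : R) : R := - (4 * Rmax (1 - psq s) 0 * Rmax s 0).

Lemma is_derive_cutoff (s : R) : is_derive cutoff s (cutoff' s).
Proof.
  assert (H : is_derive (fun s => 1 - psq s) s (- (2 * Rmax s 0))).
  { replace (- (2 * Rmax s 0)) with (0 - 2 * Rmax s 0) by ring.
    apply (is_derive_minus (V := R_NormedModule)); [|apply is_derive_psq].
    apply (is_derive_const (V := R_NormedModule)). }
  assert (H2 := is_derive_comp psq (fun s => 1 - psq s) s _ _ (is_derive_psq (1 - psq s)) H).
  unfold cutoff, cutoff'.
  replace (- (4 * Rmax (1 - psq s) 0 * Rmax s 0)) with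
    (- (2 * Rmax s 0) * (2 * Rmax (1 - psq s) 0)) by ring; exact H2.
Qed.

Lemma psq_bounds (s : R) : 0 <= psq s.
Proof. unfold psq; assert (H := Rmax_r s 0); nra. Qed.

Lemma cutoff_1 (s : R) : s <= 0 -> cutoff s = 1 /\ cutoff' s = 0.
Proof.
  intros H; unfold cutoff, cutoff', psq; rewrite (Rmax_right s) by auto; split; [|ring].
  rewrite Rmax_left by lra; ring.
Qed.

Lemma cutoff_0 (s : R) : 1 <= s -> cutoff s = 0 /\ cutoff' s = 0.
Proof.
  intros H; unfold cutoff, cutoff'.
  assert (Hp : 1 - psq s <= 0) by (unfold psq; rewrite Rmax_left by lra; nra).
  unfold psq at 1; rewrite Rmax_right by auto; split; ring.
Qed.

Lemma cutoff_bounds (s : R) : 0 <= cutoff s <= 1.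
Proof.
  unfold cutoff; split; [apply psq_bounds|].
  assert (H := psq_bounds s); unfold psq at 1.
  assert (H1 := Rmax_r (1 - psq s) 0); assert (Rmax (1 - psq s) 0 <= 1) by (apply Rmax_lub; lra); nra.
Qed.

Lemma cutoff'_bound (s : R) : Rabs (cutoff' s) <= 4.
Proof.
  destruct (Rle_lt_dec 1 s) as [H|H]; [rewrite (proj2 (cutoff_0 s H)), Rabs_R0; lra|].
  unfold cutoff'; rewrite Rabs_Ropp.
  assert (H1 := psq_bounds s); assert (H2 := Rmax_r (1 - psq s) 0); assert (H3 := Rmax_r s 0).
  assert (Rmax (1 - psq s) 0 <= 1) by (apply Rmax_lub; lra).
  assert (Rmax s 0 <= 1) by (apply Rmax_lub; lra).
  rewrite Rabs_pos_eq by (repeat apply Rmult_le_pos; lra); nra.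
Qed.

Lemma cont_at_Rmax0 (s : C -> R) (z : C) : cont_at (fun x => RtoC (s x)) z ->
  cont_at (fun x => RtoC (Rmax (s x) 0)) z.
Proof.
  intros H e He; destruct (H e He) as [d [Hd Hh]]; exists d; split; auto; intros y Hy.
  eapply Rle_lt_trans; [|apply (Hh y Hy)]; rewrite <- !RtoC_minus, !Cmod_R.
  unfold Rmax; repeat destruct (Rle_dec _ _); unfold Rabs; repeat destruct (Rcase_abs _); lra.
Qed.

Lemma cont_at_ext (u v : C -> C) (z : C) : (forall x, u x = v x) -> cont_at u z -> cont_at v z.
Proof. intros E; apply cont_at_ext_loc with 1; [lra|auto]. Qed.

Lemma cont_at_cutoff' (s : C -> R) (z : C) : cont_at (fun x => RtoC (s x)) z ->
  cont_at (fun x => RtoC (cutoff' (s x))) z.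
Proof.
  intros H.
  assert (H1 := cont_at_Rmax0 s z H).
  assert (H2 : cont_at (fun x => RtoC (1 - psq (s x))) z).
  { eapply cont_at_ext with
      (fun x => RtoC 1 + - (1) * (RtoC (Rmax (s x) 0) * RtoC (Rmax (s x) 0)))%C.
    - intros x; unfold psq; rewrite RtoC_minus, RtoC_mult; ring.
    - apply cont_at_plus; [apply cont_at_const|]; apply cont_at_mult; [apply cont_at_const|].
      now apply cont_at_mult. }
  eapply cont_at_ext with
    (fun x => RtoC (- 4) * (RtoC (Rmax (1 - psq (s x)) 0) * RtoC (Rmax (s x) 0)))%C.
  - intros x; unfold cutoff'; rewrite <- !RtoC_mult; f_equal; ring.
  - apply cont_at_mult; [apply cont_at_const|]; apply cont_at_mult; auto.
    now apply (cont_at_Rmax0 (fun x => 1 - psq (s x))).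
Qed.

(* [chi c r] is 1 on |z - c| <= 2 r and vanishes for |z - c| >= (5/2) r. *)
Definition chi_arg (c : C) (r : R) (z : C) : R := (nrm2 (z - c) / (r * r) - 4) * (4 / 9).
Definition chi (c : C) (r : R) (z : C) : R := cutoff (chi_arg c r z).
Definition dchi (c : C) (r : R) (z : C) : C :=
  (RtoC (cutoff' (chi_arg c r z)) * (RtoC (4 / 9 / (r * r)) * (z - c)))%C.

Lemma rdiff_chi_arg (c : C) (r : R) (z : C) : 0 < r ->
  exists A, rdiff (fun x => RtoC (chi_arg c r x)) z A (RtoC (4 / 9 / (r * r)) * (z - c))%C.
Proof.
  intros Hr.
  assert (H := rdiff_comp_affine (fun x => RtoC (nrm2 x)) 1 c z _ _
    (rdiff_nrm2 (RtoC 1 * (z - c))%C)).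
  assert (E : forall x, (RtoC 1 * (x - c))%C = (x - c)%C) by (intros; ring).
  assert (H1 := rdiff_minus _ _ _ _ _ _ _ (rdiff_scal (RtoC (4 / 9 / (r * r))) _ _ _ _ H)
    (rdiff_const (RtoC (16 / 9)) z)).
  eexists; eapply rdiff_ext; [|eapply rdiff_eq; [reflexivity| |exact H1]].
  - intros x; cbv beta; rewrite E, <- RtoC_mult, <- RtoC_minus; f_equal; unfold chi_arg; field; lra.
  - cbv beta; rewrite E; ring.
Qed.

Lemma rdiff_chi (c : C) (r : R) (z : C) : 0 < r ->
  exists A, rdiff (fun x => RtoC (chi c r x)) z A (dchi c r z).
Proof.
  intros Hr; destruct (rdiff_chi_arg c r z Hr) as [A HA].
  eexists; apply (rdiff_real_comp cutoff (chi_arg c r) z _ _ _ (is_derive_cutoff _) HA).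
Qed.

Lemma cont_at_dchi (c : C) (r : R) (z : C) : 0 < r -> cont_at (dchi c r) z.
Proof.
  intros Hr; destruct (rdiff_chi_arg c r z Hr) as [A HA].
  apply cont_at_mult; [apply cont_at_cutoff'; eapply cont_at_rdiff, HA|].
  apply cont_at_mult; [apply cont_at_const|].
  eapply cont_at_rdiff, rdiff_minus; [apply rdiff_id|apply rdiff_const].
Qed.

Lemma chi_bounds (c : C) (r : R) (z : C) : 0 <= chi c r z <= 1.
Proof. apply cutoff_bounds. Qed.

Lemma chi_inside (c : C) (r : R) (z : C) : 0 < r -> Cmod (z - c)%C <= 2 * r ->
  chi c r z = 1 /\ dchi c r z = 0.
Proof.
  intros Hr Hz.
  assert (H : chi_arg c r z <= 0).
  { unfold chi_arg; rewrite nrm2_Cmod; assert (H := Cmod_ge_0 (z - c)%C).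
    assert (Cmod (z - c)%C * Cmod (z - c)%C / (r * r) <= 4); [|lra].
    apply Rmult_le_reg_r with (r * r); [nra|].
    replace (Cmod (z - c)%C * Cmod (z - c)%C / (r * r) * (r * r)) with
      (Cmod (z - c)%C * Cmod (z - c)%C) by (field; lra); nra. }
  destruct (cutoff_1 _ H) as [H1 H2]; unfold chi, dchi; rewrite H2; split; auto; ring.
Qed.

Lemma chi_outside (c : C) (r : R) (z : C) : 0 < r -> 5 / 2 * r <= Cmod (z - c)%C ->
  chi c r z = 0 /\ dchi c r z = 0.
Proof.
  intros Hr Hz.
  assert (H : 1 <= chi_arg c r z).
  { unfold chi_arg; rewrite nrm2_Cmod; assert (H := Cmod_ge_0 (z - c)%C).
    assert (25 / 4 <= Cmod (z - c)%C * Cmod (z - c)%C / (r * r)); [|lra].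
    apply Rmult_le_reg_r with (r * r); [nra|].
    replace (Cmod (z - c)%C * Cmod (z - c)%C / (r * r) * (r * r)) with
      (Cmod (z - c)%C * Cmod (z - c)%C) by (field; lra); nra. }
  destruct (cutoff_0 _ H) as [H1 H2]; unfold chi, dchi; rewrite H2; split; auto; ring.
Qed.

Lemma dchi_bound (c : C) (r : R) (z : C) : 0 < r -> Cmod (dchi c r z) <= 5 / r.
Proof.
  intros Hr; destruct (Rle_lt_dec (5 / 2 * r) (Cmod (z - c)%C)) as [H|H].
  { rewrite (proj2 (chi_outside c r z Hr H)), Cmod_0; left; apply Rdiv_lt_0_compat; lra. }
  unfold dchi; rewrite !Cmod_mult, !Cmod_R.
  assert (Hp : 0 < 4 / 9 / (r * r)) by (apply Rdiv_lt_0_compat; nra).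
  rewrite (Rabs_pos_eq (4 / 9 / (r * r))) by lra.
  assert (H1 := cutoff'_bound (chi_arg c r z)); assert (H2 := Rabs_pos (cutoff' (chi_arg c r z))).
  assert (H3 := Cmod_ge_0 (z - c)%C).
  apply Rle_trans with (4 * (4 / 9 / (r * r) * (5 / 2 * r))).
  - apply Rmult_le_compat; auto; [apply Rmult_le_pos; lra|]; apply Rmult_le_compat_l; lra.
  - replace (4 * (4 / 9 / (r * r) * (5 / 2 * r))) with (40 / 9 / r) by (field; lra).
    apply Rmult_le_compat_r; [left; now apply Rinv_0_lt_compat|lra].
Qed.

(** A merely continuous cut-off for the right-hand side of the equation. The correction itself is
    cut off by [chi], which has to be differentiable. *)
Definition ramp (lo hi t : R) : R := Rmax (Rmin 1 ((hi - t) / (hi - lo))) 0.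

Lemma ramp_bounds (lo hi t : R) : 0 <= ramp lo hi t <= 1.
Proof. unfold ramp; split; [apply Rmax_r|]; apply Rmax_lub; [apply Rmin_l|lra]. Qed.

Lemma ramp_1 (lo hi t : R) : lo < hi -> t <= lo -> ramp lo hi t = 1.
Proof.
  intros H Ht; unfold ramp; rewrite Rmin_left; [apply Rmax_left; lra|].
  apply Rmult_le_reg_r with (hi - lo); [lra|].
  replace ((hi - t) / (hi - lo) * (hi - lo)) with (hi - t) by (field; lra); lra.
Qed.

Lemma ramp_0 (lo hi t : R) : lo < hi -> hi <= t -> ramp lo hi t = 0.
Proof.
  intros H Ht; unfold ramp; rewrite Rmax_right; auto.
  eapply Rle_trans; [apply Rmin_r|].
  apply Rmult_le_reg_r with (hi - lo); [lra|].
  replace ((hi - t) / (hi - lo) * (hi - lo)) with (hi - t) by (field; lra); lra.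
Qed.

Lemma cont_at_ramp (lo hi : R) (c z : C) : lo < hi ->
  cont_at (fun x => RtoC (ramp lo hi (Cmod (x - c)%C))) z.
Proof.
  intros H e He; exists (e * (hi - lo)); split; [apply Rmult_lt_0_compat; lra|]; intros y Hy.
  rewrite <- RtoC_minus, Cmod_R.
  assert (T : Rabs (Cmod (y - c)%C - Cmod (z - c)%C) <= Cmod (y - z)%C).
  { apply Rabs_le; assert (T1 := Cmod_triangle3 y z c); assert (T2 := Cmod_triangle3 z y c).
    rewrite (Cmod_minus_sym z y) in T2; lra. }
  assert (L : Rabs (ramp lo hi (Cmod (y - c)%C) - ramp lo hi (Cmod (z - c)%C)) <=
    Rabs ((hi - Cmod (y - c)%C) / (hi - lo) - (hi - Cmod (z - c)%C) / (hi - lo))).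
  { unfold ramp, Rmax, Rmin; repeat destruct (Rle_dec _ _); unfold Rabs;
      repeat destruct (Rcase_abs _); lra. }
  eapply Rle_lt_trans; [apply L|].
  replace ((hi - Cmod (y - c)%C) / (hi - lo) - (hi - Cmod (z - c)%C) / (hi - lo)) with
    (- ((Cmod (y - c)%C - Cmod (z - c)%C) / (hi - lo))) by (field; lra).
  rewrite Rabs_Ropp; unfold Rdiv; rewrite Rabs_mult, (Rabs_pos_eq (/ _))
    by (left; apply Rinv_0_lt_compat; lra).
  apply Rmult_lt_reg_r with (hi - lo); [lra|].
  rewrite Rmult_assoc, Rinv_l, Rmult_1_r by lra; lra.
Qed.

(** * Modifying a map in one chart *)

(** A disc in the parameter plane with a chart. Four concentric radii matter: the discs of radius
    [cr] cover, [chi] is 1 up to [2 * cr] and 0 from [5 / 2 * cr] on, estimates are made within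
    [3 * cr], and [4 * cr] still lies in the unit disc. *)
Record cell {n : nat} (M : complex_manifold n) := Cell
  { cc : C; cr : R; cj : chart_idx M }.
Arguments cc {n M} _.
Arguments cr {n M} _.
Arguments cj {n M} _.

Lemma rdiff_vec_choice {n : nat} (u : C -> Cn n) (z : C) :
  (forall k, exists A B, rdiff (fun x => u x k) z A B) ->
  exists A : Cn n, forall k, rdiff (fun x => u x k) z (A k) (dbar (fun x => u x k) z).
Proof.
  intros H.
  exists (fun k => proj1_sig (constructive_indefinite_description _ (dbar_rdiff _ z (H k)))).
  intros k; exact (proj2_sig (constructive_indefinite_description _ (dbar_rdiff _ z (H k)))).
Qed.

Lemma open_disc_near (c z : C) (r : R) : Cmod (z - c)%C < r ->
  exists d, 0 < d /\ forall y, Cmod (y - z)%C < d -> Cmod (y - c)%C < r.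
Proof.
  intros H; exists (r - Cmod (z - c)%C); split; [lra|]; intros y Hy.
  assert (T := Cmod_triangle3 y z c); lra.
Qed.

Lemma open_disc_compl_near (c z : C) (r : R) : r < Cmod (z - c)%C ->
  exists d, 0 < d /\ forall y, Cmod (y - z)%C < d -> r < Cmod (y - c)%C.
Proof.
  intros H; exists (Cmod (z - c)%C - r); split; [lra|]; intros y Hy.
  assert (T := Cmod_triangle3 z y c); rewrite (Cmod_minus_sym z y) in T; lra.
Qed.

Section Cells.
Context {n : nat} (M : complex_manifold n) (f : C -> M).
Variables (cells : list (cell M)) (eta0 : R).

Definition inD (p : cell M) (z : C) : Prop := Cmod (z - cc p)%C < 3 * cr p.
Definition loc (p : cell M) (g : C -> M) (z : C) : Cn n := chart M (cj p) (g z).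
Definition eb (p : cell M) (g : C -> M) (z : C) : Cn n := fun k => dbar (fun x => loc p g x k) z.

(** The regularity that survives every correction. Closeness to [f] keeps [g] inside the tubes
    around [f], and continuity of the conjugate derivative is what the solver asks of its right-hand
    side. *)
Definition state (g : C -> M) (del : R) : Prop :=
  forall p, In p cells -> forall z, inD p z ->
    cdom M (cj p) (g z) /\ cnorm (vsub (loc p g z) (loc p f z)) <= del /\
    (forall k, exists A B, rdiff (fun x => loc p g x k) z A B) /\
    (forall k, cont_at (fun x => eb p g x k) z).

Hypotheses (He0 : 0 < eta0 <= 1).
Hypothesis (Hrad : forall p, In p cells -> 0 < cr p).
Hypothesis (Htube : forall p q, In p cells -> In q cells ->
  forall z, inD p z -> inD q z -> tube M (cj p) (cj q) (f z) eta0).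

Lemma cont_M_of_cell (g : C -> M) (p : cell M) (z : C) : inD p z ->
  (forall y, inD p y -> cdom M (cj p) (g y)) ->
  (forall k, exists A B, rdiff (fun x => loc p g x k) z A B) -> cont_M M g z.
Proof.
  intros Hz Hd Hr; destruct (open_disc_near _ _ _ Hz) as [d [Hd' H]].
  apply cont_M_of_chart with (cj p) d; auto.
  - intros y Hy; apply Hd, H, Hy.
  - intros k; destruct (Hr k) as [A [B HAB]]; now apply cont_at_rdiff with A B.
Qed.

(** Holomorphic transition maps do not mix the two Wirtinger derivatives, so the error vector seen
    in another cell is the image under [L] of the one seen here. *)
Lemma eb_change (g : C -> M) (p q : cell M) (z : C) : cont_M M g z ->
  cdom M (cj p) (g z) -> cdom M (cj q) (g z) ->
  (forall k, exists A B, rdiff (fun x => loc p g x k) z A B) ->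
  (forall k, exists A B, rdiff (fun x => loc q g x k) z A B) /\
  exists L, fderiv (trans M (cj p) (cj q)) (loc p g z) L /\ eb q g z = lapp L (eb p g z).
Proof.
  intros Hc Hp Hq Hr.
  destruct (rdiff_vec_choice (loc p g) z Hr) as [A HA].
  destruct (trans_fderiv M (cj p) (cj q) (g z) Hp Hq) as [L HL].
  assert (H := rdiff_chart_change M g z (cj p) (cj q) A (eb p g z) L Hc Hp Hq HL HA).
  split; [intros k; do 2 eexists; apply H|].
  exists L; split; auto; apply functional_extensionality; intros k.
  apply dbar_unique with (lapp L A k); apply H.
Qed.

Lemma state_cont_M (g : C -> M) (del : R) (p : cell M) (z : C) :
  state g del -> In p cells -> inD p z -> cont_M M g z.
Proof.
  intros Hs Hp Hz; apply cont_M_of_cell with p; auto.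
  - intros y Hy; now apply (Hs p Hp y Hy).
  - now apply (Hs p Hp z Hz).
Qed.

Lemma state_compare (g : C -> M) (del : R) (p q : cell M) (z : C) :
  state g del -> del < eta0 -> In p cells -> In q cells -> inD p z -> inD q z ->
  cnorm (eb q g z) <= / eta0 * cnorm (eb p g z).
Proof.
  intros Hs Hdel Hp Hq Hpz Hqz.
  destruct (Hs p Hp z Hpz) as [H1 [H2 [H3 _]]]; destruct (Hs q Hq z Hqz) as [H4 _].
  destruct (eb_change g p q z (state_cont_M g del p z Hs Hp Hpz) H1 H4 H3) as [_ [L [HL ->]]].
  apply (Htube p q Hp Hq z Hpz Hqz) with (loc p g z); auto.
  eapply Rle_lt_trans; [apply H2|auto].
Qed.

Lemma eb_ext (g g' : C -> M) (p : cell M) (z : C) (d : R) : 0 < d ->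
  (forall y, Cmod (y - z)%C < d -> g' y = g y) ->
  (forall k, exists A B, rdiff (fun x => loc p g x k) z A B) ->
  eb p g' z = eb p g z.
Proof.
  intros Hd E Hr; apply functional_extensionality; intros k; symmetry.
  apply dbar_ext_loc with d; auto.
  intros h Hh; unfold loc; rewrite E; auto; now replace (z + h - z)%C with h by ring.
Qed.

(** In the chart of [j] the map becomes [g - chi v], and elsewhere it is unchanged. By the product
    rule the error changes by [chi beta], the intended correction, and by [dchi v], the price of the
    cut-off. The displacement [tau] becomes [tau / eta0] in the other charts. *)
Lemma cell_step (g : C -> M) (del tau : R) (j : cell M) (v beta : C -> Cn n) :
  state g del -> In j cells -> 0 <= tau -> del + tau / eta0 < eta0 ->
  (forall z, inD j z -> cnorm (v z) <= tau /\
     (forall k, exists A, rdiff (fun x => v x k) z A (beta z k)) /\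
     (forall k, cont_at (fun x => beta x k) z)) ->
  exists g', state g' (del + tau / eta0) /\
    (forall p z, In p cells -> inD p z -> cnorm (vsub (loc p g' z) (loc p g z)) <= tau / eta0) /\
    (forall z, 5 / 2 * cr j < Cmod (z - cc j)%C -> g' z = g z) /\
    (forall z, inD j z ->
       loc j g' z = vsub (loc j g z) (vscale (RtoC (chi (cc j) (cr j) z)) (v z)) /\
       forall k, eb j g' z k = (eb j g z k -
         (RtoC (chi (cc j) (cr j) z) * beta z k + dchi (cc j) (cr j) z * v z k))%C).
Proof.
  intros Hs Hj Htau Hdel Hv.
  assert (Hr := Hrad j Hj).
  assert (Ht1 : tau <= tau / eta0).
  { apply Rmult_le_reg_r with eta0; [lra|].
    replace (tau / eta0 * eta0) with tau by (field; lra); nra. }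
  set (X := chi (cc j) (cr j)).
  set (nw := fun z => vsub (loc j g z) (vscale (RtoC (X z)) (v z))).
  (* The two branches agree between [5 / 2 * cr] and [3 * cr], where [chi] is 0; hence regularity is
     checked either in the chart of [j] or where the map has not changed. *)
  set (g' := fun z => if Rlt_dec (Cmod (z - cc j)%C) (3 * cr j)
    then cinv M (cj j) (g z) (nw z) else g z).
  assert (Hnw : forall z, inD j z -> cnorm (vsub (nw z) (loc j g z)) <= tau).
  { intros z Hz; rewrite (cnorm_opp _ (vscale (RtoC (X z)) (v z)))
      by (intros k; unfold nw, vsub; ring).
    rewrite cnorm_scale, Cmod_R; destruct (chi_bounds (cc j) (cr j) z) as [B1 B2].
    rewrite Rabs_pos_eq by exact B1.
    destruct (Hv z Hz) as [V1 _]; assert (V0 := cnorm_ge_0 (v z)); unfold X; nra. }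
  assert (Hnwf : forall z, inD j z -> cnorm (vsub (nw z) (loc j f z)) < eta0).
  { intros z Hz; eapply Rle_lt_trans; [apply (cnorm_sub_triangle _ (loc j g z))|].
    specialize (Hnw z Hz); destruct (Hs j Hj z Hz) as [_ [N _]]; lra. }
  assert (FA : forall z, inD j z -> cdom M (cj j) (g' z) /\ loc j g' z = nw z).
  { intros z Hz; unfold loc, g'; destruct (Rlt_dec _ _) as [_|H]; [|elim H; exact Hz].
    apply cinv_spec; destruct (proj1 (Htube j j Hj Hj z Hz Hz) (nw z) (Hnwf z Hz)) as [y [Y1 [_ Y2]]].
    eauto. }
  assert (FB : forall z, 5 / 2 * cr j < Cmod (z - cc j)%C -> g' z = g z).
  { intros z Hz; unfold g'; destruct (Rlt_dec _ _) as [H|H]; auto.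
    replace (nw z) with (loc j g z).
    - apply cinv_chart; now apply (Hs j Hj z).
    - apply functional_extensionality; intros k; unfold nw, vsub, vscale, X.
      rewrite (proj1 (chi_outside (cc j) (cr j) z Hr ltac:(lra))); ring. }
  assert (FD : forall p z, In p cells -> inD p z -> cdom M (cj p) (g' z)).
  { intros p z Hp Hz; destruct (Rlt_dec (Cmod (z - cc j)%C) (3 * cr j)) as [H|H].
    - destruct (FA z H) as [A1 A2]; apply (tube_dom M (cj j) (cj p) (f z) (g' z) eta0); auto.
      change (cnorm (vsub (loc j g' z) (loc j f z)) < eta0); rewrite A2; auto.
    - rewrite FB by lra; now apply (Hs p Hp z). }
  assert (FC : forall p z, In p cells -> inD p z ->
     cnorm (vsub (loc p g' z) (loc p g z)) <= tau / eta0).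
  { intros p z Hp Hz; destruct (Rlt_dec (Cmod (z - cc j)%C) (3 * cr j)) as [H|H].
    - destruct (FA z H) as [A1 A2]; destruct (Hs j Hj z H) as [S1 [S2 _]].
      eapply Rle_trans; [apply (tube_lip M (cj j) (cj p) (f z) (g' z) (g z) eta0); auto|].
      + change (cnorm (vsub (loc j g' z) (loc j f z)) < eta0); rewrite A2; auto.
      + eapply Rle_lt_trans; [apply S2|lra].
      + change (/ eta0 * cnorm (vsub (loc j g' z) (loc j g z)) <= tau / eta0); rewrite A2.
        unfold Rdiv; rewrite Rmult_comm; apply Rmult_le_compat_r; auto.
        left; apply Rinv_0_lt_compat; lra.
    - unfold loc; rewrite FB by lra; rewrite cnorm_sub_diag; lra. }
  assert (FR : forall z, inD j z -> forall k, exists A, rdiff (fun x => loc j g' x k) z A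
     (eb j g z k - (RtoC (X z) * beta z k + dchi (cc j) (cr j) z * v z k))%C).
  { intros z Hz k.
    destruct (Hs j Hj z Hz) as [_ [_ [S3 _]]].
    destruct (dbar_rdiff _ z (S3 k)) as [A HA].
    destruct (rdiff_chi (cc j) (cr j) z Hr) as [A' HA'].
    destruct (Hv z Hz) as [_ [V _]]; destruct (V k) as [A'' HA''].
    destruct (open_disc_near _ _ _ Hz) as [d [Hd Hnear]].
    eexists; eapply rdiff_ext_loc with (u := (fun x => loc j g x k - RtoC (X x) * v x k)%C) (d := d);
      auto.
    - intros h Hh; rewrite (proj2 (FA (z + h)%C ltac:(apply Hnear;
        now replace (z + h - z)%C with h by ring))); reflexivity.
    - eapply rdiff_eq; [reflexivity| |apply rdiff_minus; [exact HA|apply rdiff_mult;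
        [exact HA'|exact HA'']]].
      unfold eb, X; ring. }
  assert (FE : forall z, inD j z -> forall k, eb j g' z k =
     (eb j g z k - (RtoC (X z) * beta z k + dchi (cc j) (cr j) z * v z k))%C).
  { intros z Hz k; destruct (FR z Hz k) as [A HA]; now apply dbar_unique with A. }
  assert (FEc : forall z, inD j z -> forall k, cont_at (fun x => eb j g' x k) z).
  { intros z Hz k; destruct (open_disc_near _ _ _ Hz) as [d [Hd Hnear]].
    apply cont_at_ext_loc with (fun x => eb j g x k + - (1) *
       (RtoC (X x) * beta x k + dchi (cc j) (cr j) x * v x k))%C d; auto.
    - intros y Hy; rewrite FE by (now apply Hnear); ring.
    - apply cont_at_plus; [now apply (Hs j Hj z Hz)|].
      apply cont_at_mult; [apply cont_at_const|].
      destruct (Hv z Hz) as [_ [V1 V2]]; destruct (V1 k) as [A HA].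
      destruct (rdiff_chi (cc j) (cr j) z Hr) as [A' HA'].
      apply cont_at_plus; apply cont_at_mult; auto.
      + eapply cont_at_rdiff, HA'.
      + now apply cont_at_dchi.
      + eapply cont_at_rdiff, HA. }
  assert (FRe : forall z, inD j z -> forall k, exists A B, rdiff (fun x => loc j g' x k) z A B).
  { intros z Hz k; destruct (FR z Hz k) as [A HA]; eauto. }
  assert (FM : forall z, inD j z -> cont_M M g' z).
  { intros z Hz; apply cont_M_of_cell with j; auto; intros y Hy; now apply FA. }
  exists g'; split; [|split; [exact FC|split; [exact FB|]]].
  2:{ intros z Hz; split; [now apply FA|]; intros k; now apply FE. }
  intros p Hp z Hz.
  split; [now apply FD|]; split.
  { eapply Rle_trans; [apply (cnorm_sub_triangle _ (loc p g z))|].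
    specialize (FC p z Hp Hz); destruct (Hs p Hp z Hz) as [_ [N _]]; lra. }
  destruct (Rlt_dec (Cmod (z - cc j)%C) (3 * cr j)) as [H|H].
  - split.
    { apply (eb_change g' j p z); auto; now apply FA. }
    (* continuity of y |-> L_y (eb j g' y), with L_y the derivative of the chart change *)
    intros k e He.
    destruct (Htube j p Hj Hp z H Hz) as [_ [_ [T3 T4]]].
    assert (Hch : forall y, inD j y -> inD p y -> exists L,
       fderiv (trans M (cj j) (cj p)) (loc j g' y) L /\ eb p g' y = lapp L (eb j g' y)).
    { intros y Hy Hy'; apply (eb_change g' j p y); auto; now apply FA. }
    destruct (Hch z H Hz) as [Lz [HLz Ez]].
    assert (Wz : cnorm (vsub (loc j g' z) (loc j f z)) < eta0) by (rewrite (proj2 (FA z H)); auto).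
    set (Q := cnorm (eb j g' z) + 1).
    assert (HQ : 1 <= Q) by (unfold Q; assert (T := cnorm_ge_0 (eb j g' z)); lra).
    set (e1 := Rmin (eta0 - cnorm (vsub (loc j g' z) (loc j f z))) (e * eta0 / (4 * Q))).
    assert (He1 : 0 < e1).
    { apply Rmin_pos; [lra|]; apply Rdiv_lt_0_compat; nra. }
    set (e2 := Rmin 1 (e * eta0 / 4)).
    assert (He2 : 0 < e2) by (apply Rmin_pos; nra).
    assert (Wc : forall l, cont_at (fun y => loc j g' y l) z).
    { intros l; destruct (FRe z H l) as [A [B HAB]]; now apply cont_at_rdiff with A B. }
    destruct (vec_cont (loc j g') z Wc e1 He1) as [d1 [Hd1 W1]].
    destruct (vec_cont (eb j g') z (FEc z H) e2 He2) as [d2 [Hd2 W2]].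
    destruct (open_disc_near _ _ _ H) as [d3 [Hd3 W3]].
    destruct (open_disc_near _ _ _ Hz) as [d4 [Hd4 W4]].
    exists (Rmin (Rmin d1 d2) (Rmin d3 d4)); split; [now repeat apply Rmin_pos|]; intros y Hy.
    assert (Y1 : Cmod (y - z)%C < d1) by (eapply Rlt_le_trans; [apply Hy|];
      eapply Rle_trans; [apply Rmin_l|apply Rmin_l]).
    assert (Y2 : Cmod (y - z)%C < d2) by (eapply Rlt_le_trans; [apply Hy|];
      eapply Rle_trans; [apply Rmin_l|apply Rmin_r]).
    assert (Y3 : Cmod (y - z)%C < d3) by (eapply Rlt_le_trans; [apply Hy|];
      eapply Rle_trans; [apply Rmin_r|apply Rmin_l]).
    assert (Y4 : Cmod (y - z)%C < d4) by (eapply Rlt_le_trans; [apply Hy|];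
      eapply Rle_trans; [apply Rmin_r|apply Rmin_r]).
    destruct (Hch y (W3 y Y3) (W4 y Y4)) as [Ly [HLy Ey]].
    specialize (W1 y Y1); specialize (W2 y Y2).
    assert (W1a : cnorm (vsub (loc j g' y) (loc j g' z)) <
       eta0 - cnorm (vsub (loc j g' z) (loc j f z))) by (eapply Rlt_le_trans; [apply W1|apply Rmin_l]).
    assert (W1b : cnorm (vsub (loc j g' y) (loc j g' z)) < e * eta0 / (4 * Q))
      by (eapply Rlt_le_trans; [apply W1|apply Rmin_r]).
    assert (W2a : cnorm (vsub (eb j g' y) (eb j g' z)) < 1)
      by (eapply Rlt_le_trans; [apply W2|apply Rmin_l]).
    assert (W2b : cnorm (vsub (eb j g' y) (eb j g' z)) < e * eta0 / 4)
      by (eapply Rlt_le_trans; [apply W2|apply Rmin_r]).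
    assert (Wy : cnorm (vsub (loc j g' y) (loc j f z)) < eta0).
    { eapply Rle_lt_trans; [apply (cnorm_sub_triangle _ (loc j g' z))|]; lra. }
    assert (QE : cnorm (eb j g' y) <= Q).
    { assert (T := cnorm_triangle (eb j g' z) (vsub (eb j g' y) (eb j g' z))).
      rewrite vadd_sub in T; unfold Q; lra. }
    rewrite Ey, Ez.
    assert (I1 := T4 _ _ _ _ (eb j g' y) Wy Wz HLy HLz).
    assert (I2 := T3 _ _ (vsub (eb j g' y) (eb j g' z)) Wz HLz).
    assert (E2 : (lapp Ly (eb j g' y) k - lapp Lz (eb j g' z) k)%C =
      (vsub (lapp Ly (eb j g' y)) (lapp Lz (eb j g' y)) k +
       lapp Lz (vsub (eb j g' y) (eb j g' z)) k)%C).
    { unfold vsub at 1.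
      assert (E3 : lapp Lz (vsub (eb j g' y) (eb j g' z)) k =
         (lapp Lz (eb j g' y) k - lapp Lz (eb j g' z) k)%C).
      { unfold lapp, vsub.
        replace (csum n (fun l => Lz k l * eb j g' y l) - csum n (fun l => Lz k l * eb j g' z l))%C
          with (csum n (fun l => Lz k l * eb j g' y l) +
                (- (1)) * csum n (fun l => Lz k l * eb j g' z l))%C by ring.
        rewrite <- csum_scal, <- csum_plus; apply csum_ext; intros l; ring. }
      rewrite E3; ring. }
    rewrite E2; eapply Rle_lt_trans; [apply Cmod_triangle|].
    eapply Rle_lt_trans; [apply Rplus_le_compat; apply cnorm_comp|].
    assert (Ie : 0 < / eta0) by (apply Rinv_0_lt_compat; lra).
    assert (J1 : / eta0 * cnorm (vsub (loc j g' y) (loc j g' z)) * cnorm (eb j g' y) <= e / 4).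
    { apply Rle_trans with (/ eta0 * (e * eta0 / (4 * Q)) * Q).
      - apply Rmult_le_compat; try apply cnorm_ge_0; auto.
        + apply Rmult_le_pos; [lra|apply cnorm_ge_0].
        + apply Rmult_le_compat_l; lra.
      - right; field; lra. }
    assert (J2 : / eta0 * cnorm (vsub (eb j g' y) (eb j g' z)) <= e / 4).
    { apply Rle_trans with (/ eta0 * (e * eta0 / 4)); [apply Rmult_le_compat_l; lra|].
      right; field; lra. }
    lra.
  - assert (Hfar : 5 / 2 * cr j < Cmod (z - cc j)%C) by lra.
    destruct (open_disc_compl_near _ _ _ Hfar) as [d [Hd Hnear]].
    destruct (Hs p Hp z Hz) as [_ [_ [S3 S4]]].
    split.
    + intros k; destruct (S3 k) as [A [B HAB]]; exists A, B.
      apply rdiff_ext_loc with (fun x => loc p g x k) d; auto.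
      intros h Hh; unfold loc; rewrite FB; auto.
      apply Hnear; now replace (z + h - z)%C with h by ring.
    + intros k; destruct (open_disc_near _ _ _ Hz) as [d' [Hd' Hnear']].
      apply cont_at_ext_loc with (fun x => eb p g x k) (Rmin d d'); [now apply Rmin_pos| |auto].
      intros y Hy.
      assert (Y1 : Cmod (y - z)%C < d) by (eapply Rlt_le_trans; [apply Hy|apply Rmin_l]).
      assert (Y2 : Cmod (y - z)%C < d') by (eapply Rlt_le_trans; [apply Hy|apply Rmin_r]).
      destruct (open_disc_compl_near _ _ _ (Hnear y Y1)) as [d'' [Hd'' Hn'']].
      rewrite (eb_ext g g' p y d''); auto.
      now apply (Hs p Hp y), Hnear'.
Qed.

End Cells.

(** * Sweeping through all charts *)

(** The increments have a geometric tail, so all terms stay bounded; an accumulation point is then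
    the limit, at the rate of the tail. *)
Lemma geometric_limit {n : nat} (u : nat -> Cn n) (c : R) :
  (forall k, cnorm (vsub (u (S k)) (u k)) <= c / 2 ^ k) ->
  exists l, forall k, cnorm (vsub (u k) l) <= 2 * c / 2 ^ k.
Proof.
  intros H.
  assert (P2 : forall k, 0 < 2 ^ k) by (intros; apply pow_lt; lra).
  assert (Hc : 0 <= c).
  { specialize (H O); assert (T := cnorm_ge_0 (vsub (u 1%nat) (u O))); simpl in H; lra. }
  assert (D : forall k m, cnorm (vsub (u (k + m)%nat) (u k)) <= 2 * c / 2 ^ k - 2 * c / 2 ^ (k + m)).
  { intros k m; induction m as [|m IH].
    - rewrite Nat.add_0_r, cnorm_sub_diag; lra.
    - rewrite Nat.add_succ_r.
      eapply Rle_trans; [apply (cnorm_sub_triangle _ (u (k + m)%nat))|].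
      specialize (H (k + m)%nat).
      replace (2 * c / 2 ^ S (k + m)) with (c / 2 ^ (k + m))
        by (simpl; specialize (P2 (k + m)%nat); field; lra).
      replace (2 * c / 2 ^ (k + m)) with (c / 2 ^ (k + m) + c / 2 ^ (k + m)) in IH by lra.
      lra. }
  assert (D' : forall k m, cnorm (vsub (u (k + m)%nat) (u k)) <= 2 * c / 2 ^ k).
  { intros k m; specialize (D k m).
    assert (0 <= 2 * c / 2 ^ (k + m))
      by (apply Rmult_le_pos; [lra|left; apply Rinv_0_lt_compat; auto]); lra. }
  destruct (bolzano_Cn n u (cnorm (u O) + 2 * c)) as [phi [l [Hphi Hl]]].
  { intros k; specialize (D' O k); simpl in D'; rewrite Rdiv_1_r in D'.
    assert (T := cnorm_triangle (u O) (vsub (u k) (u O))); rewrite vadd_sub in T; lra. }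
  exists l; intros k; apply le_epsilon; intros e He.
  destruct (Hl e He) as [N HN].
  set (m := Nat.max N k); specialize (HN m ltac:(lia)); specialize (Hphi m).
  specialize (D' k (phi m - k)%nat); replace (k + (phi m - k))%nat with (phi m) in D' by lia.
  assert (T := cnorm_sub_triangle (u k) (u (phi m)) l); rewrite (cnorm_sub_sym (u k) (u (phi m))) in T.
  lra.
Qed.

Section Sweep.
Context {n : nat} (M : complex_manifold n) (f : C -> M).
Variables (cells : list (cell M)) (eta0 C1 a0 theta r1 : R) (L : nat) (a : C).
Hypothesis (He0 : 0 < eta0 <= 1).
Hypothesis (Hrad : forall p, In p cells -> 0 < cr p).
Hypothesis (Htube : forall p q, In p cells -> In q cells ->
  forall z, inD M p z -> inD M q z -> tube M (cj p) (cj q) (f z) eta0).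
Hypothesis (Hunit : forall p, In p cells -> forall z, Cmod (z - cc p)%C < 4 * cr p -> Cmod z < 1).
Hypothesis (HC1 : 1 <= C1).
Hypothesis (HC1c : forall p, In p cells -> 5 / cr p <= C1).
Hypothesis (Ha0 : 0 < a0 <= 1).
Hypothesis (HCZ : forall p, In p cells -> forall z, Cmod z < 3 / 4 * a0 ->
  Cmod (z - cc p)%C <= 2 * cr p \/ 5 / 2 * cr p < Cmod (z - cc p)%C).
Hypothesis (Hcover : forall z, Cmod z <= r1 -> exists p, In p cells /\ Cmod (z - cc p)%C <= cr p).
Hypothesis (Ha : Cmod a <= a0 / 4).
Hypothesis (Hth : 0 < theta <= 1).
Hypothesis (Hsolve : forall (g : C -> Cn n) (K eps s : R), 0 < s ->
    (forall z k, cont_at (fun x => g x k) z) ->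
    (forall z k, 1 <= Cmod z -> g z k = 0) -> (forall z k, Cmod z < a0 / 2 -> g z k = 0) ->
    (forall z, cnorm (g z) * wt L z <= K) -> 0 < eps ->
    exists v beta : C -> Cn n,
      (forall k, v 0 k = 0) /\ (forall k, v a k = 0) /\
      forall z, Cmod z < 1 ->
        (forall k, exists A, rdiff (fun x => v x k) z A (beta z k)) /\
        (forall k, cont_at (fun x => beta x k) z) /\
        cnorm (vsub (beta z) (g z)) <= eps /\ cnorm (v z) * wt L z <= theta * K /\
        ((forall y k, Cmod (z - y)%C < s -> g y k = 0) -> forall k, beta z k = 0)).

Notation state' := (state M f cells).
Notation eb' := (eb M).

Definition bnd (g : C -> M) (R0 N : R) : Prop := forall p, In p cells ->
  forall z, inD M p z -> Cmod z <= R0 -> cnorm (eb' p g z) * wt L z <= N.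

Definition zero_in (g : C -> M) (Z : R) : Prop := forall p, In p cells ->
  forall z, inD M p z -> Cmod z < Z -> forall k, eb' p g z k = 0.

Definition disp (g g' : C -> M) (N : R) : Prop := forall p z, In p cells -> inD M p z ->
  cnorm (vsub (loc M p g' z) (loc M p g z)) <= N.

(** The factor by which one step can enlarge a bound: the old error, [1 + C1] times the new one, and
    the passage between charts. *)
Definition B : R := / eta0 * (2 + C1).

Lemma inv_eta0 : 1 <= / eta0.
Proof. rewrite <- Rinv_1; apply Rinv_le_contravar; lra. Qed.

Lemma inD_unit (p : cell M) (z : C) : In p cells -> inD M p z -> Cmod z < 1.
Proof. intros Hp Hz; apply (Hunit p Hp); specialize (Hrad p Hp); unfold inD in Hz; lra. Qed.

(** The error in cell [j], cut off by [sig], is handed to the solver. What remains is [(1 - sig)]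
    times the old error plus new errors of size [(1 + C1) * (theta * N)]. Points near 0 lie either
    where [chi] is 1 or off its support, so the cut-off creates no error there; since [v] vanishes
    at 0 and [a], these two values of the map are kept. *)
Lemma sweep_step (g : C -> M) (del Z Z' R0 R' N : R) (j : cell M) :
  state' g del -> In j cells -> a0 / 2 <= Z' < Z -> Z <= 3 / 4 * a0 -> R' < R0 -> 0 < N ->
  zero_in g Z -> bnd g R0 N -> del + theta * N * 2 ^ L / eta0 < eta0 ->
  exists g', state' g' (del + theta * N * 2 ^ L / eta0) /\
    disp g g' (theta * N * 2 ^ L / eta0) /\ zero_in g' Z' /\ g' 0 = g 0 /\ g' a = g a /\
    (forall p z Mb, In p cells -> inD M p z -> Cmod z <= R0 -> 0 <= Mb ->
       (forall q, In q cells -> inD M q z -> cnorm (eb' q g z) * wt L z <= Mb) ->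
       cnorm (eb' p g' z) * wt L z <= / eta0 * (Mb + (1 + C1) * (theta * N))) /\
    (forall p z, In p cells -> inD M p z -> Cmod z <= R' -> Cmod (z - cc j)%C <= cr j ->
       cnorm (eb' p g' z) * wt L z <= / eta0 * ((1 + C1) * (theta * N))).
Proof.
  intros Hs Hj HZ HZ2 HR HN Hz Hb Hdel.
  assert (Hr := Hrad j Hj).
  (* It is 1 on the inner disc of the cell within [|z| <= R'] and vanishes from [2 * cr j] or from
     [|z| = R0] on; this is why the controlled radius has to decrease. *)
  set (sig := fun z => ramp (cr j) (2 * cr j) (Cmod (z - cc j)%C) * ramp R' R0 (Cmod (z - 0)%C)).
  assert (Hsig : forall z, 0 <= sig z <= 1).
  { intros z; unfold sig; destruct (ramp_bounds (cr j) (2 * cr j) (Cmod (z - cc j)%C));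
      destruct (ramp_bounds R' R0 (Cmod (z - 0)%C)); split; nra. }
  assert (Hsig0 : forall z, 2 * cr j <= Cmod (z - cc j)%C -> sig z = 0).
  { intros z H; unfold sig; rewrite ramp_0 by lra; ring. }
  assert (Hm0 : forall z : C, (z - 0)%C = z) by (intros; ring).
  assert (HsigR : forall z, R0 <= Cmod z -> sig z = 0).
  { intros z H; unfold sig; rewrite (ramp_0 R' R0) by (rewrite ?Hm0; lra); ring. }
  set (G := fun z k => (RtoC (sig z) * eb' j g z k)%C).
  assert (HG0 : forall z k, sig z = 0 -> G z k = 0) by (intros z k E; unfold G; rewrite E; ring).
  assert (HGz : forall z k, Cmod z < Z -> G z k = 0).
  { intros z k H; destruct (Rlt_dec (Cmod (z - cc j)%C) (3 * cr j)) as [H1|H1].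
    - unfold G; rewrite (Hz j Hj z H1 H); ring.
    - apply HG0, Hsig0; lra. }
  assert (HGn : forall z, cnorm (G z) = sig z * cnorm (eb' j g z)).
  { intros z; destruct (Hsig z); unfold G; change (cnorm (vscale (RtoC (sig z)) (eb' j g z)) =
      sig z * cnorm (eb' j g z)); rewrite cnorm_scale, Cmod_R, Rabs_pos_eq; auto. }
  (* The solver vanishes only at distance [Z - Z'] from the support of its right-hand side, so the
     error-free disc shrinks from [Z] to [Z']. *)
  destruct (Hsolve G N (theta * N) (Z - Z')) as [v [beta [Hv0 [Hva Hvb]]]].
  - lra.
  - intros z k; destruct (Rlt_dec (Cmod (z - cc j)%C) (3 * cr j)) as [H1|H1].
    + apply cont_at_mult; [|now apply (Hs j Hj z H1)].
      apply cont_at_ext with (fun x => RtoC (ramp (cr j) (2 * cr j) (Cmod (x - cc j)%C)) *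
        RtoC (ramp R' R0 (Cmod (x - 0)%C)))%C; [intros x; now rewrite <- RtoC_mult|].
      apply cont_at_mult; apply cont_at_ramp; lra.
    + destruct (open_disc_compl_near (cc j) z (2 * cr j)) as [d [Hd Hn]]; [lra|].
      apply cont_at_ext_loc with (fun _ => RtoC 0) d; auto; [|apply cont_at_const].
      intros y Hy; symmetry; apply HG0, Hsig0; left; auto.
  - intros z k H; apply HG0, Hsig0.
    destruct (Rlt_dec (Cmod (z - cc j)%C) (4 * cr j)) as [H1|H1]; [|lra].
    specialize (Hunit j Hj z H1); lra.
  - intros z k H; apply HGz; lra.
  - intros z; rewrite HGn; destruct (Hsig z) as [S1 S2].
    assert (Hw := wt_pos L z).
    destruct (Req_dec (sig z) 0) as [E|E]; [rewrite E; lra|].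
    assert (H1 : inD M j z).
    { unfold inD; apply Rnot_le_lt; intros H; apply E, Hsig0; lra. }
    assert (H2 : Cmod z <= R0).
    { apply Rnot_lt_le; intros H; apply E, HsigR; lra. }
    specialize (Hb j Hj z H1 H2); assert (Hc := cnorm_ge_0 (eb' j g z)).
    rewrite Rmult_assoc; assert (0 <= cnorm (eb' j g z) * wt L z) by (apply Rmult_le_pos; lra); nra.
  - apply Rmult_lt_0_compat; lra.
  - set (tau := theta * N * 2 ^ L).
    assert (HtN : 0 < theta * N) by (apply Rmult_lt_0_compat; lra).
    assert (P2 : 0 < 2 ^ L) by (apply pow_lt; lra).
    assert (Hvt : forall z, inD M j z -> cnorm (v z) <= tau).
    { intros z H; assert (H1 := inD_unit j z Hj H); destruct (Hvb z H1) as [_ [_ [_ [V _]]]].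
      assert (W := wt_lower L z ltac:(lra)); rewrite pow_inv in W.
      assert (Hc := cnorm_ge_0 (v z)).
      unfold tau; apply Rmult_le_reg_r with (/ 2 ^ L); [now apply Rinv_0_lt_compat|].
      rewrite Rmult_assoc, Rinv_r, Rmult_1_r by lra.
      eapply Rle_trans; [|apply V]; apply Rmult_le_compat_l; auto. }
    destruct (cell_step M f cells eta0 He0 Hrad Htube g del tau j v beta) as
      [g' [G1 [G2 [G3 G4]]]]; auto.
    { unfold tau; apply Rmult_le_pos; lra. }
    { intros z H; assert (H1 := inD_unit j z Hj H); destruct (Hvb z H1) as [V1 [V2 _]]; auto. }
    assert (Hej : forall z, inD M j z -> cnorm (eb' j g' z) * wt L z <=
       (1 - sig z) * (cnorm (eb' j g z) * wt L z) + (1 + C1) * (theta * N)).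
    { intros z H; assert (H1 := inD_unit j z Hj H); destruct (Hvb z H1) as [_ [_ [V3 [V4 _]]]].
      assert (Hw := wt_pos L z); assert (Hw1 := wt_le_1 L z).
      destruct (Hsig z) as [S1 S2]; destruct (chi_bounds (cc j) (cr j) z) as [X1 X2].
      (* [chi] is 1 where [sig] is not 0, so cutting off the solution does not weaken the
         correction. *)
      assert (HXG : forall k, (RtoC (chi (cc j) (cr j) z) * G z k)%C = G z k).
      { intros k; destruct (Rle_lt_dec (2 * cr j) (Cmod (z - cc j)%C)) as [H2|H2].
        - rewrite HG0 by (now apply Hsig0); ring.
        - rewrite (proj1 (chi_inside (cc j) (cr j) z Hr ltac:(lra))); ring. }
      assert (Hcn : cnorm (eb' j g' z) <= (1 - sig z) * cnorm (eb' j g z) +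
         (cnorm (vsub (beta z) (G z)) + C1 * cnorm (v z))).
      { unfold cnorm; rewrite <- !fsum_scal, <- !fsum_plus; apply fsum_le; intros k.
        rewrite (proj2 (G4 z H) k).
        replace (eb' j g z k - (RtoC (chi (cc j) (cr j) z) * beta z k +
             dchi (cc j) (cr j) z * v z k))%C with
          (RtoC (1 - sig z) * eb' j g z k + - (RtoC (chi (cc j) (cr j) z) * vsub (beta z) (G z) k +
             dchi (cc j) (cr j) z * v z k))%C.
        2:{ replace (RtoC (chi (cc j) (cr j) z) * vsub (beta z) (G z) k)%C with
              (RtoC (chi (cc j) (cr j) z) * beta z k - RtoC (chi (cc j) (cr j) z) * G z k)%C
              by (unfold vsub; ring).
            rewrite HXG; unfold G; rewrite RtoC_minus; ring. }
        eapply Rle_trans; [apply Cmod_triangle|]; rewrite Cmod_mult, Cmod_R, Rabs_pos_eq by lra.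
        apply Rplus_le_compat_l; rewrite Cmod_opp.
        eapply Rle_trans; [apply Cmod_triangle|]; rewrite !Cmod_mult, Cmod_R, Rabs_pos_eq by lra.
        assert (Q1 := Cmod_ge_0 (vsub (beta z) (G z) k)); assert (Q2 := Cmod_ge_0 (v z k)).
        assert (Q3 := dchi_bound (cc j) (cr j) z Hr); specialize (HC1c j Hj).
        apply Rplus_le_compat; [nra|]; apply Rmult_le_compat_r; lra. }
      assert (Hb0 := cnorm_ge_0 (vsub (beta z) (G z))); assert (Hv0' := cnorm_ge_0 (v z)).
      apply Rle_trans with (((1 - sig z) * cnorm (eb' j g z) +
         (cnorm (vsub (beta z) (G z)) + C1 * cnorm (v z))) * wt L z);
        [apply Rmult_le_compat_r; lra|].
      assert (cnorm (vsub (beta z) (G z)) * wt L z <= theta * N) by nra.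
      assert (C1 * (cnorm (v z) * wt L z) <= C1 * (theta * N)) by (apply Rmult_le_compat_l; lra).
      lra. }
    assert (Hi := inv_eta0).
    assert (Hcmp : forall p z, In p cells -> inD M p z -> inD M j z ->
       cnorm (eb' p g' z) * wt L z <= / eta0 * (cnorm (eb' j g' z) * wt L z)).
    { intros p z Hp Hpz Hjz; rewrite <- Rmult_assoc; apply Rmult_le_compat_r; [left; apply wt_pos|].
      apply (state_compare M f cells eta0 Htube g' (del + tau / eta0)); auto. }
    assert (Hfar : forall p z, In p cells -> inD M p z -> 5 / 2 * cr j < Cmod (z - cc j)%C ->
       eb' p g' z = eb' p g z).
    { intros p z Hp Hpz H; destruct (open_disc_compl_near _ _ _ H) as [d [Hd Hn]].
      apply eb_ext with d; auto; now apply (Hs p Hp z). }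
    assert (Hfix : forall z, Cmod z < 3 / 4 * a0 -> (forall k, v z k = 0) -> g' z = g z).
    { intros z H Hvz; destruct (HCZ j Hj z H) as [H1|H1]; auto.
      assert (H2 : inD M j z) by (unfold inD; lra).
      apply (chart_inj n M (cj j)); [now apply (G1 j Hj z)|now apply (Hs j Hj z)|].
      change (loc M j g' z = loc M j g z); rewrite (proj1 (G4 z H2)).
      apply functional_extensionality; intros k; unfold vsub, vscale; rewrite Hvz; ring. }
    exists g'; split; [exact G1|]; split; [exact (fun p z Hp Hpz => G2 p z Hp Hpz)|].
    split; [|split; [|split; [|split]]].
    + intros p Hp z Hpz H k.
      destruct (HCZ j Hj z ltac:(lra)) as [H1|H1].
      * assert (H2 : inD M j z) by (unfold inD; lra).
        assert (E : cnorm (eb' j g' z) = 0).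
        { assert (E : eb' j g' z = fun _ => RtoC 0).
          { apply functional_extensionality; intros l; rewrite (proj2 (G4 z H2) l).
            destruct (chi_inside (cc j) (cr j) z Hr H1) as [-> ->].
            rewrite (Hz j Hj z H2 ltac:(lra)).
            destruct (Hvb z (inD_unit j z Hj H2)) as [_ [_ [_ [_ V]]]].
            rewrite V; [ring|]; intros y m Hy; apply HGz.
            assert (T := Cmod_le_add y z); rewrite Cmod_minus_sym in T; lra. }
          rewrite E; unfold cnorm; rewrite (fsum_ext n _ (fun _ => 0));
            [rewrite fsum_const; ring|intros; apply Cmod_0]. }
        assert (T := state_compare M f cells eta0 Htube g' (del + tau / eta0) j p z G1 Hdel
          Hj Hp H2 Hpz).
        rewrite E, Rmult_0_r in T; apply Cmod_eq_0, Rle_antisym; [|apply Cmod_ge_0].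
        eapply Rle_trans; [apply cnorm_comp|apply T].
      * rewrite Hfar by auto; apply (Hz p Hp z Hpz); lra.
    + apply Hfix; auto; rewrite Cmod_0; lra.
    + apply Hfix; auto; lra.
    + intros p z Mb Hp Hpz HzR HMb Hq.
      destruct (Rlt_dec (Cmod (z - cc j)%C) (3 * cr j)) as [H1|H1].
      * eapply Rle_trans; [apply (Hcmp p z Hp Hpz H1)|].
        apply Rmult_le_compat_l; [lra|]; eapply Rle_trans; [apply (Hej z H1)|].
        specialize (Hq j Hj H1); destruct (Hsig z) as [S1 S2].
        assert (0 <= cnorm (eb' j g z) * wt L z)
          by (apply Rmult_le_pos; [apply cnorm_ge_0|left; apply wt_pos]); nra.
      * rewrite Hfar by (auto; lra); eapply Rle_trans; [apply (Hq p Hp Hpz)|].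
        assert (0 <= (1 + C1) * (theta * N)) by (apply Rmult_le_pos; lra); nra.
    + intros p z Hp Hpz HzR H1.
      assert (H2 : inD M j z) by (unfold inD; lra).
      eapply Rle_trans; [apply (Hcmp p z Hp Hpz H2)|].
      apply Rmult_le_compat_l; [lra|]; eapply Rle_trans; [apply (Hej z H2)|].
      assert (E : sig z = 1).
      { unfold sig; rewrite (ramp_1 (cr j)), (ramp_1 R' R0) by (rewrite ?Hm0; lra); ring. }
      rewrite E; lra.
Qed.

Definition kap0 : R := theta * 2 ^ L / eta0.

(** Displacement after [m] steps for an initial error bound 1: a step moves points by [kap0] times
    the current bound, and the bound grows by [B]. *)
Fixpoint tot (m : nat) : R := match m with O => 0 | S k => kap0 + B * tot k end.

Lemma B_ge_1 : 1 <= B.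
Proof. unfold B; assert (H := inv_eta0); nra. Qed.

Lemma kap0_pos : 0 < kap0.
Proof.
  unfold kap0; apply Rdiv_lt_0_compat; [|lra]; apply Rmult_lt_0_compat; [lra|apply pow_lt; lra].
Qed.

Lemma tot_nonneg (m : nat) : 0 <= tot m.
Proof.
  induction m as [|m IH]; simpl; [lra|].
  assert (H := kap0_pos); assert (H' := B_ge_1); nra.
Qed.

(** Two bounds are carried along: a rough one, [N], everywhere, and a fine one, [theta * N], on the
    set [P] of points already treated. A step multiplies both by at most [B] and adds the disc of
    the treated cell to [P]. *)
Lemma sweep_list (R0 R' Z' : R) : R' < R0 -> a0 / 2 <= Z' ->
  forall (l : list (cell M)), incl l cells ->
  forall (g : C -> M) (del Z N : R) (P : C -> Prop),
  Z' < Z <= 3 / 4 * a0 -> 0 < N -> state' g del -> zero_in g Z -> bnd g R0 N ->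
  (forall z, P z -> Cmod z <= R' -> forall p, In p cells -> inD M p z ->
     cnorm (eb' p g z) * wt L z <= theta * N) ->
  del + N * tot (length l) < eta0 ->
  exists g', state' g' (del + N * tot (length l)) /\ disp g g' (N * tot (length l)) /\
    zero_in g' Z' /\ g' 0 = g 0 /\ g' a = g a /\
    (forall z, P z \/ (exists j, In j l /\ Cmod (z - cc j)%C <= cr j) -> Cmod z <= R' ->
       forall p, In p cells -> inD M p z ->
       cnorm (eb' p g' z) * wt L z <= theta * (B ^ length l * N)).
Proof.
  intros HR HZ'; induction l as [|j l IH]; intros Hincl g del Z N P HZ HN Hs Hz Hb HP Hdel.
  - exists g; simpl in *; rewrite Rmult_0_r, Rplus_0_r in *.
    split; [exact Hs|split; [|split; [|split; [reflexivity|split; [reflexivity|]]]]].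
    + intros p z _ _; rewrite cnorm_sub_diag; lra.
    + intros p Hp z Hpz H; apply (Hz p Hp z Hpz); lra.
    + intros z [H|[q [[] _]]] HzR p Hp Hpz; rewrite Rmult_1_l; auto.
  - assert (Hj : In j cells) by (apply Hincl; left; auto).
    assert (Hi := inv_eta0); assert (HB := B_ge_1); assert (Hk := kap0_pos).
    assert (Ht := tot_nonneg (length l)).
    simpl in Hdel.
    assert (EN : theta * N * 2 ^ L / eta0 = N * kap0) by (unfold kap0; field; lra).
    assert (HBt : 0 <= N * (B * tot (length l))) by (repeat apply Rmult_le_pos; lra).
    destruct (sweep_step g del Z ((Z + Z') / 2) R0 R' N j) as
      [g1 [S1 [S2 [S3 [S4 [S5 [S6 S7]]]]]]]; auto; try lra.
    rewrite EN in S1, S2.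
    assert (HtN : 0 < theta * N) by (apply Rmult_lt_0_compat; lra).
    assert (HthN : theta * N <= N) by nra.
    destruct (IH ltac:(intros q Hq; apply Hincl; right; auto) g1 (del + N * kap0) ((Z + Z') / 2)
      (B * N) (fun z => P z \/ Cmod (z - cc j)%C <= cr j)) as [g' [T1 [T2 [T3 [T4 [T5 T6]]]]]].
    + lra.
    + apply Rmult_lt_0_compat; lra.
    + exact S1.
    + exact S3.
    + intros p Hp z Hpz HzR; eapply Rle_trans; [apply (S6 p z N); auto; lra|].
      unfold B; rewrite Rmult_assoc; apply Rmult_le_compat_l; nra.
    + intros z Hzp HzR p Hp Hpz.
      replace (theta * (B * N)) with (/ eta0 * ((2 + C1) * (theta * N))) by (unfold B; ring).
      destruct Hzp as [Hzp|Hzp].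
      * eapply Rle_trans; [apply (S6 p z (theta * N)); auto; lra|].
        apply Rmult_le_compat_l; lra.
      * eapply Rle_trans; [apply (S7 p z); auto|]; apply Rmult_le_compat_l; nra.
    + simpl; lra.
    + exists g'; simpl.
      replace (del + N * (kap0 + B * tot (length l))) with
        (del + N * kap0 + B * N * tot (length l)) by ring.
      split; [exact T1|]; split; [|split; [exact T3|split; [congruence|split; [congruence|]]]].
      * intros p z Hp Hpz; eapply Rle_trans; [apply (cnorm_sub_triangle _ (loc M p g1 z))|].
        specialize (T2 p z Hp Hpz); specialize (S2 p z Hp Hpz).
        assert (E : N * (kap0 + B * tot (length l)) = N * kap0 + B * N * tot (length l)) by ring.
        lra.
      * intros z Hzp HzR p Hp Hpz.
        replace (theta * (B * B ^ length l * N)) with (theta * (B ^ length l * (B * N))) by ring.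
        apply T6; auto.
        destruct Hzp as [Hzp|[q [[<-|Hq] Hzq]]]; auto.
        right; eauto.
Qed.

Hypothesis (HthB : theta * B ^ length cells <= / 2).
Notation Tt := (tot (length cells)).

(** Since the inner discs cover, after all cells only the fine bound [theta * B ^ m] times [E] is
    left, and [theta] was chosen to make this at most [E / 2]. *)
Lemma sweep (g : C -> M) (del Z Z' R0 R' E : R) :
  a0 / 2 <= Z' < Z -> Z <= 3 / 4 * a0 -> R' < R0 -> R' <= r1 -> 0 < E ->
  state' g del -> zero_in g Z -> bnd g R0 E -> del + E * Tt < eta0 ->
  exists g', state' g' (del + E * Tt) /\ disp g g' (E * Tt) /\ zero_in g' Z' /\
    g' 0 = g 0 /\ g' a = g a /\ bnd g' R' (E / 2).
Proof.
  intros HZ HZ2 HR HR1 HE Hs Hz Hb Hdel.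
  destruct (sweep_list R0 R' Z' HR ltac:(lra) cells (incl_refl _) g del Z E (fun _ => False))
    as [g' [T1 [T2 [T3 [T4 [T5 T6]]]]]]; auto; try lra; [intros z []|].
  exists g'; split; [exact T1|split; [exact T2|split; [exact T3|split; [exact T4|split; [exact T5|]]]]].
  intros p Hp z Hpz HzR; eapply Rle_trans; [apply T6; auto|].
  - right; apply Hcover; lra.
  - rewrite <- Rmult_assoc; nra.
Qed.

Variables (r E del0 : R) (g0 : C -> M).
Hypothesis (Hr01 : 0 < r < r1).
Hypothesis (Ha1 : Cmod a <= r1).
Hypothesis (HE : 0 < E).
Hypothesis (Hdel0 : 0 <= del0).
Hypothesis (Hg0 : state' g0 del0).
Hypothesis (Hg0z : zero_in g0 (3 / 4 * a0)).
Hypothesis (Hg0b : bnd g0 r1 E).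
Hypothesis (Hsmall : del0 + 2 * (E * Tt) < eta0).

(** A sweep shrinks the error-free disc and the disc of control and uses up displacement. All three
    losses are halved each time, so the radii stay above [a0 / 2] and [r] and the displacement below
    [del0 + 2 * (E * Tt)]. *)
Definition inv (k : nat) (g : C -> M) : Prop :=
  state' g (del0 + 2 * (E * Tt) * (1 - / 2 ^ k)) /\ zero_in g (a0 / 2 + a0 / 4 * / 2 ^ k) /\
  bnd g (r + (r1 - r) * / 2 ^ k) (E * / 2 ^ k) /\ g 0 = g0 0 /\ g a = g0 a.

Lemma inv_step (k : nat) (g : C -> M) : inv k g ->
  exists g', inv (S k) g' /\ disp g g' (E * Tt / 2 ^ k).
Proof.
  intros [I1 [I2 [I3 [I4 I5]]]].
  assert (P2 : 0 < 2 ^ k) by (apply pow_lt; lra).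
  set (q := / 2 ^ k) in *.
  assert (Hq : 0 < q) by now apply Rinv_0_lt_compat.
  assert (Hq1 : q <= 1).
  { unfold q; rewrite <- Rinv_1; apply Rinv_le_contravar; [lra|]; apply pow_R1_Rle; lra. }
  assert (Eq : / 2 ^ S k = q / 2) by (unfold q; simpl; field; lra).
  assert (Ht := tot_nonneg (length cells)).
  assert (HET : 0 <= E * Tt) by (apply Rmult_le_pos; lra).
  destruct (sweep g (del0 + 2 * (E * Tt) * (1 - q)) (a0 / 2 + a0 / 4 * q)
    (a0 / 2 + a0 / 4 * (q / 2)) (r + (r1 - r) * q) (r + (r1 - r) * (q / 2)) (E * q))
    as [g' [T1 [T2 [T3 [T4 [T5 T6]]]]]]; auto; try nra.
  exists g'; split.
  - unfold inv; rewrite Eq; split; [|split; [exact T3|split; [|split; congruence]]].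
    + replace (del0 + 2 * (E * Tt) * (1 - q / 2)) with
        (del0 + 2 * (E * Tt) * (1 - q) + E * q * Tt) by field; exact T1.
    + replace (E * (q / 2)) with (E * q / 2) by field; exact T6.
  - replace (E * Tt / 2 ^ k) with (E * q * Tt) by (unfold q; field; lra); exact T2.
Qed.

Lemma inv_0 : inv 0 g0.
Proof.
  unfold inv; simpl; rewrite Rinv_1, Rminus_diag, !Rmult_1_r, Rmult_0_r, Rplus_0_r.
  replace (a0 / 2 + a0 / 4) with (3 / 4 * a0) by field.
  replace (r + (r1 - r)) with r1 by ring; auto.
Qed.

(** The displacements are summable, so coordinates converge uniformly in each cell. On [|z| < r] the
    conjugate derivatives of the iterates tend to 0, so the coordinates of the limit are
    [almost_hol]. *)
Lemma holomorphic_limit : exists g : C -> M,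
  (forall z, Cmod z < r -> hol_at M g z) /\ g 0 = g0 0 /\ g a = g0 a.
Proof.
  set (next := fun k (s : {g | inv k g}) =>
    constructive_indefinite_description _ (inv_step k (proj1_sig s) (proj2_sig s))).
  set (sq := fix sq k : {g | inv k g} := match k with
    | O => exist _ g0 inv_0
    | S k' => exist _ (proj1_sig (next k' (sq k'))) (proj1 (proj2_sig (next k' (sq k'))))
    end).
  set (G := fun k => proj1_sig (sq k)).
  assert (HG : forall k, inv k (G k)) by (intros k; exact (proj2_sig (sq k))).
  assert (HGd : forall k, disp (G k) (G (S k)) (E * Tt / 2 ^ k)).
  { intros k; exact (proj2 (proj2_sig (next k (sq k)))). }
  assert (P2 : forall k, 0 < 2 ^ k) by (intros; apply pow_lt; lra).
  assert (Ht := tot_nonneg (length cells)).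
  set (c := E * Tt) in *.
  assert (Hc : 0 <= c) by (apply Rmult_le_pos; lra).
  assert (Hlim : forall p z, In p cells -> inD M p z -> exists l,
     forall k, cnorm (vsub (loc M p (G k) z) l) <= 2 * c / 2 ^ k).
  { intros p z Hp Hz; apply geometric_limit; intros k; now apply HGd. }
  assert (Hvan : forall e, 0 < e -> exists k, 2 * c / 2 ^ k / eta0 < e /\ E * 2 ^ L / 2 ^ k < e).
  { intros e He; set (T := 2 * c / eta0 + E * 2 ^ L + 1).
    assert (0 <= 2 * c / eta0) by (apply Rmult_le_pos; [lra|left; apply Rinv_0_lt_compat; lra]).
    assert (0 < E * 2 ^ L) by (apply Rmult_lt_0_compat; auto).
    destruct (pow_lt_1_zero (/ 2) ltac:(rewrite Rabs_pos_eq; lra) (e / T)) as [N HN].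
    { apply Rdiv_lt_0_compat; unfold T; lra. }
    exists N; specialize (HN N (Nat.le_refl _)).
    rewrite Rabs_pos_eq, pow_inv in HN by (apply pow_le; lra).
    apply Rmult_lt_compat_l with (r := T) in HN; [|unfold T; lra].
    replace (T * (e / T)) with e in HN by (field; unfold T; lra).
    assert (Hi := Rinv_0_lt_compat _ (P2 N)).
    split.
    - replace (2 * c / 2 ^ N / eta0) with (2 * c / eta0 * / 2 ^ N)
        by (assert (HP := P2 N); field; split; lra).
      eapply Rle_lt_trans; [|apply HN]; apply Rmult_le_compat_r; unfold T; lra.
    - unfold Rdiv; eapply Rle_lt_trans; [|apply HN]; apply Rmult_le_compat_r; unfold T; lra. }
  (* The limit point is found in one cell, where it stays within [eta0] of [f z], and is carried to
     the others by the Lipschitz chart changes. Outside all cells the value is a default. *)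
  assert (Hpt : forall z, exists x, forall p, In p cells -> inD M p z ->
     cdom M (cj p) x /\ forall k, cnorm (vsub (loc M p (G k) z) (chart M (cj p) x)) <= 2 * c / 2 ^ k / eta0).
  { intros z.
    destruct (excluded_middle_informative (exists q, In q cells /\ inD M q z)) as [[q [Hq Hqz]]|HN].
    2:{ exists (f z); intros p Hp Hpz; elim HN; eauto. }
    destruct (Hlim q z Hq Hqz) as [l Hl].
    assert (HGf : forall k, cnorm (vsub (loc M q (G k) z) (loc M q f z)) <= del0 + 2 * c).
    { intros k; destruct (HG k) as [S _]; destruct (S q Hq z Hqz) as [_ [N _]].
      eapply Rle_trans; [apply N|]; fold c.
      assert (Hk := Rinv_0_lt_compat _ (P2 k)); assert (0 <= c * / 2 ^ k) by nra; lra. }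
    assert (Hlf : cnorm (vsub l (loc M q f z)) < eta0).
    { apply Rle_lt_trans with (del0 + 2 * c); auto; apply le_epsilon; intros e He.
      destruct (Hvan e He) as [k [Hk _]].
      specialize (Hl k); specialize (HGf k); rewrite cnorm_sub_sym in Hl.
      eapply Rle_trans; [apply (cnorm_sub_triangle _ (loc M q (G k) z))|].
      assert (2 * c / 2 ^ k <= 2 * c / 2 ^ k / eta0); [|lra].
      assert (0 <= 2 * c / 2 ^ k)
        by (apply Rmult_le_pos; [lra|left; apply Rinv_0_lt_compat; auto]).
      assert (Hi := inv_eta0); unfold Rdiv at 2; nra. }
    destruct (proj1 (Htube q q Hq Hq z Hqz Hqz) l Hlf) as [x [X1 [_ X2]]].
    exists x; intros p Hp Hpz.
    assert (Htb := Htube q p Hq Hp z Hqz Hpz).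
    assert (Hxf : cnorm (vsub (chart M (cj q) x) (chart M (cj q) (f z))) < eta0) by (rewrite X2; auto).
    split; [now apply (tube_dom M (cj q) (cj p) (f z) x eta0)|].
    intros k; destruct (HG k) as [S _]; destruct (S q Hq z Hqz) as [S1 _].
    eapply Rle_trans; [apply (tube_lip M (cj q) (cj p) (f z) (G k z) x eta0); auto|].
    - eapply Rle_lt_trans; [apply HGf|auto].
    - rewrite X2; unfold Rdiv; rewrite Rmult_comm; apply Rmult_le_compat_r;
        [left; apply Rinv_0_lt_compat; lra|apply Hl]. }
  set (gi := fun z => proj1_sig (constructive_indefinite_description _ (Hpt z))).
  assert (Hgi : forall z p, In p cells -> inD M p z -> cdom M (cj p) (gi z) /\
     forall k, cnorm (vsub (loc M p (G k) z) (loc M p gi z)) <= 2 * c / 2 ^ k / eta0).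
  { intros z p Hp Hpz.
    exact (proj2_sig (constructive_indefinite_description _ (Hpt z)) p Hp Hpz). }
  assert (Hin : forall z, Cmod z <= r1 -> exists p, In p cells /\ inD M p z /\
     forall y, Cmod (y - z)%C < cr p -> inD M p y).
  { intros z Hz; destruct (Hcover z Hz) as [p [Hp Hpz]]; assert (Hcr := Hrad p Hp).
    exists p; split; auto; split; [unfold inD; lra|]; intros y Hy; unfold inD.
    assert (T := Cmod_triangle3 y z (cc p)); lra. }
  assert (Hval : forall z, Cmod z <= r1 -> (forall k, G k z = g0 z) -> gi z = g0 z).
  { intros z Hz Hk; destruct (Hin z Hz) as [p [Hp [Hpz _]]].
    destruct (Hgi z p Hp Hpz) as [H1 H2].
    apply (chart_inj n M (cj p)); auto; [now apply (Hg0 p Hp z)|].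
    symmetry; apply cnorm_sub_eq_0, Rle_antisym; [|apply cnorm_ge_0].
    apply le_epsilon; intros e He; destruct (Hvan e He) as [k [Hk' _]].
    specialize (H2 k); unfold loc in H2; rewrite Hk in H2; lra. }
  exists gi; split; [|split].
  - intros z Hz; destruct (Hin z ltac:(lra)) as [p [Hp [Hpz Hnear]]].
    assert (Hcr := Hrad p Hp).
    apply hol_at_of_chart with (cj p) (cr p); auto.
    + intros y Hy; now apply Hgi, Hnear.
    + intros l.
      (* The iterates themselves are the approximants; removing the weight costs [2 ^ L], overcome
         by the factor [/ 2 ^ k]. *)
      apply almost_hol_rdiff with z (Rmin (cr p) (r - Cmod z)).
      * intros e He; destruct (Hvan e He) as [k [K1 K2]].
        exists (fun x => loc M p (G k) x l); intros x Hx.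
        assert (Hx1 : Cmod (x - z)%C < cr p) by (eapply Rlt_le_trans; [apply Hx|apply Rmin_l]).
        assert (Hx2 : Cmod (x - z)%C < r - Cmod z) by (eapply Rlt_le_trans; [apply Hx|apply Rmin_r]).
        assert (Hx3 : Cmod x < r) by (assert (T := Cmod_le_add x z); lra).
        assert (Hpx := Hnear x Hx1); destruct (Hgi x p Hp Hpx) as [_ H2].
        destruct (HG k) as [S [_ [Sb _]]]; destruct (S p Hp x Hpx) as [_ [_ [S3 _]]].
        split.
        -- eapply Rle_trans; [apply (cnorm_comp (vsub (loc M p (G k) x) (loc M p gi x)) l)|].
           specialize (H2 k); lra.
        -- destruct (dbar_rdiff _ x (S3 l)) as [A HA]; exists A; eexists; split; [exact HA|].
           assert (Hi : 0 < / 2 ^ k) by (apply Rinv_0_lt_compat; auto).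
           specialize (Sb p Hp x Hpx ltac:(nra)).
           assert (Hxu := inD_unit p x Hp Hpx).
           assert (W := wt_lower L x ltac:(lra)); rewrite pow_inv in W.
           assert (Hcn := cnorm_ge_0 (eb' p (G k) x)).
           eapply Rle_trans; [apply (cnorm_comp (eb' p (G k) x) l)|].
           apply Rle_trans with (E * 2 ^ L / 2 ^ k); [|lra].
           apply Rmult_le_reg_r with (/ 2 ^ L); [apply Rinv_0_lt_compat; auto|].
           replace (E * 2 ^ L / 2 ^ k * / 2 ^ L) with (E * / 2 ^ k)
             by (assert (HP := P2 L); assert (HP' := P2 k); field; split; lra).
           eapply Rle_trans; [|apply Sb]; apply Rmult_le_compat_l; auto.
      * replace (z - z)%C with (RtoC 0) by ring; rewrite Cmod_0; apply Rmin_pos; lra.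
  - apply Hval; [rewrite Cmod_0; lra|]; intros k; now apply HG.
  - apply Hval; auto; intros k; now apply HG.
Qed.

End Sweep.

(** * Perturbing a disc *)

Lemma list_uniform {A : Type} (l : list A) (P : A -> R -> Prop) :
  (forall x e e', P x e -> 0 < e' <= e -> P x e') ->
  (forall x, In x l -> exists e, 0 < e /\ P x e) ->
  exists e, 0 < e /\ forall x, In x l -> P x e.
Proof.
  intros Hm; induction l as [|x l IH]; intros H.
  - exists 1; split; [lra|]; intros x [].
  - destruct IH as [e1 [He1 H1]]; [intros; apply H; right; auto|].
    destruct (H x) as [e2 [He2 H2]]; [left; auto|].
    exists (Rmin e1 e2); split; [now apply Rmin_pos|].
    assert (Hp := Rmin_pos _ _ He1 He2).
    intros y [<-|Hy]; [apply Hm with e2|apply Hm with e1]; auto; split; auto;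
      [apply Rmin_r|apply Rmin_l].
Qed.

(** From each box of side [r / 2] that meets the set one point of the set is picked; the centres
    must lie in [P] because cells are later placed in an annulus. *)
Lemma totally_bounded (P : C -> Prop) (b r : R) : 0 < r -> (forall z, P z -> Cmod z <= b) ->
  exists l : list C, (forall c, In c l -> P c) /\
    forall z, P z -> exists c, In c l /\ Cmod (z - c)%C <= r.
Proof.
  intros Hr Hb.
  set (d := r / 2).
  set (box := fun (kl : nat * nat) z => P z /\
    INR (fst kl) * d <= fst z + b < (INR (fst kl) + 1) * d /\
    INR (snd kl) * d <= snd z + b < (INR (snd kl) + 1) * d).
  set (pick := fun kl => match excluded_middle_informative (exists z, box kl z) with
    | left H => proj1_sig (constructive_indefinite_description _ H) :: nil
    | right _ => nil end).
  destruct (nfloor_ex (Rabs (2 * b / d))) as [N [_ HN]]; [apply Rabs_pos|].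
  exists (flat_map pick (list_prod (seq 0 (N + 2)) (seq 0 (N + 2)))); split.
  - intros c Hc; apply in_flat_map in Hc; destruct Hc as [kl [_ Hc]].
    unfold pick in Hc; destruct (excluded_middle_informative _) as [H|H]; [|destruct Hc].
    destruct Hc as [<-|[]].
    exact (proj1 (proj2_sig (constructive_indefinite_description _ H))).
  - intros z Hz.
    assert (Hd : 0 < d) by (unfold d; lra).
    assert (Hzb := Hb z Hz).
    assert (F : forall x, Rabs x <= Cmod z -> exists k, (k < N + 2)%nat /\
      INR k * d <= x + b < (INR k + 1) * d).
    { intros x Hx; assert (Hx' : Rabs x <= b) by lra; apply Rabs_le_between in Hx'.
      destruct (nfloor_ex ((x + b) / d)) as [k [K1 K2]].
      { apply Rmult_le_pos; [lra|left; now apply Rinv_0_lt_compat]. }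
      assert (E : (x + b) / d * d = x + b) by (field; lra).
      assert (H1 := Rmult_le_compat_r d _ _ ltac:(lra) K1).
      assert (H2 := Rmult_lt_compat_r d _ _ Hd K2); rewrite E in H1, H2.
      exists k; split; [|split; auto].
      assert (H3 : INR k < INR N + 1).
      { apply Rle_lt_trans with (2 * b / d).
        - eapply Rle_trans; [apply K1|]; apply Rmult_le_compat_r; [|lra].
          left; now apply Rinv_0_lt_compat.
        - eapply Rle_lt_trans; [apply Rle_abs|auto]. }
      apply INR_lt; rewrite plus_INR; simpl; lra. }
    destruct (F (fst z) (Cmod_fst_le z)) as [k [Hk Hkx]].
    destruct (F (snd z) (Cmod_snd_le z)) as [m [Hm Hmy]].
    assert (Hex : exists z, box (k, m) z) by (exists z; split; auto).
    assert (Hin : exists c, In c (pick (k, m)) /\ box (k, m) c).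
    { unfold pick; destruct (excluded_middle_informative _) as [H|H]; [|tauto].
      eexists; split; [left; reflexivity|].
      exact (proj2_sig (constructive_indefinite_description _ H)). }
    destruct Hin as [c [Hc [_ [Hc1 Hc2]]]]; exists c; split.
    + apply in_flat_map; exists (k, m); split; auto.
      apply in_prod; apply in_seq; lia.
    + destruct z as [zx zy], c as [cx cy]; simpl in *.
      eapply Rle_trans; [apply (Cmod_le_Rabs (zx + - cx) (zy + - cy))|].
      assert (Rabs (zx + - cx) <= d) by (apply Rabs_le; lra).
      assert (Rabs (zy + - cy) <= d) by (apply Rabs_le; lra); unfold d in *; lra.
Qed.

(** The centre cell has the chart [i] and receives the affine correction [s0 + z s1]. This is
    holomorphic, so the first error comes from the cut-off alone: it vanishes near 0 and is
    proportional to [del]. The iteration removes it without touching the values at 0 and [a]. *)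
Lemma perturbation {n : nat} (M : complex_manifold n) (f : C -> M) (i : chart_idx M) (r : R) :
  holo_disc M f -> cdom M i (f (RtoC 0)) -> 0 < r < 1 ->
  exists del, 0 < del /\ forall (a : C) (s0 s1 : Cn n),
    Cmod a < del -> cnorm s0 < del -> cnorm s1 < del ->
    exists g : C -> M, (forall z, Cmod z < r -> hol_at M g z) /\
      cdom M i (g (RtoC 0)) /\ chart M i (g (RtoC 0)) = vadd (chart M i (f (RtoC 0))) s0 /\
      cdom M i (g a) /\ chart M i (g a) = vadd (chart M i (f a)) (vadd s0 (vscale a s1)).
Proof.
  intros Hf Hi Hr.
  assert (Hf' := proj1 (holo_disc_hol_at M f) Hf); unfold in_disc in Hf'.
  set (r1 := (1 + r) / 2).
  assert (Hm0 : forall z : C, (z - 0)%C = z) by (intros; ring).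
  destruct (proj1 (Hf' (RtoC 0) ltac:(rewrite Cmod_0; lra)) (cdom M i) (cdom_open n M i) Hi)
    as [d0 [Hd0 Hd0i]].
  (* Keeps the disc of radius [4 * a0] inside the unit disc and inside the preimage of the chart
     [i]. *)
  set (a0 := Rmin (d0 / 5) (r / 8)).
  assert (Ha0 : 0 < a0) by (apply Rmin_pos; lra).
  assert (Ha01 : a0 <= d0 / 5) by apply Rmin_l; assert (Ha02 : a0 <= r / 8) by apply Rmin_r.
  destruct (compact_uniform (fun z => Cmod z <= r1)
    (fun z e => exists j, forall y, Cmod (y - z)%C < e -> cdom M j (f y)) r1) as [rho [Hrho Hcov]].
  { auto. }
  { intros z Hz; now apply closed_ball_compl. }
  { intros z e e' [j Hj] He' Hee; exists j; intros y Hy; apply Hj; lra. }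
  { intros z Hz; destruct (cdom_cover n M (f z)) as [j Hj].
    destruct (proj1 (Hf' z ltac:(unfold r1 in Hz; lra)) (cdom M j) (cdom_open n M j) Hj)
      as [d [Hd Hdj]].
    exists (d / 2); split; [lra|]; intros y _ Hy; exists j; intros x Hx; apply Hdj.
    assert (T := Cmod_triangle3 x y z); lra. }
  (* The first and last bounds keep the disc of radius [4 * rr] in one chart and in the unit disc.
     With [a0 / 12], cells centred at [a0 <= |c|] have cut-offs vanishing on [|z| < 3 / 4 * a0]. *)
  set (rr := Rmin (rho / 5) (Rmin (a0 / 12) ((1 - r1) / 5))).
  assert (Hrr : 0 < rr) by (unfold r1 in *; repeat apply Rmin_pos; lra).
  assert (Hrr1 : rr <= rho / 5) by apply Rmin_l.
  assert (Hrr2 : rr <= a0 / 12) by (eapply Rle_trans; [apply Rmin_r|apply Rmin_l]).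
  assert (Hrr3 : rr <= (1 - r1) / 5) by (eapply Rle_trans; [apply Rmin_r|apply Rmin_r]).
  destruct (totally_bounded (fun z => a0 <= Cmod z <= r1) r1 rr Hrr) as [l [Hl1 Hl2]].
  { intros z [_ H]; auto. }
  set (jc := fun c => epsilon (inhabits i) (fun j => forall y, Cmod (y - c)%C < rho -> cdom M j (f y))).
  assert (Hjc : forall c, Cmod c <= r1 -> forall y, Cmod (y - c)%C < rho -> cdom M (jc c) (f y)).
  { intros c Hc; apply (epsilon_spec (inhabits i)
      (fun j => forall y, Cmod (y - c)%C < rho -> cdom M j (f y))), Hcov, Hc. }
  set (cell0 := Cell n M 0 a0 i).
  set (cells := cell0 :: map (fun c => Cell n M c rr (jc c)) l).
  assert (Hcells : forall p, In p cells -> p = cell0 \/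
     exists c, p = Cell n M c rr (jc c) /\ a0 <= Cmod c <= r1).
  { intros p [<-|Hp]; auto; right; apply in_map_iff in Hp; destruct Hp as [c [<- Hc]].
    exists c; split; auto; now apply Hl1. }
  assert (Hc0 : In cell0 cells) by (left; auto).
  assert (Hrad : forall p, In p cells -> 0 < cr p).
  { intros p Hp; destruct (Hcells p Hp) as [->|[c [-> _]]]; simpl; auto. }
  assert (Hdom : forall p, In p cells -> forall z, Cmod (z - cc p)%C < 4 * cr p ->
     Cmod z < 1 /\ cdom M (cj p) (f z)).
  { intros p Hp z Hz; destruct (Hcells p Hp) as [->|[c [-> Hc]]]; simpl in *.
    - rewrite Hm0 in Hz; split; [lra|]; apply Hd0i; rewrite Hm0; lra.
    - split; [|apply Hjc; lra].
      assert (T := Cmod_le_add z c); lra. }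
  assert (Hcover : forall z, Cmod z <= r1 -> exists p, In p cells /\ Cmod (z - cc p)%C <= cr p).
  { intros z Hz; destruct (Rle_lt_dec (Cmod z) a0) as [H|H].
    - exists cell0; split; auto; simpl; now rewrite Hm0.
    - destruct (Hl2 z) as [c [Hc Hzc]]; [lra|].
      exists (Cell n M c rr (jc c)); split; auto.
      right; apply in_map_iff; eauto. }
  assert (HCZ : forall p, In p cells -> forall z, Cmod z < 3 / 4 * a0 ->
     Cmod (z - cc p)%C <= 2 * cr p \/ 5 / 2 * cr p < Cmod (z - cc p)%C).
  { intros p Hp z Hz; destruct (Hcells p Hp) as [->|[c [-> Hc]]]; simpl.
    - left; rewrite Hm0; lra.
    - right; assert (T := Cmod_le_add c z); rewrite Cmod_minus_sym in T; lra. }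
  set (C1 := 5 / rr).
  assert (HC1 : 1 <= C1).
  { unfold C1; apply Rmult_le_reg_r with rr; auto.
    replace (5 / rr * rr) with 5 by (field; lra); lra. }
  assert (HC1c : forall p, In p cells -> 5 / cr p <= C1).
  { intros p Hp; destruct (Hcells p Hp) as [->|[c [-> Hc]]]; simpl; unfold C1; [|lra].
    apply Rmult_le_compat_l; [lra|]; apply Rinv_le_contravar; lra. }
  destruct (list_uniform (list_prod cells cells) (fun pq e => forall z,
     Cmod (z - cc (fst pq))%C <= 3 * cr (fst pq) -> Cmod (z - cc (snd pq))%C <= 3 * cr (snd pq) ->
     tube M (cj (fst pq)) (cj (snd pq)) (f z) e)) as [e1 [He1 Htb]].
  { intros pq e e' H He' z H1 H2; apply tube_shift with (f z) e; auto; [lra|].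
    rewrite cnorm_sub_diag; lra. }
  { intros [p q] Hpq; apply in_prod_iff in Hpq; destruct Hpq as [Hp Hq]; simpl.
    assert (Rp := Hrad p Hp); assert (Rq := Hrad q Hq).
    destruct (compact_uniform
      (fun z => Cmod (z - cc p)%C <= 3 * cr p /\ Cmod (z - cc q)%C <= 3 * cr q)
      (fun z e => tube M (cj p) (cj q) (f z) e) 1) as [e [He H]].
    - intros z [H1 _]; left; apply (Hdom p Hp z); lra.
    - assert (K : forall c z (b : R), ~ Cmod (z - c)%C <= b ->
        exists d, 0 < d /\ forall y, Cmod (y - z)%C < d -> ~ Cmod (y - c)%C <= b).
      { intros c z b H; apply Rnot_le_lt in H; destruct (open_disc_compl_near c z b H) as [d [Hd Hn]].
        exists d; split; auto; intros y Hy; apply Rlt_not_le, Hn, Hy. }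
      intros z Hz; destruct (Rle_lt_dec (Cmod (z - cc p)%C) (3 * cr p)) as [H1|H1].
      + destruct (Rle_lt_dec (Cmod (z - cc q)%C) (3 * cr q)) as [H2|H2]; [tauto|].
        destruct (K (cc q) z (3 * cr q)) as [d [Hd Hn]]; [lra|].
        exists d; split; auto; intros y Hy [_ Hy']; now apply (Hn y Hy).
      + destruct (K (cc p) z (3 * cr p)) as [d [Hd Hn]]; [lra|].
        exists d; split; auto; intros y Hy [Hy' _]; now apply (Hn y Hy).
    - intros z e e' H He' Hee; apply tube_shift with (f z) e; auto; rewrite cnorm_sub_diag; lra.
    - intros z [H1 H2].
      destruct (Hdom p Hp z ltac:(lra)) as [U1 U2]; destruct (Hdom q Hq z ltac:(lra)) as [_ U3].
      destruct (tube_exists M (cj p) (cj q) (f z) U2 U3) as [e [He Ht]].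
      destruct (chart_cont_along M f z (cj p) (proj1 (Hf' z U1)) U2 (e / 2)) as [d [Hd Hdn]]; [lra|].
      exists (Rmin d (e / 2)); split; [apply Rmin_pos; lra|]; intros y _ Hy.
      destruct (Hdn y) as [_ D2]; [eapply Rlt_le_trans; [apply Hy|apply Rmin_l]|].
      apply tube_shift with (f z) e; auto; [apply Rmin_pos; lra|].
      assert (T := Rmin_r d (e / 2)); lra.
    - exists e; split; auto. }
  set (eta0 := Rmin e1 1).
  assert (He0 : 0 < eta0 <= 1) by (split; [apply Rmin_pos; lra|apply Rmin_r]).
  assert (Htube : forall p q, In p cells -> In q cells ->
    forall z, inD M p z -> inD M q z -> tube M (cj p) (cj q) (f z) eta0).
  { intros p q Hp Hq z Hpz Hqz; apply tube_shift with (f z) e1; try lra.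
    - apply (Htb (p, q)); [now apply in_prod| |]; unfold inD in *; simpl; lra.
    - rewrite cnorm_sub_diag, Rplus_0_l; apply Rmin_l. }
  assert (Hi0 : 1 <= / eta0) by (rewrite <- Rinv_1; apply Rinv_le_contravar; lra).
  assert (HB : 1 <= B eta0 C1) by (unfold B; nra).
  assert (HBm : 1 <= B eta0 C1 ^ length cells) by (apply pow_R1_Rle; auto).
  (* Possible only now: the number of cells and the growth factor [B] are fixed, and neither depends
     on [theta]. *)
  set (theta := / (2 * B eta0 C1 ^ length cells)).
  assert (Hth : 0 < theta <= 1).
  { unfold theta; split; [apply Rinv_0_lt_compat; lra|].
    rewrite <- Rinv_1; apply Rinv_le_contravar; lra. }
  assert (HthB : theta * B eta0 C1 ^ length cells <= / 2) by (right; unfold theta; field; lra).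
  destruct (vdbar_solver n theta a0 ltac:(lra) ltac:(lra)) as [L HL].
  set (Tt := tot eta0 C1 theta L (length cells)).
  assert (HTt : 0 <= Tt) by (apply tot_nonneg; auto).
  (* The total displacement per unit of [del]: the affine correction, and twice the first error
     times [Tt] for all sweeps together. *)
  set (Q := 2 / eta0 + 4 * (C1 / eta0) * Tt).
  assert (Hie : 0 < C1 / eta0) by (apply Rdiv_lt_0_compat; lra).
  assert (H2e : 0 < 2 / eta0) by (apply Rdiv_lt_0_compat; lra).
  assert (HQ : 0 < Q) by (unfold Q; nra).
  set (del := Rmin (a0 / 4) (eta0 / (2 * Q))).
  assert (Hdel : 0 < del) by (apply Rmin_pos; [lra|apply Rdiv_lt_0_compat; lra]).
  assert (HdelQ : del * Q < eta0).
  { apply Rle_lt_trans with (eta0 / (2 * Q) * Q).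
    - apply Rmult_le_compat_r; [lra|apply Rmin_r].
    - replace (eta0 / (2 * Q) * Q) with (eta0 / 2) by (field; lra); lra. }
  exists del; split; auto; intros a s0 s1 Ha Hs0 Hs1.
  assert (Ha4 : Cmod a <= a0 / 4) by (assert (T := Rmin_l (a0 / 4) (eta0 / (2 * Q))); fold del in T; lra).
  assert (Hrf : forall p z, In p cells -> inD M p z -> forall k,
     exists A, rdiff (fun x => loc M p f x k) z A 0).
  { intros p z Hp Hz k; specialize (Hrad p Hp); unfold inD in Hz.
    destruct (Hdom p Hp z ltac:(lra)) as [U1 U2].
    destruct (Hf' z U1) as [_ H]; exact (H (cj p) U2 k). }
  assert (Hebf : forall p z, In p cells -> inD M p z -> forall k, eb M p f z k = 0).
  { intros p z Hp Hz k; destruct (Hrf p z Hp Hz k) as [A HA]; now apply dbar_unique with A. }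
  assert (Hsf : state M f cells f 0).
  { intros p Hp z Hz; assert (Rp := Hrad p Hp); split; [|split; [|split]].
    - apply (Hdom p Hp z); unfold inD in Hz; lra.
    - rewrite cnorm_sub_diag; lra.
    - intros k; destruct (Hrf p z Hp Hz k) as [A HA]; eauto.
    - intros k; destruct (open_disc_near _ _ _ Hz) as [d [Hd Hn]].
      apply cont_at_ext_loc with (fun _ => RtoC 0) d; auto; [|apply cont_at_const].
      intros y Hy; symmetry; apply Hebf; auto; now apply Hn. }
  (* The sign is reversed because [cell_step] subtracts. *)
  set (v := fun z k => (- (s0 k + z * s1 k))%C).
  set (tau := 2 * del).
  assert (Hvt : forall z, Cmod z < 1 -> cnorm (v z) <= tau).
  { intros z Hz; rewrite (cnorm_opp (v z) (vadd s0 (vscale z s1))) by reflexivity.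
    eapply Rle_trans; [apply cnorm_triangle|]; rewrite cnorm_scale.
    assert (H := cnorm_ge_0 s1); assert (H' := Cmod_ge_0 z); unfold tau; nra. }
  assert (Htau0 : tau / eta0 = del * (2 / eta0)) by (unfold tau; field; lra).
  assert (HQt : 0 <= del * (4 * (C1 / eta0) * Tt)) 
    by (clear - Hdel Hie HTt; apply Rmult_le_pos; [lra|apply Rmult_le_pos; lra]).
  assert (HQ' : del * (2 / eta0) + del * (4 * (C1 / eta0) * Tt) < eta0)
    by (rewrite <- Rmult_plus_distr_l; exact HdelQ).
  destruct (cell_step M f cells eta0 He0 Hrad Htube f 0 tau cell0 v (fun _ _ => RtoC 0))
    as [g0 [G1 [_ [G3 G4]]]]; auto.
  { unfold tau; clear - Hdel; lra. }
  { rewrite Htau0; clear - HQt HQ'; lra. }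
  { intros z Hz; split; [|split].
    - apply Hvt, (Hdom cell0 Hc0 z); unfold inD in Hz; specialize (Hrad cell0 Hc0); lra.
    - intros k; exists (- s1 k)%C; unfold v.
      eapply littleo_ext; [|apply littleo_0]; intros h; simpl; ring.
    - intros k; apply cont_at_const. }
  rewrite Rplus_0_l in G1.
  assert (HinD0 : forall z, Cmod z < 3 * a0 -> inD M cell0 z)
    by (intros z Hz; unfold inD; simpl; now rewrite Hm0).
  assert (Heb0 : forall z, inD M cell0 z -> cnorm (eb M cell0 g0 z) <=
     Cmod (dchi 0 a0 z) * cnorm (v z)).
  { intros z Hz; rewrite <- cnorm_scale, (cnorm_opp (eb M cell0 g0 z) (vscale (dchi 0 a0 z) (v z)));
      [lra|].
    intros k; rewrite (proj2 (G4 z Hz) k), (Hebf cell0 z Hc0 Hz k); unfold vscale; simpl; ring. }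
  assert (Hcmp : forall p z, In p cells -> inD M p z -> inD M cell0 z ->
     cnorm (eb M p g0 z) <= / eta0 * (Cmod (dchi 0 a0 z) * cnorm (v z))).
  { intros p z Hp Hz Hz0.
    eapply Rle_trans; [apply (state_compare M f cells eta0 Htube g0 (tau / eta0) cell0 p z); auto|].
    - rewrite Htau0; lra.
    - apply Rmult_le_compat_l; [lra|auto]. }
  set (E := C1 / eta0 * tau).
  assert (HE : 0 < E) by (apply Rmult_lt_0_compat; unfold tau; lra).
  destruct (holomorphic_limit M f cells eta0 C1 a0 theta r1 L a He0 Hrad Htube
    (fun p Hp z Hz => proj1 (Hdom p Hp z Hz)) HC1 HC1c ltac:(lra) HCZ Hcover Ha4 Hth (HL a Ha4) HthB
    r E (tau / eta0) g0) as [g [H1 [H2 H3]]]; auto.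
  { unfold r1; lra. }
  { unfold r1; lra. }
  { intros p Hp z Hz Hz3 k.
    assert (Hz0 : inD M cell0 z) by (apply HinD0; lra).
    assert (T := Hcmp p z Hp Hz Hz0).
    rewrite (proj2 (chi_inside 0 a0 z Ha0 ltac:(rewrite Hm0; lra))), Cmod_0, Rmult_0_l, Rmult_0_r in T.
    apply Cmod_eq_0, Rle_antisym; [|apply Cmod_ge_0]; eapply Rle_trans; [apply cnorm_comp|apply T]. }
  { intros p Hp z Hz _.
    assert (Hw := wt_pos L z); assert (Hw1 := wt_le_1 L z).
    destruct (Rlt_le_dec (Cmod z) (3 * a0)) as [H3|H3].
    - assert (Hz0 := HinD0 z H3); assert (T := Hcmp p z Hp Hz Hz0).
      assert (D := dchi_bound 0 a0 z Ha0); assert (D1 := HC1c cell0 Hc0); simpl in D1.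
      assert (V := Hvt z ltac:(lra)).
      assert (T2 : Cmod (dchi 0 a0 z) * cnorm (v z) <= C1 * tau).
      { apply Rmult_le_compat; try apply Cmod_ge_0; try apply cnorm_ge_0; lra. }
      assert (T3 : cnorm (eb M p g0 z) <= E).
      { eapply Rle_trans; [apply T|]; unfold E.
        replace (C1 / eta0 * tau) with (/ eta0 * (C1 * tau)) by (field; lra).
        apply Rmult_le_compat_l; lra. }
      assert (T4 := cnorm_ge_0 (eb M p g0 z)); nra.
    - destruct (open_disc_compl_near (cc cell0) z (5 / 2 * cr cell0)) as [d [Hd Hn]];
        [simpl; rewrite Hm0; lra|].
      rewrite (eb_ext M f g0 p z d); auto.
      + replace (cnorm (eb M p f z)) with 0; [lra|].
        symmetry; unfold cnorm; rewrite (fsum_ext n _ (fun _ => 0)); [rewrite fsum_const; ring|].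
        intros k; rewrite Hebf by auto; apply Cmod_0.
      + intros k; destruct (Hrf p z Hp Hz k) as [A HA]; eauto. }
  { fold Tt; rewrite Htau0; unfold E, tau.
    replace (2 * (C1 / eta0 * (2 * del) * Tt)) with (del * (4 * (C1 / eta0) * Tt)) by ring; lra. }
  assert (Hval : forall z, Cmod z < 3 / 4 * a0 -> cdom M i (g0 z) /\
     chart M i (g0 z) = vadd (chart M i (f z)) (vadd s0 (vscale z s1))).
  { intros z Hz; assert (Hz0 : inD M cell0 z) by (apply HinD0; lra).
    split; [apply (G1 cell0 Hc0 z Hz0)|].
    change (loc M cell0 g0 z = vadd (loc M cell0 f z) (vadd s0 (vscale z s1))).
    rewrite (proj1 (G4 z Hz0)); simpl cc; simpl cr.
    rewrite (proj1 (chi_inside 0 a0 z Ha0 ltac:(rewrite Hm0; lra))).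
    apply functional_extensionality; intros k; unfold vsub, vadd, vscale, v; ring. }
  destruct (Hval (RtoC 0)) as [V1 V2]; [rewrite Cmod_0; lra|].
  destruct (Hval a) as [V3 V4]; [lra|].
  exists g; split; [exact H1|]; rewrite H2, H3.
  split; [exact V1|split; [|split; [exact V3|exact V4]]].
  rewrite V2; apply functional_extensionality; intros k; unfold vadd, vscale; ring.
Qed.

(** * The derivative of the Lempert function *)

Lemma littleo_fin (n : nat) (r : Fin.t n -> C -> C) : (forall j, littleo (r j)) ->
  forall eps, 0 < eps -> exists d, 0 < d /\
    forall h, Cmod h < d -> cnorm (fun j => r j h) <= eps * Cmod h.
Proof.
  unfold cnorm; induction n as [|n IH]; simpl; intros H eps He.
  - exists 1; split; [lra|]; intros h _; apply Rmult_le_pos; [lra|apply Cmod_ge_0].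
  - destruct (H Fin.F1 (eps / 2)) as [d1 [Hd1 H1]]; [lra|].
    destruct (IH (fun j => r (Fin.FS j)) (fun j => H (Fin.FS j)) (eps / 2)) as [d2 [Hd2 H2]]; [lra|].
    exists (Rmin d1 d2); split; [now apply Rmin_pos|]; intros h Hh.
    specialize (H1 h (Rlt_le_trans _ _ _ Hh (Rmin_l _ _))).
    specialize (H2 h (Rlt_le_trans _ _ _ Hh (Rmin_r _ _))); lra.
Qed.

Section Upper.
Context {n : nat} (M : complex_manifold n).

Lemma kappa_nonneg (i : chart_idx M) (z : M) (v : Cn n) : Rbar_le (Finite 0) (kappa M i z v).
Proof.
  apply (Rbar_glb_correct _); intros r [a [f [d [_ [_ [_ [_ ->]]]]]]]; simpl; apply Cmod_ge_0.
Qed.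

Lemma holo_disc_const (z : M) : holo_disc M (fun _ => z).
Proof.
  apply holo_disc_hol_at; intros s _; split.
  - intros A HA HAz; exists 1; split; [lra|auto].
  - intros i _ k; exists 0; apply rdiff_const.
Qed.

(** The upper bound divides by [al]. If the disc found has [al = 0], then [v = 0], and a constant
    disc with a small nonzero [al] does as well. *)
Lemma kappa_near_optimal (i : chart_idx M) (z : M) (v : Cn n) (k0 eta : R) :
  0 < eta -> kappa M i z v = Finite k0 ->
  exists (al : C) (f : C -> M) (D : Cn n), al <> 0 /\ Cmod al < k0 + eta /\ holo_disc M f /\
    f (RtoC 0) = z /\ (forall k, rdiff (fun u => chart M i (f u) k) 0 (D k) 0) /\ vscale al D = v.
Proof.
  intros Heta Hk.
  assert (Hk0 := kappa_nonneg i z v); rewrite Hk in Hk0; simpl in Hk0.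
  destruct (glb_lt_ex _ (Finite (k0 + eta)) ltac:(unfold kappa in Hk; rewrite Hk; simpl; lra))
    as [r [[a [f [D [F1 [F2 [F3 [F4 ->]]]]]]] Hr]].
  simpl in Hr.
  destruct (excluded_middle_informative (a = 0)) as [E|E].
  - exists (RtoC (eta / 2)), (fun _ => z), (fun _ => RtoC 0).
    split; [apply RtoC_neq_0; lra|]; split; [rewrite Cmod_R, Rabs_pos_eq; lra|].
    split; [apply holo_disc_const|]; split; [auto|]; split; [intros; apply rdiff_const|].
    rewrite <- F4, E; apply functional_extensionality; intros k; unfold vscale; ring.
  - exists a, f, D; repeat (split; auto); intros k; now apply is_derive_rdiff.
Qed.

(** With [a = al t] the disc [f] passes near [w] at 0 and near [w'] at [a]. [perturbation] makes it
    pass through both on a disc of radius [r < 1]; rescaling to the unit disc gives the parameter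
    [a / r], whose modulus is only slightly more than [Cmod al] times [Cmod t]. *)
Lemma lempert_derivative_upper (i : chart_idx M) (z : M) (v : Cn n) (k0 eta : R) :
  cdom M i z -> 0 < eta -> kappa M i z v = Finite k0 ->
  exists eps, 0 < eps /\ forall q, Dset M i z v eps q -> Rbar_le q (Finite (k0 + eta)).
Proof.
  intros Hz Heta Hk.
  assert (Hk0 := kappa_nonneg i z v); rewrite Hk in Hk0; simpl in Hk0.
  destruct (kappa_near_optimal i z v k0 (eta / 4) ltac:(lra) Hk)
    as [al [f [D [Hal [Halk [Hf [Hf0 [HD Hv]]]]]]]].
  assert (HA : 0 < Cmod al) by now apply Cmod_gt_0.
  set (A := Cmod al) in *.
  (* So that rescaling by [r] replaces [A] exactly by [P = A + eta / 4]. *)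
  set (r := A / (A + eta / 4)).
  assert (Hr : 0 < r < 1).
  { unfold r; split; [apply Rdiv_lt_0_compat; lra|].
    apply Rmult_lt_reg_r with (A + eta / 4); [lra|].
    replace (A / (A + eta / 4) * (A + eta / 4)) with A by (field; lra); lra. }
  destruct (perturbation M f i r Hf ltac:(rewrite Hf0; auto) Hr) as [del [Hdel Hper]].
  destruct (littleo_fin n _ HD (del / 4)) as [d1 [Hd1 Hlo]]; [lra|].
  set (P := A + eta / 4).
  assert (HP : 0 < P < k0 + eta / 2) by (unfold P; lra).
  (* For a parameter up to [x0] the passage from the modulus to [atanh], a factor at most
     [1 / (1 - x0)], raises [P] to no more than [k0 + eta]. *)
  set (x0 := Rmin (/ 2) (eta / (2 * (k0 + eta)))).
  assert (Hx0 : 0 < x0) by (apply Rmin_pos; [lra|apply Rdiv_lt_0_compat; lra]).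
  assert (Hx01 : x0 <= / 2) by apply Rmin_l.
  assert (Hx02 : (k0 + eta) * x0 <= eta / 2).
  { apply Rle_trans with ((k0 + eta) * (eta / (2 * (k0 + eta)))).
    - apply Rmult_le_compat_l; [lra|apply Rmin_r].
    - right; field; lra. }
  set (m := Rmin (Rmin del d1) (Rmin (del * A) x0)).
  assert (HdA : 0 < del * A) by now apply Rmult_lt_0_compat.
  assert (Hm : 0 < m) by (unfold m; clearbody x0; repeat apply Rmin_pos; auto).
  assert (M1 : m <= del) by (eapply Rle_trans; [apply Rmin_l|apply Rmin_l]).
  assert (M2 : m <= d1) by (eapply Rle_trans; [apply Rmin_l|apply Rmin_r]).
  assert (M3 : m <= del * A) by (eapply Rle_trans; [apply Rmin_r|apply Rmin_l]).
  assert (M4 : m <= x0) by (eapply Rle_trans; [apply Rmin_r|apply Rmin_r]).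
  set (eps := m / (4 * (1 + P))).
  assert (Heps : 0 < eps) by (apply Rdiv_lt_0_compat; lra).
  assert (HepsP : eps * (1 + P) = m / 4) by (unfold eps; field; lra).
  assert (E1 : eps <= m / 4) by nra.
  assert (E2 : eps * P <= m / 4) by nra.
  exists eps; split; auto.
  intros q [t [w [w' [Y [Ht [Hte [Hw [Hwz [HY [Hw' [Ew' ->]]]]]]]]]]].
  assert (Ht0 : 0 < Cmod t) by now apply Cmod_gt_0.
  set (a := (al * t)%C).
  assert (Ea : Cmod a = A * Cmod t) by (unfold a; apply Cmod_mult).
  assert (Ha0 : a <> 0) by (apply Cmult_neq_0; auto).
  assert (HaP : Cmod a <= P * Cmod t) by (rewrite Ea; apply Rmult_le_compat_r; unfold P; lra).
  assert (HPt : P * Cmod t <= eps * P) by nra.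
  set (s0 := vsub (chart M i w) (chart M i z)).
  (* Solves [f a + s0 + a s1 = w'] in the chart. It splits into [(Y - v) / al] and the first-order
     remainder of [f] divided by [a], both small. *)
  set (s1 := vscale (/ a)%C (vsub (vscale t Y) (vsub (chart M i (f a)) (chart M i z)))).
  assert (Hs1 : cnorm s1 < del).
  { assert (Es1 : s1 = vadd (vscale (/ al)%C (vsub Y v))
      (vscale (/ a)%C (fun k => - (chart M i (f (0 + a)%C) k - chart M i (f (RtoC 0)) k -
         (D k * a + 0 * Cconj a)))%C)).
    { apply functional_extensionality; intros k; unfold s1, vadd, vscale, vsub.
      rewrite Hf0, Cplus_0_l, <- Hv; unfold vscale, a; field; auto. }
    rewrite Es1; eapply Rle_lt_trans; [apply cnorm_triangle|]; rewrite !cnorm_scale.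
    rewrite !Cmod_inv by auto; fold A.
    specialize (Hlo a ltac:(lra)).
    assert (N1 : / A * cnorm (vsub Y v) <= del / 4).
    { apply Rmult_le_reg_l with A; auto.
      rewrite <- Rmult_assoc, Rinv_r, Rmult_1_l by lra; lra. }
    rewrite (cnorm_opp (fun k => - _)%C (fun k => chart M i (f (0 + a)%C) k -
      chart M i (f (RtoC 0)) k - (D k * a + 0 * Cconj a))%C) by reflexivity.
    assert (Ha1 : 0 < Cmod a) by now apply Cmod_gt_0.
    assert (N2 : / Cmod a * cnorm (fun k => chart M i (f (0 + a)%C) k -
      chart M i (f (RtoC 0)) k - (D k * a + 0 * Cconj a))%C <= del / 4).
    { apply Rmult_le_reg_l with (Cmod a); auto.
      rewrite <- Rmult_assoc, Rinv_r, Rmult_1_l by lra; lra. }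
    lra. }
  destruct (Hper a s0 s1) as [g [Hg [G1 [G2 [G3 G4]]]]]; auto; try lra.
  { unfold s0; lra. }
  assert (Eg0 : g (RtoC 0) = w).
  { apply (chart_inj n M i); auto; rewrite G2, Hf0; unfold s0; apply vadd_sub. }
  assert (Ega : g a = w').
  { apply (chart_inj n M i); auto; rewrite G4, Ew'; apply functional_extensionality; intros k.
    unfold s0, s1, vadd, vscale, vsub; field; auto. }
  assert (Hx : Cmod (a / RtoC r)%C = P * Cmod t).
  { rewrite Cmod_div, Cmod_R, Rabs_pos_eq, Ea by (try apply RtoC_neq_0; lra).
    unfold r, P; field; lra. }
  assert (Hxs : P * Cmod t <= x0) by lra.
  assert (HPt0 : 0 < P * Cmod t) by (apply Rmult_lt_0_compat; lra).
  destruct (lempert_le M w w' (a / RtoC r)%C (fun s => g (RtoC r * s)%C)) as [l [L1 [L2 L3]]].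
  - unfold in_disc; rewrite Hx; lra.
  - apply holo_disc_hol_at; intros s Hs; unfold in_disc in Hs.
    apply hol_at_rescale; [apply RtoC_neq_0; lra|]; apply Hg.
    rewrite Cmod_mult, Cmod_R, Rabs_pos_eq by lra; nra.
  - rewrite Cmult_0_r; auto.
  - replace (RtoC r * (a / RtoC r))%C with a; auto; field; apply RtoC_neq_0; lra.
  - rewrite L1; simpl; rewrite Hx in L3.
    apply Rmult_le_reg_r with (Cmod t); auto.
    rewrite Rmult_assoc, Rinv_l, Rmult_1_r by lra.
    eapply Rle_trans; [apply L3|]; eapply Rle_trans; [apply atanh_le; lra|].
    apply Rmult_le_reg_r with (1 - P * Cmod t); [lra|].
    replace (P * Cmod t / (1 - P * Cmod t) * (1 - P * Cmod t)) with (P * Cmod t) by (field; lra).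
    rewrite Rmult_assoc, (Rmult_comm (Cmod t)), <- Rmult_assoc; apply Rmult_le_compat_r; [lra|].
    assert ((k0 + eta) * (P * Cmod t) <= (k0 + eta) * x0) by (apply Rmult_le_compat_l; lra); lra.
Qed.

(** Guards against the bounds of an empty set, which would be infinite: bounds on quotients say
    something about [Rbar_lub] from below and [Rbar_glb] from above only if a quotient exists. *)
Lemma Dset_nonempty (i : chart_idx M) (z : M) (v : Cn n) (eps : R) : cdom M i z -> 0 < eps ->
  exists q, Dset M i z v eps q.
Proof.
  intros Hz He.
  destruct (chart_ball M i z (fun _ => True) Hz (mopen_all n M) I) as [rho [Hrho HB]].
  assert (Hv := cnorm_ge_0 v).
  set (t := Rmin (eps / 2) (rho / (2 * (cnorm v + 1)))).
  assert (Ht : 0 < t) by (apply Rmin_pos; [lra|apply Rdiv_lt_0_compat; lra]).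
  assert (Ht1 : t <= eps / 2) by apply Rmin_l.
  assert (Ht2 : t * (cnorm v + 1) <= rho / 2).
  { apply Rle_trans with (rho / (2 * (cnorm v + 1)) * (cnorm v + 1)).
    - apply Rmult_le_compat_r; [lra|apply Rmin_r].
    - right; field; lra. }
  destruct (HB (vadd (chart M i z) (vscale (RtoC t) v))) as [w' [W1 [_ W2]]].
  { rewrite vsub_add, cnorm_scale, Cmod_R, Rabs_pos_eq by lra; nra. }
  eexists; exists (RtoC t), z, w', v; repeat split; auto.
  - apply RtoC_neq_0; lra.
  - rewrite Cmod_R, Rabs_pos_eq; lra.
  - rewrite cnorm_sub_diag; lra.
  - rewrite cnorm_sub_diag; lra.
Qed.

Lemma Dset_mono (i : chart_idx M) (z : M) (v : Cn n) (eps eps' : R) (q : Rbar) : eps <= eps' ->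
  Dset M i z v eps q -> Dset M i z v eps' q.
Proof.
  intros He [t [w [w' [Y [H1 [H2 [H3 [H4 [H5 [H6 [H7 H8]]]]]]]]]]].
  exists t, w, w', Y; repeat split; auto; lra.
Qed.

End Upper.

Lemma Rbar_le_epsilon (x : Rbar) (k : R) :
  (forall e, 0 < e -> Rbar_le x (Finite (k + e))) -> Rbar_le x (Finite k).
Proof.
  intros H; destruct x as [r| |]; simpl in *; auto; [|apply (H 1 Rlt_0_1)].
  apply le_epsilon; auto.
Qed.

Lemma Rbar_ge_epsilon (x : Rbar) (k : R) :
  (forall e, 0 < e -> Rbar_le (Finite (k - e)) x) -> Rbar_le (Finite k) x.
Proof.
  intros H; destruct x as [r| |]; simpl in *; auto; [|apply (H 1 Rlt_0_1)].
  apply le_epsilon; intros e He; specialize (H e He); lra.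
Qed.

Lemma lub_ge (P : Rbar -> Prop) (q : Rbar) : P q -> Rbar_le q (Rbar_lub P).
Proof. apply (Rbar_lub_correct P). Qed.

Theorem theorem1 (n : nat) (M : complex_manifold n) (z : M) (i : chart_idx M)
  (v : Cn n) :
  cdom M i z ->
  hyperbolic_at M z ->
  kappa_continuous_at M i z v ->
  kappa M i z v = D_lempert M i z v /\ kappa M i z v = D_lempert_low M i z v.
Proof.
  intros Hz Hyp [k0 [Hk Hcont]].
  assert (Hk0 := kappa_nonneg M i z v); rewrite Hk in Hk0; simpl in Hk0.
  assert (Up := fun e He => lempert_derivative_upper M i z v k0 e Hz He Hk).
  assert (Lo := fun e He => lempert_derivative_lower M i z v k0 e Hz Hyp Hk0 He Hcont).
  (* A common quotient links the [eps] of an estimate with the arbitrary [eps] under the outer bound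
     of the upper or lower limit. *)
  assert (Ex : forall e1 e2, 0 < e1 -> 0 < e2 -> exists q, Dset M i z v e1 q /\ Dset M i z v e2 q).
  { intros e1 e2 H1 H2.
    destruct (Dset_nonempty M i z v (Rmin e1 e2) Hz (Rmin_pos _ _ H1 H2)) as [q Hq].
    exists q; split; eapply Dset_mono; try exact Hq; [apply Rmin_l|apply Rmin_r]. }
  rewrite Hk; split; apply Rbar_le_antisym.
  - apply (Rbar_glb_correct _); intros s [eps [Heps ->]]; apply Rbar_ge_epsilon; intros e He.
    destruct (Lo e He) as [eps' [Heps' H]]; destruct (Ex eps eps' Heps Heps') as [q [Q1 Q2]].
    eapply Rbar_le_trans; [apply (H q Q2)|]; now apply lub_ge.
  - apply Rbar_le_epsilon; intros e He; destruct (Up e He) as [eps [Heps H]].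
    eapply Rbar_le_trans; [apply glb_le; exists eps; split; [exact Heps|reflexivity]|].
    apply (Rbar_lub_correct _); intros q Hq; auto.
  - apply Rbar_ge_epsilon; intros e He; destruct (Lo e He) as [eps [Heps H]].
    eapply Rbar_le_trans; [|apply lub_ge; exists eps; split; [exact Heps|reflexivity]].
    apply (Rbar_glb_correct _); intros q Hq; auto.
  - apply (Rbar_lub_correct _); intros s [eps [Heps ->]]; apply Rbar_le_epsilon; intros e He.
    destruct (Up e He) as [eps' [Heps' H]]; destruct (Ex eps eps' Heps Heps') as [q [Q1 Q2]].
    eapply Rbar_le_trans; [apply glb_le, Q1|]; auto.
Qed.
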